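(* Let $n\ge m$ be integers and let $\delta$ be such that there is a very regular irreducible component $V$ of the Severi variety $V^{\mathbb P^3, |\mathcal O_{\mathbb P^3}(m)|}_\delta$. Then the variety $\mathcal T_{n,m}$ of surfaces of degree $n$ in $\mathbb P^3$ with a point of multiplicity $m$ is contained in the Zariski closure (in $|\mathcal O_{\mathbb P^3}(n)|$) of a regular component of $V^{\mathbb P^3, |\mathcal O_{\mathbb P^3}(n)|}_{\delta}$. In other words, the general degree $n$ surface $S$ with a general ordinary singularity of multiplicity $m$ is the limit of surfaces of degree $n$ with $\delta$ nodes tending to the multiplicity $m$ point.
   Context: We work over $\mathbb C$. A node is an ordinary double point. For $d\geq 1$ and $\delta\geq 1$, $V^{\mathbb P^3, |\mathcal O_{\mathbb P^3}(d)|}_\delta\subset |\mathcal O_{\mathbb P^3}(d)|$ is the Severi variety: the locally closed subvariety parametrizing surfaces of degree $d$ in $\mathbb P^3$ with exactly $\delta$ nodes and no other singularity. For an irreducible component $V$ of it, let $[S]\in V$ be general and let $N$ be the reduced scheme of length $\delta$ of the nodes of $S$. $V$ is regular if $h^1(\mathbb P^3,\mathcal O_{\mathbb P^3}(d)\otimes \mathcal I_N)=0$, and very regular if $h^1(\mathbb P^3,\mathcal O_{\mathbb P^3}(d-1)\otimes \mathcal I_N)=0$. Let $S$ be a reduced surface with a point $p$ of multiplicity $m$, and let $f:S'\to S$ be the minimal desingularization of $S$ at $p$, with exceptional divisor $C$ over $p$, a plane curve of degree $m$. The singularity at $p$ is ordinary if $C$ is smooth and $S'$ is obtained from $S$ by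 blowing up only once at $p$; it is a general ordinary singularity if moreover $C$ is a general plane curve of degree $m$. The family $\mathcal T_{n,m}$ is irreducible and its general point corresponds to a surface with a general ordinary singularity of multiplicity $m$. *)

(* Defs.v *)
From HB Require Import structures.
From mathcomp Require Import all_boot all_order all_algebra fraction.
From mathcomp Require Import mpoly complex.
From mathcomp Require Import reals.

Set Implicit Arguments.
Unset Strict Implicit.
Unset Printing Implicit Defensive.

Import Order.TTheory GRing.Theory Num.Theory.
Local Open Scope ring_scope.

(* Points of P^3 and of |O_{P^3}(d)| are handled through nonzero               *)
(* representatives: a point of P^3 is a nonzero p : 'I_4 -> K up to scalars,   *)
(* and a surface of degree d is a nonzero form F : dhomog 4 K d up to scalars. *)

Section Points.
Variable K : numClosedFieldType.

Definition nonzero (n : nat) (p : 'I_n -> K) : Prop := exists i, p i != 0.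

Definition same_point (n : nat) (p q : 'I_n -> K) : Prop :=
  exists2 c : K, c != 0 & forall i, q i = c * p i.

End Points.

Section LinearSystem.
Variables (K : numClosedFieldType) (d : nat).

Definition monom : finType := {m : 'X_{1..4 < d.+1} | mdeg m == d}.

Definition coef (F : dhomog 4 K d) (m : monom) : K :=
  (mpoly_of_dhomog F)@_(val (val m)).

Definition coords (F : dhomog 4 K d) : 'I_#|monom| -> K :=
  fun i => coef F (enum_val i).

(* Closed subsets of the projective space |O_{P^3}(d)|; homogeneity of the     *)
(* equations makes them invariant under rescaling F.                           *)
Definition zclosed (Z : dhomog 4 K d -> Prop) : Prop :=
  exists2 E : {mpoly K[#|monom|]} -> Prop,
    forall Phi, E Phi -> exists k : nat, Phi \is k.-homog
  & forall F, Z F <-> F != 0 /\ forall Phi, E Phi -> Phi.@[coords F] = 0.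

Definition zclosure (X : dhomog 4 K d -> Prop) (F : dhomog 4 K d) : Prop :=
  forall Z, zclosed Z -> (forall G, X G -> Z G) -> Z F.

Definition irreducible_set (X : dhomog 4 K d -> Prop) : Prop :=
  (exists F, X F) /\
  forall Z1 Z2, zclosed Z1 -> zclosed Z2 ->
    (forall F, X F -> Z1 F \/ Z2 F) ->
    (forall F, X F -> Z1 F) \/ (forall F, X F -> Z2 F).

Definition irreducible_component (X W : dhomog 4 K d -> Prop) : Prop :=
  [/\ forall F, W F -> X F,
      irreducible_set W
    & forall Y, (forall F, Y F -> X F) -> irreducible_set Y ->
        (forall F, W F -> Y F) -> forall F, Y F -> W F].

(* P holds on a nonempty Zariski-open subset of X; used for irreducible X,     *)
(* where such a subset is dense.                                               *)
Definition for_general (X P : dhomog 4 K d -> Prop) : Prop :=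
  exists2 Z, zclosed Z &
    (exists2 F, X F & ~ Z F) /\ (forall F, X F -> ~ Z F -> P F).

End LinearSystem.

Section Singularities.
Variable K : numClosedFieldType.

(* Equation of F = 0, in the affine chart given by the hyperplane x_i = p_i    *)
(* (where p_i <> 0), with the origin moved to p.                               *)
Definition local_eq (i : 'I_4) (p : 'I_4 -> K) (F : {mpoly K[4]}) :
    {mpoly K[3]} :=
  F \mPo [tuple (if unlift i j is Some k then (p j)%:MP + 'X_k else (p i)%:MP)
         | j < 4].

Definition mult_in_chart (m : nat) (F : {mpoly K[4]}) (p : 'I_4 -> K)
    (i : 'I_4) : Prop :=
  [/\ p i != 0,
      forall k, (k < m)%N -> pihomog mdeg k (local_eq i p F) = 0
    & pihomog mdeg m (local_eq i p F) != 0].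

Definition has_mult (m : nat) (F : {mpoly K[4]}) (p : 'I_4 -> K) : Prop :=
  exists i, mult_in_chart m F p i.

Definition smooth_plane_curve (g : {mpoly K[3]}) : Prop :=
  forall v : 'I_3 -> K, nonzero v ->
    ~ (g.@[v] = 0 /\ forall j, (g^`M(j)).@[v] = 0).

(* The exceptional curve C of the blow-up of the surface at p is the plane     *)
(* curve cut out by the leading form of the local equation.  As C is a Cartier *)
(* divisor on the blown-up surface, smoothness of C implies smoothness of that *)
(* surface along C, so that a single blow-up desingularizes p.                 *)
Definition ordinary_sing (m : nat) (F : {mpoly K[4]}) (p : 'I_4 -> K) : Prop :=
  exists2 i, mult_in_chart m F p i
    & smooth_plane_curve (pihomog mdeg m (local_eq i p F)).

Definition node (F : {mpoly K[4]}) (p : 'I_4 -> K) : Prop :=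
  ordinary_sing 2 F p.

Definition singular (F : {mpoly K[4]}) (p : 'I_4 -> K) : Prop :=
  [/\ nonzero p, F.@[p] = 0 & forall j, (F^`M(j)).@[p] = 0].

(* q enumerates without repetition the singular points of F = 0, which are     *)
(* all nodes.                                                                  *)
Definition nodes_enum (delta : nat) (F : {mpoly K[4]})
    (q : 'I_delta -> 'I_4 -> K) : Prop :=
  [/\ forall k, node F (q k),
      forall k l, same_point (q k) (q l) -> k = l
    & forall p, singular F p -> exists k, same_point (q k) p].

Definition severi (d delta : nat) (F : dhomog 4 K d) : Prop :=
  F != 0 /\ exists q : 'I_delta -> 'I_4 -> K, nodes_enum F q.

(* T_{n,m}, with multiplicity exactly m; surfaces with a point of              *)
(* multiplicity > m lie in its closure when m <= n.                            *)
Definition mult_locus (n m : nat) (F : dhomog 4 K n) : Prop :=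
  F != 0 /\ exists p, has_mult m F p.

Definition ordinary_locus (n m : nat) (F : dhomog 4 K n) : Prop :=
  F != 0 /\ exists p, ordinary_sing m F p.

End Singularities.

Section Cohomology.
Variables (K : numClosedFieldType) (N : ('I_4 -> K) -> Prop) (d : nat).

(* Sections over the basic open set D(s), s a form of degree e, of             *)
(* O_{P^3}(d) (x) I_N, with N a finite set of points carrying its reduced      *)
(* structure.  As O(d) is locally free, O(d) (x) I_N is the subsheaf of O(d)   *)
(* of the sections vanishing on N.                                             *)
Definition twisted_ideal_section (e : nat) (s : {mpoly K[4]})
    (phi : {fraction {mpoly K[4]}}) : Prop :=
  exists (k : nat) (a : {mpoly K[4]}),
    [/\ a \is (d + k * e).-homog,
        phi = tofrac a / tofrac s ^+ k
      & forall p, N p -> s.@[p] != 0 -> a.@[p] = 0].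

(* Vanishing of the first Cech cohomology group of O_{P^3}(d) (x) I_N for the  *)
(* standard affine cover U_i = D(x_i): every 1-cocycle is a coboundary.        *)
Definition H1_vanishes : Prop :=
  forall g : 'I_4 -> 'I_4 -> {fraction {mpoly K[4]}},
    (forall i j, twisted_ideal_section 2 ('X_i * 'X_j) (g i j)) ->
    (forall i j k, g i j + g j k = g i k) ->
    exists2 h : 'I_4 -> {fraction {mpoly K[4]}},
      forall i, twisted_ideal_section 1 'X_i (h i)
    & forall i j, g i j = h j - h i.

End Cohomology.

Section Regularity.
Variables (K : numClosedFieldType) (d : nat).
Implicit Types W : dhomog 4 K d -> Prop.

Definition regular W : Prop := for_general W (fun F => H1_vanishes (node F) d).

(* d >= 1 is assumed where this is used, so that d.-1 is d - 1. *)
Definition very_regular W : Prop :=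
  for_general W (fun F => H1_vanishes (node F) d.-1).

(* F is a limit, in the complex topology, of members of W whose delta nodes    *)
(* all tend to p.                                                              *)
Definition limit_with_nodes_tending_to (delta : nat) W (F : dhomog 4 K d)
    (p : 'I_4 -> K) : Prop :=
  forall eps : K, 0 < eps ->
    exists (G : dhomog 4 K d) (q : 'I_delta -> 'I_4 -> K),
      [/\ W G, nodes_enum G q,
          forall m, `|coef G m - coef F m| < eps
        & forall k i, `|q k i - p i| < eps].

End Regularity.

(* Main.v *)
Require Import Defs.
From mathcomp Require Import all_boot all_order all_algebra.
From mathcomp Require Import complex.
From mathcomp Require Import reals.
From mathcomp Require Import fraction mpoly.
From mathcomp Require boolp classical_sets.
From mathcomp.classical Require filter.
From mathcomp Require closed_field.
From mathcomp Require Import zify ring lra.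
Set Implicit Arguments.
Unset Strict Implicit.
Unset Printing Implicit Defensive.
Import Order.TTheory GRing.Theory Num.Theory.
Local Open Scope ring_scope.

(** Choose one surface G of degree m in V whose nodes impose independent
    conditions on forms of degree m - 1, with all nodes off the plane x_0 = 0.
    At x_0^(n-m) G and these nodes, the incidence variety of pairs (surface of
    degree n, delta points singular on it) is smooth, by the independence of the
    nodes and the nondegeneracy of the Hessians; hence it is locally irreducible
    there, and the polynomials vanishing on it near that point form a prime ideal.
    The surfaces satisfying the equations of this ideal that are nodal form an
    irreducible family, and W is a component of the Severi variety containing it.

    Let F have multiplicity m at (1,0,0,0), smooth leading form f_m and no other
    singular point, where f_m is the leading form of a nodal surface G' close to G.
    Dilating by t^-1 at the point turns F into x_0^(n-m) G' + O(t).  By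
    independence of the nodes in degree m - 1, adding forms of multiplicity
    smaller than m to the dilated surface moves the nodes of G' along.  Dilating
    back yields surfaces in W (which is stable under linear changes of
    coordinates) tending to F, whose nodes tend to the m-fold point; a compactness
    estimate excludes other singular points.  Such F are dense among the surfaces
    with a point of multiplicity m, which gives the inclusion in the closure of W;
    quantifier elimination makes the set of such F contain a Zariski open set.
    Regularity is open, and holds for these surfaces because the forms
    x_0^(n-m+1) H, with H of degree m - 1, separate their nodes. *)

(** * Noetherianity *)

(** The difficulty is to land in one component: surfaces approximating different [F] might a priori
    belong to different components of the Severi variety. Irreducibility is therefore secured
    beforehand at a single incidence point, where the local ring is a domain: a polynomial vanishing
    on the incidence variety near that point lies in the prime ideal [P], hence vanishes at all
    incidence points where one denominator [s] is nonzero, and the approximants of every [F] are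
    such points after dilation. Degree [m - 1] enters because the forms correcting the nodes then
    acquire a factor x_0^(n-m+1) in degree [n]: they have order below [m] at the multiple point, so
    dilating back multiplies them by positive powers of [t], while the leading form and all higher
    terms of [F] are untouched. The construction only reaches leading forms in a small complex
    neighbourhood; such a neighbourhood is Zariski dense in a linear space, and a definable set or
    its complement contains a nonempty open set, which together yield a general [F]. *)

Section Ideals.
Variable T : comNzRingType.
Implicit Types (I : T -> Prop) (s : seq T) (a b c p : T).

Definition ideal I : Prop :=
  [/\ I 0, forall a b, I a -> I b -> I (a + b) & forall c a, I a -> I (c * a)].

Definition gen s p : Prop := exists c : nat -> T, p = \sum_(i < size s) c i * s`_i.

Lemma ideal_sum I (J : Type) (r : seq J) (P : pred J) (F : J -> T) :
  ideal I -> (forall j, P j -> I (F j)) -> I (\sum_(j <- r | P j) F j).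
Proof. by move=> [I0 ID _] IF; elim/big_ind: _. Qed.

Lemma idealN I a : ideal I -> I a -> I (- a).
Proof. by move=> [_ _ IM] Ia; rewrite -mulN1r; apply: IM. Qed.

Lemma idealB I a b : ideal I -> I a -> I b -> I (a - b).
Proof. by move=> iI Ia Ib; case: (iI) => _ ID _; apply: ID => //; apply: idealN. Qed.

Lemma gen_ideal s : ideal (gen s).
Proof.
split.
- by exists (fun=> 0); rewrite big1 // => i _; rewrite mul0r.
- move=> a b [c ->] [d ->]; exists (fun i => c i + d i).
  by rewrite -big_split /=; apply: eq_bigr => i _; rewrite mulrDl.
- move=> c a [d ->]; exists (fun i => c * d i).
  by rewrite mulr_sumr; apply: eq_bigr => i _; rewrite mulrA.
Qed.

Lemma mem_gen s p : p \in s -> gen s p.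
Proof.
move=> ps; exists (fun i => (i == index p s)%:R).
have ip : (index p s < size s)%N by rewrite index_mem.
rewrite (bigD1 (Ordinal ip)) //= eqxx mul1r nth_index // big1 ?addr0 // => i.
by rewrite -val_eqE /= => /negbTE ->; rewrite mul0r.
Qed.

Lemma gen_min I s : ideal I -> (forall p, p \in s -> I p) -> forall p, gen s p -> I p.
Proof.
move=> iI sI p [c ->]; apply: ideal_sum => // i _.
by case: iI => _ _ IM; apply/IM/sI/mem_nth.
Qed.

End Ideals.

(** Beyond every [N] the sequence attains a minimum; the subsequence jumps from one such minimizer
    to the next. *)
Lemma monotone_subseq (x : nat -> nat) :
  exists s : nat -> nat, (forall i j, (i < j)%N -> (s i < s j)%N) /\
    forall i j, (i <= j)%N -> (x (s i) <= x (s j))%N.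
Proof.
have ex N : exists k, (N <= k)%N /\ forall l, (N <= l)%N -> (x k <= x l)%N.
  have [m mP] : exists m, exists2 k, (N <= k)%N & x k = m by exists (x N), N.
  elim/ltn_ind: m mP => m IH [k Nk xk].
  have [[l [Nl xl]]|no] := boolp.EM (exists l, (N <= l)%N /\ (x l < m)%N).
    by apply: (IH (x l)) => //; exists l.
  exists k; split=> // l Nl; rewrite xk leqNgt; apply/negP => xl.
  by apply: no; exists l.
have [g gP] := boolp.choice ex.
pose s i := iter i (fun k => g k.+1) (g 0%N).
have sS i : (s i < s i.+1)%N by rewrite {2}/s iterS; case: (gP (s i).+1).
exists s; split.
  move=> i j; elim: j => // j IH; rewrite ltnS leq_eqVlt => /orP [/eqP -> //|/IH h].
  exact: ltn_trans h (sS _).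
have sx i l : (s i <= l)%N -> (x (s i) <= x l)%N.
  case: i => [|i] sl; first by have [_] := gP 0%N; apply.
  have [_] := gP (s i).+1; apply; apply: leq_trans sl; exact: sS.
move=> i j ij; apply: sx.
elim: j ij => [|j IH]; first by rewrite leqn0 => /eqP ->.
rewrite leq_eqVlt => /orP [/eqP -> //|]; rewrite ltnS => /IH h.
by apply: leq_trans h _; apply: ltnW.
Qed.

Lemma monotone_subseq_mnm n (x : nat -> 'X_{1..n}) :
  exists s : nat -> nat, (forall i j, (i < j)%N -> (s i < s j)%N) /\
    forall i j, (i <= j)%N -> (x (s i) <= x (s j))%MM.
Proof.
suff H k : exists s : nat -> nat, (forall i j, (i < j)%N -> (s i < s j)%N) /\
    forall i j, (i <= j)%N -> forall c : 'I_n, (c < k)%N -> (x (s i) c <= x (s j) c)%N.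
  have [s [s1 s2]] := H n; exists s; split=> // i j ij.
  by apply/mnm_lepP => c; apply: s2.
elim: k => [|k [s [s1 s2]]]; first by exists id.
have [kn|nk] := ltnP k n; last first.
  exists s; split=> // i j ij c ck; apply: s2 => //.
  by apply: leq_trans (ltn_ord c) nk.
have [t [t1 t2]] := monotone_subseq (fun i => x (s i) (Ordinal kn)).
exists (s \o t); split=> [i j ij|i j ij c]; first by apply/s1/t1.
rewrite ltnS leq_eqVlt => /orP [/eqP ck|ck].
  have -> : c = Ordinal kn by apply/val_inj.
  exact: t2.
apply: s2 => //; move: ij; rewrite leq_eqVlt => /orP [/eqP ->//|/t1 h].
exact: ltnW.
Qed.

(** If no finite subset of [M] were enough, one could choose successively elements of [M] divisible
    by none of the earlier ones; a subsequence increasing in every exponent contradicts this. *)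
Lemma dickson n (M : 'X_{1..n} -> Prop) :
  exists s : seq 'X_{1..n}, (forall m, m \in s -> M m) /\
    forall m, M m -> exists2 m', m' \in s & (m' <= m)%MM.
Proof.
apply: boolp.contrapT => no.
have ex (s : seq 'X_{1..n}) : exists m, (forall m, m \in s -> M m) ->
    M m /\ forall m', m' \in s -> ~~ (m' <= m)%MM.
  have [sM|nsM] := boolp.EM (forall m, m \in s -> M m); last first.
    by exists 0%MM => /nsM.
  apply: boolp.contrapT => no2; apply: no; exists s; split=> // m Mm.
  apply: boolp.contrapT => no3; apply: no2; exists m => _; split=> // m' m's.
  by apply/negP => le; apply: no3; exists m'.
have [f fP] := boolp.choice ex.
pose L i := iter i (fun s => f s :: s) [::].
have LM i : forall m, m \in L i -> M m.
  elim: i => [|i IH] m //=; rewrite inE => /orP [/eqP ->|/IH //].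
  by have [] := fP _ IH.
have fL i j : (i < j)%N -> f (L i) \in L j.
  elim: j => [//|j IH]; rewrite ltnS leq_eqVlt => /orP [/eqP ->|/IH h] /=.
    by rewrite inE eqxx.
  by rewrite inE h orbT.
have [s [s1 s2]] := monotone_subseq_mnm (fun i => f (L i)).
have [_ /(_ _ (fL _ _ (s1 0%N 1%N isT)))] := fP _ (LM (s 1%N)).
by rewrite s2.
Qed.

(** Finitely many elements of [I] have leading monomials dividing all leading monomials of [I];
    division by them terminates because the monomial order is well founded. *)
Theorem hilbert_basis (K : fieldType) n (I : {mpoly K[n]} -> Prop) :
  ideal I -> exists s, (forall p, p \in s -> I p) /\ forall p, I p -> gen s p.
Proof.
move=> iI; have [ms [msM msD]] := dickson (fun m => exists p, [/\ I p, p != 0 & mlead p = m]).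
have [g gP] : exists g : 'X_{1..n} -> {mpoly K[n]},
    forall m, m \in ms -> [/\ I (g m), g m != 0 & mlead (g m) = m].
  have ex m : exists p, m \in ms -> [/\ I p, p != 0 & mlead p = m].
    case: (boolP (m \in ms)) => [/msM [p pP]|_]; first by exists p.
    by exists 0.
  by have [g gP] := boolp.choice ex; exists g.
exists (map g ms); split=> [p /mapP [m mms ->]|p]; first by case: (gP m mms).
have gI q : gen (map g ms) q -> I q.
  by apply: gen_min => // r /mapP [m mms ->]; case: (gP m mms).
have [m] : exists m, mlead p = m by exists (mlead p).
elim/(well_founded_ind (@ltom_wf n)): m p => m IH p pm Ip.
have gid := gen_ideal (map g ms).
have [->|p0] := eqVneq p 0; first by case: gid.
have [m' m'ms m'le] := msD (mlead p) (ex_intro _ p (And3 Ip p0 erefl)).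
have [Ig g0 lg] := gP m' m'ms.
pose c := mleadc p / mleadc (g m').
pose q := c *: 'X_[mlead p - m'] * g m'.
have gq : gen (map g ms) q.
  by case: gid => _ _ h; apply: h; apply: mem_gen; apply: map_f.
have lq : mlead q = mlead p.
  rewrite /q -scalerAl mleadZ ?mulf_neq0 ?invr_eq0 ?mleadc_eq0 //.
  rewrite mleadM ?mpolyX_eq0 // ?mleadXm ?lg ?submK //.
  by rewrite -mleadc_eq0 mleadXm mcoeffX eqxx oner_eq0.
have cq : mleadc q = mleadc p.
  have X0 : 'X_[mlead p - m'] != 0 :> {mpoly K[n]}.
    by rewrite -mleadc_eq0 mleadXm mcoeffX eqxx oner_eq0.
  rewrite /q -scalerAl mleadcZE mleadM // mleadcM.
  by rewrite mleadXm mcoeffX eqxx mul1r divfK // mleadc_eq0.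
have -> : p = (p - q) + q by rewrite subrK.
case: (gid) => _ gD _; apply: gD => //.
have [->|pq0] := eqVneq (p - q) 0; first by case: gid.
apply: (IH (mlead (p - q))) => //; last by apply: idealB => //; apply: gI.
rewrite -pm lt_neqAle; apply/andP; split.
  apply/eqP => e; move: pq0; rewrite -mleadc_eq0 e mcoeffB -{2}lq cq subrr eqxx //.
by have := mleadB_le p q; rewrite lq joinxx.
Qed.

(** * Nullstellensatz *)

Lemma mpoly_alg_ind n (K : comNzRingType) (P : {mpoly K[n]} -> Prop) :
  (forall c, P c%:MP) -> (forall i, P 'X_i) ->
  (forall p q, P p -> P q -> P (p + q)) -> (forall p q, P p -> P q -> P (p * q)) ->
  forall p, P p.
Proof.
move=> PC PX PD PM p; elim/mpolyind: p => [|c m p _ _ IH]; first exact: (PC 0).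
apply: (PD) => //; rewrite -mul_mpolyC; apply: (PM) => //.
rewrite mpolyXE_id; apply: (big_ind P); [exact: (PC 1) | exact: PM |].
move=> i _; elim: (m i) => [|k IHk]; first by rewrite expr0; apply: (PC 1).
by rewrite exprS; apply: PM.
Qed.

Lemma digits_inj n (N : nat) (m m' : 'I_n -> nat) :
  (forall i, m i < N)%N -> (forall i, m' i < N)%N ->
  (\sum_(i < n) m i * N ^ i = \sum_(i < n) m' i * N ^ i)%N -> m =1 m'.
Proof.
elim: n m m' => [|n IH] m m' mN m'N; first by move=> _ [].
have N0 : (0 < N)%N by apply: leq_ltn_trans (mN ord0).
have shift (f : 'I_n.+1 -> nat) : (\sum_(i < n) f (lift ord0 i) * N ^ (lift ord0 i) =
    N * \sum_(i < n) f (lift ord0 i) * N ^ i)%N.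
  rewrite big_distrr /=; apply: eq_bigr => i _.
  by rewrite /bump /= add1n expnS mulnCA.
rewrite !big_ord_recl !shift !expn0 !muln1 => e.
have e0 : m ord0 = m' ord0.
  have := congr1 (modn^~ N) e.
  by rewrite ![(_ + N * _)%N]addnC ![(N * _)%N]mulnC !modnMDl !modn_small.
move: e; rewrite e0 => /addnI /eqP; rewrite eqn_pmul2l // => /eqP /IH e1 i.
case: (unliftP ord0 i) => [j ->|-> //].
by apply: e1.
Qed.

(** Kronecker substitution: [X_j] becomes the power [N ^ j] of a single variable, with [N] above all
    exponents, so that distinct monomials keep distinct exponents. The univariate polynomial
    obtained vanishes at too many natural numbers. *)
Lemma mpoly_eq0_fun n (K : numDomainType) (p : {mpoly K[n]}) :
  (forall v, p.@[v] = 0) -> p = 0.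
Proof.
move=> p0; pose N := msize p; pose e (m : 'X_{1..n}) := (\sum_(i < n) m i * N ^ i)%N.
pose q : {poly K} := \sum_(m <- msupp p) p@_m *: 'X^(e m).
have q0 : q = 0.
  apply: (@roots_geq_poly_eq0 _ q [seq i%:R | i <- iota 0 (size q)]).
  - apply/allP => x /mapP [i _ ->]; apply/rootP; rewrite /q horner_sum.
    rewrite -[RHS](p0 (fun j : 'I_n => i%:R ^+ (N ^ j))) mevalE.
    apply: eq_bigr => m _; rewrite hornerZ hornerXn; congr (_ * _).
    rewrite /e expr_sum; apply: eq_bigr => j _; by rewrite -exprM mulnC.
  - by rewrite map_inj_uniq ?iota_uniq // => i j /eqP; rewrite eqr_nat => /eqP.
  - by rewrite size_map size_iota.
apply/mpolyP => m; rewrite mcoeff0; apply/eqP; rewrite mcoeff_eq0; apply/negP => mp.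
have /eqP := congr1 (fun r : {poly K} => r`_(e m)) q0.
rewrite coef0 /q coef_sum (bigD1_seq m) ?msupp_uniq //= coefZ coefXn eqxx mulr1.
rewrite big_seq_cond big1 ?addr0; first by apply/negP; rewrite -mcoeff_msupp.
move=> m' /andP [m'p mm']; rewrite coefZ coefXn; case: eqP => [ee|]; last by rewrite mulr0.
have small (k : 'X_{1..n}) : k \in msupp p -> forall i, (k i < N)%N.
  move=> kp i; apply: leq_ltn_trans (msize_mdeg_lt kp).
  by rewrite mdegE (bigD1 i) //= leq_addr.
have := digits_inj (small _ mp) (small _ m'p) ee.
by move/mnmP => mm; rewrite mm eqxx in mm'.
Qed.

Lemma zorn_above (T : Type) (Q : (T -> Prop) -> Prop) (X0 : T -> Prop) :
  Q X0 ->
  (forall F : (T -> Prop) -> Prop, (exists A, F A) -> (forall A, F A -> Q A) ->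
     (forall A B, F A -> F B -> (forall x, A x -> B x) \/ (forall x, B x -> A x)) ->
     Q (fun x => exists2 A, F A & A x)) ->
  exists A, [/\ Q A, forall x, X0 x -> A x &
    forall B, Q B -> (forall x, A x -> B x) -> forall x, B x -> A x].
Proof.
move=> Q0 Qch.
(* [Zorn_bigcup] also considers the empty chain, whose union is empty; hence the first
   alternative. *)
pose P (A : classical_sets.set T) := (forall x, ~ A x) \/ (Q A /\ forall x, X0 x -> A x).
have [F FP Ftot|A [PA Amax]] := @classical_sets.Zorn_bigcup T P.
  have [[A FA [x Ax]]|no] := boolp.EM (exists2 A, F A & exists x, A x); last first.
    by left => x [A FA Ax]; apply: no; exists A => //; exists x.
  right; pose F' A := F A /\ exists x, A x.
  have FQ B : F' B -> Q B /\ forall x, X0 x -> B x.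
    by case=> FB [y By]; case: (FP _ FB) => // /(_ y).
  have FA' : F' A by split=> //; exists x.
  have eqU : classical_sets.bigcup F id = (fun x => exists2 B, F' B & B x).
    apply/boolp.funext => y; apply/boolp.propext; split=> [[B FB By]|[B [FB _] By]].
      by exists B => //; split=> //; exists y.
    by exists B.
  split; last by move=> y X0y; exists A => //; case: (FQ _ FA') => _; apply.
  rewrite eqU; apply: Qch; first by exists A.
    by move=> B /FQ [].
  by move=> B C [FB _] [FC _]; apply: Ftot.
have sup B : Q B -> (forall x, X0 x -> B x) -> (forall x, A x -> B x) -> forall x, B x -> A x.
  move=> QB X0B AB x Bx; apply: boolp.contrapT => nAx.
  apply: (Amax B); last by right.
  by split=> // /(_ x Bx).
case: PA => [A0|[QA X0A]].
  exists X0; split=> // B QB XB x Bx; case: (A0 x); apply: (sup B) => // y Ay.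
  by case: (A0 y).
by exists A; split=> // B QB AB; apply: sup => // x X0x; apply/AB/X0A.
Qed.

(** The form of uncountability that the Nullstellensatz uses: in every countable exhaustion of [K]
    by sublevel sets, one of them is infinite. *)
Definition finite_levels_escape (K : choiceType) := forall D : K -> nat,
  exists N, forall B, exists s : seq K, [/\ uniq s, size s = B & all (fun a => D a <= N)%N s].

Lemma kernel_row (K : fieldType) (B d : nat) (A : 'M[K]_(B, d)) :
  (d < B)%N -> exists2 c : 'rV_B, c != 0 & c *m A = 0.
Proof.
move=> dB; have : (0 < \rank (kermx A))%N.
  by rewrite mxrank_ker subn_gt0; apply: leq_ltn_trans (rank_leq_col A) dB.
rewrite lt0n mxrank_eq0 => /rowV0Pn [c cA c0]; exists c => //.
by apply/sub_kermxP.
Qed.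

Section Nullstellensatz.
Variables (K : numClosedFieldType) (n : nat).
Hypothesis unc : finite_levels_escape K.
Implicit Types I M : {mpoly K[n]} -> Prop.

(** If every [X_i - a] were invertible modulo [M], infinitely many of the inverses would have
    bounded degree, so that some of them are linearly dependent. Clearing denominators in the
    relation puts a nonzero polynomial in [X_i] alone into [M]; it splits into invertible linear
    factors, so [M] contains 1. *)
Lemma maximal_ideal_point M : ideal M -> ~ M 1 ->
  (forall q, ~ M q -> exists b, M (b * q - 1)) ->
  forall i, exists a, M ('X_i - a%:MP).
Proof.
move=> iM M1 Minv i; apply: boolp.contrapT => no.
have inv a : exists b, M (b * ('X_i - a%:MP) - 1) by apply: Minv => Ma; apply: no; exists a.
have [b bP] := boolp.choice inv.
have [N NP] := unc (fun a => msize (b a)).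
pose d := #|{: 'X_{1..n < N}}|.
have [s [us ss sN]] := NP d.+1.
have [c c0 cA] := kernel_row (\matrix_(j < d.+1, k < d) (b s`_j)@_(val (enum_val k))) (ltnSn d).
have sumb : \sum_(j < d.+1) c 0 j *: b s`_j = 0.
  apply/mpolyP => m; rewrite mcoeff0 raddf_sum /=.
  have [mN|mN] := ltnP (mdeg m) N.
    have /(congr1 (fun X : 'rV_d => X 0 (enum_rank (BMultinom mN)))) := cA.
    rewrite !mxE => e; rewrite -[RHS]e; apply: eq_bigr => j _.
    by rewrite mcoeffZ mxE enum_rankK.
  apply: big1 => j _; rewrite mcoeffZ [X in _ * X]memN_msupp_eq0 ?mulr0 //.
  apply: msize_mdeg_ge; apply: leq_trans mN.
  by apply: (allP sN); rewrite mem_nth // ss.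
have [ev [evC evX evD evM]] : exists ev : {poly K} -> {mpoly K[n]},
    [/\ forall a, ev a%:P = a%:MP, forall a, ev ('X - a%:P) = 'X_i - a%:MP,
        {morph ev : p q / p + q} & {morph ev : p q / p * q}].
  exists (horner_alg ('X_i : {mpoly K[n]})); split.
  - by move=> a; rewrite horner_algC alg_mpolyC.
  - by move=> a; rewrite rmorphB /= horner_algX horner_algC alg_mpolyC.
  - exact: rmorphD.
  - exact: rmorphM.
have ev0 : ev 0 = 0 by rewrite -polyC0 evC mpolyC0.
have ev1 : ev 1 = 1 by rewrite -polyC1 evC mpolyC1.
(* [q] is the numerator of [sum_j c_j / (X - s_j)]; its value at [s_j] is [c_j] times a nonzero
   product, so it is not zero. *)
pose tq j : {poly K} := (c 0 j)%:P * \prod_(l < d.+1 | l != j) ('X - (s`_l)%:P).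
pose q : {poly K} := \sum_(j < d.+1) tq j.
have [iM0 iMD iMM] := iM.
have Mq : M (ev q).
  rewrite /q (big_morph ev evD ev0).
  pose Pi : {mpoly K[n]} := \prod_(l < d.+1) ('X_i - (s`_l)%:MP).
  have evt (j : 'I_d.+1) : ev (tq j) = (c 0 j)%:MP * (- (\prod_(l < d.+1 | l != j) ('X_i - (s`_l)%:MP))
        * (b s`_j * ('X_i - (s`_j)%:MP) - 1)) + Pi * (c 0 j *: b s`_j).
    have -> : Pi = ('X_i - (s`_j)%:MP) * \prod_(l < d.+1 | l != j) ('X_i - (s`_l)%:MP).
      by rewrite /Pi (bigD1 j).
    rewrite /tq evM evC (big_morph ev evM ev1).
    under eq_bigr do rewrite evX.
    rewrite -mul_mpolyC.
    move: (\prod_(l < d.+1 | l != j) _) => P.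
    by ring.
  rewrite (eq_bigr _ (fun j _ => evt j)) big_split /= -mulr_sumr.
  rewrite sumb mulr0 addr0; apply: ideal_sum => // j _.
  by apply/iMM/iMM/bP.
have q0 : q != 0.
  have [j cj] : exists j, c 0 j != 0.
    apply: boolp.contrapT => no0; case/eqP: c0; apply/rowP => j; rewrite mxE.
    by apply/eqP; apply: boolp.contrapT => /negP cj; apply: no0; exists j.
  apply: contraNneq cj => q0; have := congr1 (fun r : {poly K} => r.[s`_j]) q0.
  rewrite horner0 /q horner_sum (bigD1 j) //= [X in _ + X]big1 => [|k kj]; rewrite /tq.
    rewrite addr0 hornerM hornerC horner_prod => /eqP; rewrite mulf_eq0 => /orP [//|].
    rewrite prodf_seq_eq0 => /hasP [l _ /andP [lj]].
    rewrite hornerXsubC subr_eq0 nth_uniq ?ss // => /eqP /val_inj jl.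
    by rewrite jl eqxx in lj.
  rewrite hornerM horner_prod (bigD1 j) ?(eq_sym j) //=.
  by rewrite hornerXsubC subrr mul0r mulr0.
have [r qr] := closed_field_poly_normal q.
have unit_inv p1 p2 b1 b2 : M (b1 * p1 - 1) -> M (b2 * p2 - 1) -> M ((b1 * b2) * (p1 * p2) - 1).
  move=> h1 h2; have -> : (b1 * b2) * (p1 * p2) - 1 =
    (b2 * p2) * (b1 * p1 - 1) + (b2 * p2 - 1) by ring.
  by apply: iMD => //; apply: iMM.
have [u Mu] : exists u, M (u * ev q - 1).
  rewrite qr -mul_polyC evM (big_morph ev evM ev1).
  have [u uP] : exists u, M (u * \prod_(z <- r) ev ('X - z%:P) - 1).
    elim: r {qr} => [|z r [u uP]]; first by exists 1; rewrite big_nil mulr1 subrr.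
    by exists (b z * u); rewrite big_cons; apply: unit_inv => //; rewrite evX.
  exists (((lead_coef q)^-1)%:MP * u); apply: unit_inv => //.
  rewrite evC -mpolyCM mulVf ?lead_coef_eq0 //.
  by rewrite mpolyC1 subrr.
apply: M1; have -> : 1 = u * ev q - (u * ev q - 1) :> {mpoly K[n]} by ring.
by apply: idealB => //; apply: iMM.
Qed.

(** Modulo a maximal ideal containing [I] each variable is congruent to a constant, so every
    polynomial is congruent to its value at the point formed by these constants. *)
Lemma weak_nullstellensatz I : ideal I -> ~ I 1 -> exists v, forall p, I p -> p.@[v] = 0.
Proof.
move=> iI I1.
have [|F [A0 FA0] FQ Ftot|M [[iM M1] IM Mmax]] :=
  @zorn_above {mpoly K[n]} (fun A => ideal A /\ ~ A 1) I; first by [].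
  split; last by case=> A /FQ [_ nA] /nA.
  split.
  - by exists A0 => //; have [[]] := FQ _ FA0.
  - move=> a b [A FA Aa] [B FB Bb].
    have [AB|BA] := Ftot _ _ FA FB.
      by exists B => //; have [[_ D _] _] := FQ _ FB; apply: D => //; apply: AB.
    by exists A => //; have [[_ D _] _] := FQ _ FA; apply: D => //; apply: BA.
  - by move=> c a [A FA Aa]; exists A => //; have [[_ _ h] _] := FQ _ FA; apply: h.
have [M0 MD MM] := iM.
have Minv q : ~ M q -> exists b, M (b * q - 1).
  move=> Mq; apply: boolp.contrapT => no; apply: Mq.
  pose B p := exists b, M (p - b * q).
  apply: (Mmax B); last by exists 1; rewrite mul1r subrr.
    split; last first.
      case=> b Mb; apply: no; exists b.
      by rewrite -opprB; apply: idealN.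
    split; first by exists 0; rewrite mul0r subrr.
      move=> p1 p2 [b1 h1] [b2 h2]; exists (b1 + b2).
      have -> : p1 + p2 - (b1 + b2) * q = (p1 - b1 * q) + (p2 - b2 * q) by ring.
      exact: MD.
    move=> c p [b h]; exists (c * b).
    have -> : c * p - c * b * q = c * (p - b * q) by ring.
    exact: MM.
  by move=> p Mp; exists 0; rewrite mul0r subr0.
have [a aP] := boolp.choice (maximal_ideal_point iM M1 Minv).
exists a => p Ip.
have h : M (p - (p.@[a])%:MP).
  elim/mpoly_alg_ind: p {Ip} => [c|i|p q hp hq|p q hp hq].
  - by rewrite mevalC subrr.
  - by rewrite mevalXU.
  - have -> : p + q - ((p + q).@[a])%:MP = (p - (p.@[a])%:MP) + (q - (q.@[a])%:MP).
      by rewrite mevalD mpolyCD; ring.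
    exact: MD.
  - have -> : p * q - ((p * q).@[a])%:MP =
       q * (p - (p.@[a])%:MP) + (p.@[a])%:MP * (q - (q.@[a])%:MP).
      by rewrite mevalM mpolyCM; ring.
    by apply: MD; apply: MM.
apply/eqP/negPn/negP => pa; apply: M1.
have -> : 1 = ((p.@[a])^-1)%:MP * (p.@[a])%:MP :> {mpoly K[n]}.
  by rewrite -mpolyCM mulVf // mpolyC1.
apply: MM; have -> : (p.@[a])%:MP = p - (p - (p.@[a])%:MP) by ring.
by apply: idealB => //; apply: IM.
Qed.

End Nullstellensatz.

Lemma meval_homog_scale n (K : comNzRingType) d (p : {mpoly K[n]}) c v :
  p \is d.-homog -> p.@[fun i => c * v i] = c ^+ d * p.@[v].
Proof.
move=> hp; rewrite !mevalE mulr_sumr [LHS]big_seq [RHS]big_seq.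
apply: eq_bigr => m mp; rewrite mulrCA; congr (_ * _).
have -> : d = mdeg m by rewrite -(dhomog_mf hp mp).
rewrite mdegE -prodrXr -big_split /=.
by apply: eq_bigr => i _; rewrite exprMn.
Qed.

Lemma dhomogM_eq n (K : comNzRingType) d1 d2 d (p q : {mpoly K[n]}) :
  p \is d1.-homog -> q \is d2.-homog -> (d1 + d2)%N = d -> p * q \is d.-homog.
Proof. by move=> hp hq <-; apply: dhomogM. Qed.

Lemma homog_eq0_chart n (K : numFieldType) d (p : {mpoly K[n]}) i :
  p \is d.-homog -> (forall v, v i = 1 -> p.@[v] = 0) -> p = 0.
Proof.
move=> hp p0; have : p * 'X_i = 0.
  apply: mpoly_eq0_fun => v; rewrite mevalM mevalXU.
  have [->|vi] := eqVneq (v i) 0; first by rewrite mulr0.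
  have -> : p.@[v] = p.@[fun j => v i * ((v i)^-1 * v j)].
    by apply: meval_eq => j; rewrite mulVKf.
  by rewrite (meval_homog_scale _ _ hp) p0 ?mulr0 ?mul0r // mulVf.
move/eqP; rewrite mulf_eq0 => /orP [/eqP //|/eqP X0].
have := congr1 (mcoeff U_(i)) X0; rewrite mcoeffX eqxx mcoeff0 => /eqP.
by rewrite oner_eq0.
Qed.

(** Each variable is treated in the chart [X_i = 1]: a common zero of [I] there would be a forbidden
    nontrivial zero, so 1 lies in [I + (X_i - 1)], and homogenizing the part in [I] exhibits a power
    of [X_i] in [I]. *)
Theorem homogeneous_nullstellensatz (K : numClosedFieldType) n
    (I : {mpoly K[n]} -> Prop) : finite_levels_escape K ->
  ideal I -> (forall p d, I p -> I (pihomog mdeg d p)) ->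
  (forall v, (forall p, I p -> p.@[v] = 0) -> forall i, v i = 0) ->
  exists k, forall m : 'X_{1..n}, (k <= mdeg m)%N -> I 'X_[m].
Proof.
move=> unc iI hI zI; have [I0 ID IM] := iI.
have pow i : exists k, I ('X_i ^+ k).
  have [[a [b [Ia ab]]]|no] := boolp.EM (exists a b, I a /\ 1 = a + b * ('X_i - 1)).
    exists (msize a); pose a' := \sum_(d < msize a) pihomog mdeg d a * 'X_i ^+ (msize a - d).
    suff -> : 'X_i ^+ msize a = a'.
      by apply: ideal_sum => // d _; rewrite mulrC; apply/IM/hI.
    have Xh k : ('X_i ^+ k : {mpoly K[n]}) \is k.-homog.
      by have := dhomogMn k (_ : ('X_i : {mpoly K[n]}) \is 1.-homog); rewrite mul1n; apply; rewrite dhomogX /= mdeg1.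
    apply/eqP; rewrite -subr_eq0; apply/eqP; apply: (@homog_eq0_chart _ _ (msize a) _ i).
      apply: rpredB => //; apply: rpred_sum => d _.
      by apply: (dhomogM_eq (pihomogP _ _ _) (Xh _)); rewrite subnKC // ltnW.
    move=> v vi; rewrite mevalB rmorphXn /= mevalXU vi expr1n /a' (raddf_sum (meval v)).
    under eq_bigr do rewrite /= mevalM rmorphXn /= mevalXU vi expr1n mulr1.
    rewrite -(raddf_sum (meval v)) /= -(pihomog_partitionE (mf := mdeg)) //.
    have := congr1 (meval v) ab; rewrite mevalD mevalM mevalB mevalXU !meval1 vi subrr mulr0 addr0 => ->.
    by rewrite subrr.
  have [|h1|v vP] := @weak_nullstellensatz _ _ unc (fun p => exists a b, I a /\ p = a + b * ('X_i - 1)).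
  - split; first by exists 0, 0; rewrite mul0r addr0.
      move=> p q [a [b [Ia ->]]] [a' [b' [Ia' ->]]]; exists (a + a'), (b + b').
      by split; [apply: ID | ring].
    move=> c p [a [b [Ia ->]]]; exists (c * a), (c * b).
    by split; [apply: IM | ring].
  - by case: no.
  have /eqP : ('X_i - 1 : {mpoly K[n]}).@[v] = 0.
    by apply: vP; exists 0, 1; rewrite mul1r add0r.
  rewrite mevalB mevalXU meval1 subr_eq0 => /eqP vi.
  have /eqP := zI v (fun p Ip => vP p (ex_intro _ p (ex_intro _ 0 (conj Ip (esym (etrans (congr1 _ (mul0r _)) (addr0 p))))))) i.
  by rewrite vi oner_eq0.
have [k kP] := boolp.choice pow.
exists (\sum_i k i).+1 => m; rewrite mdegE => le.
have [i ki] : exists i, (k i <= m i)%N.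
  apply: boolp.contrapT => no; suff : (\sum_i m i <= \sum_i k i)%N by rewrite leqNgt le.
  apply: leq_sum => i _; rewrite leqNgt; apply/negP => h.
  by apply: no; exists i; apply: ltnW.
have -> : m = (m - U_(i) *+ k i + U_(i) *+ k i)%MM.
  rewrite submK //; apply/mnm_lepP => j; rewrite mulmnE mnm1E.
  by case: eqP => [<-|_]; rewrite ?mul1n ?mul0n.
by rewrite mpolyXD; apply: IM; rewrite -mpolyXn.
Qed.

(** Cantor's argument: if all sublevel sets were finite, nested closed intervals could avoid them
    one after another, and the supremum of the left endpoints would have no level. *)
Lemma real_levels_escape (R : realType) : finite_levels_escape R.
Proof.
move=> D; apply: boolp.contrapT => no.
have ex N : exists s : seq R, forall a, (D a <= N)%N -> a \in s.
  have [B BP] : exists B, ~ exists s : seq R, [/\ uniq s, size s = B & all (fun a => D a <= N)%N s].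
    apply: boolp.contrapT => no2; apply: no; exists N => B.
    by apply: boolp.contrapT => no3; apply: no2; exists B.
  elim: B BP => [|B IH] BP; first by case: BP; exists [::].
  have [[s [us ss sN]]|h] := boolp.EM (exists s : seq R, [/\ uniq s, size s = B & all (fun a => D a <= N)%N s]); last exact: IH.
  exists s => a aN; apply/negPn/negP => as_; apply: BP; exists (a :: s).
  by rewrite /= as_ us ss aN.
have [s sP] := boolp.choice ex.
pose ok (l : seq R) (I J : R * R) := [/\ I.1 <= J.1, J.1 < J.2, J.2 <= I.2 &
  forall x, x \in l -> ~ (J.1 <= x <= J.2)].
have step l (I : R * R) : exists J, I.1 < I.2 -> ok l I J.
  suff H : I.1 < I.2 -> exists J, ok l I J.
    have [/H [J JP]|] := boolP (I.1 < I.2); [by exists J | by exists I].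
  move=> lt.
  elim: l I lt => [|x l IH] I lt; first by exists I; split.
  have [J [J1 J2 J3 J4]] := IH I lt.
  have [xm|mx] := lerP x ((J.1 + J.2) / 2).
    exists ((J.1 + 3 * J.2) / 4, J.2); split => /=; [lra|lra|lra|].
    move=> y; rewrite inE => /orP [/eqP ->|yl /andP [h1 h2]]; first by move=> /andP []; lra.
    by apply: (J4 y yl); apply/andP; split => //; lra.
  exists (J.1, (3 * J.1 + J.2) / 4); split => /=; [lra|lra|lra|].
  move=> y; rewrite inE => /orP [/eqP ->|yl /andP [h1 h2]]; first by move=> /andP []; lra.
  by apply: (J4 y yl); apply/andP; split => //; lra.
have step2 (k : nat) : {f : R * R -> R * R & forall I : R * R, I.1 < I.2 -> ok (s k) I (f I)}.
  exact: boolp.choice (step (s k)).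
pose f k := projT1 (step2 k).
pose J := fix J k := if k is k'.+1 then f k' (J k') else (0, 1) : R * R.
have Jlt k : (J k).1 < (J k).2.
  elim: k => [|k IH]; first by rewrite /= ltr01.
  by have [] := projT2 (step2 k) _ IH.
have Jok k : ok (s k) (J k) (J k.+1) := projT2 (step2 k) _ (Jlt k).
have J1 k l : (k <= l)%N -> (J k).1 <= (J l).1.
  elim: l => [|l IH]; first by rewrite leqn0 => /eqP ->.
  rewrite leq_eqVlt => /orP [/eqP -> //|/IH h]; have [h1 _ _ _] := Jok l.
  exact: le_trans h h1.
have J2 k l : (k <= l)%N -> (J l).2 <= (J k).2.
  elim: l => [|l IH]; first by rewrite leqn0 => /eqP ->.
  rewrite leq_eqVlt => /orP [/eqP -> //|/IH h]; have [_ _ h1 _] := Jok l.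
  exact: le_trans h1 h.
pose A : classical_sets.set R := fun x => exists k, x = (J k).1.
have Aub k : classical_sets.ubound A (J k).2.
  move=> _ [l ->]; have [kl|/ltnW lk] := leqP k l.
    by apply: le_trans (J2 _ _ kl); apply: ltW.
  by apply: le_trans (J1 _ _ lk) _; apply: ltW.
have supA : classical_sets.has_sup A by split; [exists (J 0%N).1, 0%N | exists (J 0%N).2; apply: Aub].
have in_ k : (J k).1 <= sup A <= (J k).2.
  apply/andP; split; first by apply: ub_le_sup => //; [case: supA | exists k].
  by apply: ge_sup; [case: supA | apply: Aub].
have [_ _ _ /(_ (sup A))] := Jok (D (sup A)); apply; last exact: in_.
exact: sP.
Qed.

Lemma complex_levels_escape (R : realType) : finite_levels_escape R[i].
Proof.
move=> D; have [N NP] := real_levels_escape (fun x : R => D x%:C%C).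
exists N => B; have [s [us ss sN]] := NP B.
exists (map (fun x => x%:C%C) s); split; last by rewrite all_map.
  by rewrite map_inj_uniq // => x y [].
by rewrite size_map.
Qed.

(** * Krull's intersection theorem *)

Lemma gen_cat (T : comNzRingType) (s1 s2 : seq T) p :
  gen (s1 ++ s2) p -> exists a b, [/\ gen s1 a, gen s2 b & p = a + b].
Proof.
case=> c ->; exists (\sum_(i < size s1) c i * s1`_i).
exists (\sum_(i < size s2) c (size s1 + i)%N * s2`_i); split.
- by exists c.
- by exists (fun i => c (size s1 + i)%N).
rewrite size_cat big_split_ord /=; congr (_ + _); apply: eq_bigr => i _.
  by rewrite nth_cat ltn_ord.
by rewrite nth_cat ltnNge leq_addr /= addKn.
Qed.

Section OrderAtOrigin.
Variables (n : nat) (K : comNzRingType).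
Implicit Types p q : {mpoly K[n]}.

(** The [k]-th power of the maximal ideal at the origin, read off from the coefficients. *)
Definition ord_ge k p := forall m, (mdeg m < k)%N -> p@_m = 0.

Lemma ord_ge0 p : ord_ge 0 p. Proof. by []. Qed.

Lemma ord_geW k l p : (k <= l)%N -> ord_ge l p -> ord_ge k p.
Proof. by move=> kl h m mk; apply: h; apply: leq_trans kl. Qed.

Lemma ord_geD k p q : ord_ge k p -> ord_ge k q -> ord_ge k (p + q).
Proof. by move=> hp hq m mk; rewrite mcoeffD hp // hq // addr0. Qed.

Lemma ord_geN k p : ord_ge k p -> ord_ge k (- p).
Proof. by move=> hp m mk; rewrite mcoeffN hp // oppr0. Qed.

Lemma ord_ge_0 k : ord_ge k 0.
Proof. by move=> m _; rewrite mcoeff0. Qed.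

Lemma ord_ge_sum k (J : Type) (r : seq J) (P : pred J) (F : J -> {mpoly K[n]}) :
  (forall j, P j -> ord_ge k (F j)) -> ord_ge k (\sum_(j <- r | P j) F j).
Proof.
move=> h; apply: (big_ind (ord_ge k)) => //; first exact: ord_ge_0.
exact: ord_geD.
Qed.

Lemma ord_geM k l p q : ord_ge k p -> ord_ge l q -> ord_ge (k + l) (p * q).
Proof.
move=> hp hq m mkl; rewrite mcoeffM big1 // => -[m1 m2] /= /eqP em.
have [h|h] := ltnP (mdeg m1) k; first by rewrite hp // mul0r.
rewrite hq ?mulr0 //; have lt : (mdeg m1 + mdeg m2 < k + l)%N by rewrite -mdegD -em.
by rewrite -(ltn_add2l k); apply: leq_ltn_trans lt; rewrite leq_add2r.
Qed.

Lemma ord_geZ k (c : K) p : ord_ge k p -> ord_ge k (c *: p).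
Proof. by move=> hp m mk; rewrite mcoeffZ hp // mulr0. Qed.

Lemma ord_geX m : ord_ge (mdeg m) 'X_[m].
Proof.
by move=> m' lt; rewrite mcoeffX; case: eqP lt => // ->; rewrite ltnn.
Qed.

End OrderAtOrigin.

(* The Rees algebra of the maximal ideal at the origin is a quotient of a     *)
(* polynomial ring in twice as many variables.                                *)
Lemma rees_presentation (n : nat) (K : fieldType) :
  exists rees : {mpoly K[n + n]} -> {poly {mpoly K[n]}},
    [/\ {morph rees : p q / p + q}, {morph rees : p q / p * q},
        forall c, rees c%:MP = (c%:MP)%:P,
        forall i, rees 'X_(lshift n i) = ('X_i)%:P
      & forall i, rees 'X_(rshift n i) = ('X_i)%:P * 'X].
Proof.
pose x (i : 'I_(n + n)) : {poly {mpoly K[n]}} :=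
  match split i with inl i => ('X_i)%:P | inr i => ('X_i)%:P * 'X end.
exists (mmap (polyC \o @mpolyC n K) x); split.
- exact: mmapD.
- exact: rmorphM.
- by move=> c; rewrite mmapC.
- by move=> i; rewrite mmapX mmap1U /x (unsplitK (inl i)).
- by move=> i; rewrite mmapX mmap1U /x (unsplitK (inr i)).
Qed.

Lemma mcoeff_pihomog n (K : nzRingType) d (p : {mpoly K[n]}) m :
  (pihomog mdeg d p)@_m = if mdeg m == d then p@_m else 0.
Proof.
elim/mpolyind: p => [|c m' p _ _ IH]; first by rewrite raddf0 mcoeff0 if_same.
rewrite linearP /= !mcoeffD !mcoeffZ IH pihomogX mcoeffX /=.
case: (altP (m' =P m)) => [->|mm]; first by case: eqP; rewrite ?mcoeffX ?eqxx ?mcoeff0 ?mulr0 ?addr0.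
rewrite mulr0 add0r; case: eqP => _; last by rewrite mcoeff0 mulr0 add0r.
by rewrite mcoeffX (negbTE mm) mulr0 add0r.
Qed.

Section Krull.
Variables (n : nat) (K : fieldType).
Implicit Types p q h : {mpoly K[n]}.

Section Rees.
Variable rees : {mpoly K[n + n]} -> {poly {mpoly K[n]}}.
Hypotheses (reesD : {morph rees : p q / p + q}) (reesM : {morph rees : p q / p * q}).
Hypothesis reesC : forall c, rees c%:MP = (c%:MP)%:P.
Hypothesis reesXl : forall i, rees 'X_(lshift n i) = ('X_i)%:P.
Hypothesis reesXr : forall i, rees 'X_(rshift n i) = ('X_i)%:P * 'X.

Let rees0 : rees 0 = 0.
Proof. by rewrite -mpolyC0 reesC mpolyC0. Qed.

Lemma rees_const p : exists P, rees P = p%:P.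
Proof.
elim/mpoly_alg_ind: p => [c|i|p q [P hP] [Q hQ]|p q [P hP] [Q hQ]].
- by exists c%:MP.
- by exists 'X_(lshift n i).
- by exists (P + Q); rewrite reesD hP hQ polyCD.
- by exists (P * Q); rewrite reesM hP hQ polyCM.
Qed.

(** In the Rees algebra the [d]-th coefficient lies in the [d]-th power of the maximal ideal. Its
    vanishing at the origin gives the multiplier in Krull's theorem the value 1 there. *)
Lemma rees_coef0 P d : (0 < d)%N -> ((rees P)`_d)@_0%MM = 0.
Proof.
elim/mpoly_alg_ind: P d => [c|i|p q hp hq|p q hp hq] d d0.
- by rewrite reesC coefC; case: d d0 => // d _; rewrite mcoeff0.
- case: (split_ordP i) => j ->.
    by rewrite reesXl coefC; case: d d0 => // d _; rewrite mcoeff0.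
  rewrite reesXr coefCM coefX; case: eqP => _; rewrite ?mulr0 ?mcoeff0 // mulr1 mcoeffX.
  by rewrite mnm1_eq0.
- by rewrite reesD coefD mcoeffD hp // hq // addr0.
- rewrite reesM coefM raddf_sum /= big1 // => j _; rewrite rmorphM /=.
  have [j0|j0] := posnP j; last by rewrite hp ?mul0r.
  by rewrite hq ?mulr0 // subn_gt0 j0.
Qed.

Lemma rees_lift k p : ord_ge k p -> exists P, rees P = p%:P * 'X^k.
Proof.
move=> hp; have mon m : (k <= mdeg m)%N -> exists P, rees P = ('X_[m])%:P * 'X^k.
  elim: k m {hp} => [|k IH] m km; first by have [P hP] := rees_const 'X_[m]; exists P; rewrite hP expr0 mulr1.
  have [i mi] : exists i, m i != 0%N.
    apply: boolp.contrapT => no; move: km; rewrite mdegE big1 // => i _.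
    by apply/eqP/negPn/negP => mi; apply: no; exists i.
  have em : m = (U_(i) + (m - U_(i)))%MM.
    by rewrite addmC submK // lep1mP.
  have [|P PP] := IH (m - U_(i))%MM.
    by move: km; rewrite {1}em mdegD mdeg1 add1n.
  exists ('X_(rshift n i) * P); rewrite reesM PP reesXr.
  by rewrite {2}em mpolyXD polyCM exprS; ring.
have : exists F : 'X_{1..n} -> {mpoly K[n + n]}, forall m, (k <= mdeg m)%N -> rees (F m) = ('X_[m])%:P * 'X^k.
  have ex m : exists P, (k <= mdeg m)%N -> rees P = ('X_[m])%:P * 'X^k.
    have [/mon [P PP]|_] := boolP (k <= mdeg m)%N; first by exists P.
    by exists 0.
  by have [F FP] := boolp.choice ex; exists F.
case=> F FP; exists (\sum_(m <- msupp p) (p@_m)%:MP * F m).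
have -> : p%:P = \sum_(m <- msupp p) (p@_m *: 'X_[m])%:P.
  by rewrite {1}(mpolyE p) (big_morph polyC (@polyCD _) (@polyC0 _)).
rewrite (big_morph rees reesD rees0) mulr_suml.
rewrite [LHS]big_seq [RHS]big_seq; apply: eq_bigr => m mp.
rewrite reesM reesC FP; first by rewrite -mul_mpolyC polyCM mulrA.
by rewrite leqNgt; apply/negP => lt; move: mp; rewrite mcoeff_msupp hp // eqxx.
Qed.

(* Perdry's argument: the lifts of h to the successive powers of the maximal   *)
(* ideal generate a finitely generated ideal of the Rees algebra.              *)
Lemma krull_intersection_rees (f : seq {mpoly K[n]}) h :
  (forall k, exists a, gen f a /\ ord_ge k (h - a)) ->
  exists s, s@_0%MM = 1 /\ gen f (s * h).
Proof.
move=> H; have [a aP] := boolp.choice H.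
have ex k : exists P, rees P = (h - a k)%:P * 'X^k by apply: rees_lift; have [] := aP k.
have [P PP] := boolp.choice ex.
have [incl inclE] := boolp.choice rees_const.
(* The ascending ideals generated by the lifts of [f] and of the first [r] errors have a finitely
   generated union, so some lift [P r] already lies in the ideal of the previous ones. *)
pose G r := map incl f ++ [seq P i | i <- iota 0 r].
have Gsub r r' : (r <= r')%N -> forall Q, gen (G r) Q -> gen (G r') Q.
  move=> rr; apply: gen_min; first exact: gen_ideal.
  move=> q; rewrite mem_cat => /orP [qf|qP].
    by apply: mem_gen; rewrite mem_cat qf.
  case/mapP: qP => i.
  rewrite mem_iota add0n /= => ir ->; apply: mem_gen; rewrite mem_cat; apply/orP; right.
  by apply: map_f; rewrite mem_iota add0n /= (leq_trans ir).
have iI : ideal (fun Q => exists r, gen (G r) Q).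
  split; first by exists 0%N; have [] := gen_ideal (G 0%N).
    move=> p q [r hr] [r' hr']; exists (maxn r r').
    have [_ D _] := gen_ideal (G (maxn r r')).
    by apply: D; [apply: Gsub hr; apply: leq_maxl | apply: Gsub hr'; apply: leq_maxr].
  by move=> c p [r hr]; exists r; have [_ _ M] := gen_ideal (G r); apply: M.
have [s [sI sgen]] := hilbert_basis iI.
have [r rP] : exists r, forall Q, Q \in s -> gen (G r) Q.
  elim: s sI {sgen} => [|q s IH] sI; first by exists 0%N.
  have [|r rP] := IH; first by move=> q' q's; apply: sI; rewrite inE q's orbT.
  have [r' r'P] := sI q (mem_head _ _).
  exists (maxn r r') => q'; rewrite inE => /orP [/eqP ->|/rP h'].
    by apply: Gsub r'P; apply: leq_maxr.
  by apply: Gsub h'; apply: leq_maxl.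
have Pr : gen (G r) (P r).
  apply: (gen_min (gen_ideal (G r)) rP); apply: sgen.
  exists r.+1; apply: mem_gen; rewrite mem_cat; apply/orP; right.
  by apply: map_f; rewrite mem_iota add0n ltnSn.
have [A [B [hA [Q hB] PAB]]] := gen_cat Pr.
have [f0 fD fM] := gen_ideal f.
have Af : gen f ((rees A)`_r).
  case: hA => c ->; rewrite (big_morph rees reesD rees0) coef_sum.
  apply: ideal_sum; first exact: gen_ideal.
  move=> i _; have fi : (i < size f)%N by case: i => i /=; rewrite size_map.
  rewrite (nth_map 0) // reesM inclE coefMC.
  by apply: fM; apply: mem_gen; apply: mem_nth.
pose t i := (rees (Q i))`_(r - i).
(* The coefficient of ['X^r] in the relation for [P r]; the [t i] are coefficients of positive
   degree [r - i], hence vanish at the origin. *)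
have e : h - a r = (rees A)`_r + \sum_(i < r) t i * (h - a i).
  have := congr1 (fun Q => (rees Q)`_r) PAB.
  rewrite PP coefMXn ltnn subnn coefC eqxx => ->.
  rewrite reesD coefD; congr (_ + _).
  rewrite hB (big_morph rees reesD rees0) coef_sum.
  have sr : size [seq P i | i <- iota 0 r] = r by rewrite size_map size_iota.
  rewrite sr; apply: eq_bigr => i _.
  rewrite (nth_map 0%N) ?size_iota // nth_iota // add0n reesM PP mulrA coefMXn.
  by rewrite ltnNge ltnW //= coefMC.
exists (1 - \sum_(i < r) t i); split.
  rewrite mcoeffB mcoeff1 eqxx raddf_sum /= big1 ?subr0 // => i _.
  by rewrite /t rees_coef0 // subn_gt0.
have -> : (1 - \sum_(i < r) t i) * h = a r + (rees A)`_r - \sum_(i < r) t i * a i.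
  have -> : \sum_(i < r) t i * a i = \sum_(i < r) t i * h - \sum_(i < r) t i * (h - a i).
    rewrite -sumrB; apply: eq_bigr => i _; ring.
  rewrite mulrBl mul1r mulr_suml; move: e; move: (\sum_(i < r) t i * (h - _)) => S.
  by move: (\sum_(i < r) t i * h) ((rees A)`_r) => S' x /eqP; rewrite subr_eq => /eqP {1}->; ring.
apply: idealB; first exact: gen_ideal.
  by apply: fD => //; have [] := aP r.
by apply: ideal_sum => [|i _]; [exact: gen_ideal | apply: fM; have [] := aP i].
Qed.

End Rees.

Lemma krull_intersection (f : seq {mpoly K[n]}) h :
  (forall k, exists a, gen f a /\ ord_ge k (h - a)) ->
  exists s, s@_0%MM = 1 /\ gen f (s * h).
Proof.
have [rees [reesD reesM reesC reesXl reesXr]] := rees_presentation n K.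
exact: krull_intersection_rees reesD reesM reesC reesXl reesXr _ _.
Qed.

End Krull.

(** * Taylor expansion in tangent coordinates modulo the equations *)

Section Taylor.
Variables (n c : nat) (K : fieldType).
Variables (f : 'I_c -> {mpoly K[n]}) (B : 'I_c -> 'I_n -> K).
Hypothesis f0 : forall j, (f j)@_0%MM = 0.
Implicit Types p q h T : {mpoly K[n]}.

Definition lin_part p : {mpoly K[n]} := \sum_a p@_U_(a) *: 'X_a.

(** When the vectors [B j] are dual to the differentials of the [f j], these are the components of
    the linear projection onto the tangent space along the span of the [B j]. *)
Definition tangent_proj : n.-tuple {mpoly K[n]} :=
  [tuple 'X_a - \sum_j B j a *: lin_part (f j) | a < n].

Local Notation If := (gen (codom f)).

Let Iord k p := exists a, If a /\ ord_ge k (p - a).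

Let IordD k p q : Iord k p -> Iord k q -> Iord k (p + q).
Proof.
move=> [a [Ia ha]] [b [Ib hb]]; exists (a + b); split.
  by have [_ D _] := gen_ideal (codom f); apply: D.
have -> : p + q - (a + b) = (p - a) + (q - b) by ring.
exact: ord_geD.
Qed.

Let IordM k l p q : ord_ge k p -> Iord l q -> Iord (k + l) (p * q).
Proof.
move=> hp [a [Ia ha]]; exists (p * a); split.
  by have [_ _ M] := gen_ideal (codom f); apply: M.
by rewrite -mulrBr; apply: ord_geM.
Qed.

Let Iord_ord k p : ord_ge k p -> Iord k p.
Proof. by exists 0; split; [have [] := gen_ideal (codom f) | rewrite subr0]. Qed.

Let IordC k (b : K) p : Iord k p -> Iord k (b *: p).
Proof. by rewrite -mul_mpolyC -(add0n k); apply: IordM. Qed.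

Let Iord_sum k (J : Type) (r : seq J) (P : pred J) (F : J -> {mpoly K[n]}) :
  (forall j, P j -> Iord k (F j)) -> Iord k (\sum_(j <- r | P j) F j).
Proof.
move=> h; apply: (big_ind (Iord k)) => // [|x y]; first exact/Iord_ord/ord_ge_0.
exact: IordD.
Qed.

Lemma lin_part_ord2 p : p@_0%MM = 0 -> ord_ge 2 (p - lin_part p).
Proof.
move=> p0 m; rewrite mcoeffB /lin_part raddf_sum /=.
under eq_bigr do rewrite mcoeffZ mcoeffX.
case: (posnP (mdeg m)) => [/eqP|m0 m2].
  rewrite mdeg_eq0 => /eqP -> _; rewrite p0 big1 ?subr0 // => i _.
  by rewrite mnm1_eq0 mulr0.
have /mdeg1P [i /eqP ->] : mdeg m == 1%N by rewrite eqn_leq m0 andbT -ltnS.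
rewrite (bigD1 i) //= eqxx mulr1 big1 ?addr0 ?subrr // => j ji.
by rewrite eq_mnm1 (negbTE ji) mulr0.
Qed.

Let lin_ord1 p : ord_ge 1 (lin_part p).
Proof.
apply: ord_ge_sum => i _; apply: ord_geZ.
by have := @ord_geX n K U_(i); rewrite mdeg1.
Qed.

Let projE a : tnth tangent_proj a = 'X_a - \sum_j B j a *: lin_part (f j).
Proof. by rewrite tnth_mktuple. Qed.

Let proj_ord1 a : ord_ge 1 (tnth tangent_proj a).
Proof.
rewrite projE; apply: ord_geD.
  by have := @ord_geX n K U_(a); rewrite mdeg1.
by apply: ord_geN; apply: ord_ge_sum => j _; apply/ord_geZ/lin_ord1.
Qed.

Let Iord_proj a : Iord 2 ('X_a - tnth tangent_proj a).
Proof.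
rewrite projE opprB addrC subrK; apply: Iord_sum => j _; apply: IordC.
exists (f j); split; first by apply: mem_gen; apply: codom_f.
by rewrite -opprB; apply/ord_geN/lin_part_ord2.
Qed.

Let mon_proj_ord m : ord_ge (mdeg m) ('X_[m] \mPo tangent_proj).
Proof.
rewrite comp_mpolyX mdegE; elim/big_ind2: _ => // [k p l q hp hq|i _].
  exact: ord_geM.
elim: (m i) => // k IH; rewrite exprS -add1n; apply: ord_geM => //.
Qed.

Let mon_taylor m : Iord (mdeg m).+1 ('X_[m] - ('X_[m] \mPo tangent_proj)).
Proof.
elim: {m}(mdeg m) {-2}m (erefl (mdeg m)) => [|k IH] m mk.
  move/eqP: mk; rewrite mdeg_eq0 => /eqP ->.
  rewrite mpolyX0 comp_mpoly1 subrr; exact/Iord_ord/ord_ge_0.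
have [i mi] : exists i, m i != 0%N.
  apply: boolp.contrapT => no; move: mk; rewrite mdegE big1 // => i _.
  by apply/eqP/negPn/negP => mi; apply: no; exists i.
have em : m = (U_(i) + (m - U_(i)))%MM by rewrite addmC submK // lep1mP.
move: (m - U_(i))%MM em mk => m' ->; rewrite mdegD mdeg1 add1n => -[mk].
rewrite mpolyXD rmorphM /= comp_mpolyXU -tnth_nth.
set p := 'X_[m'] \mPo _; set t := tnth _ i.
have -> : 'X_i * 'X_[m'] - t * p = 'X_i * ('X_[m'] - p) + p * ('X_i - t) by ring.
apply: IordD.
  rewrite -add1n; apply: IordM; last by apply: IH.
  by have := @ord_geX n K U_(i); rewrite mdeg1.
by rewrite -addn2; apply: IordM; [exact: mon_proj_ord | exact: Iord_proj].
Qed.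

(** Each coordinate agrees with its tangent projection modulo the ideal of [f] and terms of order 2,
    so a form of degree [k] agrees with its pullback up to order [k + 1]. Correcting degree by
    degree replaces [h] by a function of the tangent coordinates. *)
Lemma taylor_mod h k : exists T, exists a, If a /\ ord_ge k (h - (T \mPo tangent_proj) - a).
Proof.
elim: k => [|k [T [a [Ia ha]]]].
  by exists 0, 0; split; [have [] := gen_ideal (codom f) | exact: ord_ge0].
pose r := h - (T \mPo tangent_proj) - a.
pose rk := pihomog mdeg k r.
have rkh : rk \is k.-homog by exact: pihomogP.
have h1 : Iord k.+1 (rk - (rk \mPo tangent_proj)).
  have -> : rk - (rk \mPo tangent_proj) =
     \sum_(m <- msupp rk) rk@_m *: ('X_[m] - ('X_[m] \mPo tangent_proj)).
    under eq_bigr do rewrite scalerBr -comp_mpolyZ.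
    by rewrite sumrB -(raddf_sum (comp_mpoly tangent_proj)) /= -mpolyE.
  rewrite big_seq; apply: Iord_sum => m mrk; apply: IordC.
  by rewrite -(dhomog_mf rkh mrk); apply: mon_taylor.
have h2 : ord_ge k.+1 (r - rk).
  move=> m; rewrite ltnS leq_eqVlt => /orP [/eqP mk|mk]; last first.
    by rewrite mcoeffB ha // (dhomog_nemf_coeff rkh) ?subr0 // neq_ltn mk.
  by rewrite mcoeffB /rk mcoeff_pihomog mk eqxx subrr.
exists (T + rk); have [b [Ib hb]] : Iord k.+1 (h - ((T + rk) \mPo tangent_proj) - a).
  have -> : h - ((T + rk) \mPo tangent_proj) - a = (rk - (rk \mPo tangent_proj)) + (r - rk).
    by rewrite comp_mpolyD /r; ring.
  by apply: IordD => //; apply: Iord_ord.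
exists (a + b); split; first by have [_ D _] := gen_ideal (codom f); apply: D.
by rewrite opprD addrA.
Qed.

End Taylor.

(** * Limits of complex sequences along a free ultrafilter *)

Section Modulus.
Variable R : realType.
Implicit Types x y : R[i].

(** The modulus as a real number: estimates then take place in the ordered field [R], where linear
    arithmetic applies. *)
Definition cabs x : R := complex.Re `|x|.

Lemma cabsE x : `|x| = (cabs x)%:C%C.
Proof. by rewrite /cabs normc_def. Qed.

Lemma cabs_ge0 x : 0 <= cabs x.
Proof. by have := normr_ge0 x; rewrite cabsE lecR. Qed.

Lemma cabs_real (r : R) : cabs r%:C%C = `|r|.
Proof. by rewrite /cabs normc_def /= expr0n addr0 sqrtr_sqr. Qed.

Lemma cabs0 : cabs 0 = 0. Proof. by rewrite (cabs_real 0) normr0. Qed.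

Lemma cabs1 : cabs 1 = 1. Proof. by rewrite (cabs_real 1) normr1. Qed.

Lemma cabsN x : cabs (- x) = cabs x. Proof. by rewrite /cabs normrN. Qed.

Lemma cabsB x y : cabs (x - y) = cabs (y - x). Proof. by rewrite -cabsN opprB. Qed.

Lemma cabsM x y : cabs (x * y) = cabs x * cabs y.
Proof. by apply: (@complexI R); rewrite -cabsE normrM !cabsE rmorphM. Qed.

Lemma cabsX x k : cabs (x ^+ k) = cabs x ^+ k.
Proof. by elim: k => [|k IH]; rewrite ?expr0 ?cabs1 // !exprS cabsM IH. Qed.

Lemma cabsD x y : cabs (x + y) <= cabs x + cabs y.
Proof. by have := ler_normD x y; rewrite !cabsE -rmorphD lecR. Qed.

Lemma cabs_eq0 x : (cabs x == 0) = (x == 0).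
Proof. by rewrite -(inj_eq (@complexI R)) -cabsE normr_eq0. Qed.

Lemma cabs_gt0 x : (0 < cabs x) = (x != 0).
Proof. by rewrite lt_neqAle cabs_ge0 andbT eq_sym cabs_eq0. Qed.

Lemma cabsV x : cabs x^-1 = (cabs x)^-1.
Proof.
have [->|x0] := eqVneq x 0; first by rewrite invr0 cabs0 invr0.
by apply: (@mulfI _ (cabs x)); rewrite ?cabs_eq0 // -cabsM !divff ?cabs_eq0 // cabs1.
Qed.

Lemma cabs_sum (I : Type) (r : seq I) (P : pred I) (F : I -> R[i]) :
  cabs (\sum_(i <- r | P i) F i) <= \sum_(i <- r | P i) cabs (F i).
Proof.
apply: (big_ind2 (fun (x : R[i]) (y : R) => cabs x <= y)) => [|x1 y1 x2 y2 h1 h2|//].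
  by rewrite cabs0.
by apply: le_trans (cabsD _ _) _; apply: lerD.
Qed.

Lemma cabs_ltP x (e : R) : (`|x| < e%:C%C) = (cabs x < e).
Proof. by rewrite cabsE ltcR. Qed.

Lemma Re_le_cabs x : `|complex.Re x| <= cabs x.
Proof.
case: x => a b; rewrite /cabs normc_def /= -sqrtr_sqr ler_sqrt ?lerDl ?sqr_ge0 //.
by rewrite addr_ge0 ?sqr_ge0.
Qed.

Lemma Im_le_cabs x : `|complex.Im x| <= cabs x.
Proof.
case: x => a b; rewrite /cabs normc_def /= -sqrtr_sqr ler_sqrt ?lerDr ?sqr_ge0 //.
by rewrite addr_ge0 ?sqr_ge0.
Qed.

Lemma cabs_le_ReIm x : cabs x <= `|complex.Re x| + `|complex.Im x|.
Proof.
case: x => a b; rewrite /cabs normc_def /= -[leRHS]ger0_norm ?addr_ge0 // -sqrtr_sqr.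
rewrite ler_sqrt ?sqr_ge0 // sqrrD !real_normK ?num_real //.
by rewrite -addrA lerD2l addrC lerDl mulrn_wge0 // mulr_ge0.
Qed.

End Modulus.

Lemma inv_nat_small (R : realType) (e : R) : 0 < e ->
  exists N, forall j, (N <= j)%N -> (j.+1%:R)^-1 < e.
Proof.
move=> e0; exists (Num.bound e^-1) => j Nj.
rewrite -[ltRHS]invrK ltf_pV2 ?posrE ?ltr0n ?invr_gt0 //.
apply: lt_le_trans (archi_boundP _) _; first by rewrite invr_ge0 ltW.
by rewrite ler_nat; apply: leq_trans Nj _.
Qed.

Definition is_free_ultrafilter (U : (nat -> Prop) -> Prop) :=
  [/\ forall A B, U A -> U B -> U (fun j => A j /\ B j),
      forall A B : nat -> Prop, (forall j, A j -> B j) -> U A -> U B,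
      forall A, U (fun j => ~ A j) <-> ~ U A
    & forall A N, (forall j, (N <= j)%N -> A j) -> U A].

Lemma free_ultrafilter : exists U, is_free_ultrafilter U.
Proof.
pose F : classical_sets.set_system nat := fun A => exists N, forall j, (N <= j)%N -> A j.
have FP : filter.ProperFilter F.
  apply: filter.Build_ProperFilter.
    by case=> N /(_ N (leqnn N)).
  split.
  - by exists 0%N.
  - move=> A B [N NP] [M MP]; exists (maxn N M) => j; rewrite geq_max => /andP [Nj Mj].
    by split; [apply: NP | apply: MP].
  - by move=> A B AB [N NP]; exists N => j /NP /AB.
have [U [UU FU]] := filter.ultraFilterLemma FP.
exists U; split.
- by move=> A B UA UB; apply: filter.filterI.
- by move=> A B AB UA; apply: filter.filterS UA.
- move=> A; split=> [UnA UA|nUA].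
    have : U (classical_sets.setI A (fun j => ~ A j)) by apply: filter.filterI.
    by move=> /filter.filter_ex [j []].
  by have [//|] := filter.in_ultra_setVsetC A UU.
- by move=> A N NP; apply: FU; exists N.
Qed.

(** One free ultrafilter serves all limits: bounded sequences converge along it without extraction
    of subsequences, and when a property fails along it, the negation holds along it, which suits
    arguments by contradiction. *)
Definition uae : (nat -> Prop) -> Prop := projT1 (boolp.cid free_ultrafilter).

Lemma uaeP : is_free_ultrafilter uae.
Proof. exact: projT2 (boolp.cid free_ultrafilter). Qed.

Lemma uae_and A B : uae A -> uae B -> uae (fun j => A j /\ B j).
Proof. by case: uaeP => h _ _ _; apply: h. Qed.

Lemma uaeW (A B : nat -> Prop) : (forall j, A j -> B j) -> uae A -> uae B.
Proof. by case: uaeP => _ h _ _; apply: h. Qed.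

Lemma uae_not A : uae (fun j => ~ A j) <-> ~ uae A.
Proof. by case: uaeP => _ _ h _; apply: h. Qed.

Lemma uae_ev (A : nat -> Prop) N : (forall j, (N <= j)%N -> A j) -> uae A.
Proof. by case: uaeP => _ _ _ h; apply: h. Qed.

Lemma uae_true (A : nat -> Prop) : (forall j, A j) -> uae A.
Proof. by move=> h; apply: (@uae_ev _ 0%N). Qed.

Lemma uae_ex A : uae A -> exists j, A j.
Proof.
move=> UA; apply: boolp.contrapT => no.
have : uae (fun j => ~ A j) by apply: uae_true => j Aj; apply: no; exists j.
by rewrite uae_not.
Qed.

Lemma uae_all (I : finType) (A : I -> nat -> Prop) :
  (forall i, uae (A i)) -> uae (fun j => forall i, A i j).
Proof.
move=> h; suff : forall s : seq I, uae (fun j => forall i, i \in s -> A i j).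
  by move=> /(_ (enum I)); apply: uaeW => j hj i; apply: hj; rewrite mem_enum.
elim=> [|i s IH]; first by apply: uae_true.
apply: uaeW (uae_and (h i) IH) => j [h1 h2] k; rewrite inE => /orP [/eqP ->|/h2] //.
Qed.

Section UltraLimits.
Variable R : realType.
Local Notation C := R[i].
Implicit Types (x y : nat -> C) (l : C).

Definition ulim x l := forall e : R, 0 < e -> uae (fun j => cabs (x j - l) < e).

Lemma ulim_cst l : ulim (fun=> l) l.
Proof. by move=> e e0; apply: uae_true => j; rewrite subrr cabs0. Qed.

Lemma ulim_eq x y l : uae (fun j => x j = y j) -> ulim x l -> ulim y l.
Proof.
by move=> xy hx e e0; apply: uaeW (uae_and xy (hx e e0)) => j [<-].
Qed.

Lemma ulimD x y l l' : ulim x l -> ulim y l' -> ulim (fun j => x j + y j) (l + l').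
Proof.
move=> hx hy e e0; have e2 : 0 < e / 2 by rewrite divr_gt0.
apply: uaeW (uae_and (hx _ e2) (hy _ e2)) => j [h1 h2].
have -> : x j + y j - (l + l') = (x j - l) + (y j - l') by ring.
by apply: le_lt_trans (cabsD _ _) _; lra.
Qed.

Lemma ulim_bounded x l : ulim x l -> exists M, uae (fun j => cabs (x j) <= M).
Proof.
move=> hx; exists (cabs l + 1); apply: uaeW (hx 1 ltr01) => j h.
by rewrite -(subrK l (x j)); apply: le_trans (cabsD _ _) _; lra.
Qed.

Lemma ulim0M x y M : ulim x 0 -> uae (fun j => cabs (y j) <= M) -> ulim (fun j => x j * y j) 0.
Proof.
move=> hx hy e e0; have M0 : 0 < `|M| + 1 by rewrite ltr_wpDl.
have e2 : 0 < e / (`|M| + 1) by rewrite divr_gt0.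
apply: uaeW (uae_and (hx _ e2) hy) => j []; rewrite !subr0 cabsM => h1 h2.
have [-> //|y0] := eqVneq (cabs (y j)) 0; first by rewrite mulr0.
have yp : 0 < cabs (y j) by rewrite lt_neqAle eq_sym y0 cabs_ge0.
have : cabs (x j) * cabs (y j) < e / (`|M| + 1) * cabs (y j) by rewrite ltr_pM2r.
move/lt_le_trans; apply; rewrite -mulrA ler_piMr ?(ltW e0) // mulrC ler_pdivrMr // mul1r.
by apply: le_trans h2 _; apply: le_trans (ler_norm M) _; rewrite lerDl.
Qed.

Lemma ulimB0 x l : ulim x l <-> ulim (fun j => x j - l) 0.
Proof.
split=> h e e0; move: (h e e0); apply: uaeW => j; by rewrite subr0.
Qed.

Lemma ulimM x y l l' : ulim x l -> ulim y l' -> ulim (fun j => x j * y j) (l * l').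
Proof.
move=> hx hy; rewrite ulimB0.
have [M hM] := ulim_bounded hy.
have h1 := ulim0M ((ulimB0 x l).1 hx) hM.
have h2 := ulim0M ((ulimB0 y l').1 hy) (uae_true (fun j => lexx (cabs l))).
have := ulimD h1 h2; rewrite addr0; apply: ulim_eq; apply: uae_true => j.
by ring.
Qed.

Lemma ulimX x l k : ulim x l -> ulim (fun j => x j ^+ k) (l ^+ k).
Proof.
move=> hx; elim: k => [|k IH]; first exact: (@ulim_cst 1).
rewrite exprS; apply: (@ulim_eq (fun j => x j * x j ^+ k)); last exact: ulimM.
by apply: uae_true => j; rewrite exprS.
Qed.

Lemma ulim_sum (I : Type) (r : seq I) (P : pred I) (F : nat -> I -> C) (L : I -> C) :
  (forall i, P i -> ulim (F^~ i) (L i)) ->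
  ulim (fun j => \sum_(i <- r | P i) F j i) (\sum_(i <- r | P i) L i).
Proof.
move=> h; elim: r => [|i r IH].
  rewrite big_nil; apply: ulim_eq (@ulim_cst 0); apply: uae_true => j.
  by rewrite big_nil.
rewrite big_cons; case: (boolP (P i)) => Pi.
  apply: ulim_eq (ulimD (h i Pi) IH); apply: uae_true => j.
  by rewrite big_cons Pi.
by apply: ulim_eq IH; apply: uae_true => j; rewrite big_cons (negbTE Pi).
Qed.

Lemma ulim_prod (I : Type) (r : seq I) (P : pred I) (F : nat -> I -> C) (L : I -> C) :
  (forall i, P i -> ulim (F^~ i) (L i)) ->
  ulim (fun j => \prod_(i <- r | P i) F j i) (\prod_(i <- r | P i) L i).
Proof.
move=> h; elim: r => [|i r IH].
  rewrite big_nil; apply: ulim_eq (@ulim_cst 1); apply: uae_true => j.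
  by rewrite big_nil.
rewrite big_cons; case: (boolP (P i)) => Pi.
  apply: ulim_eq (ulimM (h i Pi) IH); apply: uae_true => j.
  by rewrite big_cons Pi.
by apply: ulim_eq IH; apply: uae_true => j; rewrite big_cons (negbTE Pi).
Qed.

Lemma ulim_meval n (p : {mpoly C[n]}) (x : nat -> 'I_n -> C) (v : 'I_n -> C) :
  (forall a, ulim (x^~ a) (v a)) -> ulim (fun j => p.@[x j]) p.@[v].
Proof.
move=> h; rewrite mevalE; apply: (@ulim_eq (fun j => \sum_(m <- msupp p) p@_m * \prod_i x j i ^+ m i)).
  by apply: uae_true => j; rewrite mevalE.
apply: ulim_sum => m _; apply: ulimM; first exact: ulim_cst.
by apply: ulim_prod => a _; apply: ulimX.
Qed.

Lemma ulim_uniq x l l' : ulim x l -> ulim x l' -> l = l'.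
Proof.
move=> h h'; apply/eqP; rewrite -subr_eq0 -cabs_eq0; apply: contraT => d0.
have d : 0 < cabs (l - l') / 2 by rewrite divr_gt0 // lt_neqAle eq_sym d0 cabs_ge0.
have [j [h1 h2]] := uae_ex (uae_and (h _ d) (h' _ d)).
have := cabsD (l - x j) (x j - l'); rewrite addrA subrK (cabsB l).
lra.
Qed.

Lemma ulim_le x l M : ulim x l -> uae (fun j => cabs (x j) <= M) -> cabs l <= M.
Proof.
move=> h hM; rewrite leNgt; apply/negP => lt.
have d : 0 < cabs l - M by rewrite subr_gt0.
have [j [h1 h2]] := uae_ex (uae_and (h _ d) hM).
by have := cabsD (l - x j) (x j); rewrite subrK cabsB; lra.
Qed.

Lemma ulim_neq0 x l : ulim x l -> l != 0 -> uae (fun j => x j != 0).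
Proof.
move=> h l0; have d : 0 < cabs l by rewrite cabs_gt0.
apply: uaeW (h _ d) => j; apply: contraTneq => ->.
by rewrite sub0r cabsN ltxx.
Qed.

Lemma ulimV x l : ulim x l -> l != 0 -> ulim (fun j => (x j)^-1) l^-1.
Proof.
move=> h l0; rewrite ulimB0.
have d : 0 < cabs l / 2 by rewrite divr_gt0 // cabs_gt0.
have big : uae (fun j => cabs ((- (x j * l))^-1) <= 2 / cabs l ^+ 2).
  apply: uaeW (h _ d) => j hj.
  have xj : cabs l / 2 <= cabs (x j).
    by have := cabsD (l - x j) (x j); rewrite subrK cabsB; lra.
  rewrite cabsV cabsN cabsM -[2 / _]invrK lef_pV2 ?posrE ?invr_gt0; last 2 first.
  - by apply: mulr_gt0; rewrite ?cabs_gt0 // -cabs_gt0; apply: lt_le_trans xj.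
  - by rewrite divr_gt0 // exprn_gt0 // cabs_gt0.
  by rewrite invf_div expr2 mulrAC ler_pM2r // cabs_gt0.
apply: ulim_eq (ulim0M ((ulimB0 x l).1 h) big).
apply: uaeW (ulim_neq0 h l0) => j xj.
by field; rewrite l0 xj.
Qed.

(** The limit is the supremum of the numbers that stay below the sequence along the ultrafilter. *)
Lemma bounded_real_limit (y : nat -> R) M : uae (fun j => `|y j| <= M) ->
  exists l : R, forall e : R, 0 < e -> uae (fun j => `|y j - l| < e).
Proof.
move=> hM; pose A : classical_sets.set R := fun a => uae (fun j => a <= y j).
have Aub : classical_sets.ubound A M.
  move=> a Aa; have [j [h1 h2]] := uae_ex (uae_and Aa hM).
  by apply: le_trans h1 _; apply: le_trans (ler_norm _) h2.
have A0 : classical_sets.nonempty A.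
  exists (- M); apply: uaeW hM => j; by rewrite ler_norml => /andP [].
have sA : classical_sets.has_sup A by split=> //; exists M.
exists (sup A) => e e0.
have h1 : uae (fun j => y j < sup A + e).
  have /uae_not : ~ uae (fun j => sup A + e <= y j).
    move=> h; have := ub_le_sup (proj2 sA) (h : A _); lra.
  by apply: uaeW => j /negP; rewrite -ltNge.
have [a Aa ha] := sup_adherent e0 sA.
apply: uaeW (uae_and h1 Aa) => j [h2 h3].
by rewrite ltr_distl; apply/andP; split; lra.
Qed.

Lemma bounded_limit x M : uae (fun j => cabs (x j) <= M) -> exists l, ulim x l.
Proof.
move=> hM.
have [a aP] : exists l : R, forall e : R, 0 < e -> uae (fun j => `|complex.Re (x j) - l| < e).
  apply: (@bounded_real_limit _ M); apply: uaeW hM => j; exact/le_trans/Re_le_cabs.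
have [b bP] : exists l : R, forall e : R, 0 < e -> uae (fun j => `|complex.Im (x j) - l| < e).
  apply: (@bounded_real_limit _ M); apply: uaeW hM => j; exact/le_trans/Im_le_cabs.
exists (Complex a b) => e e0; have e2 : 0 < e / 2 by rewrite divr_gt0.
apply: uaeW (uae_and (aP _ e2) (bP _ e2)) => j [h1 h2].
apply: le_lt_trans (cabs_le_ReIm _) _.
move: h1 h2; case: (x j) => u v /=; lra.
Qed.

Lemma ulim_inv_nat : ulim (fun j => ((j.+1%:R)^-1 : R)%:C%C) 0.
Proof.
move=> e e0; have [N NP] := inv_nat_small e0; apply: (@uae_ev _ N) => j /NP.
by rewrite subr0 cabs_real ger0_norm // invr_ge0 ler0n.
Qed.

End UltraLimits.

(** * Implicit functions and smooth points *)

Section PolydiscEstimates.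
Variables (R : realType) (n : nat).
Local Notation C := R[i].
Implicit Types (p q : {mpoly C[n]}) (x y v : 'I_n -> C).

Definition inball x (rho : R) := forall a, cabs (x a) <= rho.

Lemma inballW x rho rho' : rho <= rho' -> inball x rho -> inball x rho'.
Proof. by move=> h hx a; apply: le_trans (hx a) h. Qed.

Lemma meval_ord_bound p k : ord_ge k p ->
  exists2 M : R, 0 <= M & forall x rho, 0 <= rho <= 1 -> inball x rho -> cabs p.@[x] <= M * rho ^+ k.
Proof.
move=> hp; exists (\sum_(m <- msupp p) cabs p@_m).
  by apply: sumr_ge0 => m _; apply: cabs_ge0.
move=> x rho /andP [r0 r1] hx; rewrite mevalE; apply: le_trans (cabs_sum _ _ _) _.
rewrite mulr_suml big_seq [leRHS]big_seq; apply: ler_sum => m mp.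
rewrite cabsM ler_wpM2l ?cabs_ge0 //.
have km : (k <= mdeg m)%N.
  by rewrite leqNgt; apply/negP => lt; move: mp; rewrite mcoeff_msupp hp // eqxx.
apply: le_trans (_ : rho ^+ mdeg m <= _); last by apply: ler_wiXn2l.
rewrite mdegE -prodrXr; elim/big_ind2: _ => [|u s w t h1 h2|i _].
- by rewrite cabs1.
- by rewrite cabsM; apply: ler_pM; rewrite ?cabs_ge0.
- by rewrite cabsX; apply: lerXn2r; rewrite ?nnegrE ?cabs_ge0.
Qed.

Lemma meval_bound p : exists2 M : R, 0 <= M & forall x, inball x 1 -> cabs p.@[x] <= M.
Proof.
have [M M0 MP] := meval_ord_bound (@ord_ge0 _ _ p).
by exists M => // x hx; have := MP x 1 _ hx; rewrite expr0 mulr1; apply; rewrite ler01 lexx.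
Qed.

Lemma meval_lipschitz p : exists2 M : R, 0 <= M & forall x y d, inball x 1 -> inball y 1 ->
  0 <= d -> inball (fun a => x a - y a) d -> cabs (p.@[x] - p.@[y]) <= M * d.
Proof.
elim/mpoly_alg_ind: p => [c|i|p q [M M0 hM] [N N0 hN]|p q [M M0 hM] [N N0 hN]].
- by exists 0 => // x y d _ _ _ _; rewrite !mevalC subrr cabs0 mul0r.
- by exists 1 => // x y d _ _ _ h; rewrite !mevalXU mul1r.
- exists (M + N) => [|x y d hx hy d0 h]; first exact: addr_ge0.
  have -> : (p + q).@[x] - (p + q).@[y] = (p.@[x] - p.@[y]) + (q.@[x] - q.@[y]).
    by rewrite !mevalD; ring.
  by rewrite mulrDl; apply: le_trans (cabsD _ _) _; apply: lerD; [apply: hM | apply: hN].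
have [A A0 hA] := meval_bound p; have [B B0 hB] := meval_bound q.
exists (A * N + B * M) => [|x y d hx hy d0 h]; first by rewrite addr_ge0 ?mulr_ge0.
have -> : (p * q).@[x] - (p * q).@[y] = p.@[x] * (q.@[x] - q.@[y]) + q.@[y] * (p.@[x] - p.@[y]).
  by rewrite !mevalM; ring.
rewrite mulrDl -!mulrA; apply: le_trans (cabsD _ _) _.
by rewrite !cabsM; apply: lerD; apply: ler_pM; rewrite ?cabs_ge0 //; [apply: hA | apply: hN | apply: hB | apply: hM].
Qed.

Lemma meval_at0 p : p.@[fun=> 0] = p@_0%MM.
Proof.
elim/mpoly_alg_ind: p => [c|i|p q hp hq|p q hp hq].
- by rewrite mevalC mcoeffC eqxx mulr1.
- by rewrite mevalXU mcoeffX mnm1_eq0.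
- by rewrite mevalD mcoeffD hp hq.
- by rewrite mevalM hp hq -rmorphM.
Qed.

Definition lin_coef p x : C := \sum_a p@_U_(a) * x a.

Lemma mcoeffM_U p q (a : 'I_n) :
  (p * q)@_U_(a) = p@_0%MM * q@_U_(a) + p@_U_(a) * q@_0%MM.
Proof.
have der r : r@_U_(a) = (r^`M(a))@_0%MM by rewrite mcoeff_deriv add0m mnm0E mulr1n.
by rewrite !der mderivM mcoeffD !(rmorphM (mcoeff 0%MM)) /= addrC.
Qed.

(** The factor [rho] in the error makes the nonlinear part a contraction on small polydiscs, which
    is what the iteration for implicit functions needs. *)
Lemma meval_strict_diff p : exists2 M : R, 0 <= M & forall x y rho d, 0 <= rho <= 1 ->
  inball x rho -> inball y rho -> 0 <= d -> inball (fun a => x a - y a) d ->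
  cabs (p.@[x] - p.@[y] - lin_coef p (fun a => x a - y a)) <= M * rho * d.
Proof.
have linb r : exists2 M : R, 0 <= M & forall v d, inball v d -> cabs (lin_coef r v) <= M * d.
  exists (\sum_a cabs r@_U_(a)) => [|v d hv]; first by apply: sumr_ge0 => a _; apply: cabs_ge0.
  apply: le_trans (cabs_sum _ _ _) _; rewrite mulr_suml; apply: ler_sum => a _.
  by rewrite cabsM ler_wpM2l ?cabs_ge0.
elim/mpoly_alg_ind: p => [c|i|p q [M M0 hM] [N N0 hN]|p q [M M0 hM] [N N0 hN]].
- exists 0 => // x y rho d _ _ _ _ _; rewrite !mevalC subrr /lin_coef big1 ?subr0 ?cabs0 ?mul0r //.
  by move=> a _; rewrite mcoeffC mnm1_eq0 mulr0 mul0r.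
- exists 0 => // x y rho d _ _ _ _ _; rewrite !mevalXU /lin_coef (bigD1 i) //= big1.
    by rewrite mcoeffX eqxx mul1r addr0 subrr cabs0 !mul0r.
  by move=> a ai; rewrite mcoeffX eq_mnm1 eq_sym (negbTE ai) mul0r.
- exists (M + N) => [|x y rho d r hx hy d0 h]; first exact: addr_ge0.
  set v := fun a => x a - y a.
  have -> : (p + q).@[x] - (p + q).@[y] - lin_coef (p + q) v =
     (p.@[x] - p.@[y] - lin_coef p v) + (q.@[x] - q.@[y] - lin_coef q v).
    have -> : lin_coef (p + q) v = lin_coef p v + lin_coef q v.
      by rewrite /lin_coef -big_split /=; apply: eq_bigr => a _; rewrite mcoeffD mulrDl.
    by rewrite !mevalD; ring.
  by rewrite !mulrDl; apply: le_trans (cabsD _ _) _; apply: lerD; [apply: hM | apply: hN].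
have [A A0 hA] := meval_bound p; have [B B0 hB] := meval_bound q.
have [A' A'0 hA'] := meval_lipschitz p; have [B' B'0 hB'] := meval_lipschitz q.
have [A2 A20 hA2] := linb p; have [B2 B20 hB2] := linb q.
exists (A * N + A' * B2 + B * M + B' * A2) => [|x y rho d r hx hy d0 h].
  by rewrite !addr_ge0 ?mulr_ge0.
have /andP [r0 r1] := r; have hx1 := inballW r1 hx; have hy1 := inballW r1 hy.
set v := fun a => x a - y a.
have lipp z : inball z rho -> cabs (p.@[z] - p@_0%MM) <= A' * rho.
  move=> hz; rewrite -meval_at0; apply: hA' => //; first exact: inballW hz.
    by move=> a; rewrite cabs0.
  by move=> a; rewrite subr0.
have lipq z : inball z rho -> cabs (q.@[z] - q@_0%MM) <= B' * rho.
  move=> hz; rewrite -meval_at0; apply: hB' => //; first exact: inballW hz.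
    by move=> a; rewrite cabs0.
  by move=> a; rewrite subr0.
have -> : (p * q).@[x] - (p * q).@[y] - lin_coef (p * q) v =
    p.@[x] * (q.@[x] - q.@[y] - lin_coef q v) + (p.@[x] - p@_0%MM) * lin_coef q v
    + q.@[y] * (p.@[x] - p.@[y] - lin_coef p v) + (q.@[y] - q@_0%MM) * lin_coef p v.
  have -> : lin_coef (p * q) v = p@_0%MM * lin_coef q v + q@_0%MM * lin_coef p v.
    rewrite /lin_coef !mulr_sumr -big_split /=; apply: eq_bigr => a _.
    by rewrite mcoeffM_U; ring.
  by rewrite !mevalM; ring.
have bnd4 (a b c e : C) : cabs (a + b + c + e) <= cabs a + cabs b + cabs c + cabs e.
  by do 2 (apply: le_trans (cabsD _ _) _; rewrite lerD2r); apply: cabsD.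
apply: le_trans (bnd4 _ _ _ _) _; rewrite !cabsM.
have -> : (A * N + A' * B2 + B * M + B' * A2) * rho * d =
  A * (N * rho * d) + (A' * rho) * (B2 * d) + B * (M * rho * d) + (B' * rho) * (A2 * d) by ring.
apply: lerD; [apply: lerD; [apply: lerD|]|]; apply: ler_pM; rewrite ?cabs_ge0 //.
- exact: hA.
- exact: hN.
- exact: lipp.
- exact: hB2.
- exact: hB.
- exact: hM.
- exact: lipq.
- exact: hA2.
Qed.

End PolydiscEstimates.

Section Solver.
Variables (R : realType) (n c : nat).
Local Notation C := R[i].
Variables (f : 'I_c -> {mpoly C[n]}) (B : 'I_c -> 'I_n -> C).
Hypothesis f0 : forall j, (f j)@_0%MM = 0.
Hypothesis DB : forall i j, lin_coef (f i) (B j) = (i == j)%:R.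

Let shift (zeta : 'I_c -> C) (a : 'I_n) : C := \sum_j zeta j * B j a.

(** The map sending [zeta] to [zeta - f (v + sum_i zeta_i B_i)] contracts by 1/2, since the
    differential of [f] is the identity in the directions [B i]; the limit of its iterates from 0 is
    a zero of [f]. *)
Lemma implicit_solution : exists S r : R, [/\ 0 <= S, 0 < r &
  forall (v : 'I_n -> C) rho, 0 <= rho <= r -> inball v rho ->
  exists zeta : 'I_c -> C, (forall j, cabs (zeta j) <= S * rho) /\
    forall j, (f j).@[fun a => v a + \sum_i zeta i * B i a] = 0].
Proof.
have [M [M0 hM]] : exists M : 'I_c -> R, (forall j, 0 <= M j) /\ forall j x y rho d, 0 <= rho <= 1 ->
    inball x rho -> inball y rho -> 0 <= d -> inball (fun a => x a - y a) d ->
    cabs ((f j).@[x] - (f j).@[y] - lin_coef (f j) (fun a => x a - y a)) <= M j * rho * d.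
  have [M MP] := boolp.choice (fun j => let: ex_intro2 M M0 h := meval_strict_diff (f j) in ex_intro (fun M => 0 <= M /\ _) M (conj M0 h)).
  by exists M; split=> j; case: (MP j).
have [L [L0 hL]] : exists L : 'I_c -> R, (forall j, 0 <= L j) /\ forall j x rho, 0 <= rho <= 1 ->
    inball x rho -> cabs (f j).@[x] <= L j * rho.
  have ord1 j : ord_ge 1 (f j).
    by move=> m; rewrite ltnS leqn0 mdeg_eq0 => /eqP ->.
  have [L LP] := boolp.choice (fun j => let: ex_intro2 M M0 h := meval_ord_bound (ord1 j) in ex_intro (fun M => 0 <= M /\ _) M (conj M0 h)).
  by exists L; split=> j; case: (LP j).
pose K := \sum_j M j; pose L1 := \sum_j L j.
pose b := \sum_j \sum_a cabs (B j a).
have K0 : 0 <= K by apply: sumr_ge0.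
have L10 : 0 <= L1 by apply: sumr_ge0.
have b0 : 0 <= b by apply: sumr_ge0 => j _; apply: sumr_ge0 => a _; apply: cabs_ge0.
have KM j : M j <= K by rewrite /K (bigD1 j) //= lerDl; apply: sumr_ge0.
have LL j : L j <= L1 by rewrite /L1 (bigD1 j) //= lerDl; apply: sumr_ge0.
have shiftb zeta d : (forall j, cabs (zeta j) <= d) -> inball (shift zeta) (b * d).
  move=> hz a; rewrite /shift; apply: le_trans (cabs_sum _ _ _) _.
  rewrite /b mulr_suml; apply: ler_sum => j _; rewrite cabsM mulrC.
  apply: ler_pM; rewrite ?cabs_ge0 // (bigD1 a) //= lerDl.
  by apply: sumr_ge0 => a' _; apply: cabs_ge0.
(* The first iterate is at most [L1 * rho] and the geometric series of ratio 1/2 doubles it.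
   [G * rho] bounds all points met, and [r] below is chosen to give [G * rho <= 1] and
   [K * (G * rho) * b <= 1 / 2]. *)
pose S := 2 * L1; pose G := 1 + b * S.
have S0 : 0 <= S by rewrite mulr_ge0.
have G1 : 1 <= G by rewrite lerDl mulr_ge0.
have G0 : 0 < G by apply: lt_le_trans G1.
pose r := (G * (1 + 2 * K * b))^-1.
have den : 0 < 1 + 2 * K * b by rewrite ltr_pwDl // !mulr_ge0.
have r0 : 0 < r by rewrite invr_gt0 mulr_gt0.
exists S, r; split=> // v rho /andP [rho0 rhor] hv.
have Grho : G * rho * (1 + 2 * K * b) <= 1.
  have -> : G * rho * (1 + 2 * K * b) = rho * (G * (1 + 2 * K * b)) by ring.
  by rewrite -ler_pdivlMr ?mulr_gt0 // div1r.
have Grho0 : 0 <= G * rho by rewrite mulr_ge0 // ltW.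
have Kb0 : 0 <= K * b by rewrite mulr_ge0.
have Gr1 : 0 <= G * rho <= 1 by apply/andP; split => //; nra.
have contr : K * (G * rho) * b <= 1 / 2 by nra.
pose X zeta a := v a + shift zeta a.
have Xb zeta : (forall j, cabs (zeta j) <= S * rho) -> inball (X zeta) (G * rho).
  move=> hz a; apply: le_trans (cabsD _ _) _; rewrite /G mulrDl mul1r -mulrA.
  by apply: lerD => //; apply: shiftb.
pose g zeta (j : 'I_c) := zeta j - (f j).@[X zeta].
have gcontr z z' d : 0 <= d -> (forall j, cabs (z j) <= S * rho) -> (forall j, cabs (z' j) <= S * rho) ->
    (forall j, cabs (z j - z' j) <= d) -> forall j, cabs (g z j - g z' j) <= d / 2.
  move=> d0 hz hz' hd j; rewrite /g.
  set w := fun i => z i - z' i.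
  have dX a : X z a - X z' a = shift w a.
    rewrite /X /shift opprD addrACA subrr add0r -sumrB; apply: eq_bigr => i _.
    by rewrite /w mulrBl.
  have lw : lin_coef (f j) (fun a => X z a - X z' a) = w j.
    transitivity (\sum_i w i * (j == i)%:R).
      rewrite /lin_coef; under eq_bigr do rewrite dX /shift mulr_sumr.
      rewrite exchange_big; apply: eq_bigr => i _; rewrite -DB /lin_coef mulr_sumr.
      by apply: eq_bigr => a _; ring.
    rewrite (bigD1 j) //= eqxx mulr1 big1 ?addr0 // => i ij.
    by rewrite eq_sym (negbTE ij) mulr0.
  have bd : inball (fun a => X z a - X z' a) (b * d) by move=> a; rewrite dX; apply: shiftb.
  have := hM j _ _ _ _ Gr1 (Xb _ hz) (Xb _ hz') (mulr_ge0 b0 d0) bd; rewrite lw /w => h.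
  rewrite -cabsN.
  have -> : - (z j - (f j).@[X z] - (z' j - (f j).@[X z'])) =
     (f j).@[X z] - (f j).@[X z'] - (z j - z' j) by ring.
  apply: le_trans h _; apply: le_trans (_ : K * (G * rho) * (b * d) <= _).
    by rewrite ler_wpM2r ?mulr_ge0 // ler_wpM2r.
  have -> : K * (G * rho) * (b * d) = (K * (G * rho) * b) * d by ring.
  have -> : d / 2 = (1 / 2) * d by ring.
  by rewrite ler_wpM2r.
pose Z k := iter k g (fun=> 0).
have rho1 : 0 <= rho <= 1 by apply/andP; split => //; nra.
have Zk k : (forall j, cabs (Z k j) <= S * rho * (1 - (1 / 2) ^+ k)) /\
    forall j, cabs (Z k.+1 j - Z k j) <= (1 / 2) ^+ k * (L1 * rho).
  elim: k => [|k [IH1 IH2]].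
    split=> j; first by rewrite /= cabs0 expr0 subrr mulr0.
    rewrite /= /g sub0r subr0 expr0 mul1r cabsN.
    have -> : (f j).@[X (fun=> 0)] = (f j).@[v].
      by apply: meval_eq => a; rewrite /X /shift big1 ?addr0 // => i _; rewrite mul0r.
    by apply: le_trans (hL j _ _ rho1 hv) _; rewrite ler_wpM2r.
  have pk : 0 <= (1 / 2) ^+ k :> R by rewrite exprn_ge0 // divr_ge0.
  have Srho : 0 <= S * rho by rewrite mulr_ge0.
  have h1 j : cabs (Z k.+1 j) <= S * rho * (1 - (1 / 2) ^+ k.+1).
    rewrite -(subrK (Z k j) (Z k.+1 j)); apply: le_trans (cabsD _ _) _.
    apply: le_trans (lerD (IH2 j) (IH1 j)) _.
    by rewrite /S exprS; rewrite le_eqVlt; apply/orP; left; apply/eqP; field.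
  split=> // j.
  have wk z : (forall j, cabs (z j) <= S * rho * (1 - (1 / 2) ^+ k)) -> forall j, cabs (z j) <= S * rho.
    by move=> hz i; apply: le_trans (hz i) _; nra.
  have wk1 z : (forall j, cabs (z j) <= S * rho * (1 - (1 / 2) ^+ k.+1)) -> forall j, cabs (z j) <= S * rho.
    move=> hz i; apply: le_trans (hz i) _.
    by have : 0 <= (1 / 2) ^+ k.+1 :> R; [rewrite exprn_ge0 // divr_ge0 | move=> ?; nra].
  have := gcontr (Z k.+1) (Z k) ((1 / 2) ^+ k * (L1 * rho)) _ (wk1 _ _ h1) (wk _ _ IH1) IH2 j.
  rewrite exprS => h; apply: le_trans (h _) _; first by rewrite !mulr_ge0.
  by rewrite le_eqVlt; apply/orP; left; apply/eqP; field.
have Zb k j : cabs (Z k j) <= S * rho.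
  apply: le_trans (proj1 (Zk k) j) _.
  have : 0 <= (1 / 2) ^+ k :> R by rewrite exprn_ge0 // divr_ge0.
  have : 0 <= S * rho by rewrite mulr_ge0.
  nra.
have [zeta zP] := boolp.choice (fun j => bounded_limit (uae_true (fun k => Zb k j))).
exists zeta; split=> j; first exact: ulim_le (zP j) (uae_true (fun k => Zb k j)).
have l1 : ulim (fun k => (f j).@[X (Z k)]) (f j).@[X zeta].
  apply: ulim_meval => a; rewrite /X /shift; apply: ulimD; first exact: ulim_cst.
  by apply: ulim_sum => i _; apply: ulimM; [exact: zP | exact: ulim_cst].
apply: ulim_uniq l1 _ => e e0.
have e1 : 0 < e / (L1 * rho + 1) by rewrite divr_gt0 // ltr_wpDl // mulr_ge0.
have [N NP] := inv_nat_small e1; apply: (@uae_ev _ N) => k /NP hk.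
rewrite subr0; have -> : (f j).@[X (Z k)] = - (Z k.+1 j - Z k j) by rewrite /= /g; ring.
rewrite cabsN; apply: le_lt_trans (proj2 (Zk k) j) _.
have h2 : (1 / 2) ^+ k <= (k.+1%:R)^-1 :> R.
  rewrite expr_div_n expr1n div1r lef_pV2 ?posrE ?ltr0n ?exprn_gt0 // -natrX ler_nat.
  exact: ltn_expl.
have Lr : 0 <= L1 * rho by rewrite mulr_ge0.
move: hk; rewrite ltr_pdivlMr ?ltr_wpDl // => hk.
have q0 : 0 <= (k.+1%:R)^-1 :> R by rewrite invr_ge0 ler0n.
by apply: le_lt_trans (ler_wpM2r Lr h2) _; apply: le_lt_trans hk; rewrite mulrDr mulr1 lerDl.
Qed.

End Solver.

Section LowDegree.
Variable R : realType.
Local Notation C := R[i].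

Lemma product_perturbation (t1 t2 u1 u2 : C) (A1 A2 M1 M2 p : R) : 0 <= p <= 1 ->
  cabs (u1 - t1) <= M1 * p -> cabs (u2 - t2) <= M2 * p -> cabs u1 <= A1 -> cabs u2 <= A2 ->
  u1 * u2 = 0 -> 0 <= M1 -> cabs (t1 * t2) <= (A1 * M2 + A2 * M1 + M1 * M2) * p.
Proof.
move=> /andP [p0 p1] b1 b2 c1 c2 z12 M10.
have -> : t1 * t2 = - (u1 * (u2 - t2)) - u2 * (u1 - t1) + (u1 - t1) * (u2 - t2) + u1 * u2.
  by ring.
rewrite z12 addr0; apply: le_trans (cabsD _ _) _; rewrite [leRHS]mulrDl; apply: lerD.
  apply: le_trans (cabsD _ _) _; rewrite [leRHS]mulrDl !cabsN !cabsM -!mulrA.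
  by apply: lerD; apply: ler_pM; rewrite ?cabs_ge0.
rewrite cabsM -mulrA; apply: ler_pM; rewrite ?cabs_ge0 //.
by apply: le_trans b1 _; rewrite ler_piMr.
Qed.

Lemma poly_small_coef (q : {poly C}) k (M r : R) : 0 < r ->
  (forall t : R, 0 < t <= r -> cabs q.[t%:C%C] <= M * t ^+ k) ->
  forall d, (d < k)%N -> q`_d = 0.
Proof.
move=> r0 hq; elim/ltn_ind => d IH dk.
pose q' := drop_poly d q.
have qE : q = q' * 'X^d.
  rewrite -[LHS](poly_take_drop d q) (_ : take_poly d q = 0) ?add0r //.
  apply/polyP => i; rewrite coef_take_poly coef0; case: ifP => // id.
  by apply: IH => //; apply: ltn_trans dk.
have -> : q`_d = q'.[0] by rewrite horner_coef0 coef_drop_poly.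
have M0 : 0 <= M.
  have := hq r; rewrite r0 lexx => /(_ isT) h.
  have := le_trans (cabs_ge0 _) h; rewrite pmulr_lge0 // exprn_gt0 //.
pose t j : R := (j.+1%:R)^-1.
have tl : ulim (fun j => (t j)%:C%C) 0 by exact: ulim_inv_nat.
have l1 : ulim (fun j => q'.[(t j)%:C%C]) q'.[0].
  rewrite horner_coef; apply: (@ulim_eq _ (fun j => \sum_(i < size q') q'`_i * (t j)%:C%C ^+ i)).
    by apply: uae_true => j; rewrite horner_coef.
  by apply: ulim_sum => i _; apply: ulimM; [exact: ulim_cst | exact: ulimX].
apply: ulim_uniq l1 _ => e e0.
have [N NP] := inv_nat_small r0.
have e1 : 0 < Num.min (e / (M + 1)) 1 by rewrite lt_min ltr01 divr_gt0 // ltr_wpDl.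
have [N' NP'] := inv_nat_small e1.
apply: (@uae_ev _ (maxn N N')) => j; rewrite geq_max => /andP [/NP h1 /NP' h2].
have t0 : 0 < t j by rewrite invr_gt0 ltr0n.
rewrite subr0; have := hq (t j); rewrite t0 (ltW h1) => /(_ isT).
rewrite qE hornerM hornerXn cabsM cabsX cabs_real (gtr0_norm t0) -(subnKC (ltnW dk)) exprD.
rewrite mulrCA [X in X <= _]mulrC ler_pM2l ?exprn_gt0 // => h3; apply: le_lt_trans h3 _.
move: h2; rewrite lt_min -/(t j) => /andP [h2 h4].
have h5 : t j ^+ (k - d) <= t j.
  rewrite -[X in _ <= X]expr1; apply: ler_wiXn2l; rewrite ?ltW //.
  by rewrite subn_gt0.
move: h2; rewrite ltr_pdivlMr ?ltr_wpDl // => h2.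
have := exprn_ge0 (k - d) (ltW t0); nra.
Qed.

Lemma meval_line n (Q : {mpoly C[n]}) v : exists q : {poly C},
  (forall d, q`_d = (pihomog mdeg d Q).@[v]) /\ forall t, q.[t] = Q.@[fun a => t * v a].
Proof.
exists (\poly_(d < msize Q) (pihomog mdeg d Q).@[v]); split=> [d|t].
  rewrite coef_poly; case: ltnP => // h; rewrite -[LHS](meval0 v); congr (_.@[v]).
  apply/mpolyP => m; rewrite mcoeff0 mcoeff_pihomog; case: eqP => // md.
  by rewrite memN_msupp_eq0 //; apply: msize_mdeg_ge; rewrite md.
have e := pihomog_partitionE (mf := mdeg) (leqnn (msize Q)).
rewrite horner_poly [in RHS]e (raddf_sum (meval _)) /=.
apply: eq_bigr => d _; rewrite mulrC (meval_homog_scale (d := d)) //.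
exact: pihomogP.
Qed.

(** Real rays suffice: on each of them a univariate polynomial of size [t ^ k] has no coefficient
    below degree [k], and a form that vanishes in every direction is zero. *)
Lemma ord_ge_of_small n (Q : {mpoly C[n]}) k :
  (forall v, exists M r : R, 0 < r /\
     forall t : R, 0 < t <= r -> cabs Q.@[fun a => t%:C%C * v a] <= M * t ^+ k) ->
  ord_ge k Q.
Proof.
move=> hQ m mk; suff Q0 : pihomog mdeg (mdeg m) Q = 0.
  by have := congr1 (mcoeff m) Q0; rewrite mcoeff0 mcoeff_pihomog eqxx.
apply: mpoly_eq0_fun => v; have [M [r [r0 h]]] := hQ v.
have [q [q1 q2]] := meval_line Q v.
by rewrite -q1; apply: (poly_small_coef r0 _ mk) => t tr; rewrite q2; apply: h.
Qed.

(** The lowest homogeneous parts of [p] and [q] have a nonzero product, so the order at the origin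
    is additive. *)
Lemma ord_ge_mul_dvd (K : idomainType) n (p q : {mpoly K[n]}) k l :
  ord_ge (k + l) (p * q) -> ord_ge k p \/ ord_ge l q.
Proof.
move=> hpq; apply: boolp.contrapT => /boolp.not_orP [np nq].
have low (r : {mpoly K[n]}) a : ~ ord_ge a r -> exists d, [/\ (d < a)%N, ord_ge d r & pihomog mdeg d r != 0].
  elim: a => [|a IH] nr; first by case: nr; apply: ord_ge0.
  have [ra|/IH [d [da h1 h2]]] := boolp.EM (ord_ge a r); last first.
    by exists d; split=> //; apply: ltnW.
  exists a; split=> //; apply/eqP => r0; apply: nr => m.
  rewrite ltnS leq_eqVlt => /orP [/eqP ma|/ra //].
  by have := congr1 (mcoeff m) r0; rewrite mcoeff_pihomog ma eqxx mcoeff0.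
have [d [dk od hd]] := low _ _ np; have [e [el oe he]] := low _ _ nq.
have rest (r : {mpoly K[n]}) a : ord_ge a r -> ord_ge a.+1 (r - pihomog mdeg a r).
  move=> ha m; rewrite ltnS leq_eqVlt mcoeffB mcoeff_pihomog => /orP [/eqP ->|ma].
    by rewrite eqxx subrr.
  by rewrite ha // if_same subr0.
have h1 := rest _ _ od; have h2 := rest _ _ oe.
set pd := pihomog mdeg d p in hd h1; set qe := pihomog mdeg e q in he h2.
have pdo : ord_ge d pd by move=> m ma; rewrite mcoeff_pihomog; case: eqP ma => // ->; rewrite ltnn.
have : ord_ge (d + e).+1 (p * q - pd * qe).
  have -> : p * q - pd * qe = (p - pd) * q + pd * (q - qe) by ring.
  by apply: ord_geD; [rewrite -addSn | rewrite -addnS]; apply: ord_geM.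
have : ord_ge (d + e).+1 (p * q).
  by apply: ord_geW hpq; rewrite -addSn; apply: leq_add => //; apply: ltnW.
move=> h3 h4; have : pd * qe != 0 by rewrite mulf_neq0.
have : pd * qe \is (d + e).-homog by apply: dhomogM; apply: pihomogP.
move=> hom nz; have := mlead_supp nz; rewrite mcoeff_msupp => /eqP; apply.
have md : mdeg (mlead (pd * qe)) = (d + e)%N := dhomog_mf hom (mlead_supp nz).
have := h4 (mlead (pd * qe)); rewrite md ltnSn mcoeffB h3 ?md // sub0r => /(_ isT) /eqP.
by rewrite oppr_eq0 => /eqP.
Qed.

End LowDegree.

(** * Primeness of the ideal of a zero set at a smooth point *)

Section SmoothPointAtOrigin.
Variables (R : realType) (n c : nat).
Local Notation C := R[i].
Variables (f : 'I_c -> {mpoly C[n]}) (B : 'I_c -> 'I_n -> C).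
Hypothesis f0 : forall j, (f j)@_0%MM = 0.
Hypothesis DB : forall i j, lin_coef (f i) (B j) = (i == j)%:R.

Let zeros x := forall j, (f j).@[x] = 0.
Let pi := tangent_proj f B.
Local Notation If := (gen (codom f)).

Definition vanish_near0 (h : {mpoly C[n]}) :=
  exists2 e : R, 0 < e & forall x, inball x e -> zeros x -> h.@[x] = 0.

Let If_zero p x : If p -> zeros x -> p.@[x] = 0.
Proof.
move=> Ip zx; pose I (q : {mpoly C[n]}) := q.@[x] = 0.
apply: (gen_min (I := I)) Ip.
  split; rewrite /I; first exact: meval0.
    by move=> a b ha hb; rewrite mevalD ha hb addr0.
  by move=> a b hb; rewrite mevalM hb mulr0.
by move=> q /codomP [j ->]; apply: zx.
Qed.

Let lin_coefE j x : (lin_part (f j)).@[x] = lin_coef (f j) x.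
Proof.
rewrite /lin_part (raddf_sum (meval x)) /lin_coef; apply: eq_bigr => a _.
by rewrite /= mevalZ mevalXU.
Qed.

Let lin_coefD j x y : lin_coef (f j) (fun a => x a + y a) = lin_coef (f j) x + lin_coef (f j) y.
Proof. by rewrite /lin_coef -big_split /=; apply: eq_bigr => a _; rewrite mulrDr. Qed.

Let lin_coefZ j t x : lin_coef (f j) (fun a => t * x a) = t * lin_coef (f j) x.
Proof. by rewrite /lin_coef mulr_sumr; apply: eq_bigr => a _; rewrite mulrCA. Qed.

Let lin_coefBs j z : lin_coef (f j) (fun a => \sum_i z i * B i a) = z j.
Proof.
transitivity (\sum_i z i * (j == i)%:R).
  rewrite /lin_coef; under eq_bigr do rewrite mulr_sumr.
  rewrite exchange_big; apply: eq_bigr => i _; rewrite -DB /lin_coef mulr_sumr.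
  by apply: eq_bigr => a _; ring.
rewrite (bigD1 j) //= eqxx mulr1 big1 ?addr0 // => i ij.
by rewrite eq_sym (negbTE ij) mulr0.
Qed.

Let pi_eval a x : (tnth pi a).@[x] = x a - \sum_j lin_coef (f j) x * B j a.
Proof.
rewrite tnth_mktuple mevalB mevalXU (raddf_sum (meval x)); congr (_ - _).
by apply: eq_bigr => j _; rewrite /= mevalZ lin_coefE mulrC.
Qed.

(** The zero set is a graph over its tangent space: the projection [w] of [v] is tangent, and the
    implicit solution above [t w] adds only a combination of the [B i], which the projection
    kills. *)
Lemma tangent_lift (v : 'I_n -> C) : exists M r : R, [/\ 0 < r, 0 <= M & forall t : R, 0 < t <= r ->
  exists x, [/\ zeros x, inball x (M * t) &
    forall a, (tnth pi a).@[x] = (tnth pi a).@[fun b => t%:C%C * v b]]].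
Proof.
have [S [r [S0 r0 hsol]]] := implicit_solution f0 DB.
pose w a := (tnth pi a).@[v].
pose N := \sum_a cabs (w a) + 1.
have N0 : 0 < N by rewrite ltr_wpDl // sumr_ge0 // => a _; apply: cabs_ge0.
have wN : inball w N.
  move=> a; rewrite /N (bigD1 a) //= -addrA lerDl addr_ge0 // sumr_ge0 // => b _; exact: cabs_ge0.
pose b := \sum_j \sum_a cabs (B j a).
have b0 : 0 <= b by apply: sumr_ge0 => j _; apply: sumr_ge0 => a _; apply: cabs_ge0.
exists (N * (1 + b * S)), (r / N); split.
- by rewrite divr_gt0.
- by apply: mulr_ge0; [exact: ltW | apply: addr_ge0 => //; exact: mulr_ge0].
move=> t /andP [t0 tr].
have tNr : 0 <= t * N <= r by rewrite mulr_ge0 ?(ltW t0) ?(ltW N0) //= -ler_pdivlMr.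
have hv : inball (fun a => t%:C%C * w a) (t * N).
  by move=> a; rewrite cabsM cabs_real gtr0_norm // ler_pM2l.
have [z [z1 z2]] := hsol _ _ tNr hv.
exists (fun a => t%:C%C * w a + \sum_i z i * B i a); split=> //.
  move=> a; apply: le_trans (cabsD _ _) _.
  have -> : N * (1 + b * S) * t = t * N + b * (S * (t * N)) by ring.
  apply: lerD => //; apply: le_trans (cabs_sum _ _ _) _.
  rewrite /b mulr_suml; apply: ler_sum => j _; rewrite cabsM mulrC.
  apply: ler_pM; rewrite ?cabs_ge0 // (bigD1 a) //= lerDl.
  by apply: sumr_ge0 => a' _; apply: cabs_ge0.
have lw j : lin_coef (f j) w = 0.
  have -> : lin_coef (f j) w = lin_coef (f j) (fun a => v a + \sum_i (- lin_coef (f i) v) * B i a).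
    rewrite /lin_coef; apply: eq_bigr => a _; rewrite /w pi_eval; congr (_ * (_ + _)).
    by rewrite -sumrN; apply: eq_bigr => i _; rewrite mulNr.
  by rewrite lin_coefD lin_coefBs subrr.
move=> a; rewrite !pi_eval.
have -> : \sum_j lin_coef (f j) (fun a0 => t%:C%C * w a0 + \sum_i z i * B i a0) * B j a =
    \sum_j z j * B j a.
  by apply: eq_bigr => j _; rewrite lin_coefD lin_coefZ lw mulr0 add0r lin_coefBs.
have -> : \sum_j lin_coef (f j) (fun b => t%:C%C * v b) * B j a =
    t%:C%C * \sum_j lin_coef (f j) v * B j a.
  by rewrite mulr_sumr; apply: eq_bigr => j _; rewrite lin_coefZ mulrA.
by rewrite addrK -mulrBr /w pi_eval.
Qed.

(** By [tangent_lift] the zeros realize every small tangent vector at a comparable distance from the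
    origin, so a bound on the zero set becomes a bound on rays. *)
Lemma ord_ge_on_zeros T k :
  (exists M e : R, 0 < e /\ forall x rho, 0 <= rho <= e -> inball x rho -> zeros x ->
     cabs (T \mPo pi).@[x] <= M * rho ^+ k) ->
  ord_ge k (T \mPo pi).
Proof.
case=> M [e [e0 h]]; apply: ord_ge_of_small => v.
have [N [r [r0 N0 hl]]] := tangent_lift v.
have N1 : 0 < N + 1 by rewrite ltr_wpDl.
exists (M * (N + 1) ^+ k), (Num.min r (e / (N + 1))); split.
  by rewrite lt_min r0 divr_gt0.
move=> t /andP [t0]; rewrite le_min => /andP [tr te].
have /hl [x [zx xb xe]] : 0 < t <= r by rewrite t0 tr.
have -> : (T \mPo pi).@[fun a => t%:C%C * v a] = (T \mPo pi).@[x].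
  by rewrite !comp_mpoly_meval; apply: meval_eq => a; rewrite xe.
rewrite -mulrA -exprMn; apply: h => //.
  by rewrite mulr_ge0 ?(ltW N1) ?(ltW t0) //= mulrC -ler_pdivlMr.
by apply: inballW xb; rewrite ler_pM2r // lerDl.
Qed.

Let approx h k := exists a, If a /\ ord_ge k (h - a).

(** On the zero set both [h] and the combination of the [f j] vanish, so the tangent function
    approximating [h] is as small there as the remainder, hence has order [k] itself. *)
Lemma vanish_approx h : vanish_near0 h -> forall k, approx h k.
Proof.
case=> e e0 he k; have [T [a [Ia ha]]] := taylor_mod B f0 h k.
exists a; split=> //.
have -> : h - a = (h - (T \mPo pi) - a) + (T \mPo pi) by rewrite /pi; ring.
apply: ord_geD => //; apply: ord_ge_on_zeros.
have [M M0 hM] := meval_ord_bound ha.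
exists M, (Num.min e 1); split; first by rewrite lt_min e0 ltr01.
move=> x rho /andP [rho0]; rewrite le_min => /andP [re r1] hx zx.
have := hM x rho _ hx; rewrite rho0 r1 !mevalB (If_zero Ia zx) (he x (inballW re hx) zx).
by rewrite sub0r subr0 cabsN; apply.
Qed.

(** Both factors are replaced by functions of the tangent coordinates up to order [k = k1 + l].
    Their product is small on the zero set, hence has order [k]; by additivity of the order, failure
    of [h1] at order [k1] forces order [l] on the side of [h2]. *)
Lemma approx_prime h1 h2 : vanish_near0 (h1 * h2) ->
  (forall k, approx h1 k) \/ (forall k, approx h2 k).
Proof.
case=> e e0 he; have [//|/boolp.existsNP [k1 nk1]] := boolp.EM (forall k, approx h1 k); first by left.
right=> l; pose k := (k1 + l)%N.
have [T1 [a1 [Ia1 ha1]]] := taylor_mod B f0 h1 k.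
have [T2 [a2 [Ia2 ha2]]] := taylor_mod B f0 h2 k.
have [M1 M10 hM1] := meval_ord_bound ha1; have [M2 M20 hM2] := meval_ord_bound ha2.
have [A1 A10 hA1] := meval_bound h1; have [A2 A20 hA2] := meval_bound h2.
have dec h T a : h - a = (h - (T \mPo pi) - a) + (T \mPo pi) by ring.
have : ord_ge k ((T1 * T2) \mPo pi).
  apply: ord_ge_on_zeros; exists (A1 * M2 + A2 * M1 + M1 * M2), (Num.min e 1).
  split; first by rewrite lt_min e0 ltr01.
  move=> x rho /andP [rho0]; rewrite le_min => /andP [re r1] hx zx.
  have r01 : 0 <= rho <= 1 by rewrite rho0 r1.
  have b1 := hM1 x rho r01 hx; have b2 := hM2 x rho r01 hx.
  have x1 := inballW r1 hx; have c1 := hA1 x x1; have c2 := hA2 x x1.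
  have := he x (inballW re hx) zx; rewrite mevalM => z12.
  have -> : ((T1 * T2) \mPo pi).@[x] = (T1 \mPo pi).@[x] * (T2 \mPo pi).@[x].
    by rewrite rmorphM mevalM.
  have z1 : a1.@[x] = 0 := If_zero Ia1 zx; have z2 : a2.@[x] = 0 := If_zero Ia2 zx.
  have b1' : cabs (h1.@[x] - (T1 \mPo pi).@[x]) <= M1 * rho ^+ k.
    by rewrite -[X in cabs X]subr0 -z1 -(mevalB x h1) -(mevalB x (h1 - _)).
  have b2' : cabs (h2.@[x] - (T2 \mPo pi).@[x]) <= M2 * rho ^+ k.
    by rewrite -[X in cabs X]subr0 -z2 -(mevalB x h2) -(mevalB x (h2 - _)).
  by apply: (product_perturbation _ b1' b2' c1 c2 z12) => //; rewrite exprn_ge0 ?exprn_ile1.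
rewrite rmorphM /= => /ord_ge_mul_dvd [o1|o2].
  case: nk1; exists a1; split=> //; rewrite (dec _ T1); apply: ord_geD => //.
  by apply: ord_geW ha1; apply: leq_addr.
exists a2; split=> //; rewrite (dec _ T2); apply: ord_geD => //.
by apply: ord_geW ha2; apply: leq_addl.
Qed.

(** [P] is the ideal generated by [f] in the local ring at the origin, contracted to polynomials.
    Krull's theorem places in it everything that lies in the ideal of [f] modulo each power of the
    maximal ideal, and finite generation of [P] provides the common denominator [s]. *)
Lemma smooth_origin : exists (P : {mpoly C[n]} -> Prop) (s : {mpoly C[n]}),
  [/\ s@_0%MM != 0,
      forall p x, P p -> zeros x -> s.@[x] != 0 -> p.@[x] = 0,
      forall p, vanish_near0 p -> P p
    & forall p q, vanish_near0 (p * q) -> P p \/ P q].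
Proof.
pose P (p : {mpoly C[n]}) := exists s, s@_0%MM != 0 /\ If (s * p).
have approxP p : (forall k, approx p k) -> P p.
  by move/krull_intersection => [s [s1 s2]]; exists s; rewrite s1 oner_eq0.
have [I0 ID IM] := gen_ideal (codom f).
have mulc (s t : {mpoly C[n]}) : s@_0%MM != 0 -> t@_0%MM != 0 -> (s * t)@_0%MM != 0.
  by move=> hs ht; rewrite (rmorphM (mcoeff 0%MM)) mulf_neq0.
have iP : ideal P.
  split.
  - by exists 1; rewrite mcoeff1 eqxx oner_eq0 mulr0.
  - move=> p q [s [s0 hs]] [t [t0 ht]]; exists (s * t); split; first exact: mulc.
    have -> : s * t * (p + q) = t * (s * p) + s * (t * q) by ring.
    by apply: ID; apply: IM.
  - move=> a p [s [s0 hs]]; exists s; split=> //; rewrite mulrCA; exact: IM.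
have [gs [gsP gsG]] := hilbert_basis iP.
have [s [s0 sP]] : exists s, s@_0%MM != 0 /\ forall g, g \in gs -> If (s * g).
  elim: gs gsP {gsG} => [|g gs IH] gsP; first by exists 1; rewrite mcoeff1 eqxx oner_eq0.
  have [t [t0 tP]] := gsP g (mem_head _ _).
  have [|s [s0 sP]] := IH; first by move=> p pgs; apply: gsP; rewrite inE pgs orbT.
  exists (s * t); split; first exact: mulc.
  move=> p; rewrite inE => /orP [/eqP ->|/sP h]; first by rewrite -mulrA; apply: IM.
  by rewrite mulrAC mulrC; apply: IM.
exists P, s; split=> //.
- move=> p x Pp zx sx; have : If (s * p).
    apply: (gen_min (I := fun q => If (s * q))) (gsG _ Pp) => //.
    split; [by rewrite mulr0 | move=> a b ha hb | move=> a b hb].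
      by rewrite mulrDr; apply: ID.
    by rewrite mulrCA; apply: IM.
  by move/If_zero/(_ zx)/eqP; rewrite mevalM mulf_eq0 (negbTE sx) => /eqP.
- by move=> p /vanish_approx /approxP.
- by move=> p q /approx_prime [/approxP|/approxP]; [left | right].
Qed.

End SmoothPointAtOrigin.

(** * Polynomial functions and definable sets *)

Section PolynomialFunctions.
Variables (K : comNzRingType) (I : finType).
Implicit Types (phi psi : (I -> K) -> K) (x : I -> K).

(** Coordinates are indexed by an arbitrary finite type, such as monomials, matrix entries or sums
    of these, so that variables need not be numbered by hand. *)
Definition polyfun phi := exists Phi : {mpoly K[#|I|]},
  forall x, phi x = Phi.@[fun a => x (enum_val a)].

Lemma polyfun_ext phi psi : phi =1 psi -> polyfun phi -> polyfun psi.
Proof. by move=> e [P PP]; exists P => x; rewrite -e. Qed.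

Lemma polyfunC c : polyfun (fun=> c).
Proof. by exists c%:MP => x; rewrite mevalC. Qed.

Lemma polyfunX i : polyfun (fun x => x i).
Proof. by exists 'X_(enum_rank i) => x; rewrite mevalXU enum_rankK. Qed.

Lemma polyfunD phi psi : polyfun phi -> polyfun psi -> polyfun (fun x => phi x + psi x).
Proof. by move=> [P hP] [Q hQ]; exists (P + Q) => x; rewrite mevalD hP hQ. Qed.

Lemma polyfunM phi psi : polyfun phi -> polyfun psi -> polyfun (fun x => phi x * psi x).
Proof. by move=> [P hP] [Q hQ]; exists (P * Q) => x; rewrite mevalM hP hQ. Qed.

Lemma polyfunN phi : polyfun phi -> polyfun (fun x => - phi x).
Proof. by move=> [P hP]; exists (- P) => x; rewrite mevalN hP. Qed.

Lemma polyfunB phi psi : polyfun phi -> polyfun psi -> polyfun (fun x => phi x - psi x).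
Proof. by move=> hp hq; apply: polyfunD => //; apply: polyfunN. Qed.

Lemma polyfun_sum (J : Type) (r : seq J) (P : pred J) (F : J -> (I -> K) -> K) :
  (forall j, P j -> polyfun (F j)) -> polyfun (fun x => \sum_(j <- r | P j) F j x).
Proof.
move=> h; elim: r => [|j r IH].
  by apply: polyfun_ext (polyfunC 0) => x; rewrite big_nil.
case: (boolP (P j)) => Pj.
  by apply: polyfun_ext (polyfunD (h j Pj) IH) => x; rewrite big_cons Pj.
by apply: polyfun_ext IH => x; rewrite big_cons (negbTE Pj).
Qed.

Lemma polyfun_prod (J : Type) (r : seq J) (P : pred J) (F : J -> (I -> K) -> K) :
  (forall j, P j -> polyfun (F j)) -> polyfun (fun x => \prod_(j <- r | P j) F j x).
Proof.
move=> h; elim: r => [|j r IH].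
  by apply: polyfun_ext (polyfunC 1) => x; rewrite big_nil.
case: (boolP (P j)) => Pj.
  by apply: polyfun_ext (polyfunM (h j Pj) IH) => x; rewrite big_cons Pj.
by apply: polyfun_ext IH => x; rewrite big_cons (negbTE Pj).
Qed.

Lemma polyfun_exp phi k : polyfun phi -> polyfun (fun x => phi x ^+ k).
Proof.
move=> h; elim: k => [|k IH]; first by apply: polyfun_ext (polyfunC 1) => x; rewrite expr0.
by apply: polyfun_ext (polyfunM h IH) => x; rewrite exprS.
Qed.

Lemma polyfun_det n (A : (I -> K) -> 'M[K]_n) :
  (forall i j, polyfun (fun x => A x i j)) -> polyfun (fun x => \det (A x)).
Proof.
move=> h; apply: polyfun_sum => s _; apply: polyfunM; first exact: polyfunC.
by apply: polyfun_prod.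
Qed.

Lemma polyfun_meval n (P : {mpoly K[n]}) (v : 'I_n -> (I -> K) -> K) :
  (forall i, polyfun (v i)) -> polyfun (fun x => P.@[fun i => v i x]).
Proof.
move=> h; apply: polyfun_ext (_ : polyfun (fun x => \sum_(m <- msupp P) P@_m * \prod_i v i x ^+ m i)).
  by move=> x; rewrite mevalE.
apply: polyfun_sum => m _; apply: polyfunM; first exact: polyfunC.
by apply: polyfun_prod => i _; apply: polyfun_exp.
Qed.

End PolynomialFunctions.

Lemma polyfun_comp (K : comNzRingType) (I J : finType) (phi : (I -> K) -> K)
    (v : I -> (J -> K) -> K) :
  polyfun phi -> (forall i, polyfun (v i)) -> polyfun (fun x => phi (fun i => v i x)).
Proof.
case=> P hP hv; apply: polyfun_ext (polyfun_meval P (fun a => hv (enum_val a))) => x.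
by rewrite hP.
Qed.

Section Definable.
Variable K : closedFieldType.

(** The coordinates may sit at any positions [s] of the environment; this freedom lets formulas be
    reused under reindexing and under quantifiers. *)
Definition definable (I : finType) (D : (I -> K) -> Prop) :=
  forall s : I -> nat, exists f : GRing.formula K,
  forall e : seq K, D (fun i => e`_(s i)) <-> GRing.holds e f.

Lemma definable_ext (I : finType) (D E : (I -> K) -> Prop) :
  (forall x, D x <-> E x) -> definable D -> definable E.
Proof. by move=> DE h s; have [f fP] := h s; exists f => e; rewrite -fP DE. Qed.

Lemma definable_zero (I : finType) (phi : (I -> K) -> K) :
  polyfun phi -> definable (fun x => phi x = 0).
Proof.
case=> P hP s; have [t tP] : exists t : GRing.term K, forall e,
    GRing.eval e t = P.@[fun a => e`_(s (enum_val a))].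
  elim/mpoly_alg_ind: P {hP} => [c|i|p q [t tP] [u uP]|p q [t tP] [u uP]].
  - by exists (GRing.Const c) => e; rewrite mevalC.
  - by exists (GRing.Var K (s (enum_val i))) => e; rewrite mevalXU.
  - by exists (GRing.Add t u) => e; rewrite mevalD /= tP uP.
  - by exists (GRing.Mul t u) => e; rewrite mevalM /= tP uP.
by exists (GRing.Equal t (GRing.Const 0)) => e /=; rewrite tP hP.
Qed.

Lemma definable_not (I : finType) (D : (I -> K) -> Prop) :
  definable D -> definable (fun x => ~ D x).
Proof. by move=> h s; have [f fP] := h s; exists (GRing.Not f) => e; rewrite /= fP. Qed.

Lemma definable_and (I : finType) (D E : (I -> K) -> Prop) :
  definable D -> definable E -> definable (fun x => D x /\ E x).
Proof.
move=> h h' s; have [f fP] := h s; have [g gP] := h' s.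
by exists (GRing.And f g) => e; rewrite /= fP gP.
Qed.

Lemma definable_const (I : finType) (Q : Prop) : definable (fun _ : I -> K => Q).
Proof.
move=> s; have [q|nq] := boolp.EM Q; first by exists (GRing.Bool true).
by exists (GRing.Bool false).
Qed.

Lemma definable_imp (I : finType) (D E : (I -> K) -> Prop) :
  definable D -> definable E -> definable (fun x => D x -> E x).
Proof.
move=> h h' s; have [f fP] := h s; have [g gP] := h' s.
by exists (GRing.Implies f g) => e; rewrite /= fP gP.
Qed.

Lemma definable_all (I J : finType) (D : J -> (I -> K) -> Prop) :
  (forall j, definable (D j)) -> definable (fun x => forall j, D j x).
Proof.
move=> h; suff H (r : seq J) : definable (fun x => forall j, j \in r -> D j x).
  apply: definable_ext (H (enum J)) => x; split=> [hx j|hx j _]; last exact: hx.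
  by apply: hx; rewrite mem_enum.
elim: r => [|j r IH]; first by apply: (@definable_ext _ (fun=> True)); [split | exact: definable_const].
apply: definable_ext (definable_and (h j) IH) => x; split.
  by move=> [h1 h2] k; rewrite inE => /orP [/eqP ->|/h2].
by move=> h1; split=> [|k kr]; apply: h1; rewrite inE ?eqxx ?kr ?orbT.
Qed.

Lemma definable_reindex (I J : finType) (g : I -> J) (D : (I -> K) -> Prop) :
  definable D -> definable (fun x : J -> K => D (fun i => x (g i))).
Proof. by move=> h s; exact: (h (s \o g)). Qed.

Definition joinv (I J : finType) (x : I -> K) (y : J -> K) (k : I + J) : K :=
  match k with inl i => x i | inr j => y j end.

Lemma definable_ex (I J : finType) (D : (I + J -> K) -> Prop) :
  definable D -> definable (fun x : I -> K => exists y : J -> K, D (joinv x y)).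
Proof.
(* Positions from [N] on are fresh, so the quantified block [N + i] cannot capture the
   parameters. *)
move=> h s; pose N := (\max_i (s i).+1)%N.
have sN i : (s i < N)%N by rewrite /N (bigD1 i) //= leq_maxl.
pose t (k : I + J) : nat := match k with inl i => s i | inr j => (N + enum_rank j)%N end.
have [f fP] := h t.
pose G k (f : GRing.formula K) := foldr (fun i f => GRing.Exists (N + i) f) f (iota 0 k).
pose g k := G k f.
have setE (e : seq K) (y : nat -> K) k : exists e', forall i, e'`_i = if (N <= i < N + k)%N then y (i - N)%N else e`_i.
  exists (mkseq (fun i => if (N <= i < N + k)%N then y (i - N)%N else e`_i) (maxn (N + k) (size e))) => i.
  have [lt|] := ltnP i (maxn (N + k) (size e)); first by rewrite nth_mkseq.
  rewrite geq_max => /andP [h1 h2]; rewrite nth_default ?size_mkseq ?geq_max ?h1 //.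
  by rewrite (ltnNge i) h1 andbF nth_default.
have eqholds (e e' : seq K) f' : (forall i, e`_i = e'`_i) -> GRing.holds e f' -> GRing.holds e' f'.
  by move=> ee; apply: GRing.eq_holds.
have GP k f' e : GRing.holds e (G k f') <-> exists y : nat -> K, forall e' : seq K,
    (forall i, e'`_i = if (N <= i < N + k)%N then y (i - N)%N else e`_i) -> GRing.holds e' f'.
  have cmp y z i l : (N <= i < N + l)%N -> (if i == (N + l)%N then y else z : K) = z.
    by move=> /andP [_ lt]; rewrite ltn_eqF.
  elim: k f' => [|k IH] f'.
    split=> [he|[y hy]].
      exists (fun=> 0) => e' he'; apply: eqholds he => i; rewrite he' addn0.
      by case: ltnP => // _; rewrite ltnn.
    by apply: hy => i; rewrite addn0; case: (ltnP i N) => // h1; rewrite ?andbF ?(leq_gtF h1) ?andbF.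
  have -> : G k.+1 f' = G k (GRing.Exists (N + k) f').
    by rewrite /G -addn1 iotaD foldr_cat.
  have nthk (e' : seq K) x i : (set_nth 0 e' (N + k) x)`_i = if i == (N + k)%N then x else e'`_i.
    by rewrite nth_set_nth.
  have rng i : (N <= i < N + k.+1)%N = (i == (N + k)%N) || (N <= i < N + k)%N.
    by apply/idP/idP; lia.
  rewrite IH; split=> [[y hy]|[y hy]].
    have [e' he'] := setE e y k; have [x hx] := hy e' he'.
    exists (fun i => if i == k then x else y i) => e'' he''.
    apply: eqholds hx => i; rewrite nthk he'' he' rng.
    case: (i =P (N + k)%N) => [->|ne] /=; first by rewrite addKn eqxx.
    case: ifP => // /andP [h1 h2]; case: eqP => // ee; case: ne; lia.
  exists y => e' he'; exists (y k); apply: hy => i; rewrite nthk he' rng.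
  by case: eqP => [->|//] /=; rewrite addKn.
have gP k e : GRing.holds e (g k) <-> exists y : nat -> K, forall e' : seq K,
    (forall i, e'`_i = if (N <= i < N + k)%N then y (i - N)%N else e`_i) -> GRing.holds e' f.
  exact: GP.
exists (g #|J|) => e; rewrite gP; split.
  case=> y Dy; exists (fun i => odflt 0 (omap (fun j : 'I_#|J| => y (enum_val j)) (insub i))) => e' he'.
  rewrite -fP; move: Dy; congr (D _); apply/boolp.funext => -[i|j] /=; rewrite he'.
    by rewrite leqNgt sN.
  by rewrite leq_addr ltn_add2l ltn_ord addKn valK /= enum_rankK.
case=> y hy; exists (fun j => y (enum_rank j)).
have [e' he'] := setE e y #|J|.
have := hy _ he'; rewrite -fP; congr (D _); apply/boolp.funext => -[i|j] /=; rewrite he'.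
  by rewrite leqNgt sN.
by rewrite leq_addr ltn_add2l ltn_ord addKn.
Qed.

Lemma definable_forall (I J : finType) (D : (I + J -> K) -> Prop) :
  definable D -> definable (fun x : I -> K => forall y : J -> K, D (joinv x y)).
Proof.
move=> h; apply: definable_ext (definable_not (definable_ex (definable_not h))) => x.
split=> [nex y|hy [y]]; last exact.
by apply: boolp.contrapT => nD; apply: nex; exists y.
Qed.

(** Irreducibility expressed by functions: those vanishing on [X] form a prime ideal. *)
Definition prime_set (I : finType) (X : (I -> K) -> Prop) :=
  (exists x, X x) /\ forall phi psi, polyfun phi -> polyfun psi ->
    (exists2 x, X x & phi x != 0) -> (exists2 x, X x & psi x != 0) ->
    exists2 x, X x & phi x * psi x != 0.

(* Chevalley's theorem, through quantifier elimination. *)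
Theorem definable_generic (I : finType) (X D : (I -> K) -> Prop) :
  prime_set X -> definable D -> exists phi, [/\ polyfun phi, exists2 x, X x & phi x != 0 &
    (forall x, X x -> phi x != 0 -> D x) \/ (forall x, X x -> phi x != 0 -> ~ D x)].
Proof.
move=> [[x0 Xx0] Xp] hD; have [f0 f0P] := hD (fun i => enum_rank i).
pose env (x : I -> K) : seq K := [seq x i | i <- enum I].
have envE x i : (env x)`_(enum_rank i) = x i.
  rewrite /env (nth_map i) ?nth_enum_rank // -cardE; exact: ltn_ord.
have DE x : D x <-> GRing.holds (env x) f0.
  by rewrite -f0P; have -> : (fun i => (env x)`_(enum_rank i)) = x by apply/boolp.funext.
have term_poly t : GRing.rterm t -> polyfun (fun x => GRing.eval (env x) t).
  elim: t => //=.
  - move=> k _; have [lt|ge] := ltnP k #|I|.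
      apply: polyfun_ext (polyfunX K (enum_val (Ordinal lt))) => x.
      by rewrite -(envE x) enum_valK.
    apply: polyfun_ext (polyfunC _ 0) => x.
    by rewrite nth_default // size_map -cardE.
  - by move=> c _; apply: polyfunC.
  - by move=> c _; apply: polyfunC.
  - by move=> t ht u hu /andP [/ht pt /hu pu]; apply: polyfunD.
  - by move=> t ht /ht; apply: polyfunN.
  - move=> t ht k /ht pt; apply: polyfun_ext (polyfunM (polyfunC _ k%:R) pt) => x.
    by rewrite mulr_natl.
  - by move=> t ht u hu /andP [/ht pt /hu pu]; apply: polyfunM.
  - by move=> t ht k /ht pt; apply: polyfun_exp.
(* A condition is good when its truth value is constant on a nonempty open part of [X]; primeness of
   [X] makes this stable under the connectives. *)
pose good (b : (I -> K) -> bool) := exists phi, [/\ polyfun phi, exists2 x, X x & phi x != 0 &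
    (forall x, X x -> phi x != 0 -> b x) \/ (forall x, X x -> phi x != 0 -> ~~ b x)].
have good2 b1 b2 (op : bool -> bool -> bool) : good b1 -> good b2 -> good (fun x => op (b1 x) (b2 x)).
  move=> [p1 [h1 e1 o1]] [p2 [h2 e2 o2]]; exists (fun x => p1 x * p2 x).
  have [x Xx hx] := Xp _ _ h1 h2 e1 e2.
  split; [exact: polyfunM | by exists x |].
  have o1' : exists c1, forall x, X x -> p1 x != 0 -> b1 x = c1.
    by case: o1 => h; [exists true | exists false] => y Xy hy; [rewrite h | apply/negbTE/h].
  have o2' : exists c2, forall x, X x -> p2 x != 0 -> b2 x = c2.
    by case: o2 => h; [exists true | exists false] => y Xy hy; [rewrite h | apply/negbTE/h].
  case: o1' o2' => c1 hc1 [c2 hc2].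
  case e : (op c1 c2); [left | right] => y Xy; rewrite mulf_eq0 negb_or => /andP [n1 n2].
    by rewrite (hc1 y) // (hc2 y).
  by rewrite (hc1 y) // (hc2 y) // e.
have qf_good f : GRing.qf_form f -> GRing.rformula f -> good (fun x => GRing.qf_eval (env x) f).
  elim: f => //=.
  - move=> b _ _; exists (fun=> 1); split; first exact: polyfunC.
      by exists x0 => //; rewrite oner_eq0.
    by case: b; [left | right].
  - move=> t u _ /andP [/term_poly pt /term_poly pu].
    have pd := polyfunB pt pu.
    have [[x Xx hx]|no] := boolp.EM (exists2 x, X x & GRing.eval (env x) t - GRing.eval (env x) u != 0).
      exists (fun x => GRing.eval (env x) t - GRing.eval (env x) u); split=> //; first by exists x.
      by right=> y Xy; rewrite subr_eq0.
    exists (fun=> 1); split; first exact: polyfunC.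
      by exists x0 => //; rewrite oner_eq0.
    left=> y Xy _; rewrite -subr_eq0; apply/negPn/negP => h; apply: no.
    by exists y.
  - by move=> f hf g hg /andP [/hf af /hg ag] /andP [/af bf /ag bg]; exact: (good2 _ _ andb).
  - by move=> f hf g hg /andP [/hf af /hg ag] /andP [/af bf /ag bg]; exact: (good2 _ _ orb).
  - by move=> f hf g hg /andP [/hf af /hg ag] /andP [/af bf /ag bg]; exact: (good2 _ _ implb).
  - by move=> f hf /hf af /af bf; exact: (good2 _ _ (fun b _ => ~~ b) bf bf).
pose f1 := GRing.to_rform f0.
have rf1 : GRing.rformula f1 by apply: GRing.to_rform_rformula.
pose qe := GRing.quantifier_elim (@closed_field.ClosedFieldQE.ex_elim K) f1.
have wf := @closed_field.ClosedFieldQE.wf_ex_elim K.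
have ok := closed_field.ClosedFieldQE.holds_ex_elim (@solve_monicpoly K).
have [||phi [h1 h2 h3]] := qf_good qe.
- by have /andP [] := GRing.quantifier_elim_wf wf rf1.
- by have /andP [] := GRing.quantifier_elim_wf wf rf1.
have qeP x : D x <-> GRing.qf_eval (env x) qe.
  rewrite DE -(GRing.to_rformP (env x) f0); apply: rwP.
  exact: (GRing.quantifier_elim_rformP wf ok).
exists phi; split=> //; case: h3 => h3; [left | right] => x Xx hx; first by rewrite qeP; apply: h3.
by rewrite qeP; apply/negP; apply: h3.
Qed.

End Definable.

Section Translation.
Variables (n : nat) (K : comNzRingType) (y : 'I_n -> K).

Definition translate (p : {mpoly K[n]}) : {mpoly K[n]} :=
  p \mPo [tuple 'X_a + (y a)%:MP | a < n].

Lemma translate_eval p x : (translate p).@[x] = p.@[fun a => x a + y a].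
Proof.
rewrite /translate comp_mpoly_meval; apply: meval_eq => a.
by rewrite tnth_mktuple mevalD mevalXU mevalC.
Qed.

Lemma translateM : {morph translate : p q / p * q}.
Proof. by move=> p q; rewrite /translate rmorphM. Qed.

Lemma translate_deriv a p : (translate p)^`M(a) = translate p^`M(a).
Proof.
elim/mpoly_alg_ind: p => [c|i|p q hp hq|p q hp hq].
- by rewrite /translate comp_mpolyC !mderivC comp_mpoly0.
- rewrite /translate comp_mpolyXU -tnth_nth tnth_mktuple mderivD mderivC addr0 mderivX.
  rewrite mnm1E comp_mpolyZ; case: eqP => [->|_]; last by rewrite !scale0r.
  have -> : (U_(a) - U_(a) = 0)%MM by apply/mnmP => j; rewrite mnmBE mnm0E subnn.
  by rewrite !scale1r mpolyX0 comp_mpoly1.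
- by rewrite mderivD /translate !comp_mpolyD mderivD hp hq.
- by rewrite mderivM translateM mderivM hp hq /translate comp_mpolyD !rmorphM.
Qed.

End Translation.

Section TranslationValues.
Variables (R : realType) (n : nat) (y : 'I_n -> R[i]).
Implicit Types p : {mpoly R[i][n]}.

Lemma translate_coef0 p : (translate y p)@_0%MM = p.@[y].
Proof. by rewrite -meval_at0 translate_eval; apply: meval_eq => a; rewrite add0r. Qed.

Lemma translate_coefU a p : (translate y p)@_U_(a) = (p^`M(a)).@[y].
Proof.
by rewrite -translate_coef0 -translate_deriv mcoeff_deriv add0m mnm0E mulr1n.
Qed.

Lemma nonzero_near p : p.@[y] != 0 ->
  exists2 e : R, 0 < e & forall x, inball (fun a => x a - y a) e -> p.@[x] != 0.
Proof.
move=> py; have [M M0 hM] := meval_lipschitz (translate y p).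
have d0 : 0 < cabs p.@[y] by rewrite cabs_gt0.
have M1 : 0 < M + 1 by rewrite ltr_wpDl.
exists (Num.min 1 (cabs p.@[y] / (2 * (M + 1)))).
  by rewrite lt_min ltr01 divr_gt0 // mulr_gt0.
move=> x hx; have [hx1 hx2] : inball (fun a => x a - y a) 1 /\
    inball (fun a => x a - y a) (cabs p.@[y] / (2 * (M + 1))).
  by split; apply: inballW hx; rewrite ge_min lexx ?orbT.
apply/eqP => px; have e0 : 0 <= cabs p.@[y] / (2 * (M + 1)).
  by rewrite divr_ge0 ?cabs_ge0 // mulr_ge0 // ltW.
have := hM (fun a => x a - y a) (fun=> 0) _ hx1 _ e0 _; rewrite !translate_eval.
have -> : (fun a => x a - y a + y a) = x by apply/boolp.funext => a; rewrite subrK.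
have -> : (fun a => 0 + y a) = y by apply/boolp.funext => a; rewrite add0r.
rewrite px sub0r cabsN => h.
have : cabs p.@[y] <= M * (cabs p.@[y] / (2 * (M + 1))).
  by apply: h => a; rewrite ?cabs0 ?subr0.
rewrite mulrCA -[X in X <= _]mulr1 ler_pM2l // => h1.
have : M / (2 * (M + 1)) < 1 by rewrite ltr_pdivrMr ?mulr_gt0 // mul1r; lra.
by rewrite ltNge h1.
Qed.

End TranslationValues.

Section SmoothPoint.
Variables (R : realType) (n c : nat).
Local Notation C := R[i].
Variables (f : 'I_c -> {mpoly C[n]}) (B : 'I_c -> 'I_n -> C) (y : 'I_n -> C).
Hypothesis fy : forall j, (f j).@[y] = 0.
Hypothesis DB : forall i j, \sum_a ((f i)^`M(a)).@[y] * B j a = (i == j)%:R.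

Let zeros x := forall j, (f j).@[x] = 0.

Definition vanish_near (p : {mpoly C[n]}) :=
  exists2 e : R, 0 < e & forall x, inball (fun a => x a - y a) e -> zeros x -> p.@[x] = 0.

Let g j := translate y (f j).
Let g0 j : (g j)@_0%MM = 0. Proof. by rewrite translate_coef0 fy. Qed.
Let DgB i j : lin_coef (g i) (B j) = (i == j)%:R.
Proof. by rewrite -DB; apply: eq_bigr => a _; rewrite translate_coefU. Qed.

Lemma implicit_solution_at : exists S r : R, [/\ 0 <= S, 0 < r &
  forall (v : 'I_n -> C) rho, 0 <= rho <= r -> inball v rho ->
  exists zeta : 'I_c -> C, (forall j, cabs (zeta j) <= S * rho) /\
    zeros (fun a => y a + v a + \sum_i zeta i * B i a)].
Proof.
have [S [r [S0 r0 h]]] := implicit_solution g0 DgB.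
exists S, r; split=> // v rho hr hv; have [z [z1 z2]] := h v rho hr hv.
exists z; split=> // j; rewrite -[RHS](z2 j) translate_eval; apply: meval_eq => a.
by ring.
Qed.

Theorem smooth_point : exists (P : {mpoly C[n]} -> Prop) (s : {mpoly C[n]}),
  [/\ s.@[y] != 0,
      forall p x, P p -> zeros x -> s.@[x] != 0 -> p.@[x] = 0,
      forall p, vanish_near p -> P p
    & forall p q, P (p * q) -> P p \/ P q].
Proof.
have [P [s [s0 P1 P2 P3]]] := smooth_origin g0 DgB.
have xyK x : (fun a => x a - y a + y a) = x by apply/boolp.funext => a; rewrite subrK.
(* Membership in [P] gives vanishing near [y], as [s] is nonzero there; this turns primeness of
   germs into a statement about [P] alone. *)
have PV p : P p -> vanish_near0 g p.
  move=> Pp; rewrite -meval_at0 in s0; have [e e0 he] := nonzero_near s0.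
  exists e => // x hx zx; apply: P1 => //; apply: he => a; rewrite subr0; exact: hx.
exists (fun p => P (translate y p)), (translate (fun a => - y a) s); split.
- rewrite translate_eval -meval_at0 in s0 *.
  by have -> : (fun a => y a - y a) = (fun=> 0) by apply/boolp.funext => a; rewrite subrr.
- move=> p x Pp zx sx.
  have Ex q : (translate y q).@[fun a => x a - y a] = q.@[x] by rewrite (translate_eval y q) xyK.
  rewrite -(Ex p); apply: P1 => //; first by move=> j; rewrite (Ex (f j)); apply: zx.
  have := sx; rewrite (translate_eval (fun a => - y a) s); exact.
- move=> p [e e0 he]; apply: P2; exists e => // x hx zx.
  rewrite (translate_eval y p); apply: he; first by move=> a; rewrite addrK.
  by move=> j; rewrite -(translate_eval y (f j)); exact: zx.
- by move=> p q; rewrite translateM => /PV /P3.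
Qed.

End SmoothPoint.

(** * Forms, linear changes of coordinates and nodes *)

Section Derivatives.
Variable K : comNzRingType.

Lemma mderiv_comp n l (p : {mpoly K[n]}) (t : n.-tuple {mpoly K[l]}) j :
  (p \mPo t)^`M(j) = \sum_i (p^`M(i) \mPo t) * (tnth t i)^`M(j).
Proof.
elim/mpoly_alg_ind: p => [c|i|p q hp hq|p q hp hq].
- rewrite comp_mpolyC mderivC big1 // => i _; by rewrite mderivC comp_mpoly0 mul0r.
- rewrite comp_mpolyXU -tnth_nth (bigD1 i) //= big1 => [|k ki]; rewrite mderivX mnm1E.
    have -> : (U_(i) - U_(i) = 0)%MM by apply/mnmP => a; rewrite mnmBE mnm0E subnn.
    by rewrite eqxx scale1r mpolyX0 comp_mpoly1 mul1r addr0.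
  by rewrite eq_sym (negbTE ki) scale0r comp_mpoly0 mul0r.
- rewrite comp_mpolyD mderivD hp hq -big_split; apply: eq_bigr => i _ /=.
  by rewrite mderivD comp_mpolyD mulrDl.
- rewrite rmorphM /= mderivM hp hq mulr_suml mulr_sumr -big_split; apply: eq_bigr => i _ /=.
  by rewrite mderivM comp_mpolyD !rmorphM /=; ring.
Qed.

Lemma mderiv_homog n d (p : {mpoly K[n]}) j : p \is d.-homog -> p^`M(j) \is d.-1.-homog.
Proof.
move=> hp; apply/dhomogP => m; rewrite mcoeff_msupp mcoeff_deriv => h.
have : p@_(m + U_(j)) != 0 by apply: contraNneq h => ->; rewrite mul0rn.
rewrite -mcoeff_msupp => /(dhomog_mf hp).
by rewrite /= mdegD mdeg1 addn1 => <-.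
Qed.

Lemma euler n d (p : {mpoly K[n]}) v : p \is d.-homog ->
  \sum_j v j * (p^`M(j)).@[v] = d%:R * p.@[v].
Proof.
move=> hp; rewrite [in RHS](mpolyE p) [X in _ * X](raddf_sum (meval v)) mulr_sumr.
have -> : \sum_j v j * (p^`M(j)).@[v] = \sum_j \sum_(m <- msupp p) v j * (p@_m * ('X_[m]^`M(j)).@[v]).
  apply: eq_bigr => j _; rewrite {1}(mpolyE p) (raddf_sum (mderiv j)) (raddf_sum (meval v)) mulr_sumr.
  by apply: eq_bigr => m _; rewrite /= mderivZ mevalZ.
rewrite exchange_big /= big_seq [RHS]big_seq; apply: eq_bigr => m /(dhomog_mf hp) <-.
rewrite /= mevalZ mdegE natr_sum mulr_suml; apply: eq_bigr => j _.
rewrite mderivX mevalZ; case: (posnP (m j)) => [->|mj]; first by rewrite !mul0r !mulr0.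
have -> : 'X_[m] = 'X_[m - U_(j)] * 'X_j :> {mpoly K[n]} by rewrite -mpolyXD submK // lep1mP -lt0n.
by rewrite mevalM mevalXU; ring.
Qed.

Lemma pihomog_deriv n k (p : {mpoly K[n]}) j :
  (pihomog mdeg k.+1 p)^`M(j) = pihomog mdeg k p^`M(j).
Proof.
apply/mpolyP => m; rewrite mcoeff_deriv !mcoeff_pihomog mcoeff_deriv mdegD mdeg1 addn1 eqSS.
by case: ifP => // _; rewrite mul0rn.
Qed.

Lemma meval_origin n (p : {mpoly K[n]}) : p.@[fun=> 0] = p@_0%MM.
Proof.
elim/mpoly_alg_ind: p => [c|i|p q hp hq|p q hp hq].
- by rewrite mevalC mcoeffC eqxx mulr1.
- by rewrite mevalXU mcoeffX (inj_eq (@mnm1_inj _) _ _) || rewrite mevalXU mcoeffX; case: eqP => // /mnmP /(_ i); rewrite mnm1E mnm0E eqxx.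
- by rewrite mevalD mcoeffD hp hq.
- by rewrite mevalM hp hq mcoeff0_is_multiplicative || rewrite mevalM hp hq rmorphM.
Qed.

Lemma mcoeffU_deriv n (p : {mpoly K[n]}) j : p@_U_(j) = (p^`M(j)).@[fun=> 0].
Proof. by rewrite meval_origin mcoeff_deriv add0m mnm0E mulr1n. Qed.

Lemma mdeg1_eq n (m : 'X_{1..n}) : mdeg m = 1%N -> exists j, m = U_(j)%MM.
Proof. by move/eqP; rewrite mdeg_eq1 => /existsP [j /eqP ->]; exists j. Qed.

Lemma pihomog1E n (p : {mpoly K[n]}) : pihomog mdeg 1 p = \sum_j p@_U_(j) *: 'X_j.
Proof.
apply/mpolyP => m; rewrite mcoeff_pihomog (raddf_sum (mcoeff m)) /=.
case: eqP => [/mdeg1_eq [j ->]|h].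
  rewrite (bigD1 j) //= big1 => [|k kj]; rewrite mcoeffZ mcoeffX.
    by rewrite eqxx mulr1 addr0.
  case: eqP => [/mnmP /(_ k)|]; last by rewrite mulr0.
  by rewrite !mnm1E eqxx eq_sym (negbTE kj).
rewrite big1 // => k _; rewrite mcoeffZ mcoeffX; case: eqP => [e|]; last by rewrite mulr0.
by case: h; rewrite -e mdeg1.
Qed.

End Derivatives.

Section LinearSubstitution.
Variables (K : numClosedFieldType).
Implicit Types (p F : {mpoly K[4]}) (g h : 'M[K]_4) (x : 'I_4 -> K).

Lemma mpoly_ext n (p q : {mpoly K[n]}) : (forall v, p.@[v] = q.@[v]) -> p = q.
Proof.
by move=> h; apply/eqP; rewrite -subr_eq0; apply/eqP/mpoly_eq0_fun => v; rewrite mevalB h subrr.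
Qed.

Definition gv g x : 'I_4 -> K := fun i => \sum_j g i j * x j.
Definition act g p : {mpoly K[4]} := p \mPo [tuple \sum_j g i j *: 'X_j | i < 4].

Lemma act_eval g p x : (act g p).@[x] = p.@[gv g x].
Proof.
rewrite /act comp_mpoly_meval; apply: meval_eq => i.
rewrite tnth_mktuple (raddf_sum (meval x)); apply: eq_bigr => j _.
by rewrite /= mevalZ mevalXU.
Qed.

Lemma gvM g h x : gv g (gv h x) = gv (g *m h) x.
Proof.
apply/boolp.funext => i; rewrite /gv.
under eq_bigr => j _ do rewrite mulr_sumr.
rewrite exchange_big /=; apply: eq_bigr => k _; rewrite mxE mulr_suml.
by apply: eq_bigr => j _; rewrite mulrA.
Qed.

Lemma gv1 x : gv 1%:M x = x.
Proof.
apply/boolp.funext => i; rewrite /gv (bigD1 i) //= big1 => [|j ji]; rewrite mxE.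
  by rewrite eqxx mul1r addr0.
by rewrite eq_sym (negbTE ji) mul0r.
Qed.

Lemma gvZ g c x : gv g (fun i => c * x i) = (fun i => c * gv g x i).
Proof.
by apply/boolp.funext => i; rewrite /gv mulr_sumr; apply: eq_bigr => j _; rewrite mulrCA.
Qed.

Lemma act_mul g h p : act g (act h p) = act (h *m g) p.
Proof. by apply: mpoly_ext => v; rewrite !act_eval gvM. Qed.

Lemma act1 p : act 1%:M p = p.
Proof. by apply: mpoly_ext => v; rewrite act_eval gv1. Qed.

Lemma actZ g c p : act g (c *: p) = c *: act g p.
Proof. by rewrite /act comp_mpolyZ. Qed.

Lemma act_homog g d p : p \is d.-homog -> act g p \is d.-homog.
Proof.
move=> hp; rewrite /act comp_mpolyEX big_seq; apply: rpred_sum => m /(dhomog_mf hp) <-.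
apply: rpredZ; rewrite comp_mpolyX /= mdegE.
apply: (big_ind2 (fun (q : {mpoly K[4]}) k => q \is k.-homog)) => [|q1 k1 q2 k2 h1 h2|i _].
- exact: dhomog1.
- exact: dhomogM.
have -> : m i = (1 * m i)%N by rewrite mul1n.
rewrite {1}mul1n; apply: dhomogMn; rewrite tnth_mktuple; apply: rpred_sum => j _; apply: rpredZ.
by rewrite dhomogX /= mdeg1.
Qed.

Lemma act_deriv g p j : (act g p)^`M(j) = \sum_i g i j *: act g p^`M(i).
Proof.
rewrite /act mderiv_comp; apply: eq_bigr => i _; rewrite tnth_mktuple.
rewrite (raddf_sum (mderiv j)) (bigD1 j) //= big1 => [|k kj]; rewrite mderivZ mderivX mnm1E.
  have -> : (U_(j) - U_(j) = 0)%MM by apply/mnmP => a; rewrite mnmBE mnm0E subnn.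
  by rewrite eqxx scale1r mpolyX0 addr0 -scalerAr mulr1.
by rewrite (negbTE kj) scale0r scaler0.
Qed.

Definition hess p x : 'M[K]_4 := \matrix_(i, j) (p^`M(i)^`M(j)).@[x].

Lemma hess_sym p x : (hess p x)^T = hess p x.
Proof. by apply/matrixP => i j; rewrite !mxE mderiv_comm. Qed.

Lemma hess_act g p x : hess (act g p) x = g^T *m hess p (gv g x) *m g.
Proof.
apply/matrixP => i j; rewrite !mxE act_deriv (raddf_sum (mderiv j)) (raddf_sum (meval x)).
have -> : \sum_k ((g k i *: act g p^`M(k))^`M(j)).@[x] =
    \sum_k \sum_l g k i * (g l j * (p^`M(k)^`M(l)).@[gv g x]).
  apply: eq_bigr => k _; rewrite mderivZ mevalZ act_deriv (raddf_sum (meval x)) mulr_sumr.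
  by apply: eq_bigr => l _; rewrite /= mevalZ act_eval.
rewrite exchange_big /=; apply: eq_bigr => l _; rewrite mxE mulr_suml.
by apply: eq_bigr => k _; rewrite !mxE; ring.
Qed.

Definition cvec x : 'cV[K]_4 := \col_i x i.

Lemma hess_point d p x : p \is d.-homog -> hess p x *m cvec x = d.-1%:R *: \col_i (p^`M(i)).@[x].
Proof.
move=> hp; apply/colP => i; rewrite !mxE -(euler _ (mderiv_homog i hp)).
by apply: eq_bigr => j _; rewrite !mxE mulrC.
Qed.

Lemma same_point_sym n (p q : 'I_n -> K) : same_point p q -> same_point q p.
Proof. by case=> c c0 h; exists c^-1; [rewrite invr_eq0 | move=> i; rewrite h mulKf]. Qed.

Lemma same_point_trans n (p q r : 'I_n -> K) : same_point p q -> same_point q r -> same_point p r.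
Proof.
case=> c c0 h [e e0 k]; exists (e * c); first by rewrite mulf_neq0.
by move=> i; rewrite k h mulrA.
Qed.

Lemma same_point_refl n (p : 'I_n -> K) : same_point p p.
Proof. by exists 1; [rewrite oner_eq0 | move=> i; rewrite mul1r]. Qed.

Lemma nonzero_same n (p q : 'I_n -> K) : same_point p q -> nonzero p -> nonzero q.
Proof. by case=> c c0 h [i pi]; exists i; rewrite h mulf_neq0. Qed.

Section Charts.
Variables (i : 'I_4) (p : 'I_4 -> K).

Definition chart_pt (v : 'I_3 -> K) : 'I_4 -> K :=
  fun j => if unlift i j is Some k then p j + v k else p j.

Lemma local_eq_eval F v : (local_eq i p F).@[v] = F.@[chart_pt v].
Proof.
rewrite /local_eq comp_mpoly_meval; apply: meval_eq => j; rewrite tnth_mktuple /chart_pt.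
by case: unliftP => [k _|->]; rewrite ?mevalD ?mevalXU !mevalC.
Qed.

Lemma chart_pt0 : chart_pt (fun=> 0) = p.
Proof. by apply/boolp.funext => j; rewrite /chart_pt; case: unlift => // k; rewrite addr0. Qed.

Lemma local_eq_deriv F k : (local_eq i p F)^`M(k) = local_eq i p F^`M(lift i k).
Proof.
rewrite /local_eq mderiv_comp (bigD1 (lift i k)) //= big1 => [|j ji]; rewrite tnth_mktuple.
  rewrite liftK mderivD mderivC add0r mderivX mnm1E eqxx.
  have -> : (U_(k) - U_(k) = 0)%MM by apply/mnmP => a; rewrite mnmBE mnm0E subnn.
  by rewrite scale1r mpolyX0 mulr1 addr0.
case: unliftP => [l e|_]; last by rewrite mderivC mulr0.
rewrite mderivD mderivC add0r mderivX mnm1E; case: eqP => [e'|]; last by rewrite scale0r mulr0.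
by rewrite e e' eqxx in ji.
Qed.

Lemma local_eq0 F : (local_eq i p F)@_0%MM = F.@[p].
Proof. by rewrite -meval_origin local_eq_eval chart_pt0. Qed.

Lemma local_eqU F k : (local_eq i p F)@_U_(k) = (F^`M(lift i k)).@[p].
Proof. by rewrite mcoeffU_deriv local_eq_deriv local_eq_eval chart_pt0. Qed.

Definition chart_hess F : 'M[K]_3 := \matrix_(k, l) hess F p (lift i k) (lift i l).

Lemma quadratic_part_deriv F k v :
  ((pihomog mdeg 2 (local_eq i p F))^`M(k)).@[v] = \sum_l chart_hess F k l * v l.
Proof.
rewrite pihomog_deriv pihomog1E (raddf_sum (meval v)); apply: eq_bigr => l _ /=.
by rewrite mevalZ mevalXU mcoeffU_deriv !local_eq_deriv local_eq_eval chart_pt0 !mxE.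
Qed.

(** The singular points of a conic are the kernel of its symmetric matrix; Euler's identity, with 2
    invertible, takes care of the equation itself. *)
Lemma smooth_quadratic_part F :
  smooth_plane_curve (pihomog mdeg 2 (local_eq i p F)) <->
  forall v : 'I_3 -> K, (forall k, \sum_l chart_hess F k l * v l = 0) -> forall l, v l = 0.
Proof.
split=> [sm v hv l|inj v [l vl] [_ hv]].
  apply/eqP/negPn/negP => vl; apply: (sm v); first by exists l.
  have dv k : ((pihomog mdeg 2 (local_eq i p F))^`M(k)).@[v] = 0 by rewrite quadratic_part_deriv.
  split=> //; have := euler v (pihomogP mdeg 2 (local_eq i p F)).
  rewrite big1 => [/esym/eqP|k _]; last by rewrite dv mulr0.
  by rewrite mulf_eq0 pnatr_eq0 /= => /eqP.
by move: vl; rewrite (inj v) ?eqxx // => k; rewrite -quadratic_part_deriv hv.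
Qed.

End Charts.

Lemma sum_lift (i : 'I_4) (f : 'I_4 -> K) : \sum_j f j = f i + \sum_k f (lift i k).
Proof. by rewrite (bigD1_ord i). Qed.

(** Euler's identity yields the remaining derivative, in the direction of the nonzero coordinate
    [x i]. *)
Lemma singular_euler d F x i : F \is d.-homog -> x i != 0 -> F.@[x] = 0 ->
  (forall k, (F^`M(lift i k)).@[x] = 0) -> singular F x.
Proof.
move=> hF xi Fx dF; split=> //; first by exists i.
have := euler x hF; rewrite Fx mulr0 (sum_lift i) big1 => [/eqP|k _]; last by rewrite dF mulr0.
rewrite addr0 mulf_eq0 (negbTE xi) => /eqP di j.
by case: (unliftP i j) => [k ->|->].
Qed.

(** A kernel vector of the 3 by 3 block, extended by 0 at [i], lies in the kernel of the full
    Hessian: the missing row follows from symmetry and from [x] being in the kernel. A multiple of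
    [x] with zero entry at [i] is zero. *)
Lemma chart_hess_inj d F x i : F \is d.-homog -> x i != 0 -> (forall j, (F^`M(j)).@[x] = 0) ->
  (forall v : 'cV_4, hess F x *m v = 0 -> exists c, v = c *: cvec x) ->
  forall v : 'I_3 -> K, (forall k, \sum_l chart_hess i x F k l * v l = 0) -> forall l, v l = 0.
Proof.
move=> hF xi F1 ker v hv l.
pose w : 'cV[K]_4 := \col_j (if unlift i j is Some k then v k else 0).
have wl k : w (lift i k) 0 = v k by rewrite mxE liftK.
have wi : w i 0 = 0 by rewrite mxE unlift_none.
have hx : hess F x *m cvec x = 0.
  by rewrite (hess_point x hF); apply/colP => j; rewrite !mxE F1 mulr0.
have hl k : (hess F x *m w) (lift i k) 0 = 0.
  rewrite mxE (sum_lift i) wi mulr0 add0r -[RHS](hv k); apply: eq_bigr => a _.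
  by rewrite wl [chart_hess _ _ _ _ _]mxE.
have hw : hess F x *m w = 0.
  apply/colP => j; rewrite [RHS]mxE; case: (unliftP i j) => [k ->|->] //.
  have /(congr1 (fun A : 'M_1 => A 0 0)) : (cvec x)^T *m (hess F x *m w) = 0.
    by rewrite mulmxA -[hess F x]hess_sym -trmx_mul hx trmx0 mul0mx.
  rewrite mxE (sum_lift i) big1 => [|k _]; last by rewrite hl mulr0.
  by rewrite addr0 [_^T _ _]mxE [cvec x _ _]mxE [RHS]mxE => /eqP; rewrite mulf_eq0 (negbTE xi) => /eqP.
have [c wc] := ker w hw; have : c = 0.
  by have /eqP := wi; rewrite wc !mxE mulf_eq0 (negbTE xi) orbF => /eqP.
by rewrite -wl wc !mxE => ->; rewrite mul0r.
Qed.

(** A criterion without charts, which makes nodes visibly compatible with linear substitutions,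
    rescaling and change of representative. *)
Lemma nodeP d F x : F \is d.-homog ->
  node F x <-> singular F x /\
    forall v : 'cV_4, hess F x *m v = 0 -> exists c, v = c *: cvec x.
Proof.
move=> hF; split.
  case=> i [xi mF _] /smooth_quadratic_part inj.
  have F0 : F.@[x] = 0.
    have /(congr1 (mcoeff 0%MM)) := mF 0%N isT.
    by rewrite mcoeff_pihomog mdeg0 eqxx mcoeff0 local_eq0.
  have F1 k : (F^`M(lift i k)).@[x] = 0.
    have /(congr1 (mcoeff U_(k)%MM)) := mF 1%N isT.
    by rewrite mcoeff_pihomog mdeg1 eqxx mcoeff0 local_eqU.
  have sF := singular_euler hF xi F0 F1; split=> // v hv.
  have hx : hess F x *m cvec x = 0.
    rewrite (hess_point x hF); case: sF => _ _ sF.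
    by apply/colP => j; rewrite !mxE sF mulr0.
  pose c := v i 0 / x i; exists c; pose w := v - c *: cvec x.
  have wi : w i 0 = 0 by rewrite !mxE /c divfK ?subrr.
  have hw : hess F x *m w = 0 by rewrite mulmxBr hv -scalemxAr hx scaler0 subrr.
  suff -> : v = c *: cvec x + w by rewrite [w](_ : _ = 0) ?addr0 //; apply/colP => j; rewrite [RHS]mxE;
    case: (unliftP i j) => [k ->|->] //; apply: (inj (fun l => w (lift i l) 0)) => k';
    have /colP /(_ (lift i k')) := hw; rewrite !mxE (sum_lift i) wi mulr0 add0r => e; rewrite -[RHS]e;
    apply: eq_bigr => l _; rewrite !mxE.
  by rewrite /w addrC subrK.
case=> [[[i xi] F0 F1] ker].
have inj : smooth_plane_curve (pihomog mdeg 2 (local_eq i x F)).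
  exact/smooth_quadratic_part/(chart_hess_inj hF xi F1 ker).
exists i => //; split=> //.
  move=> k k2; apply/mpolyP => a; rewrite mcoeff_pihomog mcoeff0; case: eqP => // ak.
    case: k k2 ak => [|[|//]] _ ak.
      by rewrite (eqP (_ : a == 0%MM)) ?local_eq0 // -mdeg_eq0 ak.
    by have [j ->] := mdeg1_eq ak; rewrite local_eqU.
  apply/eqP => q0; apply: (inj (fun=> 1)); first by exists 0; rewrite oner_eq0.
  by rewrite q0 meval0; split=> // j; rewrite mderiv0 meval0.
Qed.

Lemma gv_unitK g x : g \in unitmx -> gv (invmx g) (gv g x) = x.
Proof. by move=> ug; rewrite gvM mulVmx // gv1. Qed.

Lemma gv_unitVK g x : g \in unitmx -> gv g (gv (invmx g) x) = x.
Proof. by move=> ug; rewrite gvM mulmxV // gv1. Qed.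

Lemma act_unitK g p : g \in unitmx -> act (invmx g) (act g p) = p.
Proof. by move=> ug; rewrite act_mul mulmxV // act1. Qed.

Lemma nonzero_gv g x : g \in unitmx -> nonzero x -> nonzero (gv g x).
Proof.
move=> ug [i xi]; apply: boolp.contrapT => no; case/eqP: xi.
rewrite -(gv_unitK x ug) [LHS]/gv big1 // => j _; apply/eqP; rewrite mulf_eq0; apply/orP; right.
by apply/negPn/negP => h; apply: no; exists j.
Qed.

Lemma singular_act g p x : g \in unitmx -> singular (act g p) x <-> singular p (gv g x).
Proof.
move=> ug; have H h q y : h \in unitmx -> singular q (gv h y) -> singular (act h q) y.
  move=> uh [nz q0 dq]; split.
  - by rewrite -(gv_unitK y uh); apply: nonzero_gv => //; rewrite unitmx_inv.
  - by rewrite act_eval.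
  - move=> j; rewrite act_deriv (raddf_sum (meval y)) big1 // => i _ /=.
    by rewrite mevalZ act_eval dq mulr0.
split; last exact: H.
rewrite -{1}(gv_unitK x ug) => /H; rewrite unitmx_inv act_unitK //; exact.
Qed.

Lemma node_act g d p x : g \in unitmx -> p \is d.-homog -> node p (gv g x) -> node (act g p) x.
Proof.
move=> ug hp; rewrite (nodeP _ hp) (nodeP _ (act_homog g hp)) singular_act // => -[sp ker].
split=> // v; rewrite hess_act -!mulmxA => hv.
have {}hv : hess p (gv g x) *m (g *m v) = 0.
  by rewrite -[LHS]mul1mx -(mulVmx (_ : g^T \in unitmx)) ?unitmx_tr // -mulmxA hv mulmx0.
have [c gc] := ker _ hv; exists c; rewrite -[v]mul1mx -(mulVmx ug) -mulmxA gc -scalemxAr.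
congr (_ *: _); apply/colP => i; rewrite mxE [RHS]mxE -{2}(gv_unitK x ug).
by apply: eq_bigr => j _; rewrite mxE.
Qed.

Lemma same_point_gv g (p q : 'I_4 -> K) : same_point p q -> same_point (gv g p) (gv g q).
Proof.
case=> c c0 h; exists c => // i; have -> : q = (fun i => c * p i) by apply/boolp.funext.
by rewrite gvZ.
Qed.

Lemma nodes_enum_act g d delta p (q : 'I_delta -> 'I_4 -> K) : g \in unitmx -> p \is d.-homog ->
  nodes_enum p q -> nodes_enum (act g p) (fun k => gv (invmx g) (q k)).
Proof.
move=> ug hp [nd dist all]; split.
- by move=> k; apply: (node_act ug hp); rewrite gv_unitVK.
- by move=> k l /(same_point_gv g); rewrite !gv_unitVK //; apply: dist.
- move=> x; rewrite singular_act // => /all [k hk]; exists k.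
  by rewrite -(gv_unitK x ug); apply: same_point_gv.
Qed.

Lemma singularZ c p x : c != 0 -> singular (c *: p) x <-> singular p x.
Proof.
move=> c0; split=> -[nz p0 dp]; split=> //.
- by apply/eqP; move/eqP: p0; rewrite mevalZ mulf_eq0 (negbTE c0).
- by move=> j; apply/eqP; move/eqP: (dp j); rewrite mderivZ mevalZ mulf_eq0 (negbTE c0).
- by rewrite mevalZ p0 mulr0.
- by move=> j; rewrite mderivZ mevalZ dp mulr0.
Qed.

Lemma hessZ c p x : hess (c *: p) x = c *: hess p x.
Proof. by apply/matrixP => i j; rewrite !mxE !mderivZ mevalZ. Qed.

Lemma nodeZ d c p x : c != 0 -> p \is d.-homog -> node p x -> node (c *: p) x.
Proof.
move=> c0 hp; rewrite (nodeP _ hp) (nodeP _ (dhomogZ c hp)) singularZ // => -[sp ker].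
split=> // v; rewrite hessZ -scalemxAl => /(canRL (scalerK c0)).
by rewrite scaler0; apply: ker.
Qed.

Lemma nodes_enumZ d delta c p (q : 'I_delta -> 'I_4 -> K) : c != 0 -> p \is d.-homog ->
  nodes_enum p q -> nodes_enum (c *: p) q.
Proof.
move=> c0 hp [nd dist all]; split; [by move=> k; apply: (nodeZ c0 hp) | exact: dist |].
by move=> x; rewrite singularZ //; apply: all.
Qed.

Lemma singular_same d p x y : p \is d.-homog -> same_point x y -> singular p x -> singular p y.
Proof.
move=> hp xy [nz p0 dp]; split; first exact: nonzero_same nz.
- case: xy => c _ h; have -> : y = (fun i => c * x i) by apply/boolp.funext.
  by rewrite (meval_homog_scale _ _ hp) p0 mulr0.
- move=> j; case: xy => c _ h; have -> : y = (fun i => c * x i) by apply/boolp.funext.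
  by rewrite (meval_homog_scale _ _ (mderiv_homog j hp)) dp mulr0.
Qed.

End LinearSubstitution.

Lemma poly_eq0_on (K : idomainType) (A : K -> Prop) (p : {poly K}) :
  (forall N, exists s : seq K, [/\ uniq s, size s = N & forall t, t \in s -> A t]) ->
  (forall t, A t -> p.[t] = 0) -> p = 0.
Proof.
move=> inf h; have [s [us ss sA]] := inf (size p).
apply: (roots_geq_poly_eq0 _ us); last by rewrite ss.
by apply/allP => t /sA /h /eqP; rewrite rootE.
Qed.

Lemma naturals_infinite (K : numDomainType) N :
  exists s : seq K, [/\ uniq s, size s = N & forall t, t \in s -> True].
Proof.
exists [seq k%:R | k <- iota 0 N]; rewrite size_map size_iota map_inj_uniq ?iota_uniq //.
by move=> k l /eqP; rewrite eqr_nat => /eqP.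
Qed.

Lemma poly_ext (K : numDomainType) (p q : {poly K}) : (forall t, p.[t] = q.[t]) -> p = q.
Proof.
move=> h; apply/eqP; rewrite -subr_eq0; apply/eqP.
by apply: (poly_eq0_on (@naturals_infinite K)) => t _; rewrite hornerD hornerN h subrr.
Qed.

Section PolynomialFunctionsNear.
Variables (R : realType) (I : finType).
Local Notation C := R[i].
Implicit Types (x y : I -> C) (phi psi : (I -> C) -> C).

Definition near y (e : R) x := forall a, cabs (x a - y a) <= e.

Lemma near_inball y e x : near y e x ->
  inball (fun a : 'I_#|I| => x (enum_val a) - y (enum_val a)) e.
Proof. by move=> h a; apply: h. Qed.

Lemma polyfun_nonzero_near phi y : polyfun phi -> phi y != 0 ->
  exists2 e : R, 0 < e & forall x, near y e x -> phi x != 0.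
Proof.
case=> p hp; rewrite hp => py; have [e e0 he] := nonzero_near py.
by exists e => // x hx; rewrite hp; apply: he; apply: near_inball.
Qed.

Lemma polyfun_line phi x z : polyfun phi ->
  exists q : {poly C}, forall t, q.[t] = phi (fun a => x a + t * z a).
Proof.
case=> p hp; have [q [_ hq]] := meval_line (translate (fun a => x (enum_val a)) p) (fun a => z (enum_val a)).
exists q => t; rewrite hq (translate_eval (fun a => x (enum_val a)) p) hp.
by apply: meval_eq => a; rewrite addrC.
Qed.

Lemma inv_naturals_small (b : R) N : 0 < b ->
  exists s : seq C, [/\ uniq s, size s = N & forall t, t \in s -> cabs t <= b].
Proof.
move=> b0; have [M hM] := inv_nat_small b0.
exists [seq (((M + k).+1%:R)^-1 : R)%:C%C | k <- iota 0 N]; rewrite size_map size_iota; split=> //.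
  rewrite map_inj_uniq ?iota_uniq // => k l [] /invr_inj /eqP.
  by rewrite eqr_nat eqSS eqn_add2l => /eqP.
move=> t /mapP [k _ ->]; rewrite cabs_real ger0_norm ?invr_ge0 ?ler0n //.
by apply/ltW/hM; rewrite leq_addr.
Qed.

Section SmoothPoint.
Variables (J : finType) (f : J -> (I -> C) -> C) (y : I -> C) (B : J -> I -> C).
Hypothesis hf : forall j, polyfun (f j).
Hypothesis fy : forall j, f j y = 0.
(** The differential of [f i] along [B j], read off as the linear coefficient on the line through
    [y]. *)
Hypothesis DB : forall i j, exists r : {poly C}, forall t,
  f i (fun a => y a + t * B j a) = t * (i == j)%:R + t ^+ 2 * r.[t].

Definition vanish_nearf phi := exists2 e : R, 0 < e &
  forall x, near y e x -> (forall j, f j x = 0) -> phi x = 0.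

Let F j := projT1 (boolp.cid (hf j)).
Let FP j x : f j x = (F j).@[fun a => x (enum_val a)]. Proof. exact: (projT2 (boolp.cid (hf j))). Qed.
Let f' (i : 'I_#|J|) := F (enum_val i).
Let B' (i : 'I_#|J|) (a : 'I_#|I|) := B (enum_val i) (enum_val a).
Let y' (a : 'I_#|I|) := y (enum_val a).
Let unenum (x : 'I_#|I| -> C) (a : I) := x (enum_rank a).
Let unenumK (x : 'I_#|I| -> C) : (fun a => unenum x (enum_val a)) = x.
Proof. by apply/boolp.funext => a; rewrite /unenum enum_valK. Qed.
Let fE i (x : 'I_#|I| -> C) : (f' i).@[x] = f (enum_val i) (unenum x).
Proof. by rewrite FP unenumK. Qed.

Let fy' i : (f' i).@[y'] = 0. Proof. by rewrite -FP fy. Qed.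

Let DB' i j : \sum_a ((f' i)^`M(a)).@[y'] * B' j a = (i == j)%:R.
Proof.
have [q [q1 qe]] := meval_line (translate y' (f' i)) (B' j).
have [r hr] := DB (enum_val i) (enum_val j).
have qE : q = (enum_val i == enum_val j)%:R *: 'X + 'X^2 * r.
  apply: poly_ext => t; rewrite qe (translate_eval y' (f' i)) hornerD hornerZ hornerM hornerXn hornerX.
  by rewrite mulrC -hr FP; apply: meval_eq => a; rewrite addrC.
have := q1 1%N; rewrite qE coefD coefZ coefX coefXnM /= addr0 mulr1 (inj_eq enum_val_inj) => ->.
rewrite pihomog1E (raddf_sum (meval (B' j))); apply: eq_bigr => a _ /=.
by rewrite mevalZ mevalXU (translate_coefU y' a (f' i)).
Qed.

Lemma implicit_solution_fun : exists S r : R, [/\ 0 <= S, 0 < r &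
  forall (v : I -> C) rho, 0 <= rho <= r -> (forall a, cabs (v a) <= rho) ->
  exists zeta : J -> C, (forall j, cabs (zeta j) <= S * rho) /\
    forall j, f j (fun a => y a + v a + \sum_i zeta i * B i a) = 0].
Proof.
have [S [r [S0 r0 h]]] := implicit_solution_at fy' DB'.
exists S, r; split=> // v rho hr hv.
have [|z [z1 z2]] := h (fun a => v (enum_val a)) rho hr; first by move=> a; apply: hv.
exists (fun j => z (enum_rank j)); split=> // j.
apply: etrans (z2 (enum_rank j)); rewrite fE enum_rankK; congr (f j).
apply/boolp.funext => a; rewrite /unenum /y' enum_rankK; congr (_ + _).
rewrite [RHS](reindex enum_rank) /=; last by exists enum_val => i _; rewrite ?enum_valK ?enum_rankK.
by apply: eq_bigr => i _; rewrite /B' !enum_rankK.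
Qed.

Theorem smooth_point_fun : exists (P : ((I -> C) -> C) -> Prop) (s : (I -> C) -> C),
  [/\ polyfun s /\ s y != 0,
      forall phi x, P phi -> (forall j, f j x = 0) -> s x != 0 -> phi x = 0,
      forall phi, polyfun phi -> vanish_nearf phi -> P phi
    & forall phi psi, polyfun phi -> polyfun psi -> P (fun x => phi x * psi x) -> P phi \/ P psi].
Proof.
have [P [s [s0 P1 P2 P3]]] := smooth_point fy' DB'.
pose ev (p : {mpoly C[#|I|]}) (x : I -> C) := p.@[fun a => x (enum_val a)].
have evinj p q : (forall x, ev p x = ev q x) -> p = q.
  by move=> h; apply: mpoly_ext => v; have := h (unenum v); rewrite /ev unenumK.
exists (fun phi => exists2 p, P p & forall x, phi x = ev p x), (ev s); split.
- by split=> //; exists s.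
- move=> phi x [p Pp ->] zx sx; apply: P1 => // j; rewrite fE.
  have -> : unenum (fun a => x (enum_val a)) = x; last exact: zx.
  by apply/boolp.funext => a; rewrite /unenum enum_rankK.
- move=> phi [p hp] [e e0 he]; exists p => //; apply: P2; exists e => // x hx zx.
  have := hp (unenum x); rewrite unenumK => <-; apply: he.
    by move=> a; have := hx (enum_rank a); rewrite /y' enum_rankK.
  by move=> j; have := zx (enum_rank j); rewrite fE enum_rankK.
- move=> phi psi [p hp] [q hq] [pq Ppq hpq].
  have epq : pq = p * q by apply: evinj => x; rewrite -hpq hp hq /ev mevalM.
  by move: Ppq; rewrite epq => /P3 [h|h]; [left; exists p | right; exists q].
Qed.

End SmoothPoint.
End PolynomialFunctionsNear.

(** * The Jacobian ideal of a nodal surface *)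

Section SeparatingForms.
Variable K : numClosedFieldType.
Implicit Types (x y p q v : 'I_4 -> K) (F G H : {mpoly K[4]}).

Definition linform x : {mpoly K[4]} := \sum_j x j *: 'X_j.

Lemma linform_eval x v : (linform x).@[v] = \sum_j x j * v j.
Proof.
by rewrite /linform (raddf_sum (meval v)); apply: eq_bigr => j _ /=; rewrite mevalZ mevalXU.
Qed.

Lemma linform_homog x : linform x \is 1.-homog.
Proof. by apply: rpred_sum => j _; apply: rpredZ; rewrite dhomogX /= mdeg1. Qed.

Lemma linform_deriv x j : (linform x)^`M(j) = (x j)%:MP.
Proof.
rewrite /linform (raddf_sum (mderiv j)) (bigD1 j) //= big1 => [|k kj]; rewrite mderivZ mderivX mnm1E.
  have -> : (U_(j) - U_(j) = 0)%MM by apply/mnmP => a; rewrite mnmBE mnm0E subnn.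
  by rewrite eqxx scale1r mpolyX0 addr0 -mul_mpolyC mulr1.
by rewrite (negbTE kj) scale0r scaler0.
Qed.

Lemma separating_linform p q : nonzero q -> (forall c, exists i, p i != c * q i) ->
  exists x, \sum_j x j * q j = 0 /\ \sum_j x j * p j != 0.
Proof.
move=> [j qj] np; have [s ps] := np (p j / q j).
(* The form [q_j X_s - q_s X_j] vanishes at [q]; at [p] it is nonzero because [s] was chosen against
   the ratio [p_j / q_j]. *)
exists (fun a => q j * (a == s)%:R - q s * (a == j)%:R).
have H v : \sum_a (q j * (a == s)%:R - q s * (a == j)%:R) * v a = q j * v s - q s * v j.
  have -> : \sum_a (q j * (a == s)%:R - q s * (a == j)%:R) * v a =
      \sum_a q j * (a == s)%:R * v a - \sum_a q s * (a == j)%:R * v a.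
    by rewrite -sumrB; apply: eq_bigr => a _; rewrite mulrBl.
  have D c b : \sum_(a < 4) c * (a == b)%:R * v a = c * v b.
    rewrite (bigD1 b) //= big1 => [|a ab]; first by rewrite eqxx mulr1 addr0.
    by rewrite (negbTE ab) mulr0 mul0r.
  by rewrite !D.
rewrite !H; split; first by rewrite mulrC subrr.
apply: contraNneq ps => /eqP; rewrite subr_eq0 => /eqP e.
by rewrite -[p s](mulKf qj) e; apply/eqP; field.
Qed.

Lemma not_same_point p q : nonzero p -> ~ same_point q p -> forall c, exists i, p i != c * q i.
Proof.
move=> [i pi] ns c; apply: boolp.contrapT => no; apply: ns; exists c.
  apply/eqP => c0; case/eqP: pi; apply/eqP/negPn/negP => h.
  by apply: no; exists i; rewrite c0 mul0r.
by move=> k; apply/eqP/negPn/negP => h; apply: no; exists k.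
Qed.

Lemma homog_prod d (f : 'I_d -> {mpoly K[4]}) : (forall l, f l \is 1.-homog) ->
  \prod_l f l \is d.-homog.
Proof.
elim: d f => [|d IH] f hf; first by rewrite big_ord0 dhomog1.
rewrite big_ord_recl; apply: (@dhomogM_eq _ _ 1 d) => //; exact: IH.
Qed.

Lemma homogX_exp e d F : F \is e.-homog -> F ^+ d \is (d * e).-homog.
Proof. by move=> hF; rewrite mulnC; apply: dhomogMn. Qed.

(** A product of planes, one through each [q l] and missing [p], brought to degree [k] by a power of
    a coordinate nonzero at [p]. *)
Lemma separating_form delta (P : pred 'I_delta) (q : 'I_delta -> 'I_4 -> K) p k : (delta <= k)%N ->
  nonzero p -> (forall l, P l -> nonzero (q l) /\ ~ same_point (q l) p) ->
  exists H, [/\ H \is k.-homog, H.@[p] != 0 & forall l, P l -> H.@[q l] = 0].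
Proof.
move=> dk nzp hq; have [i pi] := nzp.
have ex l : exists x, \sum_j x j * p j != 0 /\ (P l -> \sum_j x j * q l j = 0).
  case: (boolP (P l)) => Pl; last first.
    exists (fun j => (j == i)%:R); split => //; rewrite (bigD1 i) //= big1 => [|j ji].
      by rewrite eqxx mul1r addr0.
    by rewrite (negbTE ji) mul0r.
  have [nzq ns] := hq l Pl; have [x [x1 x2]] := separating_linform nzq (not_same_point nzp ns).
  by exists x.
have [x xP] := boolp.choice ex.
exists (\prod_l linform (x l) * 'X_i ^+ (k - delta)); split.
- apply: (@dhomogM_eq _ _ delta (k - delta)); last by rewrite subnKC.
    by apply: homog_prod => l; apply: linform_homog.
  by rewrite -[X in X.-homog]muln1; apply: homogX_exp; rewrite dhomogX /= mdeg1.
- rewrite mevalM rmorphXn /= mevalXU mulf_neq0 ?expf_neq0 // (rmorph_prod (meval p)).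
  by apply/prodf_neq0 => l _; rewrite /= linform_eval; have [] := xP l.
- move=> l Pl; rewrite mevalM (rmorph_prod (meval (q l))) (bigD1 l) //= linform_eval.
  by have [_ ->] := xP l; rewrite ?mul0r.
Qed.

(** A plane through [q l0] that does not contain [v], times a form vanishing at the other points
    only: at [q l0] just the derivative of the linear factor survives. *)
Lemma separating_tangent delta (q : 'I_delta -> 'I_4 -> K) l0 v k : (delta < k)%N ->
  (forall l, nonzero (q l)) -> (forall l, same_point (q l) (q l0) -> l = l0) ->
  (forall c, exists i, v i != c * q l0 i) ->
  exists H, [/\ H \is k.-homog, forall l, H.@[q l] = 0 & \sum_j v j * (H^`M(j)).@[q l0] != 0].
Proof.
move=> dk nzq dist nv.
have [||H [hH H0 Hl]] := @separating_form delta (predC1 l0) q (q l0) k.-1 _ (nzq l0).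
- by lia.
- by move=> l /= ll0; split=> // /dist e; rewrite e eqxx in ll0.
have [x [x1 x2]] := separating_linform (nzq l0) nv.
exists (linform x * H); split.
- by apply: (@dhomogM_eq _ _ 1 k.-1) => //; [exact: linform_homog | lia].
- move=> l; rewrite mevalM linform_eval; case: (eqVneq l l0) => [->|ll0]; first by rewrite x1 mul0r.
  by rewrite (Hl l) // mulr0.
have -> : \sum_j v j * ((linform x * H)^`M(j)).@[q l0] = (\sum_j x j * v j) * H.@[q l0].
  rewrite mulr_suml; apply: eq_bigr => j _.
  by rewrite mderivM mevalD !mevalM linform_deriv mevalC linform_eval x1; ring.
by rewrite mulf_neq0.
Qed.

(** The coefficients run along the moment curve [(1, tau, tau^2, tau^3)]: each point excludes only
    the roots of a nonzero polynomial in [tau]. *)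
Lemma avoiding_linform (J : finType) (q : J -> 'I_4 -> K) : (forall l, nonzero (q l)) ->
  exists tau : K, forall l, \sum_(i < 4) tau ^+ i * q l i != 0.
Proof.
move=> nzq; pose P l : {poly K} := \poly_(i < 4) q l (inord i).
have P0 l : P l != 0.
  have [i qi] := nzq l; apply: contraNneq qi => /(congr1 (fun p : {poly K} => p`_i)).
  by rewrite coef_poly ltn_ord inord_val coef0 => ->.
have [[t ht]|no] := boolp.EM (exists t, (\prod_l P l).[t] != 0).
  exists t => l; move: ht; rewrite horner_prod => /prodf_neq0 /(_ l isT).
  rewrite horner_poly; congr (_ != 0); apply: eq_bigr => i _.
  by rewrite inord_val mulrC.
have /eqP : \prod_l P l = 0.
  by apply: poly_ext => t; rewrite horner0; apply/eqP/negPn/negP => h; apply: no; exists t.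
by have /prodf_neq0 /negbTE -> : forall l, true -> P l != 0 by move=> l _; apply: P0.
Qed.

End SeparatingForms.

Section HomogeneousProducts.
Variables (K : comNzRingType) (n : nat).
Implicit Types p q G : {mpoly K[n]}.

Lemma mpoly_pihomog_sum p : exists N, p = \sum_(d < N) pihomog mdeg d p.
Proof. by exists (mmeasure mdeg p); apply: pihomog_partitionE. Qed.

Lemma pihomog_mulr_homog e k p G : G \is e.-homog ->
  pihomog mdeg k (p * G) = if (e <= k)%N then pihomog mdeg (k - e) p * G else 0.
Proof.
move=> hG; have [N hN] := mpoly_pihomog_sum p.
have hj j : pihomog mdeg k (pihomog mdeg j p * G) =
    if (j + e)%N == k then pihomog mdeg j p * G else 0.
  have hjG : pihomog mdeg j p * G \is (j + e).-homog by apply: dhomogM => //; apply: pihomogP.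
  case: eqP => [<-|/eqP ne]; first by rewrite pihomog_dE.
  apply/mpolyP => m; rewrite mcoeff_pihomog mcoeff0; case: eqP => // mk.
  by rewrite (dhomog_nemf_coeff hjG) //= mk eq_sym.
rewrite {1}hN mulr_suml (raddf_sum (pihomog mdeg k)) /=.
case: leqP => ek; last first.
  by rewrite big1 // => j _; rewrite hj; case: eqP => // e2; lia.
case: (ltnP (k - e) N) => kN.
  rewrite (bigD1 (Ordinal kN)) //= big1 => [|j jne]; rewrite hj.
    by rewrite subnK // eqxx addr0.
  case: eqP => // e2; case/eqP: jne; apply: val_inj => /=; lia.
rewrite big1 => [|j _]; last by rewrite hj; case: eqP => // e2; have := ltn_ord j; lia.
suff -> : pihomog mdeg (k - e) p = 0 by rewrite mul0r.
apply/mpolyP => m; rewrite {1}hN mcoeff_pihomog mcoeff0; case: eqP => // mk.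
rewrite (raddf_sum (mcoeff m)) big1 // => j _; rewrite /= mcoeff_pihomog mk.
by case: eqP => // e2; have := ltn_ord j; lia.
Qed.

Lemma comp_sub_ideal l (t u : n.-tuple {mpoly K[l]}) p :
  exists A : 'I_n -> {mpoly K[l]}, (p \mPo t) - (p \mPo u) = \sum_s A s * (tnth t s - tnth u s).
Proof.
elim/mpoly_alg_ind: p => [c|i|p q [A hA] [B hB]|p q [A hA] [B hB]].
- by exists (fun=> 0); rewrite !comp_mpolyC subrr big1 // => s _; rewrite mul0r.
- exists (fun s => (s == i)%:R); rewrite !comp_mpolyXU -!tnth_nth (bigD1 i) //= big1.
    by rewrite eqxx mul1r addr0.
  by move=> s /negbTE ->; rewrite mul0r.
- exists (fun s => A s + B s); rewrite !comp_mpolyD opprD addrACA hA hB -big_split.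
  by apply: eq_bigr => s _ /=; rewrite mulrDl.
- exists (fun s => A s * (q \mPo t) + (p \mPo u) * B s).
  have -> : ((p * q) \mPo t) - ((p * q) \mPo u) =
      ((p \mPo t) - (p \mPo u)) * (q \mPo t) + (p \mPo u) * ((q \mPo t) - (q \mPo u)).
    by rewrite !rmorphM /= mulrBl mulrBr addrA subrK.
  rewrite hA hB mulr_suml mulr_sumr -big_split; apply: eq_bigr => s _ /=.
  by rewrite mulrDl !mulrA -[A s * _ * _]mulrA [_ * (q \mPo t)]mulrC mulrA.
Qed.

End HomogeneousProducts.

(** Evaluate [H] on the vectors [q_i X] and [X_i q]. By homogeneity and [H(q) = 0] the difference is
    [q_i^e H], and it lies in the ideal of the differences of coordinates. *)
Lemma homog_point_ideal (K : numClosedFieldType) n e (H : {mpoly K[n]}) (q : 'I_n -> K) i :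
  H \is e.-homog -> H.@[q] = 0 -> q i != 0 ->
  exists A : 'I_n -> {mpoly K[n]}, H = \sum_s A s * (q i *: 'X_s - q s *: 'X_i).
Proof.
move=> hH Hq qi.
have [A hA] := comp_sub_ideal [tuple q i *: 'X_s | s < n] [tuple q s *: 'X_i | s < n] H.
exists (fun s => (q i) ^- e *: A s).
have -> : \sum_s ((q i) ^- e *: A s) * (q i *: 'X_s - q s *: 'X_i) =
    (q i) ^- e *: \sum_s A s * (q i *: 'X_s - q s *: 'X_i).
  by rewrite scaler_sumr; apply: eq_bigr => s _; rewrite scalerAl.
have -> : \sum_s A s * (q i *: 'X_s - q s *: 'X_i) = (q i) ^+ e *: H.
  have -> : \sum_s A s * (q i *: 'X_s - q s *: 'X_i) =
      (H \mPo [tuple q i *: 'X_s | s < n]) - (H \mPo [tuple q s *: 'X_i | s < n]).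
    by rewrite hA; apply: eq_bigr => s _; rewrite !tnth_mktuple.
  apply: mpoly_ext => v; rewrite mevalB !comp_mpoly_meval mevalZ.
  have -> : H.@[fun s => (tnth [tuple q i *: 'X_s | s < n] s).@[v]] = q i ^+ e * H.@[v].
    rewrite -(meval_homog_scale _ _ hH); apply: meval_eq => s.
    by rewrite tnth_mktuple mevalZ mevalXU.
  have -> : H.@[fun s => (tnth [tuple q s *: 'X_i | s < n] s).@[v]] = v i ^+ e * H.@[q].
    rewrite -(meval_homog_scale _ _ hH); apply: meval_eq => s.
    by rewrite tnth_mktuple mevalZ mevalXU mulrC.
  by rewrite Hq mulr0 subr0.
by rewrite scalerA mulVf ?scale1r // expf_neq0.
Qed.

Section JacobianIdeal.
Variable R : realType.
Local Notation C := R[i].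
Implicit Types (F G H : {mpoly C[4]}) (q : 'I_4 -> C).

Definition jac F G := exists b : 'I_4 -> {mpoly C[4]}, G = \sum_j b j * F^`M(j).

Lemma jac_ideal F : ideal (jac F).
Proof.
split.
- by exists (fun=> 0); rewrite big1 // => j _; rewrite mul0r.
- move=> a b [u ->] [v ->]; exists (fun j => u j + v j).
  by rewrite -big_split; apply: eq_bigr => j _; rewrite mulrDl.
- move=> c a [u ->]; exists (fun j => c * u j).
  by rewrite mulr_sumr; apply: eq_bigr => j _; rewrite mulrA.
Qed.

Lemma jac_deriv F j : jac F F^`M(j).
Proof.
exists (fun i => (i == j)%:R); rewrite (bigD1 j) //= big1 => [|i /negbTE ->]; last by rewrite mul0r.
by rewrite eqxx mul1r addr0.
Qed.

Lemma jac_homog d k F G : F \is d.-homog -> G \is k.-homog -> jac F G ->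
  exists b : 'I_4 -> {mpoly C[4]}, (forall j, b j \is (k - d.-1).-homog) /\ 
    G = \sum_j b j * F^`M(j).
Proof.
move=> hF hG [b hb]; exists (fun j => if (d.-1 <= k)%N then pihomog mdeg (k - d.-1) (b j) else 0).
split; first by move=> j; case: ifP => _; rewrite ?pihomogP ?dhomog0.
rewrite -{1}(pihomog_dE hG) hb (raddf_sum (pihomog mdeg k)); apply: eq_bigr => j _ /=.
by rewrite (pihomog_mulr_homog _ _ (mderiv_homog j hF)); case: ifP => // _; rewrite mul0r.
Qed.

Lemma jac_pihomog d k F G : F \is d.-homog -> jac F G -> jac F (pihomog mdeg k G).
Proof.
move=> hF [b ->]; rewrite (raddf_sum (pihomog mdeg k)).
exists (fun j => if (d.-1 <= k)%N then pihomog mdeg (k - d.-1) (b j) else 0); apply: eq_bigr => j _ /=.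
by rewrite (pihomog_mulr_homog _ _ (mderiv_homog j hF)); case: ifP => // _; rewrite mul0r.
Qed.

Lemma node_same d F (x y : 'I_4 -> C) : F \is d.-homog -> same_point x y -> node F x -> node F y.
Proof.
move=> hF xy; rewrite !(nodeP _ hF) => -[sx ker]; split; first exact: (singular_same hF xy sx).
case: xy => c c0 hc; have yE : y = (fun i => c * x i) by apply/boolp.funext.
have hE : hess F y = c ^+ d.-1.-1 *: hess F x.
  apply/matrixP => i j; rewrite !mxE yE.
  by rewrite (meval_homog_scale _ _ (mderiv_homog j (mderiv_homog i hF))).
move=> v; rewrite hE -scalemxAl => /(canRL (scalerK (expf_neq0 _ c0))); rewrite scaler0 => /ker [e ->].
by exists (e / c); apply/colP => i; rewrite !mxE yE; field.
Qed.

(** In the local ring of a node the partial derivatives generate the ideal of the point. They are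
    combinations, with coefficients [A], of the minors [q_i X_s - q_s X_i]; nondegeneracy of the
    Hessian makes [A] of maximal rank at [q], and Cramer's rule solves for the minors up to a
    determinant equal to 1 at [q]. *)
Lemma node_local_ideal d F q : F \is d.-homog -> node F q ->
  exists2 D : {mpoly C[4]}, D.@[q] = 1 &
    forall e H, H \is e.-homog -> H.@[q] = 0 -> jac F (D * H).
Proof.
move=> hF /(nodeP _ hF) [[[i qi] F0 F1] ker].
have exA j : exists A : 'I_4 -> {mpoly C[4]}, F^`M(j) = \sum_s A s * (q i *: 'X_s - q s *: 'X_i).
  exact: homog_point_ideal (mderiv_homog j hF) (F1 j) qi.
have [A hA] := boolp.choice exA.
pose Aq : 'M[C]_4 := \matrix_(j, s) (A j s).@[q].
have hessE j t : hess F q j t = q i * Aq j t - (t == i)%:R * \sum_s Aq j s * q s.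
  rewrite mxE hA (raddf_sum (mderiv t)) (raddf_sum (meval q)).
  have -> : \sum_s ((A j s * (q i *: 'X_s - q s *: 'X_i))^`M(t)).@[q] =
      \sum_s ((s == t)%:R * (q i * Aq j s) - (t == i)%:R * (Aq j s * q s)).
    apply: eq_bigr => s _; rewrite mderivM mderivB !mderivZ mevalD !mevalM !mevalB !mevalZ !mevalXU !mxE.
    rewrite !mderivX !mnm1E !mevalZ.
    have U a b : ((a == b)%:R : C) * ('X_[U_(a) - U_(b)] : {mpoly C[4]}).@[q] = (a == b)%:R.
      case: eqP => [->|_]; last by rewrite mul0r.
      have -> : (U_(b) - U_(b) = 0)%MM by apply/mnmP => a'; rewrite mnmBE mnm0E subnn.
      by rewrite mpolyX0 meval1 mulr1.
    by rewrite !U (eq_sym i t); ring.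
  rewrite sumrB mulr_sumr; congr (_ - _); rewrite (bigD1 t) //= big1 => [|s st].
    by rewrite eqxx mul1r addr0.
  by rewrite (negbTE st) mul0r.
(* The minor with [s = i] is zero, so column [i] of [A] is arbitrary; the extra row pins it down and
   makes the columns independent. *)
pose N : 'M[C]_(4 + 1, 4) := col_mx Aq (delta_mx 0 i).
have fullN : row_full N.
  rewrite -cokermx_eq0; apply/eqP; apply/matrixP => a b; rewrite [RHS]mxE.
  pose v := col b (cokermx N).
  have Nv : N *m v = 0 by rewrite /v colE mulmxA mulmx_coker mul0mx.
  move: Nv; rewrite mul_col_mx => /eqP; rewrite col_mx_eq0 => /andP [/eqP Av /eqP dv].
  have vi : v i 0 = 0 by have /colP /(_ 0) := dv; rewrite -rowE !mxE.
  have Avj j : \sum_s Aq j s * v s 0 = 0 by have /colP /(_ j) := Av; rewrite !mxE.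
  have [|c vc] := ker v.
    apply/colP => j; rewrite mxE [RHS]mxE.
    have -> : \sum_t hess F q j t * v t 0 =
        \sum_t (q i * (Aq j t * v t 0) - (t == i)%:R * (v t 0 * \sum_s Aq j s * q s)).
      by apply: eq_bigr => t _; rewrite hessE; ring.
    rewrite sumrB -mulr_sumr Avj mulr0 sub0r (bigD1 i) //= vi mul0r mulr0 add0r.
    by rewrite big1 ?oppr0 // => t /negbTE ->; rewrite mul0r.
  have c0 : c = 0 by have /eqP := vi; rewrite vc !mxE mulf_eq0 (negbTE qi) orbF => /eqP.
  by have /colP /(_ a) := vc; rewrite c0 scale0r /v !mxE.
have [B BN] : exists B : 'M_(4, 4 + 1), B *m N = 1%:M by exists (pinvmx N); apply: mulVpmx.
pose M : 'M[{mpoly C[4]}]_4 := \matrix_(t, s) (\sum_j (lsubmx B t j) *: A j s + (rsubmx B t 0 * (s == i)%:R)%:MP).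
have Mq : map_mx (meval q) M = 1%:M.
  rewrite -BN -[B]hsubmxK mul_row_col; apply/matrixP => t s; rewrite !mxE.
  rewrite mevalD mevalC (raddf_sum (meval q)) /=; congr (_ + _).
    by apply: eq_bigr => j _; rewrite !mxE mevalZ.
  by rewrite big_ord1 !mxE eqxx.
have Ml t : jac F (\sum_s M t s * (q i *: 'X_s - q s *: 'X_i)).
  have -> : \sum_s M t s * (q i *: 'X_s - q s *: 'X_i) = \sum_j (lsubmx B t j) *: F^`M(j).
    have -> : \sum_s M t s * (q i *: 'X_s - q s *: 'X_i) =
      \sum_s \sum_j (lsubmx B t j) *: (A j s * (q i *: 'X_s - q s *: 'X_i)).
      apply: eq_bigr => s _; rewrite mxE mulrDl mulr_suml.
      have -> : (rsubmx B t 0 * (s == i)%:R)%:MP * (q i *: 'X_s - q s *: 'X_i) = 0 :> {mpoly C[4]}.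
        by case: eqP => [->|_]; rewrite ?subrr ?mulr0 // mpolyC0 mul0r.
      by rewrite addr0; apply: eq_bigr => j _; rewrite scalerAl.
    rewrite exchange_big /=; apply: eq_bigr => j _; rewrite -scaler_sumr; congr (_ *: _).
    by rewrite hA.
  by exists (fun j => (lsubmx B t j)%:MP); apply: eq_bigr => j _; rewrite mul_mpolyC.
exists (\det M).
  have -> : (\det M).@[q] = \det (map_mx (meval q) M) by rewrite det_map_mx.
  by rewrite Mq det1.
move=> e H hH Hq; have [A' ->] := homog_point_ideal hH Hq qi.
have iJ := jac_ideal F; have [_ _ JM] := iJ.
rewrite mulr_sumr; apply: ideal_sum => // s _.
rewrite mulrCA; apply: (JM).
have -> : \det M * (q i *: 'X_s - q s *: 'X_i) =
    \sum_t (\adj M) s t * \sum_s' M t s' * (q i *: 'X_s' - q s' *: 'X_i).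
  have /(congr1 (fun Q : 'M_4 => \sum_s' Q s s' * (q i *: 'X_s' - q s' *: 'X_i))) := mul_adj_mx M.
  rewrite /= [RHS](bigD1 s) //= [X in _ = _ + X]big1 => [|s' ne]; last first.
    by rewrite mxE eq_sym (negbTE ne) mulr0n mul0r.
  rewrite addr0 [(\det M)%:M s s]mxE eqxx mulr1n => <-.
  have -> : \sum_s' (\adj M *m M) s s' * (q i *: 'X_s' - q s' *: 'X_i) =
      \sum_s' \sum_t (\adj M) s t * (M t s' * (q i *: 'X_s' - q s' *: 'X_i)).
    by apply: eq_bigr => s' _; rewrite mxE mulr_suml; apply: eq_bigr => t _; rewrite mulrA.
  by rewrite exchange_big /=; apply: eq_bigr => t _; rewrite mulr_sumr.
by apply: ideal_sum => // t _; apply: JM.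
Qed.

(** The multipliers [A] that carry all forms through the nodes into the Jacobian ideal have no
    common zero: a partial derivative of [F] does the job away from the nodes, [node_local_ideal] at
    a node. Hence [A] contains all monomials of large degree, and the ideal of the nodes has
    generators of bounded degree. *)
Theorem jac_saturation d delta F (q : 'I_delta -> 'I_4 -> C) : (0 < d)%N -> F \is d.-homog ->
  nodes_enum F q -> exists k0, forall k H, (k0 <= k)%N -> H \is k.-homog ->
  (forall l, H.@[q l] = 0) -> jac F H.
Proof.
move=> d0 hF [nd _ all]; have iJ := jac_ideal F; have [J0 JD JM] := iJ.
pose A a := forall e H, H \is e.-homog -> (forall l, H.@[q l] = 0) -> jac F (a * H).
have iA : ideal A.
  split; first by move=> e H _ _; rewrite mul0r.
    by move=> a b ha hb e H h1 h2; rewrite mulrDl; apply: JD; [apply: ha h1 h2 | apply: hb h1 h2].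
  by move=> c a ha e H h1 h2; rewrite -mulrA; apply/JM/(ha _ _ h1 h2).
have [||k1 hk1] := @homogeneous_nullstellensatz C 4 A (@complex_levels_escape R) iA.
- move=> a k ha e H h1 h2; have := jac_pihomog (k + e) hF (ha e H h1 h2).
  by rewrite (pihomog_mulr_homog _ _ h1) leq_addl addnK.
- move=> x hx i; apply/eqP/negPn/negP => xi.
  have dF j : (F^`M(j)).@[x] = 0.
    by apply: hx => e H _ _; rewrite mulrC; apply/JM/jac_deriv.
  have sx : singular F x.
    apply: (singular_euler hF xi) => //; apply/eqP.
    have /eqP := euler x hF; rewrite big1 => [|j _]; last by rewrite dF mulr0.
    by rewrite eq_sym mulf_eq0 pnatr_eq0 -leqn0 leqNgt d0.
  have [l hl] := all x sx; have nx := node_same hF hl (nd l).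
  have [D D1 hD] := node_local_ideal hF nx.
  suff AD : A D by have /eqP := hx D AD; rewrite D1 oner_eq0.
  move=> e H h1 h2; apply: (hD _ _ h1); case: hl => c _ hc.
  have -> : x = (fun i => c * q l i) by apply/boolp.funext.
  by rewrite (meval_homog_scale _ _ h1) h2 mulr0.
pose I p := forall l c, p.@[fun i => c * q l i] = 0 :> C.
have iI : ideal I.
  split; first by move=> l c; rewrite meval0.
    by move=> a b ha hb l c; rewrite mevalD ha hb addr0.
  by move=> a b hb l c; rewrite mevalM hb mulr0.
have Ihom p k l : I p -> (pihomog mdeg k p).@[q l] = 0.
  move=> hp; have [Q [Q1 Q2]] := meval_line p (q l).
  have -> : (pihomog mdeg k p).@[q l] = Q`_k by rewrite Q1.
  have -> : Q = 0 by apply: poly_ext => t; rewrite Q2 hp horner0.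
  by rewrite coef0.
have [s [sI sgen]] := hilbert_basis iI.
pose D := (\max_(i < size s) mmeasure mdeg s`_i)%N.
exists (k1 + D)%N => k H kk hH Hq.
have [|c Hc] := sgen H; first by move=> l t; rewrite (meval_homog_scale _ _ hH) Hq mulr0.
rewrite -(pihomog_dE hH) Hc (raddf_sum (pihomog mdeg k)); apply: ideal_sum => // i _ /=.
have -> : c i * s`_i = \sum_(j < D) c i * pihomog mdeg j s`_i.
  by rewrite -mulr_sumr -pihomog_partitionE // /D (bigD1 i) //= leq_maxl.
rewrite (raddf_sum (pihomog mdeg k)); apply: ideal_sum => // j _ /=.
rewrite (pihomog_mulr_homog _ _ (pihomogP _ _ _)); case: ifP => // _.
have : A (pihomog mdeg (k - j) (c i)).
  rewrite [pihomog _ _ _]mpolyE big_seq; apply: ideal_sum => // m ms.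
  rewrite -mul_mpolyC; have [_ _ AM] := iA; apply/AM/hk1.
  have := dhomog_mf (pihomogP mdeg (k - j) (c i)) ms; rewrite /= => ->.
  by have := ltn_ord j; lia.
by apply; [exact: pihomogP | move=> l; apply: Ihom; apply: sI; rewrite mem_nth].
Qed.

End JacobianIdeal.

(** * Forms as vectors of coefficients *)

Section Forms.
Variable K : numClosedFieldType.

Definition mval d (mu : monom d) : 'X_{1..4} := val (val mu).

Lemma mdeg_mval d (mu : monom d) : mdeg (mval mu) = d.
Proof. by apply/eqP; case: mu => m /=. Qed.

Lemma mval_inj d : injective (@mval d).
Proof. by move=> a b h; apply: val_inj; apply: val_inj. Qed.

Lemma mval_onto d (m : 'X_{1..4}) : mdeg m = d -> exists mu : monom d, mval mu = m.
Proof.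
move=> md; have lt : (mdeg m < d.+1)%N by rewrite md.
have ok : mdeg (BMultinom lt) == d by apply/eqP.
by exists (exist (fun m : 'X_{1..4 < d.+1} => mdeg m == d) (BMultinom lt) ok).
Qed.

Definition pform d (x : monom d -> K) : {mpoly K[4]} := \sum_mu x mu *: 'X_[mval mu].

Lemma pform_homog d (x : monom d -> K) : pform x \is d.-homog.
Proof. by apply: rpred_sum => mu _; apply: rpredZ; rewrite dhomogX /= mdeg_mval. Qed.

Lemma mcoeff_pform d (x : monom d -> K) mu : (pform x)@_(mval mu) = x mu.
Proof.
rewrite /pform (raddf_sum (mcoeff (mval mu))) /= (bigD1 mu) //= big1 => [|nu ne].
  by rewrite mcoeffZ mcoeffX eqxx mulr1 addr0.
by rewrite mcoeffZ mcoeffX (inj_eq (@mval_inj d)) (negbTE ne) mulr0.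
Qed.

Definition fcoef d (F : {mpoly K[4]}) : monom d -> K := fun mu => F@_(mval mu).

Lemma pformK d F : F \is d.-homog -> pform (@fcoef d F) = F.
Proof.
move=> hF; apply/mpolyP => m; case: (eqVneq (mdeg m) d) => [md|md].
  by have [mu <-] := mval_onto md; rewrite mcoeff_pform.
by rewrite (dhomog_nemf_coeff (pform_homog _)) ?(dhomog_nemf_coeff hF).
Qed.

Lemma fcoefK d (x : monom d -> K) : fcoef (pform x) = x.
Proof. by apply/boolp.funext => mu; apply: mcoeff_pform. Qed.

Lemma pform_eval d (x : monom d -> K) v : (pform x).@[v] = \sum_mu x mu * ('X_[mval mu]).@[v].
Proof. by rewrite (raddf_sum (meval v)); apply: eq_bigr => mu _ /=; rewrite mevalZ. Qed.

Lemma pform_deriv_eval d (x : monom d -> K) j v :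
  ((pform x)^`M(j)).@[v] = \sum_mu x mu * (('X_[mval mu])^`M(j)).@[v].
Proof.
rewrite (raddf_sum (mderiv j)) (raddf_sum (meval v)); apply: eq_bigr => mu _ /=.
by rewrite mderivZ mevalZ.
Qed.

Lemma polyfun_pform (I : finType) d (x : monom d -> (I -> K) -> K) (v : 'I_4 -> (I -> K) -> K) :
  (forall mu, polyfun (x mu)) -> (forall i, polyfun (v i)) ->
  polyfun (fun z => (pform (fun mu => x mu z)).@[fun i => v i z]).
Proof.
move=> hx hv; apply: (@polyfun_ext _ _ (fun z => \sum_mu x mu z * ('X_[mval mu]).@[fun i => v i z])).
  by move=> z; rewrite pform_eval.
by apply: polyfun_sum => mu _; apply: polyfunM => //; apply: polyfun_meval.
Qed.

Lemma polyfun_pform_deriv (I : finType) d (x : monom d -> (I -> K) -> K) j (v : 'I_4 -> (I -> K) -> K) :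
  (forall mu, polyfun (x mu)) -> (forall i, polyfun (v i)) ->
  polyfun (fun z => ((pform (fun mu => x mu z))^`M(j)).@[fun i => v i z]).
Proof.
move=> hx hv; apply: (@polyfun_ext _ _ (fun z => \sum_mu x mu z * (('X_[mval mu])^`M(j)).@[fun i => v i z])).
  by move=> z; rewrite pform_deriv_eval.
by apply: polyfun_sum => mu _; apply: polyfunM => //; apply: polyfun_meval.
Qed.

End Forms.

Lemma meval_derivM0 (K : comNzRingType) n (p G : {mpoly K[n]}) x j :
  G.@[x] = 0 -> ((p * G)^`M(j)).@[x] = p.@[x] * (G^`M(j)).@[x].
Proof. by move=> G0; rewrite mderivM mevalD !mevalM G0 mulr0 add0r. Qed.

(** * Openness of nodality among surfaces keeping their singular points *)

Section Openness.
Variable R : realType.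
Local Notation C := R[i].

Definition distinct_points delta (q : 'I_delta -> 'I_4 -> C) :=
  forall k l, same_point (q k) (q l) -> k = l.

Definition value_det delta (H : 'I_delta -> {mpoly C[4]}) (q : 'I_delta -> 'I_4 -> C) :=
  \det (\matrix_(k, l) (H k).@[q l]).

(* Modulo the Jacobian ideal the forms of degree k have dimension at most      *)
(* delta; as delta distinct singular points impose delta conditions on them,   *)
(* the Jacobian ideal contains every form of degree k vanishing there.         *)
Lemma nodes_enum_of_spanning d delta k F (E : 'I_delta -> {mpoly C[4]}) (q : 'I_delta -> 'I_4 -> C) :
  (delta < k)%N -> F \is d.-homog ->
  (forall G, G \is k.-homog -> exists (b : 'I_4 -> {mpoly C[4]}) (c : 'I_delta -> C),
     G = \sum_j b j * F^`M(j) + \sum_i c i *: E i) ->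
  (forall l, singular F (q l)) -> distinct_points q ->
  nodes_enum F q /\ value_det E q != 0.
Proof.
move=> dk hF span sing dist.
have nzq l : nonzero (q l) by have [] := sing l.
have val (b : 'I_4 -> {mpoly C[4]}) (c : 'I_delta -> C) l : (\sum_j b j * F^`M(j) + \sum_i c i *: E i).@[q l] =
    \sum_i c i * (E i).@[q l].
  rewrite mevalD !(raddf_sum (meval (q l))) big1 => [|j _]; last first.
    by rewrite /= mevalM; have [_ _ ->] := sing l; rewrite mulr0.
  by rewrite add0r; apply: eq_bigr => i _; rewrite /= mevalZ.
have exc l0 : exists c : 'I_delta -> C, forall l, \sum_i c i * (E i).@[q l] = (l0 == l)%:R.
  have [||H [hH H0 Hl]] := @separating_form C delta (predC1 l0) q (q l0) k _ (nzq l0); first exact: ltnW.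
    by move=> l /= ll; split=> // /dist e; rewrite e eqxx in ll.
  have [b [c e]] := span _ hH; exists (fun i => c i / H.@[q l0]) => l.
  have -> : \sum_i c i / H.@[q l0] * (E i).@[q l] = H.@[q l] / H.@[q l0].
    by rewrite {2}e val mulr_suml; apply: eq_bigr => i _; rewrite mulrAC.
  by case: eqP => [<-|/eqP ne]; [rewrite divff | rewrite Hl ?mul0r //= eq_sym].
have [c hc] := boolp.choice exc.
have cE : (\matrix_(l, i) c l i) *m (\matrix_(i, l) (E i).@[q l]) = 1%:M.
  by apply/matrixP => l0 l; rewrite !mxE -hc; apply: eq_bigr => i _; rewrite !mxE.
have detE : value_det E q != 0.
  have /(congr1 determinant) := cE; rewrite det_mulmx det1 => h.
  by apply/eqP => h0; move: h; rewrite [X in _ * X]h0 mulr0 => /esym /eqP; rewrite oner_eq0.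
have vanish_jac H : H \is k.-homog -> (forall l, H.@[q l] = 0) ->
    exists b : 'I_4 -> {mpoly C[4]}, H = \sum_j b j * F^`M(j).
  move=> hH Hq; have [b [c' e]] := span _ hH; exists b.
  have c0 i : c' i = 0.
    have : (\row_i c' i) *m (\matrix_(i, l) (E i).@[q l]) = 0.
      apply/rowP => l; rewrite mxE [RHS]mxE; apply: etrans (Hq l); rewrite [in RHS]e val.
      by apply: eq_bigr => i' _; rewrite !mxE.
    move=> /(congr1 (mulmx^~ (invmx (\matrix_(i, l) (E i).@[q l])))).
    by rewrite mulmxK ?unitmxE ?unitfE // mul0mx => /rowP /(_ i); rewrite !mxE.
  by rewrite {1}e [X in _ + X]big1 ?addr0 // => i _; rewrite c0 scale0r.
split=> //; split=> //.
  move=> l0; apply/(nodeP _ hF); split=> // v hv; apply: boolp.contrapT => no.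
  have [||H [hH Hq Hv]] := @separating_tangent C delta q l0 (fun i => v i 0) k dk nzq.
  - by move=> l /dist.
  - move=> c'; apply: boolp.contrapT => no2; apply: no; exists c'.
    by apply/colP => i; rewrite !mxE; apply/eqP/negPn/negP => h; apply: no2; exists i.
  have [b e] := vanish_jac H hH Hq; case/eqP: Hv.
  have [_ _ dF] := sing l0.
  have -> : \sum_j v j 0 * (H^`M(j)).@[q l0] =
      \sum_j \sum_i (b i).@[q l0] * (hess F (q l0) i j * v j 0).
    apply: eq_bigr => j _; rewrite e (raddf_sum (mderiv j)) (raddf_sum (meval (q l0))) mulr_sumr.
    apply: eq_bigr => i _; rewrite /= meval_derivM0; last exact: dF.
    by rewrite mxE mulrCA [v j 0 * _]mulrC.
  rewrite exchange_big /= big1 // => i _; rewrite -mulr_sumr.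
  have /colP /(_ i) := hv; rewrite !mxE => ->; by rewrite mulr0.
move=> p sp; apply: boolp.contrapT => no.
have [|||H [hH H0 Hl]] := @separating_form C delta predT q p k; first exact: ltnW.
- by case: sp.
- by move=> l _; split=> // h; apply: no; exists l.
have [b e] := vanish_jac H hH (fun l => Hl l isT); case/eqP: H0.
rewrite e (raddf_sum (meval p)) big1 // => j _.
by rewrite /= mevalM; case: sp => _ _ ->; rewrite mulr0.
Qed.

(** In large degree [k] the multiples of the partial derivatives and the multiples [E i] of the
    [H i] span all forms. Writing the monomials in this way with coefficients [w], and keeping [w]
    while the surface varies, gives a square matrix [D x] that is the identity at [x0]; spanning
    persists where its determinant is nonzero. *)
Theorem nodal_open d e delta (x0 : monom d -> C) (q : 'I_delta -> 'I_4 -> C) (H : 'I_delta -> {mpoly C[4]}) :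
  (0 < d)%N -> nodes_enum (pform x0) q -> (forall k, H k \is e.-homog) -> value_det H q != 0 ->
  exists rho, [/\ polyfun rho, rho x0 != 0 & forall x, rho x != 0 ->
    forall q' : 'I_delta -> 'I_4 -> C, (forall l, singular (pform x) (q' l)) -> distinct_points q' ->
    nodes_enum (pform x) q' /\ value_det H q' != 0].
Proof.
move=> d0 nod hH detH; have hx (x : monom d -> C) := pform_homog x.
have [nd dist _] := nod.
have nzq l : nonzero (q l) by have [[]] := (nodeP (q l) (hx x0)).1 (nd l).
have [k0 sat] := jac_saturation d0 (hx x0) nod.
(* Large enough for saturation, for lifting the [H i] and the partial derivatives to degree [k], and
   above [delta] for the separating forms. *)
pose k := (k0 + e + d + delta).+1.
have [tau tauP] := avoiding_linform nzq; pose L := linform (fun i : 'I_4 => tau ^+ i).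
have hL : L \is 1.-homog by apply: linform_homog.
have Lq l : L.@[q l] != 0 by rewrite linform_eval.
pose E i := L ^+ (k - e) * H i.
have hE i : E i \is k.-homog.
  apply: (@dhomogM_eq _ _ (k - e) e) => //; last by rewrite /k; lia.
  by rewrite -[X in X.-homog]muln1; apply: homogX_exp.
have Eval i (v : 'I_4 -> C) : (E i).@[v] = L.@[v] ^+ (k - e) * (H i).@[v].
  by rewrite mevalM rmorphXn.
have detE (v : 'I_delta -> 'I_4 -> C) : value_det E v = value_det H v * \prod_l (L.@[v l] ^+ (k - e)).
  rewrite /value_det; have -> : \prod_l (L.@[v l] ^+ (k - e)) = \det (diag_mx (\row_l L.@[v l] ^+ (k - e))).
    by rewrite det_diag; apply: eq_bigr => l _; rewrite mxE.
  rewrite -det_mulmx; congr (\det _); apply/matrixP => i l; rewrite mul_mx_diag !mxE.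
  by rewrite Eval mulrC.
have detE0 : value_det E q != 0.
  by rewrite detE mulf_neq0 //; apply/prodf_neq0 => l _; apply: expf_neq0.
pose T : finType := ((monom (k - d.-1) * 'I_4) + 'I_delta)%type.
pose gn (x : monom d -> C) (t : T) : {mpoly C[4]} :=
  match t with inl (nu, j) => 'X_[mval nu] * (pform x)^`M(j) | inr i => E i end.
have gn_homog x t : gn x t \is k.-homog.
  case: t => [[nu j]|i] /=; last exact: hE.
  apply: (@dhomogM_eq _ _ (k - d.-1) d.-1); last by rewrite /k; lia.
    by rewrite dhomogX /= mdeg_mval.
  exact: mderiv_homog.
have span0 G : G \is k.-homog -> exists w : T -> C, G = \sum_t w t *: gn x0 t.
  move=> hG; pose A := \matrix_(i, l) (E i).@[q l].
  have uA : A \in unitmx by rewrite unitmxE unitfE.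
  pose c := (\row_l G.@[q l]) *m invmx A.
  have hG' : G - \sum_i c 0 i *: E i \is k.-homog.
    by rewrite rpredB //; apply: rpred_sum => i _; apply: rpredZ.
  have vG' l : (G - \sum_i c 0 i *: E i).@[q l] = 0.
    rewrite mevalB (raddf_sum (meval (q l))).
    have /rowP /(_ l) : c *m A = \row_l G.@[q l] by rewrite mulmxKV.
    rewrite mxE [RHS]mxE => <-; apply/eqP; rewrite subr_eq0; apply/eqP; apply: eq_bigr => i _.
    by rewrite /= mevalZ [A i l]mxE.
  have kk : (k0 <= k)%N by rewrite /k; lia.
  have [b [hb eb]] := jac_homog (hx x0) hG' (sat k _ kk hG' vG').
  exists (fun t => match t with inl (nu, j) => (b j)@_(mval nu) | inr i => c 0 i end).
  rewrite big_sumType /= -[LHS](subrK (\sum_i c 0 i *: E i)) eb; congr (_ + _).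
  have -> : \sum_(t : monom (k - d.-1) * 'I_4) (let (nu, j) := t in (b j)@_(mval nu)) *: gn x0 (inl t) =
      \sum_(nu : monom (k - d.-1)) \sum_(j < 4) (b j)@_(mval nu) *: ('X_[mval nu] * (pform x0)^`M(j)).
    by rewrite pair_bigA; apply: eq_bigr => -[nu j] _.
  rewrite exchange_big /=; apply: eq_bigr => j _.
  rewrite -{1}(pformK (hb j)) mulr_suml; apply: eq_bigr => nu _.
  by rewrite -scalerAl.
have exw (mu : monom k) : exists w : T -> C, 'X_[mval mu] = \sum_t w t *: gn x0 t.
  by apply: span0; rewrite dhomogX /= mdeg_mval.
have [w hw] := boolp.choice exw.
pose D x : 'M[C]_#|monom k| :=
  \matrix_(a, b) \sum_t w (enum_val a) t * (gn x t)@_(mval (enum_val b)).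
have D0 : D x0 = 1%:M.
  apply/matrixP => a b; rewrite !mxE.
  have /(congr1 (mcoeff (mval (enum_val b)))) := hw (enum_val a).
  rewrite mcoeffX (inj_eq (@mval_inj k)) (inj_eq enum_val_inj) => ->.
  by rewrite (raddf_sum (mcoeff _)); apply: eq_bigr => t _; rewrite /= mcoeffZ.
exists (fun x => \det (D x)); split.
- apply: polyfun_det => a b.
  apply: (@polyfun_ext _ _ (fun x => \sum_t w (enum_val a) t * (gn x t)@_(mval (enum_val b)))).
    by move=> x; rewrite mxE.
  apply: polyfun_sum => t _; apply: polyfunM; first exact: polyfunC.
  case: t => [[nu j]|i] /=; last exact: polyfunC.
  apply: (@polyfun_ext _ _ (fun x => \sum_mu x mu * ('X_[mval nu] * ('X_[mval mu])^`M(j))@_(mval (enum_val b)))).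
    move=> x; rewrite (raddf_sum (mderiv j)) mulr_sumr (raddf_sum (mcoeff _)).
    by apply: eq_bigr => mu _; rewrite /= mderivZ -scalerAr mcoeffZ.
  by apply: polyfun_sum => mu _; apply: polyfunM; [exact: polyfunX | exact: polyfunC].
- by rewrite D0 det1 oner_eq0.
move=> x Dx q' sq' dq'.
have [||n1 n2] := @nodes_enum_of_spanning d delta k (pform x) E q' _ (hx x) _ sq' dq'.
- by rewrite /k; lia.
- move=> G hG; pose y := (\row_b G@_(mval (enum_val b))) *m invmx (D x).
  have uD : D x \in unitmx by rewrite unitmxE unitfE.
  have yD : y *m D x = \row_b G@_(mval (enum_val b)) by rewrite mulmxKV.
  pose W t := \sum_a y 0 a * w (enum_val a) t.
  have GE : G = \sum_t W t *: gn x t.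
    apply/mpolyP => m; case: (eqVneq (mdeg m) k) => [mk|mk]; last first.
      rewrite (dhomog_nemf_coeff hG) // (dhomog_nemf_coeff (_ : _ \is k.-homog)) //.
      by apply: rpred_sum => t _; apply/rpredZ/gn_homog.
    have [mu <-] := mval_onto mk.
    have /rowP /(_ (enum_rank mu)) := yD; rewrite mxE [RHS]mxE enum_rankK => <-.
    rewrite (raddf_sum (mcoeff _)) /=.
    have -> : \sum_t (W t *: gn x t)@_(mval mu) = \sum_t \sum_a y 0 a * (w (enum_val a) t * (gn x t)@_(mval mu)).
      by apply: eq_bigr => t _; rewrite mcoeffZ mulr_suml; apply: eq_bigr => a _; rewrite mulrA.
    rewrite exchange_big /=; apply: eq_bigr => a _; rewrite [D x _ _]mxE enum_rankK mulr_sumr.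
    by [].
  exists (fun j => \sum_nu W (inl (nu, j)) *: 'X_[mval nu]), (fun i => W (inr i)).
  rewrite GE big_sumType /=; congr (_ + _).
  have -> : \sum_(t : monom (k - d.-1) * 'I_4) W (inl t) *: gn x (inl t) =
      \sum_(nu : monom (k - d.-1)) \sum_(j < 4) W (inl (nu, j)) *: ('X_[mval nu] * (pform x)^`M(j)).
    by rewrite pair_bigA; apply: eq_bigr => -[nu j] _.
  rewrite exchange_big /=; apply: eq_bigr => j _.
  by rewrite mulr_suml; apply: eq_bigr => nu _; rewrite -scalerAl.
split; first exact: n1.
by move: n2; rewrite (detE q') mulf_eq0 negb_or => /andP [].
Qed.

End Openness.

(** * Independence of nodes and Cech cohomology *)

Lemma fraction_sub (F : fieldType) (a b x y : F) : x != 0 -> y != 0 ->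
  a / x - b / y = (a * y - b * x) / (x * y).
Proof. by move=> x0 y0; field; rewrite x0 y0. Qed.

Lemma sub_swap (V : zmodType) (u v w z : V) : v - u = z - w -> u - w = v - z.
Proof.
move=> h; have -> : v = z - w + u by rewrite -h subrK.
by rewrite [RHS]addrAC [z - w]addrC addrK addrC.
Qed.

Lemma meval_cross (K : idomainType) n (a b x y z u v : {mpoly K[n]}) p :
  (a * x - b * y) * z = u * v -> u.@[p] = 0 -> z.@[p] != 0 -> a.@[p] * x.@[p] = b.@[p] * y.@[p].
Proof.
move=> /(congr1 (meval p)) + u0 z0; rewrite !mevalM mevalB !mevalM u0 mul0r => /eqP.
by rewrite mulf_eq0 (negbTE z0) orbF subr_eq0 => /eqP.
Qed.

Lemma factor_sub (T : pzRingType) (e a b x y : T) : e * a * x - e * b * y = e * (a * x - b * y).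
Proof. by rewrite mulrBr !mulrA. Qed.

Lemma minor_eval (K : comNzRingType) n (p : 'I_n -> K) (e : K) i j k :
  ((p j ^+ k)%:MP * 'X_i ^+ k - (p i ^+ k)%:MP * 'X_j ^+ k : {mpoly K[n]}).@[fun l => e * p l] = 0.
Proof.
rewrite mevalB !mevalM !mevalC !rmorphXn /= !mevalXU !exprMn.
by rewrite mulrCA [p i ^+ k * (_ * _)]mulrCA [p i ^+ k * _]mulrC subrr.
Qed.

Section Fractions.
Variable T : idomainType.
Implicit Types a b x y z : T.

Lemma tofrac_sub a b x y : x != 0 -> y != 0 ->
  tofrac a / tofrac x - tofrac b / tofrac y = tofrac (a * y - b * x) / tofrac (x * y).
Proof.
move=> x0 y0; rewrite tofracB !tofracM.
by apply: fraction_sub; rewrite tofrac_eq0.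
Qed.

Lemma tofrac_cross a b x y : x != 0 -> y != 0 ->
  tofrac a / tofrac x = tofrac b / tofrac y -> a * y = b * x.
Proof.
move=> x0 y0 /eqP; rewrite -subr_eq0 tofrac_sub // mulf_eq0 invr_eq0 !tofrac_eq0 mulf_eq0.
by rewrite (negbTE x0) (negbTE y0) !orbF subr_eq0 => /eqP.
Qed.

Lemma tofrac_mulr a x z : x != 0 -> z != 0 -> tofrac (a * z) / tofrac (x * z) = tofrac a / tofrac x.
Proof.
move=> x0 z0; rewrite !tofracM -mulf_div mulfV ?mulr1 //.
by rewrite tofrac_eq0.
Qed.

Lemma tofrac_inj a b : tofrac a = tofrac b -> a = b.
Proof. by move/eqP; rewrite tofrac_eq => /eqP. Qed.

End Fractions.

Section Cech.
Variable R : realType.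
Local Notation C := R[i].
Implicit Types (F G H : {mpoly C[4]}).

Lemma mpolyX_neq0 n (m : 'X_{1..n}) : 'X_[m] != 0 :> {mpoly C[n]}.
Proof. by rewrite -msupp_eq0 msuppX. Qed.

Lemma monomial_dvd d (m : 'X_{1..4}) F : F \is (d + mdeg m).-homog ->
  (forall u, F@_u != 0 -> (m <= u)%MM) -> exists2 G, G \is d.-homog & F = G * 'X_[m].
Proof.
move=> hF hm; exists (\sum_(u <- msupp F) F@_u *: 'X_[u - m]).
  rewrite big_seq; apply: rpred_sum => u us; apply: rpredZ; rewrite dhomogX /=.
  have := dhomog_mf hF us; rewrite /= mcoeff_msupp in us *.
  by rewrite -{1}(submK (hm u us)) mdegD => /eqP; rewrite eqn_add2r.
rewrite {1}(mpolyE F) mulr_suml big_seq [RHS]big_seq; apply: eq_bigr => u us.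
by rewrite -scalerAl -mpolyXD submK //; apply: hm; rewrite -mcoeff_msupp.
Qed.

Lemma mcoeff_mulX_ge (p : {mpoly C[4]}) m v : (p * 'X_[m])@_v != 0 -> (m <= v)%MM.
Proof.
apply: contraNT => mv; rewrite (mpolyE p) mulr_suml (raddf_sum (mcoeff v)) big1 // => u _ /=.
rewrite -scalerAl -mpolyXD mcoeffZ mcoeffX; case: eqP => [e|_]; last by rewrite mulr0.
by case/negP: mv; rewrite -e lem_addl.
Qed.

Lemma monomial_cross (b b' : {mpoly C[4]}) i j k k' u : i != j ->
  b * 'X_i ^+ k = b' * 'X_j ^+ k' -> b@_u != 0 -> (k' <= u j)%N.
Proof.
move=> ij e bu; have : (b * 'X_i ^+ k)@_(U_(i) *+ k + u) != 0 by rewrite mpolyXn mcoeffMX.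
rewrite e mpolyXn => /mcoeff_mulX_ge /mnm_lepP /(_ j).
by rewrite mnmDE !mulmnE !mnm1E eqxx (negbTE ij) mul1n mul0n add0n.
Qed.

Lemma X_homog (i : 'I_4) k : ('X_i ^+ k : {mpoly C[4]}) \is k.-homog.
Proof. by rewrite -[X in X.-homog]muln1; apply: homogX_exp; rewrite dhomogX /= mdeg1. Qed.

Lemma Xexp_eval (i : 'I_4) k v : ('X_i ^+ k : {mpoly C[4]}).@[v] = v i ^+ k.
Proof. by rewrite rmorphXn /= mevalXU. Qed.

Lemma Xexp_neq0 (i : 'I_4) k : 'X_i ^+ k != 0 :> {mpoly C[4]}.
Proof. by rewrite expf_neq0 // mpolyX_neq0. Qed.

Lemma node_singular d F x : F \is d.-homog -> node F x -> singular F x.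
Proof. by move=> hF /(nodeP _ hF) []. Qed.

(** [E] has degree [d + delta] and vanishes at all nodes but [q l]. The fractions [c i / X_i^delta]
    are local sections of [O(d)] whose differences vanish at every node, so they form a cocycle of
    the ideal sheaf. Corrected by a coboundary, they glue to a form of degree [d] that is nonzero at
    [q l] and zero at the other nodes. *)
Lemma indep_of_H1 e d delta F (q : 'I_delta -> 'I_4 -> C) : F \is e.-homog -> nodes_enum F q ->
  H1_vanishes (node F) d ->
  exists H : 'I_delta -> {mpoly C[4]}, (forall k, H k \is d.-homog) /\ value_det H q != 0.
Proof.
move=> hF [nd dist all] h1.
have nzq l : nonzero (q l) by have [] := node_singular hF (nd l).
suff ex l : exists H, [/\ H \is d.-homog, H.@[q l] != 0 & forall l', l' != l -> H.@[q l'] = 0].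
  have [H HP] := boolp.choice ex; exists H; split; first by move=> k; have [] := HP k.
  rewrite /value_det; have -> : \matrix_(k, l) (H k).@[q l] = diag_mx (\row_l (H l).@[q l]).
    apply/matrixP => k l; rewrite !mxE; case: eqP => [->|/eqP ne]; first by rewrite mulr1n.
    by have [_ _ ->] := HP k; rewrite ?mulr0n // eq_sym.
  by rewrite det_diag; apply/prodf_neq0 => l _; rewrite mxE; have [] := HP l.
have [||E [hE E0 El]] := @separating_form C delta (predC1 l) q (q l) (d + delta) _ (nzq l).
- by rewrite leq_addl.
- by move=> l' /= ll; split=> // /dist e'; rewrite e' eqxx in ll.
pose c (i : 'I_4) : {mpoly C[4]} := E * (q l i ^+ delta)%:MP.
pose s i := tofrac (c i) / tofrac ('X_i ^+ delta).
have [|i j k|h hh hg] := h1 (fun i j => s j - s i); first 1 last.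
- by rewrite addrC addrA subrK.
- have eqs i j : s i - h i = s j - h j.
    by apply: sub_swap; apply: hg.
  have exb i : exists k b ai, [/\ b \is (d + (delta + k)).-homog, s i - h i = tofrac b / tofrac ('X_i ^+ (delta + k)),
      b = c i * 'X_i ^+ k - ai * 'X_i ^+ delta
    & forall p, node F p -> p i != 0 -> ai.@[p] = 0].
    have [k [ai [ha ei va]]] := hh i.
    exists k, (c i * 'X_i ^+ k - ai * 'X_i ^+ delta), ai; split=> //.
    - rewrite rpredB //.
        apply: (@dhomogM_eq _ _ (d + delta) k); [|exact: X_homog | by rewrite addnA].
        by rewrite /c mulrC mul_mpolyC; apply: rpredZ.
      apply: (@dhomogM_eq _ _ (d + k) delta); [|exact: X_homog | lia].
      by rewrite muln1 in ha.
    - rewrite ei -tofracXn exprD; apply: tofrac_sub; exact: Xexp_neq0.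
    - by move=> p np pi; apply: va => //; rewrite mevalXU.
  have [k kP] := boolp.choice exb; have [b bP] := boolp.choice kP; have [ai aiP] := boolp.choice bP.
  have cross i j : b i * 'X_j ^+ (delta + k j) = b j * 'X_i ^+ (delta + k i).
    apply: tofrac_cross; [exact: Xexp_neq0 | exact: Xexp_neq0 |].
    by have [_ <- _ _] := aiP i; have [_ <- _ _] := aiP j; apply: eqs.
  pose K0 := (delta + k ord0)%N.
  (* The corrected fractions agree; comparing with a chart other than 0 shows that the numerator is
     divisible by the whole power of [X_0], and the quotient is the glued form. *)
  have [||H hH bH] := @monomial_dvd d (U_(ord0) *+ K0) (b ord0).
  - by rewrite mdegMn mdeg1 mul1n; have [] := aiP ord0.
  - move=> u hu; apply/mnm_lepP => j; rewrite mulmnE mnm1E; case: eqP => [<-|]; last by rewrite mul0n.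
    pose j1 : 'I_4 := inord 1; have ne : j1 != ord0 by rewrite -val_eqE /= inordK.
    by rewrite mul1n; exact: (monomial_cross ne (cross ord0 j1) hu).
  have HX i : H * 'X_i ^+ (delta + k i) = b i.
    have XK : 'X_[(U_(ord0) *+ K0)] = 'X_ord0 ^+ K0 :> {mpoly C[4]} by rewrite mpolyXn.
    rewrite XK in bH; apply: (mulIf (Xexp_neq0 ord0 K0)).
    by rewrite mulrAC -bH; apply: (cross ord0 i).
  have ev l' i : q l' i != 0 -> H.@[q l'] * q l' i ^+ (delta + k i) = E.@[q l'] * (q l i ^+ delta * q l' i ^+ k i).
    move=> qi; have /(congr1 (meval (q l'))) := HX i; have [_ _ -> va] := aiP i.
    rewrite mevalM Xexp_eval mevalB !mevalM !Xexp_eval mevalC (va _ (nd l') qi).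
    by rewrite mul0r subr0 mulrA.
  exists H; split=> //.
    have [i qi] := nzq l; have e1 := ev l i qi; apply/eqP => h0; move: e1; rewrite h0 mul0r.
    by move/esym/eqP; rewrite !mulf_eq0 !expf_eq0 (negbTE E0) (negbTE qi) !andbF.
  move=> l' ll; have [i qi] := nzq l'; have := ev l' i qi; rewrite (El l' ll) mul0r => /eqP.
  by rewrite mulf_eq0 expf_eq0 (negbTE qi) andbF orbF => /eqP.
exists delta, (E * ((q l j ^+ delta)%:MP * 'X_i ^+ delta - (q l i ^+ delta)%:MP * 'X_j ^+ delta)); split.
- apply: (@dhomogM_eq _ _ (d + delta) delta) => //; last by lia.
  by rewrite rpredB // mul_mpolyC rpredZ // X_homog.
- rewrite /s tofrac_sub; [|exact: Xexp_neq0 | exact: Xexp_neq0].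
  have -> : c j * 'X_i ^+ delta - c i * 'X_j ^+ delta =
      E * ((q l j ^+ delta)%:MP * 'X_i ^+ delta - (q l i ^+ delta)%:MP * 'X_j ^+ delta).
    exact: factor_sub.
  have -> : 'X_j ^+ delta * 'X_i ^+ delta = ('X_i * 'X_j) ^+ delta :> {mpoly C[4]} by rewrite exprMn mulrC.
  by rewrite tofracXn.
move=> p np _; have [l' [e' e0 pE]] := all p (node_singular hF np).
have -> : p = (fun i => e' * q l' i) by apply/boolp.funext.
rewrite mevalM (meval_homog_scale _ _ hE); case: (eqVneq l' l) => [->|ll]; last by rewrite (El l' ll) mulr0 mul0r.
by rewrite minor_eval ?mulr0.
Qed.

(** The cocycle is first split in [O(d)], monomial by monomial. The local sections found need not
    vanish at the nodes, but since the cocycle does, their values agree in all charts; independence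
    of the nodes gives a global form [G] with these values, and subtracting it repairs the
    splitting. *)
Lemma H1_of_indep e d delta F (q : 'I_delta -> 'I_4 -> C) (H : 'I_delta -> {mpoly C[4]}) :
  F \is e.-homog -> nodes_enum F q -> (forall k, H k \is d.-homog) -> value_det H q != 0 ->
  H1_vanishes (node F) d.
Proof.
move=> hF [nd dist all] hH detH g hg gg.
have gii i : g i i = 0 by have := gg i i i; rewrite -{3}[g i i]addr0 => /addrI.
have hg' i j : exists k, exists a, [/\ a \is (d + k * 2).-homog,
    g i j = tofrac a / tofrac ('X_i * 'X_j) ^+ k & forall p, node F p -> ('X_i * 'X_j).@[p] != 0 -> a.@[p] = 0] := hg i j.
have [kk2 hkk2] := boolp.choice (fun ij : 'I_4 * 'I_4 => hg' ij.1 ij.2).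
pose kk i j := kk2 (i, j); have hkk i j := hkk2 (i, j) : exists a, [/\ a \is (d + kk i j * 2).-homog,
    g i j = tofrac a / tofrac ('X_i * 'X_j) ^+ kk i j & forall p, node F p -> ('X_i * 'X_j).@[p] != 0 -> a.@[p] = 0].
pose k := (\sum_i \sum_j kk i j)%N.
have kle i j : (kk i j <= k)%N.
  rewrite /k (bigD1 i) //= (bigD1 j) //=; lia.
(* A common denominator, the [k]-th power of the product of all variables; the numerator [b i j] is
   then divisible by [X_l^k] for every [l] other than [i] and [j]. *)
pose D := [multinom k | l < 4]; pose tD : {fraction {mpoly C[4]}} := tofrac 'X_[D].
have D0 : tD != 0 by rewrite tofrac_eq0 mpolyX_neq0.
have mdD : mdeg D = (4 * k)%N.
  by rewrite mdegE; under eq_bigr => l _ do rewrite mnmE; rewrite sum_nat_const card_ord.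
have exb i j : exists b, [/\ b \is (d + 4 * k).-homog, tofrac b = g i j * tD &
    forall u, b@_u != 0 -> forall l, l != i -> l != j -> (k <= u l)%N].
  case: (eqVneq i j) => [<-|ij].
    by exists 0; split; rewrite ?dhomog0 ?gii ?tofrac0 ?mul0r // => u; rewrite mcoeff0 eqxx.
  have [a [ha ea va]] := hkk i j.
  pose mm := (D - (U_(i) + U_(j)) *+ kk i j)%MM.
  have le : ((U_(i) + U_(j)) *+ kk i j <= D)%MM.
    apply/mnm_lepP => l; rewrite mulmnE mnmDE !mnm1E mnmE.
    case: (i =P l) => [<-|_]; last by case: (j =P l) => _; rewrite ?mul0n ?mul1n // kle.
    by rewrite eq_sym (negbTE ij) addn0 mul1n kle.
  exists (a * 'X_[mm]); split.
  - apply: (@dhomogM_eq _ _ _ (mdeg mm) _ _ _ ha); first by rewrite dhomogX /=.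
    have : (mdeg mm + mdeg ((U_(i) + U_(j)) *+ kk i j)%MM)%N = mdeg D by rewrite -mdegD submK.
    by rewrite mdegMn mdegD !mdeg1 mdD; lia.
  - have XX : ('X_i * 'X_j) ^+ kk i j != 0 :> {mpoly C[4]} by rewrite expf_neq0 // mulf_neq0 // mpolyX_neq0.
    have XE : 'X_[D] = 'X_[mm] * ('X_i * 'X_j) ^+ kk i j :> {mpoly C[4]}.
      by rewrite -{1}(submK le) mpolyXD -mpolyXn mpolyXD.
    rewrite ea -tofracXn /tD XE; apply: (@mulIf _ (tofrac 1)); first by rewrite tofrac_eq0 oner_eq0.
    rewrite tofrac1 !mulr1 [tofrac (_ * (_ ^+ _))]tofracM mulrCA divfK ?tofrac_eq0 //.
    by rewrite -tofracM mulrC.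
  - move=> u /mcoeff_mulX_ge /mnm_lepP h l li lj; apply: leq_trans (h l).
    by rewrite mnmBE mulmnE mnmDE !mnm1E mnmE eq_sym (negbTE li) eq_sym (negbTE lj) mul0n subn0.
have [b2 hb2] := boolp.choice (fun ij : 'I_4 * 'I_4 => exb ij.1 ij.2).
pose b0 i j := b2 (i, j); have hb i j := hb2 (i, j) : [/\ b0 i j \is (d + 4 * k).-homog,
    tofrac (b0 i j) = g i j * tD & forall u, (b0 i j)@_u != 0 -> forall l, l != i -> l != j -> (k <= u l)%N].
have bb i j l u : (b0 i j)@_u + (b0 j l)@_u = (b0 i l)@_u.
  rewrite -mcoeffD; congr (_ @_ _); apply: tofrac_inj; rewrite tofracD.
  by have [_ -> _] := hb i j; have [_ -> _] := hb j l; have [_ -> _] := hb i l; rewrite -mulrDl gg.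
(* coefficientwise the cocycle is contracted to an index at which the Laurent  *)
(* monomial is regular                                                         *)
pose c (u : 'X_{1..4}) : 'I_4 := odflt ord0 [pick l : 'I_4 | (k <= u l)%N].
pose w i : {mpoly C[4]} := pform (fun mu : monom (d + 4 * k) => (b0 (c (mval mu)) i)@_(mval mu)).
have wE i u : (w i)@_u = (b0 (c u) i)@_u.
  case: (eqVneq (mdeg u) (d + 4 * k)%N) => [hu|hu].
    by have [mu <-] := mval_onto hu; rewrite mcoeff_pform.
  rewrite (dhomog_nemf_coeff (pform_homog _) hu); have [h _ _] := hb (c u) i.
  by rewrite (dhomog_nemf_coeff h hu).
have wreg i u : (w i)@_u != 0 -> forall l, l != i -> (k <= u l)%N.
  rewrite wE => h l li; have [_ _ reg] := hb (c u) i; move: (reg u h); rewrite /c.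
  case: pickP => [l0 /= kl0|no] /= r.
    by case: (eqVneq l l0) => [->|ll0] //; apply: r.
  (* Here no exponent reaches [k] and the default index 0 was taken. But the exponent does reach [k]
     at every index other than 0 and [i], and four variables leave such an index. *)
  have [l1 [l10 l1i]] : exists l1 : 'I_4, l1 != ord0 /\ l1 != i.
    case: (eqVneq i (inord 1)) => [->|i1]; last first.
      by exists (inord 1); split; [rewrite -val_eqE /= inordK | rewrite eq_sym].
    by exists (inord 2); rewrite -!val_eqE /= !inordK.
  by have := no l1; rewrite /= (r l1 l10 l1i).
have exA i : exists2 A, A \is (d + k).-homog & w i = A * 'X_[D - U_(i) *+ k].
  have leD : (U_(i) *+ k <= D)%MM.
    by apply/mnm_lepP => l; rewrite mulmnE mnm1E mnmE; case: eqP => _; rewrite ?mul1n ?mul0n.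
  have md : (mdeg (D - U_(i) *+ k) + k)%N = (4 * k)%N.
    by rewrite -mdD -{2}(submK leD) mdegD mdegMn mdeg1 mul1n.
  apply: monomial_dvd.
    have -> : (d + k + mdeg (D - U_(i) *+ k))%N = (d + 4 * k)%N by rewrite -md; lia.
    exact: pform_homog.
  move=> u hu; apply/mnm_lepP => l; rewrite mnmBE mulmnE mnm1E mnmE.
  case: (eqVneq i l) => [_|il]; first by rewrite mul1n subnn.
  by rewrite mul0n subn0; apply: (wreg i u hu); rewrite eq_sym.
have [A hA wA] : exists2 A : 'I_4 -> {mpoly C[4]}, (forall i, A i \is (d + k).-homog) &
    forall i, w i = A i * 'X_[D - U_(i) *+ k].
  have [A hA] := boolp.choice (fun i => let: ex_intro2 A h1 h2 := exA i in ex_intro (fun A => A \is (d + k).-homog /\ w i = A * 'X_[D - U_(i) *+ k]) A (conj h1 h2)).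
  by exists A => i; have [] := hA i.
have wD i : tofrac (w i) / tD = tofrac (A i) / tofrac ('X_i ^+ k).
  have leD : (U_(i) *+ k <= D)%MM.
    by apply/mnm_lepP => l; rewrite mulmnE mnm1E mnmE; case: eqP => _; rewrite ?mul1n ?mul0n.
  have tE : 'X_[D] = 'X_i ^+ k * 'X_[D - U_(i) *+ k] :> {mpoly C[4]}.
    by rewrite mulrC mpolyXn -mpolyXD submK.
  by rewrite wA /tD tE tofrac_mulr ?Xexp_neq0 ?mpolyX_neq0.
have gw i j : g i j = tofrac (A j) / tofrac ('X_j ^+ k) - tofrac (A i) / tofrac ('X_i ^+ k).
  rewrite -!wD -mulrBl; apply: (mulIf D0); rewrite divfK // -tofracB.
  have [_ <- _] := hb i j; congr tofrac; apply/mpolyP => u.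
  by rewrite mcoeffB !wE -(bb (c u) i j) addrAC subrr add0r.
have Aval l i j : q l i != 0 -> q l j != 0 ->
    (A j).@[q l] / q l j ^+ k = (A i).@[q l] / q l i ^+ k.
  move=> qi qj; have [a [ha ea va]] := hkk i j.
  have vq : a.@[q l] = 0 by apply: va; rewrite ?mevalM ?mevalXU ?mulf_neq0.
  have : (A j * 'X_i ^+ k - A i * 'X_j ^+ k) * ('X_i * 'X_j) ^+ kk i j = a * ('X_j ^+ k * 'X_i ^+ k).
    have XX : ('X_i * 'X_j) ^+ kk i j != 0 :> {mpoly C[4]} by rewrite expf_neq0 // mulf_neq0 // mpolyX_neq0.
    apply: tofrac_cross; [by rewrite mulf_neq0 ?Xexp_neq0 | exact: XX |].
    by rewrite -tofrac_sub ?Xexp_neq0 // -gw ea -tofracXn.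
  move/meval_cross => /(_ _ vq); rewrite !Xexp_eval => h.
  apply/eqP; rewrite eqr_div ?expf_neq0 //; apply/eqP; apply: h.
  by rewrite rmorphXn /= mevalM !mevalXU expf_neq0 // mulf_neq0.
have nzq l : nonzero (q l) by have [] := node_singular hF (nd l).
have exval l : exists v : C, forall i, q l i != 0 -> (A i).@[q l] = v * q l i ^+ k.
  have [i qi] := nzq l; exists ((A i).@[q l] / q l i ^+ k) => j qj.
  by rewrite -(Aval l i j qi qj) divfK ?expf_neq0.
have [v hv] := boolp.choice exval.
pose M := \matrix_(i, l) (H i).@[q l]; have uM : M \in unitmx by rewrite unitmxE unitfE.
pose cf := (\row_l v l) *m invmx M; pose G := \sum_i cf 0 i *: H i.
have hG : G \is d.-homog by apply: rpred_sum => i _; apply/rpredZ/hH.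
have Gq l : G.@[q l] = v l.
  have /rowP /(_ l) : cf *m M = \row_l v l by rewrite mulmxKV.
  rewrite mxE [RHS]mxE => <-; rewrite (raddf_sum (meval (q l))); apply: eq_bigr => i _.
  by rewrite /= mevalZ [M _ _]mxE.
exists (fun i => tofrac (A i) / tofrac ('X_i ^+ k) - tofrac G) => [i|i j]; last by rewrite gw opprB addrA subrK.
have hB : A i - G * 'X_i ^+ k \is (d + k).-homog.
  by rewrite rpredB //; apply: (dhomogM_eq hG (X_homog i k)).
exists k, (A i - G * 'X_i ^+ k); split; first by rewrite muln1.
  have XX := Xexp_neq0 i k; rewrite -tofracXn.
  have -> : tofrac G = tofrac G / tofrac 1 by rewrite tofrac1 divr1.
  by rewrite tofrac_sub ?oner_eq0 // !mulr1.
move=> p np; rewrite mevalXU => pi.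
have [l [e' e0 pE]] := all p (node_singular hF np).
have -> : p = (fun i => e' * q l i) by apply/boolp.funext.
rewrite (meval_homog_scale _ _ hB) mevalB mevalM Xexp_eval (hv l) ?Gq ?subrr ?mulr0 //.
by apply: contraNneq pi => h; rewrite pE h mulr0.
Qed.

End Cech.

(** * Deformations of nodal surfaces *)

Lemma expansion_collect (A : comPzRingType) (t a b c d u v : A) :
  c + t * d + t ^+ 2 * u + t * (a + t * b + t ^+ 2 * v) = c + t * (a + d) + t ^+ 2 * (u + b + t * v).
Proof. by ring. Qed.

Section Expansion.
Variables (R : realType) (n : nat).
Local Notation C := R[i].

Lemma poly_taylor2 (q : {poly C}) : exists r : {poly C}, forall t,
  q.[t] = q`_0 + t * q`_1 + t ^+ 2 * r.[t].
Proof.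
exists (drop_poly 2 q) => t; rewrite -{1}(poly_take_drop 2 q) hornerD hornerM hornerXn mulrC.
congr (_ + _).
have -> : take_poly 2 q = (q`_0)%:P + (q`_1) *: 'X.
  apply/polyP => -[|[|i]]; rewrite coef_take_poly coefD coefC coefZ coefX /= ?mulr0 ?addr0 //.
  by rewrite mulr1 add0r.
by rewrite hornerD hornerC hornerZ hornerX mulrC.
Qed.

Lemma pihomog0E (p : {mpoly C[n]}) : pihomog mdeg 0 p = (p@_0%MM)%:MP.
Proof.
apply/mpolyP => m; rewrite mcoeff_pihomog mcoeffC mdeg_eq0 eq_sym.
by case: eqP => [->|]; rewrite ?mulr1 ?mulr0.
Qed.

Lemma line_expansion (P Q : {mpoly C[n]}) p w : exists r : {poly C}, forall t,
  (P + t *: Q).@[fun i => p i + t * w i] =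
  P.@[p] + t * (Q.@[p] + \sum_j (P^`M(j)).@[p] * w j) + t ^+ 2 * r.[t].
Proof.
have ex (L : {mpoly C[n]}) : exists r : {poly C}, forall t,
    L.@[fun i => p i + t * w i] = L.@[p] + t * (\sum_j (L^`M(j)).@[p] * w j) + t ^+ 2 * r.[t].
  have [q [q1 qe]] := meval_line (translate p L) w.
  have [r hr] := poly_taylor2 q; exists r => t.
  have -> : L.@[fun i => p i + t * w i] = q.[t].
    by rewrite qe (translate_eval p L); apply: meval_eq => i; rewrite addrC.
  rewrite hr !q1; congr (_ + _ * _ + _).
    by rewrite pihomog0E mevalC (translate_coef0 p L).
  rewrite pihomog1E (raddf_sum (meval w)); apply: eq_bigr => j _ /=.
  by rewrite mevalZ mevalXU (translate_coefU p j L).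
have [r1 h1] := ex P; have [r2 h2] := ex Q.
exists (r1 + (\sum_j (Q^`M(j)).@[p] * w j)%:P + 'X * r2) => t.
rewrite mevalD mevalZ h1 h2 !hornerD hornerC hornerM hornerX.
exact: expansion_collect.
Qed.

End Expansion.

Section Charts.
Variable K : numClosedFieldType.

Lemma unitmx_of_inj n (A : 'M[K]_n) : (forall v : 'cV_n, A *m v = 0 -> v = 0) -> A \in unitmx.
Proof.
move=> inj; rewrite -row_full_unit -cokermx_eq0; apply/eqP/matrixP => a b; rewrite [RHS]mxE.
have /colP /(_ a) : col b (cokermx A) = 0; last by rewrite !mxE.
by apply: inj; rewrite colE mulmxA mulmx_coker mul0mx.
Qed.

Lemma node_chart_hess d (F : {mpoly K[4]}) x i : F \is d.-homog -> node F x -> x i != 0 ->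
  chart_hess i x F \in unitmx.
Proof.
move=> hF nF xi; apply: unitmx_of_inj => v hv; apply/colP => l; rewrite [RHS]mxE.
have [[_ F0 F1] ker] := (nodeP x hF).1 nF.
apply: (chart_hess_inj hF xi F1 ker (v := fun l => v l 0)) => k.
by have /colP /(_ k) := hv; rewrite !mxE.
Qed.

End Charts.

Section Deformation.
Variables (R : realType) (n delta : nat).
Local Notation C := R[i].

Definition affine_pt (u : 'I_3 -> C) : 'I_4 -> C :=
  fun i => if unlift ord0 i is Some l then u l else 1.

Lemma affine_pt0 u : affine_pt u ord0 = 1.
Proof. by rewrite /affine_pt unlift_none. Qed.

Lemma affine_ptS u l : affine_pt u (lift ord0 l) = u l.
Proof. by rewrite /affine_pt liftK. Qed.

Definition dvar : finType := (monom n + 'I_delta * 'I_3)%type.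
Definition deqn : finType := ('I_delta * 'I_4)%type.
Implicit Types z : dvar -> C.

Definition dform z : monom n -> C := fun mu => z (inl mu).
Definition dpt z (k : 'I_delta) : 'I_4 -> C := affine_pt (fun l => z (inr (k, l))).
Definition dpair (x : monom n -> C) (u : 'I_delta -> 'I_3 -> C) : dvar -> C :=
  fun a => match a with inl mu => x mu | inr (k, l) => u k l end.

(** Four equations per point: the value and the derivatives in the three affine directions. Euler's
    identity supplies the derivative along [x_0]. *)
Definition incidence (j : deqn) z : C :=
  if unlift ord0 j.2 is Some l then ((pform (dform z))^`M(j.2)).@[dpt z j.1]
  else (pform (dform z)).@[dpt z j.1].

Lemma polyfun_dpt k i : polyfun (fun z => dpt z k i).
Proof.
rewrite /dpt /affine_pt; case: unliftP => [l _|_]; [exact: polyfunX | exact: polyfunC].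
Qed.

Lemma polyfun_incidence j : polyfun (incidence j).
Proof.
rewrite /incidence; case: unliftP => [l _|_].
  by apply: (polyfun_pform_deriv j.2) => [mu|i]; [exact: polyfunX | exact: polyfun_dpt].
by apply: polyfun_pform => [mu|i]; [exact: polyfunX | exact: polyfun_dpt].
Qed.

Lemma incidenceP z : (forall j, incidence j z = 0) <-> forall k, singular (pform (dform z)) (dpt z k).
Proof.
split=> [h k|h [k i]]; last first.
  have [_ h0 h1] := h k; rewrite /incidence /=; case: unliftP => [l _|_]; first exact: h1.
  exact: h0.
apply: (@singular_euler _ n _ _ ord0); rewrite ?pform_homog /dpt ?affine_pt0 ?oner_eq0 //.
  by have := h (k, ord0); rewrite /incidence /= unlift_none.
by move=> l; have := h (k, lift ord0 l); rewrite /incidence /= liftK.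
Qed.

Variables (x0 : monom n -> C) (u0 : 'I_delta -> 'I_3 -> C) (Phi : 'I_delta -> monom n -> C).
Hypothesis sing0 : forall k, singular (pform x0) (affine_pt (u0 k)).
Hypothesis hess0 : forall k, chart_hess ord0 (affine_pt (u0 k)) (pform x0) \in unitmx.
Hypothesis PhiE : forall k l, (pform (Phi k)).@[affine_pt (u0 l)] = (k == l)%:R.

Let y0 := dpair x0 u0.
Let Hs k := chart_hess ord0 (affine_pt (u0 k)) (pform x0).

(* a right inverse of the differential of the incidence equations: the values  *)
(* at the nodes are moved by the forms Phi, the gradients by moving the nodes  *)
Let B (j : deqn) : dvar -> C := fun a => match a, unlift ord0 j.2 with
  | inl mu, None => Phi j.1 mu
  | inl mu, Some _ => 0
  | inr (k, l), Some l' => (k == j.1)%:R * (invmx (Hs k)) l l'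
  | inr (k, l), None => - \sum_b (invmx (Hs k)) l b * ((pform (Phi j.1))^`M(lift ord0 b)).@[affine_pt (u0 k)]
  end.

Let Bform j : pform (dform (B j)) = if unlift ord0 j.2 is Some _ then 0 else pform (Phi j.1).
Proof.
case e : (unlift ord0 j.2) => [l|]; last by congr pform; apply/boolp.funext => mu; rewrite /dform /B e.
by rewrite /pform big1 // => mu _; rewrite /dform /B e scale0r.
Qed.

Let sum_unit_row (A : 'M[C]_3) (hA : A \in unitmx) (a l : 'I_3) : \sum_b A a b * invmx A b l = (a == l)%:R.
Proof. by have /matrixP /(_ a l) := mulmxV hA; rewrite !mxE. Qed.

(** In a value equation only [Phi] contributes, as the gradient vanishes at a node. In a gradient
    equation, moving the points through the inverse Hessian either produces the unit entry or
    cancels the gradient of [Phi]. *)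
Let B_deriv i j : exists r : {poly C}, forall t,
  incidence i (fun a => y0 a + t * B j a) = t * (i == j)%:R + t ^+ 2 * r.[t].
Proof.
case: i => k i; pose P := pform x0; pose Q := pform (dform (B j)).
pose w : 'I_4 -> C := fun i => if unlift ord0 i is Some l then B j (inr (k, l)) else 0.
have w0 : w ord0 = 0 by rewrite /w unlift_none.
have wS l : w (lift ord0 l) = B j (inr (k, l)) by rewrite /w liftK.
have ptE t : dpt (fun a => y0 a + t * B j a) k = (fun i => affine_pt (u0 k) i + t * w i).
  apply/boolp.funext => a; rewrite /dpt /affine_pt /w; case: unliftP => [l _|_] //=.
  by rewrite mulr0 addr0.
have fE t : pform (dform (fun a => y0 a + t * B j a)) = P + t *: Q.
  rewrite /P /Q /pform scaler_sumr -big_split; apply: eq_bigr => mu _ /=.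
  by rewrite /dform /= scalerDl scalerA.
have [_ P0 P1] := sing0 k.
rewrite /incidence /=; case: (unliftP ord0 i) => [a ->|->]; last first.
  have [r hr] := line_expansion P Q (affine_pt (u0 k)) w; exists r => t.
  rewrite ptE fE hr P0 add0r; congr (t * _ + _).
  rewrite big1 => [|b _]; last by rewrite P1 mul0r.
  rewrite addr0 /Q Bform; case: j {ptE fE w0 wS w Q hr} => k' i' /=.
  case: unliftP => [l ->|->]; first by rewrite meval0 xpair_eqE andbF.
  by rewrite PhiE xpair_eqE eqxx andbT eq_sym.
have [r hr] := line_expansion P^`M(lift ord0 a) Q^`M(lift ord0 a) (affine_pt (u0 k)) w; exists r => t.
rewrite ptE fE mderivD mderivZ hr P1 add0r; congr (t * _ + _).
rewrite (sum_lift ord0) w0 mulr0 add0r.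
have -> : \sum_b ((P^`M(lift ord0 a))^`M(lift ord0 b)).@[affine_pt (u0 k)] * w (lift ord0 b) =
    \sum_b Hs k a b * B j (inr (k, b)) by apply: eq_bigr => b _; rewrite !mxE wS.
rewrite /Q Bform; case: j {ptE fE w0 wS w Q hr} => k' i' /=.
case: (unliftP ord0 i') => [l ->|->].
  rewrite mderiv0 meval0 add0r.
  have -> : \sum_b Hs k a b * ((k == k')%:R * invmx (Hs k) b l) = (k == k')%:R * \sum_b Hs k a b * invmx (Hs k) b l.
    by rewrite mulr_sumr; apply: eq_bigr => b _; rewrite mulrCA.
  rewrite (sum_unit_row (hess0 k)) xpair_eqE (inj_eq lift_inj).
  by case: (k == k'); case: (a == l); rewrite ?mulr1 ?mulr0 // mul0r.
have -> : \sum_b Hs k a b * (- \sum_b0 invmx (Hs k) b b0 * ((pform (Phi k'))^`M(lift ord0 b0)).@[affine_pt (u0 k)]) =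
    - \sum_b0 (\sum_b Hs k a b * invmx (Hs k) b b0) * ((pform (Phi k'))^`M(lift ord0 b0)).@[affine_pt (u0 k)].
  under eq_bigr => b _ do rewrite mulrN mulr_sumr; rewrite sumrN; congr (- _).
  rewrite exchange_big /=; apply: eq_bigr => b0 _; rewrite mulr_suml.
  by apply: eq_bigr => b _; rewrite mulrA.
under eq_bigr => b0 _ do rewrite (sum_unit_row (hess0 k)).
rewrite (bigD1 a) //= big1 => [|b /negbTE]; last by rewrite eq_sym => ->; rewrite mul0r.
by rewrite eqxx mul1r addr0 subrr xpair_eqE andbC.
Qed.

Let inc0 j : incidence j y0 = 0.
Proof. by move: j; apply/incidenceP => k; apply: sing0. Qed.

Definition incidence_point z := forall k, singular (pform (dform z)) (dpt z k).

Theorem incidence_local : exists (P : ((dvar -> C) -> C) -> Prop) (s : (dvar -> C) -> C),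
  [/\ polyfun s /\ s y0 != 0,
      forall phi z, P phi -> incidence_point z -> s z != 0 -> phi z = 0,
      forall phi, polyfun phi -> (exists2 e : R, 0 < e &
        forall z, near y0 e z -> incidence_point z -> phi z = 0) -> P phi
    & forall phi psi, polyfun phi -> polyfun psi -> P (fun z => phi z * psi z) -> P phi \/ P psi].
Proof.
have [P [s [h1 h2 h3 h4]]] := smooth_point_fun polyfun_incidence inc0 B_deriv.
exists P, s; split=> //.
  by move=> phi z Pp /incidenceP; apply: h2.
by move=> phi hp [e e0 he]; apply: h3 => //; exists e => // z hz /incidenceP; apply: he.
Qed.

(** Only coefficients occurring in some [Phi k] receive a correction; all others follow [v] exactly.
    This keeps control of the terms of high order when the [Phi k] have low order. *)
Theorem incidence_solve : exists S r : R, [/\ 0 <= S, 0 < r &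
  forall (v : monom n -> C) rho, 0 <= rho <= r -> (forall mu, cabs (v mu) <= rho) ->
  exists x u, [/\ forall mu, (forall k, Phi k mu = 0) -> x mu = x0 mu + v mu,
    forall mu, cabs (x mu - x0 mu) <= S * rho,
    forall k l, cabs (u k l - u0 k l) <= S * rho
  & forall k, singular (pform x) (affine_pt (u k))]].
Proof.
have [S [r [S0 r0 h]]] := implicit_solution_fun polyfun_incidence inc0 B_deriv.
pose M := \sum_j \sum_a cabs (B j a).
have M0 : 0 <= M by apply: sumr_ge0 => j _; apply: sumr_ge0 => a _; apply: cabs_ge0.
exists (1 + S * M), r; split=> //; first by rewrite addr_ge0 // mulr_ge0.
move=> v rho hr hv; have rho0 : 0 <= rho by case/andP: hr.
have [[mu|kl]|zeta [z1 z2]] := h (fun a => if a is inl mu then v mu else 0) rho hr.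
- exact: hv.
- by rewrite cabs0.
have bnd a : cabs (\sum_j zeta j * B j a) <= S * M * rho.
  apply: le_trans (cabs_sum _ _ _) _; rewrite mulrAC /M mulr_sumr; apply: ler_sum => j _.
  rewrite cabsM; apply: ler_pM; rewrite ?cabs_ge0 //.
  by rewrite (bigD1 a) //= lerDl sumr_ge0 // => b _; apply: cabs_ge0.
exists (fun mu => x0 mu + v mu + \sum_j zeta j * B j (inl mu)),
  (fun k l => u0 k l + 0 + \sum_j zeta j * B j (inr (k, l))); split.
- move=> mu hmu; rewrite big1 ?addr0 // => -[k i] _.
  by rewrite /B; case: (unlift _ _) => [l|]; rewrite /= ?hmu mulr0.
- move=> mu; rewrite addrAC [x0 mu + _]addrC addrK mulrDl mul1r.
  by apply: le_trans (cabsD _ _) _; apply: lerD.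
- move=> k l; rewrite addr0 [u0 k l + _]addrC addrK mulrDl mul1r; apply: le_trans (bnd _) _.
  by rewrite lerDr.
- by have /incidenceP := z2.
Qed.

End Deformation.

(** * Dilations at a multiple point *)

Section FormLimits.
Variable R : realType.
Local Notation C := R[i].

Lemma ulim_det k (A : nat -> 'M[C]_k) (B : 'M[C]_k) :
  (forall a b, ulim (fun j => A j a b) (B a b)) -> ulim (fun j => \det (A j)) (\det B).
Proof.
move=> h; apply: ulim_sum => s _; apply: ulimM; first exact: ulim_cst.
by apply: ulim_prod => a _; apply: h.
Qed.

Section OneSequence.
Variables (n : nat) (x : nat -> monom n -> C) (x0 : monom n -> C).
Variables (p : nat -> 'I_4 -> C) (p0 : 'I_4 -> C).
Hypothesis hx : forall mu, ulim (fun j => x j mu) (x0 mu).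
Hypothesis hp : forall i, ulim (fun j => p j i) (p0 i).

Lemma ulim_pform : ulim (fun j => (pform (x j)).@[p j]) (pform x0).@[p0].
Proof.
rewrite pform_eval; apply: (@ulim_eq _ (fun j => \sum_mu x j mu * ('X_[mval mu]).@[p j])).
  by apply: uae_true => j; rewrite pform_eval.
by apply: ulim_sum => mu _; apply: ulimM => //; apply: ulim_meval.
Qed.

Lemma ulim_pform_deriv a : ulim (fun j => ((pform (x j))^`M(a)).@[p j]) ((pform x0)^`M(a)).@[p0].
Proof.
rewrite pform_deriv_eval; apply: (@ulim_eq _ (fun j => \sum_mu x j mu * (('X_[mval mu])^`M(a)).@[p j])).
  by apply: uae_true => j; rewrite pform_deriv_eval.
by apply: ulim_sum => mu _; apply: ulimM => //; apply: ulim_meval.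
Qed.

Lemma ulim_pform_hess a b : ulim (fun j => hess (pform (x j)) (p j) a b) (hess (pform x0) p0 a b).
Proof.
pose e (mu : monom n) : {mpoly C[4]} := ('X_[mval mu])^`M(a)^`M(b).
have E (y : monom n -> C) (q : 'I_4 -> C) : hess (pform y) q a b = \sum_mu y mu * (e mu).@[q].
  rewrite mxE /pform (raddf_sum (mderiv a)) (raddf_sum (mderiv b)) (raddf_sum (meval q)).
  by apply: eq_bigr => mu _; rewrite /= !mderivZ mevalZ.
have H : ulim (fun j => \sum_mu x j mu * (e mu).@[p j]) (\sum_mu x0 mu * (e mu).@[p0]).
  by apply: ulim_sum => mu _; apply: ulimM => //; apply: ulim_meval.
have EE : (fun j => hess (pform (x j)) (p j) a b) = (fun j => \sum_mu x j mu * (e mu).@[p j]).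
  by apply/boolp.funext => j; exact: (E (x j) (p j)).
apply: (eq_ind_r (fun l => ulim _ l) _ (E x0 p0)).
exact: (eq_ind_r (fun y => ulim y _) H EE).
Qed.

Lemma ulim_eq0 y (l : C) : ulim y l -> uae (fun j => y j = 0) -> l = 0.
Proof.
move=> hy h0; apply: (ulim_uniq hy); apply: (@ulim_eq _ (fun=> 0)); last exact: ulim_cst.
by apply: uaeW h0 => j ->.
Qed.

Lemma singular_limit : nonzero p0 -> uae (fun j => singular (pform (x j)) (p j)) ->
  singular (pform x0) p0.
Proof.
move=> nz h; split=> //.
  by apply: (ulim_eq0 ulim_pform); apply: uaeW h => j [].
by move=> a; apply: (ulim_eq0 (ulim_pform_deriv a)); apply: uaeW h => j [].
Qed.

End OneSequence.
End FormLimits.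

Section MultiplePoint.
Variables (R : realType) (n m : nat).
Local Notation C := R[i].
Hypothesis mn : (m <= n)%N.
Implicit Types (x : monom n -> C) (mu : monom n).

(* the degree of a monomial in the affine coordinates at the point (1,0,0,0)   *)
Definition gr mu := (n - mval mu ord0)%N.

Definition mult_ge x := forall mu, (gr mu < m)%N -> x mu = 0.
Definition lead x mu := if gr mu == m then x mu else 0.
(** Smoothness of the exceptional curve, phrased on the cone over it: in the chart [x_0 = 1] the
    cone is singular at most at its vertex. *)
Definition smooth_lead x := forall v : 'I_3 -> C,
  singular (pform (lead x)) (affine_pt v) -> forall l, v l = 0.
Definition sole_singular x := forall p : 'I_4 -> C,
  singular (pform x) p -> forall l, p (lift ord0 l) = 0.

Lemma mval_le mu : (mval mu ord0 <= n)%N.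
Proof. by rewrite -{2}(mdeg_mval mu) mdegE (bigD1 ord0) //= leq_addr. Qed.

Definition dil (t : C) : 'M[C]_4 := diag_mx (\row_i (if i == ord0 then 1 else t)).

Lemma gv_dil t p : gv (dil t) p = (fun i => if i == ord0 then p i else t * p i).
Proof.
apply/boolp.funext => i; rewrite /gv (bigD1 i) //= big1 => [|j ji].
  by rewrite !mxE eqxx mulr1n addr0; case: ifP; rewrite ?mul1r.
by rewrite !mxE [i == j]eq_sym (negbTE ji) mulr0n mul0r.
Qed.

Lemma dil_unit t : t != 0 -> dil t \in unitmx.
Proof.
move=> t0; rewrite unitmxE unitfE det_diag; apply/prodf_neq0 => i _; rewrite mxE.
by case: ifP; rewrite ?oner_eq0.
Qed.

Lemma gv_dil_affine t u : gv (dil t) (affine_pt u) = affine_pt (fun l => t * u l).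
Proof.
rewrite gv_dil; apply/boolp.funext => i; case: (unliftP ord0 i) => [l ->|->] //.
  by rewrite !affine_ptS.
by rewrite eqxx !affine_pt0.
Qed.

Lemma act_dil t x : act (dil t) (pform x) = pform (fun mu => t ^+ gr mu * x mu).
Proof.
apply: mpoly_ext => v; rewrite act_eval !pform_eval gv_dil; apply: eq_bigr => mu _.
rewrite [t ^+ _ * _]mulrC -mulrA; congr (_ * _).
rewrite !mevalX (bigD1_ord ord0) //= [in RHS](bigD1_ord ord0) //= mulrCA; congr (_ * _).
have -> : t ^+ gr mu = \prod_(i < 3) t ^+ mval mu (lift ord0 i).
  rewrite -expr_sum; congr (_ ^+ _).
  by rewrite /gr -{1}(mdeg_mval mu) mdegE (bigD1_ord ord0) //= addKn.
by rewrite -big_split; apply: eq_bigr => i _; rewrite exprMn.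
Qed.

(** Singular points, normalized by their largest coordinate, tend to a singular point of [x0], hence
    to the base point. If their affine distance [beta] were not of order [t], dilating by [beta]
    would carry the surfaces to the tangent cone of [x0] and the points to a singular point of it
    away from the vertex. *)
Lemma singular_points_shrink (x : nat -> monom n -> C) (x0 : monom n -> C) (t : nat -> R)
    (p : nat -> 'I_4 -> C) (M : R) : 0 <= M -> sole_singular x0 -> smooth_lead x0 ->
  (forall j, 0 <= t j) -> (forall mu, ulim (fun j => x j mu) (x0 mu)) ->
  (forall mu, (gr mu < m)%N -> uae (fun j => cabs (x j mu) <= M * t j ^+ (m - gr mu))) ->
  uae (fun j => singular (pform (x j)) (p j)) ->
  exists2 D : R, 0 <= D & uae (fun j => p j ord0 != 0 /\
    forall l, cabs (p j (lift ord0 l)) <= D * t j * cabs (p j ord0)).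
Proof.
move=> M0 sole smooth t0 hx small sing.
have [i iP] : exists i : nat -> 'I_4, forall j k, cabs (p j k) <= cabs (p j (i j)).
  suff ex j : exists i, forall k, cabs (p j k) <= cabs (p j i).
    by have [i hi] := boolp.choice ex; exists i.
  by exists [arg max_(i > ord0) cabs (p j i)]%O; case: arg_maxP => // k _ hk l; apply: hk.
pose q j k := p j k / p j (i j).
have pi0 : uae (fun j => p j (i j) != 0).
  apply: uaeW sing => j [[k pk] _ _]; rewrite -cabs_gt0; apply: lt_le_trans (iP j k).
  by rewrite cabs_gt0.
have q1 j k : cabs (q j k) <= 1.
  rewrite /q cabsM cabsV; case: (eqVneq (p j (i j)) 0) => [->|ne].
    by rewrite cabs0 invr0 mulr0 ler01.
  by rewrite ler_pdivrMr ?cabs_gt0 // mul1r.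
have sq : uae (fun j => singular (pform (x j)) (q j)).
  apply: uaeW (uae_and pi0 sing) => j [p0 sj].
  apply: (singular_same (pform_homog (x j)) _ sj); exists (p j (i j))^-1; first by rewrite invr_eq0.
  by move=> k; rewrite /q mulrC.
have exl k : exists l, ulim (fun j => q j k) l by apply: (@bounded_limit _ _ 1); apply: uae_true => j.
have [q0 hq] := boolp.choice exl.
have nzq : nonzero q0.
  apply: boolp.contrapT => no; have : uae (fun j => forall k, cabs (q j k) < 1).
    apply: uae_all => k; apply: uaeW (hq k 1 ltr01) => j; rewrite (_ : q0 k = 0) ?subr0 //.
    by apply/eqP/negPn/negP => h; apply: no; exists k.
  move=> h; have [j [pj hj]] := uae_ex (uae_and pi0 h).
  by have := hj (i j); rewrite /q divff // cabs1 ltxx.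
have sq0 := singular_limit hx hq nzq sq.
have q0l l : q0 (lift ord0 l) = 0 by apply: sole.
have q00 : q0 ord0 != 0.
  by have [k] := nzq; case: (unliftP ord0 k) => [l ->|->] //; rewrite q0l eqxx.
have qj0 : uae (fun j => q j ord0 != 0) by apply: ulim_neq0 (hq ord0) q00.
pose b j l := q j (lift ord0 l) / q j ord0.
have hb l : ulim (fun j => b j l) 0.
  rewrite -(mul0r (q0 ord0)^-1) -(q0l l); apply: ulimM => //; exact: ulimV.
pose beta j : R := \sum_l cabs (b j l).
have beta0 j : 0 <= beta j by apply: sumr_ge0 => l _; apply: cabs_ge0.
have b_le j l : cabs (b j l) <= beta j.
  by rewrite /beta (bigD1 l) //= lerDl sumr_ge0 // => k _; apply: cabs_ge0.
have hbeta : ulim (fun j => (beta j)%:C%C) 0.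
  apply: (@ulim_eq _ (fun j => \sum_l ((cabs (b j l))%:C%C : C))).
    by apply: uae_true => j; rewrite /beta rmorph_sum.
  have e3 : \sum_(l < 3) (0 : C) = 0 by rewrite big1.
  rewrite -[X in ulim _ X]e3.
  apply: ulim_sum => l _ e e0; apply: uaeW (hb l e e0) => j.
  by rewrite !subr0 cabs_real ger0_norm ?cabs_ge0.
have sb : uae (fun j => singular (pform (x j)) (affine_pt (b j))).
  apply: uaeW (uae_and qj0 sq) => j [p0 sj].
  apply: (singular_same (pform_homog (x j)) _ sj); exists (q j ord0)^-1; first by rewrite invr_eq0.
  move=> k; case: (unliftP ord0 k) => [l ->|->]; rewrite ?affine_ptS ?affine_pt0 /b; first by rewrite mulrC.
  by rewrite mulVf.
have [D D0 hD] : exists2 D : R, 0 <= D & uae (fun j => beta j <= D * t j).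
  apply: boolp.contrapT => no.
  have big D : 0 <= D -> uae (fun j => D * t j < beta j).
    move=> D0; apply: boolp.contrapT => h; apply: no; exists D => //.
    have /uae_not := h; apply: uaeW => j; rewrite ltNge => h1.
    by apply: boolp.contrapT => h2; apply: h1; apply/negP.
  have bpos : uae (fun j => 0 < beta j) by apply: uaeW (big 0 (lexx _)) => j; rewrite mul0r.
  pose tau j := (t j / beta j)%:C%C : C.
  have htau : ulim tau 0.
    move=> e e0; have e1 : 0 <= 2 / e by rewrite divr_ge0 // ltW.
    apply: uaeW (uae_and bpos (big _ e1)) => j [bj hj].
    rewrite subr0 /tau cabs_real ger0_norm ?divr_ge0 // ltr_pdivrMr //.
    move: hj; rewrite mulrAC ltr_pdivrMr // => hj; rewrite mulrC.
    by move: (t0 j) hj; lra.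
  (* The coefficients of the surface dilated by [beta] and divided by [beta^m]. Terms of affine
     degree above [m] tend to 0 because [beta] does, those below because [t / beta] does. *)
  pose y j mu : C := if (m <= gr mu)%N then (beta j)%:C%C ^+ (gr mu - m) * x j mu
     else x j mu / (beta j)%:C%C ^+ (m - gr mu).
  have bC : uae (fun j => (beta j)%:C%C != 0 :> C).
    by apply: uaeW bpos => j bj; rewrite -cabs_gt0 cabs_real ger0_norm.
  have hy mu : ulim (fun j => y j mu) (lead x0 mu).
    rewrite /y /lead; case: leqP => [le|lt].
      case: eqP => [e|ne].
        by rewrite e subnn; apply: ulim_eq (hx mu); apply: uae_true => j; rewrite expr0 mul1r.
      have [M' hM'] := ulim_bounded (hx mu); apply: ulim0M hM'.
      have -> : (0 : C) = 0 ^+ (gr mu - m) by rewrite expr0n; case: eqP => //; lia.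
      exact: ulimX.
    rewrite ltn_eqF //; have [k kE] : exists k, (m - gr mu)%N = k.+1 by exists (m - gr mu).-1; lia.
    have htk : ulim (fun j => tau j ^+ k.+1 * M%:C%C) 0.
      apply: (@ulim0M _ _ _ (cabs M%:C%C)); last by apply: uae_true => j.
      have -> : (0 : C) = 0 ^+ k.+1 by rewrite expr0n.
      exact: ulimX.
    move=> e e0; have := htk e e0 => hte.
    apply: uaeW (uae_and bpos (uae_and hte (small mu lt))) => j [bj [h1 h2]].
    rewrite subr0 in h1; apply: le_lt_trans h1.
    rewrite kE in h2; rewrite subr0 kE !cabsM cabsV !cabsX /tau !cabs_real !ger0_norm ?divr_ge0 //.
    rewrite ler_pdivrMr ?exprn_gt0 // expr_div_n mulrAC divfK ?expf_neq0 ?gt_eqF //.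
    by rewrite mulrC.
  pose w j l := b j l / (beta j)%:C%C.
  have sw : uae (fun j => singular (pform (y j)) (affine_pt (w j))).
    apply: uaeW (uae_and bC sb) => j [bj sj].
    have -> : pform (y j) = ((beta j)%:C%C ^+ m)^-1 *: act (dil (beta j)%:C%C) (pform (x j)).
      rewrite act_dil /pform scaler_sumr; apply: eq_bigr => mu _; rewrite scalerA; congr (_ *: _).
      rewrite /y; case: leqP => h.
        by rewrite -{2}(subnK h) exprD mulrA; field; rewrite expf_neq0.
      by rewrite -{2}(subnK (ltnW h)) exprD invfM; field; rewrite !expf_neq0.
    apply/singularZ; first by rewrite invr_eq0 expf_neq0.
    apply/singular_act; first exact: dil_unit.
    rewrite gv_dil_affine; have -> : (fun l => (beta j)%:C%C * w j l) = b j => //.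
    by apply/boolp.funext => l; rewrite /w mulrC divfK.
  have w1 : uae (fun j => forall l, cabs (w j l) <= 1).
    apply: uaeW bpos => j bj l.
    by rewrite /w cabsM cabsV cabs_real ger0_norm // ler_pdivrMr // mul1r.
  have exw l : exists l', ulim (fun j => w j l) l'.
    by apply: (@bounded_limit _ _ 1); apply: uaeW w1 => j.
  have [w0 hw] := boolp.choice exw.
  have haff k : ulim (fun j => affine_pt (w j) k) (affine_pt w0 k).
    by rewrite /affine_pt; case: unliftP => [l _|_]; [exact: hw | exact: ulim_cst].
  have nza : nonzero (affine_pt w0) by exists ord0; rewrite affine_pt0 oner_eq0.
  have w00 := smooth _ (singular_limit hy haff nza sw).
  (* The moduli of the three coordinates of [w j] add up to 1, which is impossible if each is below
     1/4. *)
  have : uae (fun j => forall l, cabs (w j l) < 4^-1).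
    apply: uae_all => l; have h4 : (0 : R) < 4^-1 by rewrite invr_gt0.
    by apply: uaeW (hw l _ h4) => j; rewrite w00 subr0.
  move=> h; have [j [bj hj]] := uae_ex (uae_and bpos h).
  have : \sum_l cabs (w j l) = 1.
    have -> : \sum_l cabs (w j l) = beta j / beta j.
      rewrite {1}/beta mulr_suml; apply: eq_bigr => l _.
      by rewrite /w cabsM cabsV cabs_real ger0_norm.
    by rewrite divff // gt_eqF.
  rewrite !big_ord_recl big_ord0 => e.
  have h1 := hj ord0; have h2 := hj (lift ord0 ord0); have h3 := hj (lift ord0 (lift ord0 ord0)).
  by move: e h1 h2 h3; lra.
exists D => //; apply: uaeW (uae_and pi0 (uae_and qj0 hD)) => j [pj [qj hj]].
have pj0 : p j ord0 != 0 by move: qj; rewrite /q mulf_eq0 negb_or => /andP [].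
split=> // l; have : cabs (b j l) <= D * t j by apply: le_trans hj.
rewrite /b /q; have -> : p j (lift ord0 l) / p j (i j) / (p j ord0 / p j (i j)) = p j (lift ord0 l) / p j ord0.
  by field; rewrite pj0 pj.
by rewrite cabsM cabsV ler_pdivrMr // cabs_gt0.
Qed.

End MultiplePoint.

(** * Isolation of nondegenerate singular points *)

Section LocalUniqueness.
Variable R : realType.
Local Notation C := R[i].

(** Divided differences, built by induction on the polynomial; they play over [C] the role of the
    mean value theorem. *)
Lemma mean_value n (P : {mpoly C[n]}) : exists A : 'I_n -> ('I_n -> C) -> ('I_n -> C) -> C,
  [/\ forall x y, P.@[x] - P.@[y] = \sum_s A s x y * (x s - y s),
      forall s x, A s x x = (P^`M(s)).@[x]
    & forall s (x y : nat -> 'I_n -> C) (x0 y0 : 'I_n -> C), (forall a, ulim (fun j => x j a) (x0 a)) ->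
        (forall a, ulim (fun j => y j a) (y0 a)) -> ulim (fun j => A s (x j) (y j)) (A s x0 y0)].
Proof.
elim/mpoly_alg_ind: P => [c|i|p q [A [A1 A2 A3]] [B [B1 B2 B3]]|p q [A [A1 A2 A3]] [B [B1 B2 B3]]].
- exists (fun _ _ _ => 0); split=> [x y|s x|*]; last exact: ulim_cst.
    by rewrite !mevalC subrr big1 // => s _; rewrite mul0r.
  by rewrite mderivC meval0.
- exists (fun s _ _ => (s == i)%:R); split=> [x y|s x|*]; last exact: ulim_cst.
    by rewrite !mevalXU (bigD1 i) //= big1 ?addr0 ?eqxx ?mul1r // => s /negbTE ->; rewrite mul0r.
  rewrite mderivX mnm1E mevalZ eq_sym; case: eqP => [->|]; last by rewrite mul0r.
  have -> : (U_(s) - U_(s) = 0)%MM by apply/mnmP => a; rewrite mnmBE mnm0E subnn.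
  by rewrite mpolyX0 meval1 mulr1.
- exists (fun s x y => A s x y + B s x y); split=> [x y|s x|s x y x0 y0 hx hy].
  + rewrite !mevalD opprD addrACA A1 B1 -big_split; apply: eq_bigr => s _ /=; by rewrite mulrDl.
  + by rewrite mderivD mevalD A2 B2.
  + by apply: ulimD; [apply: A3 | apply: B3].
- exists (fun s x y => A s x y * q.@[x] + p.@[y] * B s x y); split=> [x y|s x|s x y x0 y0 hx hy].
  + have -> : (p * q).@[x] - (p * q).@[y] = (p.@[x] - p.@[y]) * q.@[x] + p.@[y] * (q.@[x] - q.@[y]).
      by rewrite !mevalM mulrBl mulrBr addrA subrK.
    rewrite A1 B1 mulr_suml mulr_sumr -big_split; apply: eq_bigr => s _ /=.
    by rewrite mulrDl mulrAC mulrA.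
  + by rewrite mderivM mevalD !mevalM A2 B2.
  + by apply: ulimD; apply: ulimM; [apply: A3 | apply: ulim_meval | apply: ulim_meval | apply: B3].
Qed.

Lemma chart_hessE i p (F : {mpoly C[4]}) a l :
  chart_hess i p F a l = (F^`M(lift i a)^`M(lift i l)).@[p].
Proof. by rewrite !mxE. Qed.

Lemma ulim_affine (w : nat -> 'I_3 -> C) w0 k : (forall l, ulim (fun j => w j l) (w0 l)) ->
  ulim (fun j => affine_pt (w j) k) (affine_pt w0 k).
Proof. by move=> h; rewrite /affine_pt; case: unliftP => [l _|_]; [exact: h | exact: ulim_cst]. Qed.

Lemma ulim_chart_hess n (x : nat -> monom n -> C) x0 (b : nat -> 'I_3 -> C) v a l :
  (forall mu, ulim (fun j => x j mu) (x0 mu)) -> (forall l, ulim (fun j => b j l) (v l)) ->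
  ulim (fun j => chart_hess ord0 (affine_pt (b j)) (pform (x j)) a l) (chart_hess ord0 (affine_pt v) (pform x0) a l).
Proof.
move=> hx hb; have H := ulim_pform_hess hx (fun k => ulim_affine k hb) (lift ord0 a) (lift ord0 l).
have E p F : chart_hess ord0 p F a l = hess F p (lift ord0 a) (lift ord0 l) :> C by rewrite mxE.
have EE : (fun j => chart_hess ord0 (affine_pt (b j)) (pform (x j)) a l) =
    (fun j => hess (pform (x j)) (affine_pt (b j)) (lift ord0 a) (lift ord0 l)).
  by apply/boolp.funext => j; exact: E.
apply: (eq_ind_r (fun l => ulim _ l) _ (E _ _)).
exact: (eq_ind_r (fun y => ulim y _) H EE).
Qed.

(** The difference of two singular points is annihilated by a matrix of divided differences of the
    gradient, which tends to the invertible Hessian at their common limit. *)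
Lemma singular_points_isolated n (x : nat -> monom n -> C) x0 (b c : nat -> 'I_3 -> C) v :
  (forall mu, ulim (fun j => x j mu) (x0 mu)) ->
  (forall l, ulim (fun j => b j l) (v l)) -> (forall l, ulim (fun j => c j l) (v l)) ->
  chart_hess ord0 (affine_pt v) (pform x0) \in unitmx ->
  uae (fun j => singular (pform (x j)) (affine_pt (b j))) ->
  uae (fun j => singular (pform (x j)) (affine_pt (c j))) ->
  uae (fun j => b j = c j).
Proof.
move=> hx hb hc hu sb sc.
pose e (mu : monom n) (a : 'I_3) : {mpoly C[4]} := ('X_[mval mu])^`M(lift ord0 a).
have [A hA] := boolp.choice (fun mua : monom n * 'I_3 => mean_value (e mua.1 mua.2)).
have A1 mu a := let: And3 h _ _ := hA (mu, a) in h.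
have A2 mu a := let: And3 _ h _ := hA (mu, a) in h.
have A3 mu a := let: And3 _ _ h := hA (mu, a) in h.
pose M j : 'M[C]_3 := \matrix_(a, l) \sum_mu x j mu * A (mu, a) (lift ord0 l) (affine_pt (b j)) (affine_pt (c j)).
pose M0 : 'M[C]_3 := \matrix_(a, l) \sum_mu x0 mu * A (mu, a) (lift ord0 l) (affine_pt v) (affine_pt v).
have M0E : M0 = chart_hess ord0 (affine_pt v) (pform x0).
  apply/matrixP => a l; rewrite !mxE.
  rewrite /pform (raddf_sum (mderiv (lift ord0 a))) (raddf_sum (mderiv (lift ord0 l))) (raddf_sum (meval (affine_pt v))).
  by apply: eq_bigr => mu _; rewrite /= !mderivZ mevalZ A2.
have hM : ulim (fun j => \det (M j)) (\det M0).
  apply: ulim_det => a l; rewrite [M0 a l]mxE.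
  apply: (@ulim_eq _ (fun j => \sum_mu x j mu * A (mu, a) (lift ord0 l) (affine_pt (b j)) (affine_pt (c j)))).
    by apply: uae_true => j; rewrite [M j a l]mxE.
  apply: ulim_sum => mu _; apply: ulimM => //; apply: A3 => k; exact: ulim_affine.
have dM : uae (fun j => \det (M j) != 0).
  by apply: ulim_neq0 hM _; rewrite M0E -unitfE -unitmxE.
apply: uaeW (uae_and dM (uae_and sb sc)) => j [dj [[_ _ sbj] [_ _ scj]]].
have uM : M j \in unitmx by rewrite unitmxE unitfE.
pose d : 'cV[C]_3 := \col_l (b j l - c j l).
have Md : M j *m d = 0.
  apply/colP => a; rewrite mxE [RHS]mxE.
  transitivity (((pform (x j))^`M(lift ord0 a)).@[affine_pt (b j)] - ((pform (x j))^`M(lift ord0 a)).@[affine_pt (c j)]);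
    last by rewrite sbj scj subrr.
  rewrite !pform_deriv_eval -sumrB.
  have -> : \sum_l M j a l * d l 0 = \sum_l \sum_mu x j mu * (A (mu, a) (lift ord0 l) (affine_pt (b j)) (affine_pt (c j)) * (b j l - c j l)).
    by apply: eq_bigr => l _; rewrite !mxE mulr_suml; apply: eq_bigr => mu _; rewrite mulrA.
  rewrite exchange_big /=; apply: eq_bigr => mu _; rewrite -mulr_sumr -mulrBr; congr (_ * _).
  rewrite (A1 mu a) (sum_lift ord0) !affine_pt0 subrr mulr0 add0r.
  by apply: eq_bigr => l _; rewrite !affine_ptS.
have d0 : d = 0 by rewrite -[d](mulKmx uM) Md mulmx0.
apply/boolp.funext => l; apply/eqP; rewrite -subr_eq0; apply/eqP.
by have /colP /(_ l) := d0; rewrite !mxE.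
Qed.

Lemma node_of_chart_hess d (F : {mpoly C[4]}) x i : F \is d.-homog -> singular F x -> x i != 0 ->
  chart_hess i x F \in unitmx -> node F x.
Proof.
move=> hF sF xi hu; apply/(nodeP _ hF); split=> // v hv.
have hx : hess F x *m cvec x = 0.
  by rewrite (hess_point x hF); case: sF => _ _ sF; apply/colP => j; rewrite !mxE sF mulr0.
pose c := v i 0 / x i; exists c; pose w := v - c *: cvec x.
have wi : w i 0 = 0 by rewrite !mxE /c divfK ?subrr.
have hw : hess F x *m w = 0 by rewrite mulmxBr hv -scalemxAr hx scaler0 subrr.
pose w' : 'cV[C]_3 := \col_l w (lift i l) 0.
have hw' : chart_hess i x F *m w' = 0.
  apply/colP => k; have /colP /(_ (lift i k)) := hw; rewrite mxE [RHS]mxE (sum_lift i) wi mulr0 add0r => e.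
  by rewrite mxE [RHS]mxE -[RHS]e; apply: eq_bigr => l _; rewrite [w' _ _]mxE [chart_hess _ _ _ _ _]mxE.
have w0 : w' = 0 by rewrite -[w'](mulKmx hu) hw' mulmx0.
apply/eqP; rewrite -subr_eq0 -/w; apply/eqP/colP => j; rewrite [RHS]mxE.
by case: (unliftP i j) => [l ->|->] //; have /colP /(_ l) := w0; rewrite !mxE.
Qed.

End LocalUniqueness.

(** * Nodal surfaces tending to a surface with a multiple point *)

Section Raising.
Variables (R : realType) (n m : nat).
Local Notation C := R[i].
Hypothesis mn : (m <= n)%N.

Lemma singular_affineP d (F : {mpoly C[4]}) u : F \is d.-homog ->
  singular F (affine_pt u) <-> F.@[affine_pt u] = 0 /\ forall l, (F^`M(lift ord0 l)).@[affine_pt u] = 0.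
Proof.
move=> hF; split=> [[_ h0 h1]|[h0 h1]]; first by split.
by apply: (@singular_euler _ d _ _ ord0) => //; rewrite affine_pt0 oner_eq0.
Qed.

Lemma deriv_X0_mul N (P : {mpoly C[4]}) l :
  ('X_ord0 ^+ N * P)^`M(lift ord0 l) = 'X_ord0 ^+ N * P^`M(lift ord0 l).
Proof.
rewrite mderivM mpolyXn mderivX mulmnE mnm1E.
have -> : (ord0 == lift ord0 l) = false by [].
by rewrite mul0n scale0r mul0r add0r.
Qed.

Lemma X0_affine N u : ('X_ord0 ^+ N : {mpoly C[4]}).@[affine_pt u] = 1.
Proof. by rewrite Xexp_eval affine_pt0 expr1n. Qed.

Lemma X0_mul_affine N (P : {mpoly C[4]}) u : ('X_ord0 ^+ N * P).@[affine_pt u] = P.@[affine_pt u].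
Proof. by rewrite mevalM X0_affine mul1r. Qed.

Lemma singular_X0_mul d N (P : {mpoly C[4]}) u : P \is d.-homog ->
  singular ('X_ord0 ^+ N * P) (affine_pt u) <-> singular P (affine_pt u).
Proof.
move=> hP; have hQ : 'X_ord0 ^+ N * P \is (N + d).-homog by apply: dhomogM => //; apply: X_homog.
rewrite (singular_affineP u hP) (singular_affineP u hQ) X0_mul_affine.
have E l : (('X_ord0 ^+ N * P)^`M(lift ord0 l)).@[affine_pt u] = (P^`M(lift ord0 l)).@[affine_pt u].
  by rewrite deriv_X0_mul X0_mul_affine.
by split=> -[h0 h1]; split=> // l; [rewrite -E | rewrite E].
Qed.

Lemma chart_hess_X0_mul N (P : {mpoly C[4]}) u :
  chart_hess ord0 (affine_pt u) ('X_ord0 ^+ N * P) = chart_hess ord0 (affine_pt u) P.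
Proof. have E a l : ('X_ord0 ^+ N * P)^`M(lift ord0 a)^`M(lift ord0 l) = 'X_ord0 ^+ N * P^`M(lift ord0 a)^`M(lift ord0 l).
  by rewrite deriv_X0_mul deriv_X0_mul.
apply/matrixP => a l; rewrite [LHS]chart_hessE [RHS]chart_hessE.
by apply: etrans (congr1 (meval (affine_pt u)) (E a l)) _; apply: X0_mul_affine. Qed.

(** Adds the plane [x_0 = 0] with multiplicity [n - m], which is invisible in the chart [x_0 = 1]:
    the affine equation and the nodes stay the same. *)
Definition raise (G : monom m -> C) : monom n -> C := fcoef ('X_ord0 ^+ (n - m) * pform G).

Lemma pform_raise G : pform (raise G) = 'X_ord0 ^+ (n - m) * pform G.
Proof.
rewrite /raise pformK //; apply: (@dhomogM_eq _ _ (n - m) m); rewrite ?X_homog ?pform_homog //.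
by rewrite subnK.
Qed.

Lemma raise_low G mu : (m < gr mu)%N -> raise G mu = 0.
Proof.
move=> h; apply/eqP/negPn/negP; rewrite /raise /fcoef mulrC mpolyXn => /mcoeff_mulX_ge.
move/mnm_lepP => /(_ ord0); rewrite mulmnE mnm1E eqxx mul1n; move: h; rewrite /gr.
by have := mval_le mu; lia.
Qed.

Section Approximants.
Variable delta : nat.
Variables (G : monom m -> C) (u : 'I_delta -> 'I_3 -> C) (H : 'I_delta -> {mpoly C[4]}).
Hypothesis m0 : (0 < m)%N.
Hypothesis nodG : nodes_enum (pform G) (fun k => affine_pt (u k)).
Hypothesis hH : forall k, H k \is m.-1.-homog.
Hypothesis detH : value_det H (fun k => affine_pt (u k)) != 0.

Let hG : pform G \is m.-homog. Proof. exact: pform_homog. Qed.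

Lemma raise_singular k : singular (pform (raise G)) (affine_pt (u k)).
Proof.
rewrite pform_raise; apply/(singular_X0_mul _ _ hG).
by have [nd _ _] := nodG; apply: (node_singular hG (nd k)).
Qed.

Lemma raise_hess k : chart_hess ord0 (affine_pt (u k)) (pform (raise G)) \in unitmx.
Proof.
rewrite pform_raise chart_hess_X0_mul; have [nd _ _] := nodG.
by apply: (node_chart_hess hG (nd k)); rewrite affine_pt0 oner_eq0.
Qed.

Let Mv : 'M[C]_delta := \matrix_(i, l) (H i).@[affine_pt (u l)].
Let uMv : Mv \in unitmx. Proof. by rewrite unitmxE unitfE. Qed.

(** The dual basis of the evaluations at the nodes. Starting from degree [m - 1] yields the
    additional factor [X_0], so only monomials of affine degree below [m] occur, and nodes are moved
    without touching the leading form at the multiple point. *)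
Definition node_forms k : monom n -> C :=
  fcoef ('X_ord0 ^+ (n - m).+1 * \sum_i (invmx Mv) k i *: H i).

Let comb_homog k : \sum_i (invmx Mv) k i *: H i \is m.-1.-homog.
Proof. by apply: rpred_sum => i _; apply/rpredZ/hH. Qed.

Lemma node_formsE k l : (pform (node_forms k)).@[affine_pt (u l)] = (k == l)%:R.
Proof.
rewrite /node_forms pformK; last first.
  by apply: (@dhomogM_eq _ _ (n - m).+1 m.-1); [exact: X_homog | exact: comb_homog | lia].
rewrite X0_mul_affine (raddf_sum (meval (affine_pt (u l)))).
have /matrixP /(_ k l) := mulVmx uMv; rewrite mxE [RHS]mxE => <-.
by apply: eq_bigr => i _; rewrite /= mevalZ [Mv _ _]mxE.
Qed.

Lemma node_forms_low k mu : (m <= gr mu)%N -> node_forms k mu = 0.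
Proof.
move=> h; apply/eqP/negPn/negP; rewrite /node_forms /fcoef mulrC mpolyXn => /mcoeff_mulX_ge.
move/mnm_lepP => /(_ ord0); rewrite mulmnE mnm1E eqxx mul1n; move: h; rewrite /gr.
by have := mval_le mu; move: m0; lia.
Qed.

Variable x : monom n -> C.
Hypothesis multx : mult_ge m x.
Hypothesis leadx : lead m x = lead m (raise G).

Let lead_eq mu : gr mu = m -> x mu = raise G mu.
Proof. by move=> h; have /(congr1 (fun f => f mu)) := leadx; rewrite /lead h eqxx. Qed.

(* [F j] tends to [x]; rescaled at the multiple point it becomes [X j], which   *)
(* tends to x_0^(n-m) G and keeps the nodes of G                               *)
Lemma approximants_exist : exists (F X : nat -> monom n -> C) (U : nat -> 'I_delta -> 'I_3 -> C) (M : R),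
  let t j : R := j.+1%:R^-1 in
  [/\ 0 <= M,
      forall j, pform (X j) = ((t j)%:C%C ^+ m)^-1 *: act (dil (t j)%:C%C) (pform (F j)),
      [/\ forall mu, ulim (fun j => X j mu) (raise G mu),
        forall k l, ulim (fun j => U j k l) (u k l) &
        forall mu, ulim (fun j => F j mu) (x mu)],
      forall mu, (gr mu < m)%N -> uae (fun j => cabs (F j mu) <= M * t j ^+ (m - gr mu))
    & uae (fun j => forall k, singular (pform (X j)) (affine_pt (U j k)))].
Proof.
pose t j : R := j.+1%:R^-1; pose tC j : C := (t j)%:C%C.
have t_gt0 j : 0 < t j by rewrite invr_gt0 ltr0Sn.
have t_le1 j : t j <= 1 by rewrite invf_le1 ?ltr0Sn // ler1n.
have tC0 j : tC j != 0 by rewrite -cabs_gt0 cabs_real gtr0_norm.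
have cabs_t j k : cabs (tC j ^+ k) = t j ^+ k by rewrite cabsX cabs_real gtr0_norm.
have htC : ulim tC 0 by exact: ulim_inv_nat.
have [S [r [S0 r0 hsol]]] := incidence_solve raise_singular raise_hess node_formsE.
pose Mx := \sum_mu cabs (x mu).
have Mx0 : 0 <= Mx by apply: sumr_ge0 => mu _; apply: cabs_ge0.
have x_le mu : cabs (x mu) <= Mx.
  by rewrite /Mx (bigD1 mu) //= lerDl sumr_ge0 // => nu _; apply: cabs_ge0.
(* The terms of [x] beyond the leading form, dilated by [t]. They tend to 0, and the solution keeps
   them exactly because no [node_forms] reaches affine degree [m]. *)
pose v j mu : C := if (m < gr mu)%N then tC j ^+ (gr mu - m) * x mu else 0.
have v_le j mu : cabs (v j mu) <= t j * Mx.
  rewrite /v; case: ltnP => h; last by rewrite cabs0 mulr_ge0 // ltW.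
  rewrite cabsM cabs_t; apply: ler_pM; rewrite ?cabs_ge0 ?exprn_ge0 ?(ltW (t_gt0 j)) ?x_le //.
  have -> : (gr mu - m)%N = (gr mu - m).-1.+1 by lia.
  by rewrite exprS ler_piMr ?(ltW (t_gt0 j)) // exprn_ile1 // ltW.
have ex j : exists xu : (monom n -> C) * ('I_delta -> 'I_3 -> C), t j * Mx <= r ->
    [/\ forall mu, (m <= gr mu)%N -> xu.1 mu = raise G mu + v j mu,
    forall mu, cabs (xu.1 mu - raise G mu) <= S * (t j * Mx),
    forall k l, cabs (xu.2 k l - u k l) <= S * (t j * Mx)
  & forall k, singular (pform xu.1) (affine_pt (xu.2 k))].
  have [h|h] := boolp.EM (t j * Mx <= r); last by exists (raise G, u) => /h.
  have [|x' [u' [h1 h2 h3 h4]]] := hsol (v j) (t j * Mx) _ (v_le j).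
    by rewrite h andbT mulr_ge0 // ltW.
  exists (x', u') => _; split=> // mu hmu; apply: h1 => k; exact: node_forms_low.
have [XU hXU] := boolp.choice ex.
have small e : 0 < e -> uae (fun j => t j * Mx <= e).
  move=> e0; have hM : ulim (fun j => tC j * Mx%:C%C) 0.
    apply: (@ulim0M _ _ _ (cabs Mx%:C%C)) => //; exact: uae_true.
  apply: uaeW (hM e e0) => j; rewrite subr0 cabsM !cabs_real !ger0_norm //; first exact: ltW.
  exact: (ltW (t_gt0 j)).
have good := uaeW hXU (small r r0).
have small0 (y : nat -> C) l : uae (fun j => cabs (y j - l) <= S * (t j * Mx)) -> ulim y l.
  move=> h e e0; have S1 : 0 < S + 1 by rewrite ltr_wpDl.
  have e1 : 0 < e / (S + 1) by rewrite divr_gt0.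
  apply: uaeW (uae_and h (small _ e1)) => j [h1 h2]; apply: le_lt_trans h1 _.
  apply: (@le_lt_trans _ _ (S * (e / (S + 1)))); first exact: ler_wpM2l.
  by rewrite mulrA ltr_pdivrMr // mulrC ltr_pM2l // ltrDl ltr01.
pose X j := (XU j).1; pose U j := (XU j).2.
(* Dilating back: in affine degree at least [m] the coefficients of [x] reappear exactly, below it a
   positive power of [t] remains. *)
pose F j mu : C := tC j ^+ m * (tC j ^+ gr mu)^-1 * X j mu.
pose M := \sum_mu cabs (raise G mu) + S * Mx.
have F_high mu : (m <= gr mu)%N -> uae (fun j => F j mu = x mu).
  move=> h; apply: uaeW good => j [h1 _ _ _]; rewrite /F /X h1 // /v.
  case: ltnP => h'; last first.
    have e : gr mu = m by apply/eqP; rewrite eqn_leq h h'.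
    by rewrite e mulfV ?expf_neq0 // mul1r addr0 lead_eq.
  rewrite raise_low // add0r.
  have -> : tC j ^+ gr mu = tC j ^+ (gr mu - m) * tC j ^+ m by rewrite -exprD subnK.
  move: (expf_neq0 m (tC0 j)) (expf_neq0 (gr mu - m) (tC0 j)).
  by move: (tC j ^+ m) (tC j ^+ _) (x mu) => y z w y0 z0; field; rewrite y0 z0.
have hFX j : pform (X j) = (tC j ^+ m)^-1 *: act (dil (tC j)) (pform (F j)).
  rewrite act_dil /pform scaler_sumr; apply: eq_bigr => mu _; rewrite scalerA; congr (_ *: _).
  by rewrite /F; field; rewrite !expf_neq0.
have F_low mu : (gr mu < m)%N -> uae (fun j => cabs (F j mu) <= M * t j ^+ (m - gr mu)).
  move=> h; apply: uaeW good => j [_ h1 _ _].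
  have -> : F j mu = tC j ^+ (m - gr mu) * X j mu.
    by rewrite /F -{1}(subnK (ltnW h)) exprD mulfK // expf_neq0.
  rewrite cabsM cabs_t mulrC; apply: ler_wpM2r; first by rewrite exprn_ge0 // ltW.
  have -> : X j mu = raise G mu + (X j mu - raise G mu) by rewrite addrC subrK.
  apply: le_trans (cabsD _ _) _; apply: lerD.
    by rewrite (bigD1 mu) //= lerDl sumr_ge0 // => nu _; apply: cabs_ge0.
  apply: le_trans (h1 mu) _; apply: ler_wpM2l => //.
  by rewrite ler_piMl.
exists F, X, U, M; split=> //.
- by rewrite addr_ge0 // ?mulr_ge0 // sumr_ge0 // => mu _; apply: cabs_ge0.
- split=> [mu|k l|mu].
  + by apply: small0; apply: uaeW good => j [_ h _ _]; exact: h.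
  + by apply: small0; apply: uaeW good => j [_ _ h _]; exact: h.
  case: (leqP m (gr mu)) => h.
    by apply: ulim_eq (ulim_cst (x mu)); apply: uaeW (F_high mu h) => j.
  rewrite multx //; have [k kE] : exists k, (m - gr mu)%N = k.+1 by exists (m - gr mu).-1; lia.
  have htk : ulim (fun j => tC j ^+ k.+1 * M%:C%C) 0.
    apply: (@ulim0M _ _ _ (cabs M%:C%C)); last exact: uae_true.
    have -> : (0 : C) = 0 ^+ k.+1 by rewrite expr0n.
    exact: ulimX.
  move=> e e0; apply: uaeW (uae_and (F_low mu h) (htk e e0)) => j [h1].
  rewrite !subr0 => h2; apply: le_lt_trans h1 (le_lt_trans _ h2).
  rewrite cabsM cabs_t cabs_real kE mulrC; apply: ler_wpM2l; first by rewrite exprn_ge0 // ltW.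
  exact: ler_norm.
- by apply: uaeW good => j [_ _ _ h].
Qed.

Hypothesis solex : sole_singular x.
Hypothesis smoothx : smooth_lead m x.

(** The nodes of [F j] are those of [X j], contracted; the point is that no other singularity
    exists. A stray one would lie within a multiple of [t] of the base point, so after dilation it
    would converge to a node of [G], near which the singular point is unique. *)
Theorem nodal_approximants : exists (F X : nat -> monom n -> C) (U : nat -> 'I_delta -> 'I_3 -> C),
  let t j : C := (j.+1%:R^-1 : R)%:C%C in
  [/\ forall j, pform (X j) = (t j ^+ m)^-1 *: act (dil (t j)) (pform (F j)),
      [/\ forall mu, ulim (fun j => X j mu) (raise G mu),
        forall k l, ulim (fun j => U j k l) (u k l) &
        forall mu, ulim (fun j => F j mu) (x mu)],
      uae (fun j => forall k, singular (pform (X j)) (affine_pt (U j k)))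
    & uae (fun j => nodes_enum (pform (F j)) (fun k => affine_pt (fun l => t j * U j k l)))].
Proof.
have [F [X [U [M [M0 FX [hX hU hF] low sX]]]]] := approximants_exist.
pose t j : R := j.+1%:R^-1; pose tC j : C := (t j)%:C%C.
have t_gt0 j : 0 < t j by rewrite invr_gt0 ltr0Sn.
have tC0 j : tC j != 0 by rewrite -cabs_gt0 cabs_real gtr0_norm.
have c0 j : (tC j ^+ m)^-1 != 0 by rewrite invr_eq0 expf_neq0.
have XF j p : singular (pform (X j)) p <-> singular (pform (F j)) (gv (dil (tC j)) p).
  have h1 := singularZ (act (dil (tC j)) (pform (F j))) p (c0 j).
  have h2 := singular_act (pform (F j)) p (dil_unit (tC0 j)).
  by rewrite (FX j); exact: (iff_trans h1 h2).
exists F, X, U; split=> //.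
have [ndG distG allG] := nodG.
have distU : uae (fun j => forall k l, U j k = U j l -> k = l).
  apply: uae_all => k; apply: uae_all => l; case: (eqVneq k l) => [->|kl]; first exact: uae_true.
  apply: boolp.contrapT => /uae_not h; case/eqP: kl; apply: distG.
  have -> : u l = u k; last exact: same_point_refl.
  apply/boolp.funext => a; apply: ulim_uniq (hU l a) _; apply: ulim_eq (hU k a).
  apply: uaeW h => j hj; suff -> : U j k = U j l by [].
  by apply: boolp.contrapT => ne; apply: hj => /ne.
have nodeX : uae (fun j => forall k, chart_hess ord0 (affine_pt (U j k)) (pform (X j)) \in unitmx).
  apply: uae_all => k; have h := raise_hess k.
  have hd : ulim (fun j => \det (chart_hess ord0 (affine_pt (U j k)) (pform (X j))))
      (\det (chart_hess ord0 (affine_pt (u k)) (pform (raise G)))).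
    by apply: ulim_det => a l; apply: ulim_chart_hess => // b; apply: hU.
  rewrite unitmxE unitfE in h; apply: uaeW (ulim_neq0 hd h) => j.
  by rewrite unitmxE unitfE.
have all : uae (fun j => forall p, singular (pform (F j)) p ->
    exists k, same_point (affine_pt (fun l => tC j * U j k l)) p).
  apply: boolp.contrapT => /uae_not no.
  have ex j : exists p, ~ (forall p, singular (pform (F j)) p ->
      exists k, same_point (affine_pt (fun l => tC j * U j k l)) p) ->
      singular (pform (F j)) p /\ forall k, ~ same_point (affine_pt (fun l => tC j * U j k l)) p.
    have [[p hp]|nex] := boolp.EM (exists p, singular (pform (F j)) p /\
        forall k, ~ same_point (affine_pt (fun l => tC j * U j k l)) p); first by exists p.
    exists (fun=> 0) => h; exfalso; apply: h => p sp; apply: boolp.contrapT => nk.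
    by apply: nex; exists p; split=> // k hk; apply: nk; exists k.
  have [p hp] := boolp.choice ex; have bad := uaeW hp no.
  have sp : uae (fun j => singular (pform (F j)) (p j)) by apply: uaeW bad => j [].
  have [D D0 hD] := singular_points_shrink mn M0 solex smoothx (fun j => ltW (t_gt0 j)) hF low sp.
  pose b j l := p j (lift ord0 l) / p j ord0 / tC j.
  have pE j : p j ord0 != 0 -> same_point (p j) (affine_pt (fun l => tC j * b j l)).
    move=> p0; exists (p j ord0)^-1; first by rewrite invr_eq0.
    move=> k; case: (unliftP ord0 k) => [l ->|->]; rewrite ?affine_ptS ?affine_pt0 ?mulVf //.
    by rewrite /b mulrC divfK // mulrC.
  have bb : uae (fun j => forall l, cabs (b j l) <= D).
    apply: uaeW hD => j [p0 h] l; rewrite /b !cabsM !cabsV cabs_real gtr0_norm //.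
    by rewrite ler_pdivrMr // ler_pdivrMr ?cabs_gt0.
  have exb l : exists l', ulim (fun j => b j l) l'.
    by apply: (@bounded_limit _ _ D); apply: uaeW bb => j.
  have [b0 hb] := boolp.choice exb.
  have sb : uae (fun j => singular (pform (X j)) (affine_pt (b j))).
    apply: uaeW (uae_and hD sp) => j [[p0 _] sj]; apply/XF; rewrite gv_dil_affine.
    exact: singular_same (pform_homog _) (pE j p0) sj.
  have nz : nonzero (affine_pt b0) by exists ord0; rewrite affine_pt0 oner_eq0.
  have := singular_limit hX (fun k => ulim_affine k hb) nz sb.
  rewrite pform_raise => /(singular_X0_mul _ _ hG) /allG [k [c c1 ce]].
  have c_1 : c = 1 by have := ce ord0; rewrite !affine_pt0 mulr1.
  have bu : b0 = u k.
    by apply/boolp.funext => l; have := ce (lift ord0 l); rewrite !affine_ptS c_1 mul1r.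
  have hb' l : ulim (fun j => b j l) (u k l) by rewrite -bu; apply: hb.
  have sU : uae (fun j => singular (pform (X j)) (affine_pt (U j k))) by apply: uaeW sX => j.
  have eq := singular_points_isolated hX hb' (hU k) (raise_hess k) sb sU.
  have [j [[p0 _] [[_ nsp] bU]]] := uae_ex (uae_and hD (uae_and bad eq)).
  apply: (nsp k); apply: same_point_sym.
  by have := pE j p0; rewrite bU.
apply: uaeW (uae_and sX (uae_and distU (uae_and nodeX all))) => j [h1 [h2 [h3 h4]]]; split; last exact: h4.
- move=> k; have uD := dil_unit (tC0 j).
  have nX : node (pform (X j)) (affine_pt (U j k)).
    by apply: (node_of_chart_hess (pform_homog _) (h1 k) _ (h3 k)); rewrite affine_pt0 oner_eq0.
  have -> : pform (F j) = (tC j ^+ m) *: act (invmx (dil (tC j))) (pform (X j)).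
    by rewrite FX actZ act_unitK // scalerA mulfV ?scale1r // expf_neq0.
  apply: (nodeZ (expf_neq0 _ (tC0 j)) (act_homog _ (pform_homog _))).
  apply: (node_act _ (pform_homog _)); first by rewrite unitmx_inv.
  by rewrite -gv_dil_affine gv_unitK.
- move=> k l [c c0' ce]; apply: h2; have c1 : c = 1 by have := ce ord0; rewrite !affine_pt0 mulr1.
  apply/boolp.funext => a; have := ce (lift ord0 a); rewrite !affine_ptS c1 mul1r => /(mulfI (tC0 j)).
  by [].
Qed.

End Approximants.
End Raising.

Arguments raise {R} n {m} G.

(** * Generic surfaces with a multiple point *)

Section Lines.
Variables (R : realType) (I : finType).
Local Notation C := R[i].

Definition segment (x y : I -> C) (t : C) : I -> C := fun a => x a + t * (y a - x a).

Lemma segment0 x y : segment x y 0 = x.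
Proof. by apply/boolp.funext => a; rewrite /segment mul0r addr0. Qed.

Lemma segment1 x y : segment x y 1 = y.
Proof. by apply/boolp.funext => a; rewrite /segment mul1r addrC subrK. Qed.

Lemma poly_nonzero_small (q : {poly C}) (e : R) : 0 < e -> q != 0 ->
  exists2 t, cabs t <= e & q.[t] != 0.
Proof.
move=> e0 q0; apply: boolp.contrapT => no; case/eqP: q0.
apply: (@poly_eq0_on _ (fun t => cabs t <= e)); first by move=> N; apply: inv_naturals_small.
by move=> t ht; apply/eqP/negPn/negP => h; apply: no; exists t.
Qed.

Lemma poly_of_value (q : {poly C}) t : q.[t] != 0 -> q != 0.
Proof. by apply: contraNneq => ->; rewrite horner0. Qed.

Lemma segment_near phi x y (e : R) : polyfun phi -> phi y != 0 -> 0 < e ->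
  exists t, near x e (segment x y t) /\ phi (segment x y t) != 0.
Proof.
move=> hphi py e0; have [q hq] := polyfun_line x (fun a => y a - x a) hphi.
have q0 : q != 0 by apply: (@poly_of_value _ 1); rewrite hq; have := segment1 x y; rewrite /segment => ->.
pose M := 1 + \sum_a cabs (y a - x a); have M0 : 0 < M.
  by rewrite ltr_wpDr // sumr_ge0 // => a _; apply: cabs_ge0.
have [t ht qt] := poly_nonzero_small (divr_gt0 e0 M0) q0; exists t; split; last by rewrite -hq.
move=> a; rewrite /segment addrC addKr cabsM -[leRHS](@divfK _ M) ?gt_eqF //; apply: ler_pM; rewrite ?cabs_ge0 //.
by rewrite /M (bigD1 a) //= addrCA lerDl addr_ge0 // sumr_ge0 // => b _; exact: cabs_ge0.
Qed.

Lemma segment_generic phi psi x y : polyfun phi -> polyfun psi -> phi x != 0 -> psi y != 0 ->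
  exists t, phi (segment x y t) != 0 /\ psi (segment x y t) != 0.
Proof.
move=> hphi hpsi px py.
have [q hq] := polyfun_line x (fun a => y a - x a) hphi.
have [r hr] := polyfun_line x (fun a => y a - x a) hpsi.
have q0 : q != 0 by apply: (@poly_of_value _ 0); rewrite hq; have := segment0 x y; rewrite /segment => ->.
have r0 : r != 0 by apply: (@poly_of_value _ 1); rewrite hr; have := segment1 x y; rewrite /segment => ->.
have [t _ ht] := poly_nonzero_small ltr01 (mulf_neq0 q0 r0 : q * r != 0).
by move: ht; rewrite hornerM mulf_eq0 negb_or hq hr => /andP [h1 h2]; exists t.
Qed.

Lemma ulim_polyfun phi (x : nat -> I -> C) x0 : polyfun phi ->
  (forall a, ulim (fun j => x j a) (x0 a)) -> ulim (fun j => phi (x j)) (phi x0).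
Proof.
case=> p hp h; rewrite hp; have H : ulim (fun j => p.@[fun a => x j (enum_val a)]) p.@[fun a => x0 (enum_val a)].
  by apply: ulim_meval => a; apply: h.
by apply: ulim_eq H; apply: uae_true => j; rewrite hp.
Qed.

Lemma near_ulim (x : nat -> I -> C) x0 : (forall j, near x0 (j.+1%:R^-1 : R) (x j)) ->
  forall a, ulim (fun j => x j a) (x0 a).
Proof.
move=> h a e e0; have [N hN] := inv_nat_small e0; apply: (@uae_ev _ N) => j Nj.
exact: le_lt_trans (h j a) (hN j Nj).
Qed.

End Lines.

Section DefinableSingular.
Variables (R : realType).
Local Notation C := R[i].

Lemma definable_singular (I : finType) n (x : monom n -> (I -> C) -> C) (v : 'I_4 -> (I -> C) -> C) :
  (forall mu, polyfun (x mu)) -> (forall i, polyfun (v i)) ->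
  definable (fun z => singular (pform (fun mu => x mu z)) (fun i => v i z)).
Proof.
move=> hx hv; apply: (@definable_ext _ _ (fun z => (~ (forall i, v i z = 0)) /\
   ((pform (fun mu => x mu z)).@[fun i => v i z] = 0 /\
    forall j, ((pform (fun mu => x mu z))^`M(j)).@[fun i => v i z] = 0))).
  move=> z; split=> [[h1 [h2 h3]]|[[i hi] h2 h3]]; last first.
    by split=> // h; rewrite h eqxx in hi.
  split=> //; apply: boolp.contrapT => no; apply: h1 => i.
  by apply/eqP/negPn/negP => h; apply: no; exists i.
apply: definable_and; first by apply: definable_not; apply: definable_all => i; apply: definable_zero.
apply: definable_and; first by apply: definable_zero; apply: polyfun_pform.
by apply: definable_all => j; apply: definable_zero; apply: polyfun_pform_deriv.
Qed.

End DefinableSingular.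

Section GenericMultiplePoint.
Variables (R : realType) (n m : nat).
Local Notation C := R[i].
Hypothesis mn : (m <= n)%N.
Hypothesis m1 : (1 < m)%N.
Implicit Types (x : monom n -> C).

Lemma definable_sole : definable (@sole_singular R n).
Proof.
apply: definable_forall (fun z : monom n + 'I_4 -> C => singular (pform (fun mu => z (inl mu))) (fun i => z (inr i)) ->
  forall l, z (inr (lift ord0 l)) = 0) _.
apply: definable_imp; first by apply: definable_singular => *; apply: polyfunX.
by apply: definable_all => l; apply: definable_zero; apply: polyfunX.
Qed.

Lemma definable_smooth : definable (@smooth_lead R n m).
Proof.
apply: definable_forall (fun z : monom n + 'I_3 -> C =>
  singular (pform (lead m (fun mu => z (inl mu)))) (affine_pt (fun i => z (inr i))) ->
  forall l, z (inr l) = 0) _.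
apply: definable_imp; last by apply: definable_all => l; apply: definable_zero; apply: polyfunX.
apply: (@definable_singular _ _ _ (fun mu z => lead m (fun mu => z (inl mu)) mu)
  (fun i z => affine_pt (fun i => z (inr i)) i)) => [mu|i].
  by rewrite /lead; case: eqP => _; [exact: polyfunX | exact: polyfunC].
by rewrite /affine_pt; case: unlift => [l|]; [exact: polyfunX | exact: polyfunC].
Qed.

Lemma mult_ge_segment x y t : mult_ge m x -> mult_ge m y -> mult_ge m (segment x y t).
Proof. by move=> hx hy mu h; rewrite /segment hx // hy // subrr mulr0 addr0. Qed.

Lemma prime_mult_ge : prime_set (@mult_ge R n m).
Proof.
split; first by exists (fun=> 0).
move=> phi psi hphi hpsi [x Lx px] [y Ly py].
have [t [h1 h2]] := segment_generic hphi hpsi px py.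
by exists (segment x y t); [exact: mult_ge_segment | rewrite mulf_neq0].
Qed.

Lemma lead_cone x v c : c != 0 -> singular (pform (lead m x)) (affine_pt v) ->
  singular (pform (lead m x)) (affine_pt (fun l => c * v l)).
Proof.
move=> c0 sv; rewrite -gv_dil_affine; apply/(singular_act _ _ (dil_unit c0)).
rewrite act_dil; have -> : pform (fun mu => c ^+ gr mu * lead m x mu) = c ^+ m *: pform (lead m x).
  rewrite /pform scaler_sumr; apply: eq_bigr => mu _; rewrite scalerA /lead; congr (_ *: _).
  by case: eqP => [->|]; rewrite ?mulr0.
by apply/singularZ => //; rewrite expf_neq0.
Qed.

(** For the first property [singular_points_shrink] is used with [t = 0], which leaves only the base
    point. For the second, singular points of the tangent cones are scaled to norm 1 and pass to the
    limit. *)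
Lemma sole_smooth_stable (x : nat -> monom n -> C) x0 : sole_singular x0 -> smooth_lead m x0 ->
  (forall j, mult_ge m (x j)) -> (forall mu, ulim (fun j => x j mu) (x0 mu)) ->
  uae (fun j => sole_singular (x j) /\ smooth_lead m (x j)).
Proof.
move=> sole smooth Lx hx; apply: uae_and.
  apply: boolp.contrapT => /uae_not no.
  have ex j : exists p, ~ sole_singular (x j) -> singular (pform (x j)) p /\ ~ forall l, p (lift ord0 l) = 0.
    have [h|h] := boolp.EM (exists p, singular (pform (x j)) p /\ ~ forall l, p (lift ord0 l) = 0).
      by have [p hp] := h; exists p.
    exists (fun=> 0) => ns; exfalso; apply: ns => p sp.
    by apply: boolp.contrapT => nl; apply: h; exists p.
  have [p hp] := boolp.choice ex; have bad := uaeW hp no.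
  have sp : uae (fun j => singular (pform (x j)) (p j)) by apply: uaeW bad => j [].
  have low mu : (gr mu < m)%N -> uae (fun j => cabs (x j mu) <= 0 * (0 : R) ^+ (m - gr mu)).
    by move=> h; apply: uae_true => j; rewrite Lx // cabs0 mul0r.
  have [D _ hD] := singular_points_shrink mn (lexx 0) sole smooth (fun=> lexx 0) hx low sp.
  have [j [[_ h1] [_ h2]]] := uae_ex (uae_and hD bad); apply: h2 => l.
  by apply/eqP; rewrite -cabs_eq0 eq_le cabs_ge0 andbT; have := h1 l; rewrite mulr0 mul0r.
apply: boolp.contrapT => /uae_not no.
have ex j : exists v, ~ smooth_lead m (x j) ->
    singular (pform (lead m (x j))) (affine_pt v) /\ \sum_l cabs (v l) = 1.
  have [h|h] := boolp.EM (exists v, singular (pform (lead m (x j))) (affine_pt v) /\ ~ forall l, v l = 0); last first.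
    exists (fun=> 0) => ns; exfalso; apply: ns => v sv.
    by apply: boolp.contrapT => nl; apply: h; exists v.
  have [v [sv nv]] := h; pose b := \sum_l cabs (v l).
  have b0 : 0 < b.
    rewrite lt_neqAle sumr_ge0 ?andbT => [|l _]; last exact: cabs_ge0.
    apply: contra_not_neq nv => /esym/eqP; rewrite psumr_eq0 => [/allP h0 l|l _]; last exact: cabs_ge0.
    by apply/eqP; rewrite -cabs_eq0; apply: (h0 l); rewrite mem_index_enum.
  exists (fun l => (b%:C%C)^-1 * v l) => _; split.
    by apply: lead_cone sv; rewrite invr_eq0 -cabs_eq0 cabs_real gtr0_norm // gt_eqF.
  have -> : \sum_l cabs ((b%:C%C)^-1 * v l) = b^-1 * b.
    by rewrite /b mulr_sumr; apply: eq_bigr => l _; rewrite cabsM cabsV cabs_real gtr0_norm.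
  by rewrite mulVf // gt_eqF.
have [v hv] := boolp.choice ex; have bad := uaeW hv no.
have v1 : uae (fun j => forall l, cabs (v j l) <= 1).
  apply: uaeW bad => j [_ <-] l; rewrite (bigD1 l) //= lerDl sumr_ge0 // => k _; exact: cabs_ge0.
have exw l : exists l', ulim (fun j => v j l) l'.
  by apply: (@bounded_limit _ _ 1); apply: uaeW v1 => j.
have [w hw] := boolp.choice exw.
have hlead mu : ulim (fun j => lead m (x j) mu) (lead m x0 mu).
  by rewrite /lead; case: eqP => _; [exact: hx | exact: ulim_cst].
have nz : nonzero (affine_pt w) by exists ord0; rewrite affine_pt0 oner_eq0.
have sv : uae (fun j => singular (pform (lead m (x j))) (affine_pt (v j))) by apply: uaeW bad => j [].
have w0 := smooth _ (singular_limit hlead (fun k => ulim_affine k hw) nz sv).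
have : uae (fun j => forall l, cabs (v j l) < 4^-1).
  apply: uae_all => l; have h4 : (0 : R) < 4^-1 by rewrite invr_gt0.
  by apply: uaeW (hw l _ h4) => j; rewrite w0 subr0.
move=> h; have [j [hj [_]]] := uae_ex (uae_and h bad); rewrite !big_ord_recl big_ord0.
have h1 := hj ord0; have h2 := hj (lift ord0 ord0); have h3 := hj (lift ord0 (lift ord0 ord0)).
by move: h1 h2 h3; lra.
Qed.

(** By quantifier elimination the property is generically true or generically false on a linear
    space. It cannot be generically false, because it persists near [x1] and a nonempty Zariski open
    set meets every neighbourhood of [x1]. *)
Lemma generic_sole_smooth x1 : mult_ge m x1 -> sole_singular x1 -> smooth_lead m x1 ->
  exists h, [/\ polyfun h, exists2 x, mult_ge m x & h x != 0 &
    forall x, mult_ge m x -> h x != 0 -> sole_singular x /\ smooth_lead m x].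
Proof.
move=> L1 s1 s2.
have [h [hh [x Lx hx] [hD|hD]]] := definable_generic prime_mult_ge (definable_and definable_sole definable_smooth).
  by exists h; split=> //; exists x.
exfalso; have ex j : exists y, [/\ mult_ge m y, near x1 (j.+1%:R^-1 : R) y & h y != 0].
  have e0 : 0 < (j.+1%:R^-1 : R) by rewrite invr_gt0 ltr0Sn.
  have [t [h1 h2]] := segment_near x1 hh hx e0; exists (segment x1 x t); split=> //.
  exact: mult_ge_segment.
have [y hy] := boolp.choice ex.
have Ly j : mult_ge m (y j) by have [] := hy j.
have lim := near_ulim (fun j => let: And3 _ h _ := hy j in h).
have [j hj] := uae_ex (sole_smooth_stable s1 s2 Ly lim).
by have [_ _ hyj] := hy j; exact: (hD (y j) (Ly j) hyj).
Qed.

End GenericMultiplePoint.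

(** * A surface whose only singular point is ordinary of multiplicity [m] *)

Section Example.
Variables (R : realType) (n m : nat).
Local Notation C := R[i].
Hypothesis mn : (m <= n)%N.
Hypothesis m1 : (1 < m)%N.

Let wt (i : 'I_3) : nat := 2 ^ i.
Let mA (i : 'I_3) : 'X_{1..4} := (U_(ord0) *+ (n - m) + U_(lift ord0 i) *+ m)%MM.
Let mB (i : 'I_3) : 'X_{1..4} := (U_(lift ord0 i) *+ n)%MM.

Let mAE i : ('X_[mA i] : {mpoly C[4]}) = 'X_ord0 ^+ (n - m) * 'X_(lift ord0 i) ^+ m.
Proof. by rewrite /mA mpolyXD !mpolyXn. Qed.

Let mBE i : ('X_[mB i] : {mpoly C[4]}) = 'X_(lift ord0 i) ^+ n.
Proof. by rewrite /mB mpolyXn. Qed.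

(** The weights are 1, 2, 4: each exceeds the sum of the preceding ones, so terms of modulus 0 or a
    common value cannot cancel. Equal weights would allow extra singular points. *)
Definition fermat : {mpoly C[4]} := \sum_(i < 3) (wt i)%:R *: ('X_[mA i] + 'X_[mB i]).
(** For [n = m] the two monomials of each summand coincide, which doubles the coefficient. *)
Definition fermat_cone : {mpoly C[4]} :=
  \sum_(i < 3) (wt i)%:R *: ((1 + (n == m)%:R) *: 'X_[mA i]).
Definition fermat_coefs : monom n -> C := fcoef fermat.

Let degA i : mdeg (mA i) = n.
Proof. by rewrite mdegD !mdegMn !mdeg1 !mul1n subnK. Qed.
Let degB i : mdeg (mB i) = n.
Proof. by rewrite mdegMn mdeg1 mul1n. Qed.

Let fermatK : pform fermat_coefs = fermat.
Proof.
rewrite /fermat_coefs pformK //; apply: rpred_sum => i _; apply: rpredZ.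
by apply: rpredD; rewrite dhomogX /= ?degA ?degB.
Qed.

Let fermat_coef mu : fermat_coefs mu = \sum_(i < 3) (wt i)%:R * ((mA i == mval mu)%:R + (mB i == mval mu)%:R).
Proof.
rewrite /fermat_coefs /fcoef (raddf_sum (mcoeff (mval mu))); apply: eq_bigr => i _ /=.
by rewrite mcoeffZ mcoeffD !mcoeffX.
Qed.

Let mA0 i : mA i ord0 = (n - m)%N.
Proof. by rewrite mnmDE !mulmnE !mnm1E eqxx /= mul1n mul0n addn0. Qed.
Let mB0 i : mB i ord0 = 0%N.
Proof. by rewrite mulmnE mnm1E /= mul0n. Qed.

Lemma fermat_mult : mult_ge m fermat_coefs.
Proof.
move=> mu h; rewrite fermat_coef big1 // => i _; move: h; rewrite /gr.
case: eqP => [<-|_]; first by rewrite mA0; lia.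
case: eqP => [<-|_]; first by rewrite mB0; lia.
by rewrite addr0 mulr0.
Qed.

Let lead_fermat : pform (lead m fermat_coefs) = fermat_cone.
Proof.
rewrite -[RHS](@pformK _ n); last first.
  by apply: rpred_sum => i _; apply/rpredZ/rpredZ; rewrite dhomogX /= degA.
congr pform; apply/boolp.funext => mu.
rewrite /lead /fcoef (raddf_sum (mcoeff (mval mu))) fermat_coef.
have E i : ((wt i)%:R *: ((1 + (n == m)%:R) *: 'X_[mA i]) : {mpoly C[4]})@_(mval mu) =
    (wt i)%:R * ((1 + (n == m)%:R) * (mA i == mval mu)%:R) by rewrite !mcoeffZ mcoeffX.
under [RHS]eq_bigr => i _ do rewrite /= E.
rewrite /gr; case: eqP => h.
  apply: eq_bigr => i _; congr (_ * _); case: (n =P m) => [e|ne].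
    by have -> : mB i = mA i; [rewrite /mA /mB e subnn mulm0n add0m | rewrite mulrDl mul1r].
  rewrite addr0 mul1r; case: (mB i =P mval mu) => [e|]; last by rewrite addr0.
  by move: h; rewrite -e mB0; lia.
rewrite big1 // => i _; case: (mA i =P mval mu) => [e|]; last by rewrite !mulr0.
by case: h; rewrite -e mA0; lia.
Qed.

Let Xn_deriv (i j : 'I_4) k : (('X_i ^+ k : {mpoly C[4]})^`M(j)) = ((i == j)%:R * k%:R) *: 'X_i ^+ k.-1.
Proof.
rewrite mpolyXn mderivX mulmnE mnm1E; case: eqP => [->|_]; last by rewrite mul0n !mul0r !scale0r.
rewrite mul1n mul1r; case: k => [|k]; first by rewrite !scale0r.
congr (_ *: _); rewrite mpolyXn; congr 'X_[_]; apply/mnmP => l.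
by rewrite mnmBE !mulmnE mnm1E; case: (j == l); lia.
Qed.

Let wt0 i : (wt i)%:R != 0 :> C. Proof. by rewrite pnatr_eq0 expn_eq0. Qed.

Lemma fermat_smooth : smooth_lead m fermat_coefs.
Proof.
move=> v; rewrite lead_fermat => -[_ _ /(_ (lift ord0 _)) dv] l.
have := dv l; rewrite /fermat_cone (raddf_sum (mderiv (lift ord0 l))) (raddf_sum (meval (affine_pt v))).
have E i : (((wt i)%:R *: ((1 + (n == m)%:R) *: 'X_[mA i]) : {mpoly C[4]})^`M(lift ord0 l)).@[affine_pt v] =
    (i == l)%:R * ((wt l)%:R * (1 + (n == m)%:R) * (m%:R * v l ^+ m.-1)).
  rewrite !mderivZ !mevalZ mAE deriv_X0_mul X0_mul_affine Xn_deriv mevalZ Xexp_eval affine_ptS.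
  rewrite (inj_eq (@lift_inj _ ord0)); case: (i =P l) => [->|_]; last by rewrite !mul0r !mulr0.
  by rewrite !mul1r mulrA.
under eq_bigr => i _ do rewrite /= E.
rewrite (bigD1 l) //= big1 => [|i /negbTE ->]; last by rewrite mul0r.
rewrite eqxx mul1r addr0 => /eqP; rewrite !mulf_eq0 (negbTE (wt0 l)) pnatr_eq0 expf_eq0.
have -> : (1 + (n == m)%:R == 0 :> C) = false by rewrite -(natrD _ 1) pnatr_eq0.
by rewrite !orFb gtn_eqF ?(ltnW m1) // orFb => /andP [_ /eqP].
Qed.

(** For [n > m] and nonzero [x_0], the derivatives in the affine directions give all nonzero
    coordinates the same modulus, and the derivative along [x_0] makes the weighted sum of their
    [m]-th powers vanish, which the weights forbid. For [n = m] or [x_0 = 0] the affine derivatives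
    suffice. *)
Lemma fermat_sole : sole_singular fermat_coefs.
Proof.
move=> p; rewrite fermatK => -[nz p0 dp].
set x := p ord0; pose v l := p (lift ord0 l); pose N := (n - m)%N.
have d0 : N%:R * x ^+ N.-1 * (\sum_(i < 3) (wt i)%:R * v i ^+ m) = 0.
  rewrite -[RHS](dp ord0) /fermat (raddf_sum (mderiv ord0)) (raddf_sum (meval p)) mulr_sumr.
  apply: eq_bigr => i _; rewrite /= mderivZ mevalZ mderivD mevalD mAE mBE mderivM !Xn_deriv.
  have l0 : (lift ord0 i == ord0 :> 'I_4) = false by [].
  rewrite mevalD !mevalM !mevalZ !Xexp_eval eqxx l0 !mul1r !mul0r mulr0 !addr0.
  by rewrite mulrCA mulrA.
have dl l : v l ^+ m.-1 * (m%:R * x ^+ N + n%:R * v l ^+ N) = 0.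
  apply: (mulfI (wt0 l)); rewrite mulr0 -[RHS](dp (lift ord0 l)).
  rewrite /fermat (raddf_sum (mderiv (lift ord0 l))) (raddf_sum (meval p)).
  have E i : (((wt i)%:R *: ('X_[mA i] + 'X_[mB i]) : {mpoly C[4]})^`M(lift ord0 l)).@[p] =
     (i == l)%:R * ((wt l)%:R * (v l ^+ m.-1 * (m%:R * x ^+ N + n%:R * v l ^+ N))).
    rewrite mderivZ mevalZ mderivD mevalD mAE mBE deriv_X0_mul mevalM !Xn_deriv !mevalZ !Xexp_eval.
    rewrite (inj_eq (@lift_inj _ ord0)); case: (i =P l) => [->|_]; last by rewrite !mul0r mulr0 addr0 mulr0.
    rewrite !mul1r -/(v l) -/x; have -> : n.-1 = (m.-1 + N)%N by rewrite /N; lia.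
    by rewrite exprD; ring.
  under [RHS]eq_bigr => i _ do rewrite /= E.
  by rewrite (bigD1 l) //= big1 => [|i /negbTE ->]; rewrite ?eqxx ?mul1r ?addr0 // mul0r.
have m1_0 (y : C) : y ^+ m.-1 = 0 -> y = 0 by move=> /eqP; rewrite expf_eq0 => /andP [_ /eqP].
suff v0 : forall l, v l = 0 by [].
have alt l : v l = 0 \/ m%:R * x ^+ N + n%:R * v l ^+ N = 0.
  have /eqP := dl l; rewrite mulf_eq0 => /orP [/eqP /m1_0 h|/eqP h]; [by left | by right].
have n0 : n%:R != 0 :> C by rewrite pnatr_eq0; lia.
case: (posnP N) => N0.
  move=> l; case: (alt l) => //; rewrite N0 !expr0 !mulr1 -natrD => /eqP.
  by rewrite pnatr_eq0; lia.
case: (eqVneq x 0) => x0.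
  move=> l; case: (alt l) => // /eqP; rewrite x0 expr0n gtn_eqF // mulr0 add0r mulf_eq0 (negbTE n0) /=.
  by rewrite expf_eq0 => /andP [_ /eqP].
have sum0 : \sum_(i < 3) (wt i)%:R * v i ^+ m = 0.
  by move/eqP: d0; rewrite !mulf_eq0 expf_eq0 (negbTE x0) pnatr_eq0 gtn_eqF // andbF => /eqP.
pose r : R := cabs (m%:R * x ^+ N) / cabs (n%:R : C).
have absN l : v l = 0 \/ cabs (v l) ^+ N = r.
  case: (alt l) => [|/eqP h]; [by left | right].
  rewrite -cabsX /r; have -> : m%:R * x ^+ N = - (n%:R * v l ^+ N).
    by apply/eqP; rewrite -addr_eq0.
  by rewrite cabsN cabsM mulrAC mulfV ?mul1r // cabs_eq0.
pose w l := cabs (v l ^+ m).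
have eqw k l : v k != 0 -> v l != 0 -> w k = w l.
  move=> vk vl; rewrite /w !cabsX; congr (_ ^+ _).
  have ek : cabs (v k) ^+ N = r by case: (absN k) => // h; rewrite h eqxx in vk.
  have el : cabs (v l) ^+ N = r by case: (absN l) => // h; rewrite h eqxx in vl.
  by apply/eqP; rewrite -(eqrXn2 N0) ?cabs_ge0 // ek el.
have w_ge0 l : 0 <= w l by apply: cabs_ge0.
have w0 l : w l = 0 -> v l = 0.
  by move/eqP; rewrite cabs_eq0 expf_eq0 => /andP [_ /eqP].
have wle k l : v k != 0 -> w l <= w k.
  move=> vk; case: (eqVneq (v l) 0) => [vl|vl]; last by rewrite (eqw l k).
  by rewrite {1}/w vl expr0n gtn_eqF ?cabs0 ?cabs_ge0 // ltnW.
pose i0 : 'I_3 := ord0; pose i1 : 'I_3 := lift ord0 ord0; pose i2 : 'I_3 := lift ord0 (lift ord0 ord0).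
have sum3 : v i0 ^+ m + 2 * v i1 ^+ m + 4 * v i2 ^+ m = 0.
  move: sum0; rewrite !big_ord_recl big_ord0 addr0 /= mul1r addrA; apply.
have v2 : v i2 = 0.
  apply/eqP/negPn/negP => h2; have h0 := wle i2 i0 h2; have h1 := wle i2 i1 h2.
  have : cabs (4 * v i2 ^+ m) <= w i0 + 2 * w i1.
    have -> : 4 * v i2 ^+ m = - (v i0 ^+ m + 2 * v i1 ^+ m).
      by apply/eqP; rewrite -addr_eq0 addrC sum3.
    rewrite cabsN; apply: le_trans (cabsD _ _) _; rewrite cabsM.
    by have -> : cabs 2 = 2 :> R by have := cabs_real (2 : R); rewrite rmorph_nat normr_nat.
  rewrite cabsM; have -> : cabs 4 = 4 :> R by have := cabs_real (4 : R); rewrite rmorph_nat normr_nat.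
  rewrite -/(w i2) => h4; have : w i2 <= 0 by move: h4 h0 h1; lra.
  by move=> h5; case/eqP: h2; apply: w0; apply/eqP; rewrite eq_le h5 w_ge0.
have m0 : (m == 0)%N = false by apply/eqP; lia.
have v1 : v i1 = 0.
  apply/eqP/negPn/negP => h1; have h0 := wle i1 i0 h1.
  have : cabs (2 * v i1 ^+ m) <= w i0.
    have -> : 2 * v i1 ^+ m = - v i0 ^+ m; last by rewrite cabsN.
    by apply/eqP; rewrite -addr_eq0 addrC -[X in _ == X]sum3 v2 expr0n m0 mulr0 addr0.
  rewrite cabsM; have -> : cabs 2 = 2 :> R by have := cabs_real (2 : R); rewrite rmorph_nat normr_nat.
  rewrite -/(w i1) => h4; have : w i1 <= 0 by move: h4 h0; lra.
  by move=> h5; case/eqP: h1; apply: w0; apply/eqP; rewrite eq_le h5 w_ge0.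
have v0 : v i0 = 0.
  apply/eqP; have /eqP := sum3; rewrite v2 v1 !expr0n m0 !mulr0 !addr0 expf_eq0.
  by case/andP.
move=> l; case: (unliftP ord0 l) => [a ->|->] //; case: (unliftP ord0 a) => [b ->|->] //.
by have -> : b = ord0 by apply: val_inj; case: b => [[]].
Qed.

End Example.

(** * Polynomial dependence of coefficients on parameters and matrices *)

Section PolynomialCoefficients.
Variables (K : comNzRingType) (I : finType) (n : nat).
Implicit Types P Q : (I -> K) -> {mpoly K[n]}.

Definition polycoef P := forall m, polyfun (fun z => (P z)@_m).

Lemma polycoef_ext P Q : P =1 Q -> polycoef P -> polycoef Q.
Proof. by move=> e h m; apply: polyfun_ext (h m) => z; rewrite e. Qed.

Lemma polycoef_cst p : polycoef (fun=> p).
Proof. by move=> m; apply: polyfunC. Qed.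

Lemma polycoefZ c P : polyfun c -> polycoef P -> polycoef (fun z => c z *: P z).
Proof.
move=> hc hP m; apply: (@polyfun_ext _ _ (fun z => c z * (P z)@_m)); last exact: polyfunM.
by move=> z; rewrite mcoeffZ.
Qed.

Lemma polycoef_sum (J : Type) (r : seq J) (F : J -> (I -> K) -> {mpoly K[n]}) :
  (forall j, polycoef (F j)) -> polycoef (fun z => \sum_(j <- r) F j z).
Proof.
move=> h m; apply: (@polyfun_ext _ _ (fun z => \sum_(j <- r) (F j z)@_m)).
  by move=> z; rewrite (raddf_sum (mcoeff m)).
by apply: polyfun_sum => j _; apply: h.
Qed.

Lemma polycoefM P Q : polycoef P -> polycoef Q -> polycoef (fun z => P z * Q z).
Proof.
move=> hP hQ m; apply: (@polyfun_ext _ _ (fun z =>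
    \sum_(k : 'X_{1..n < (mdeg m).+1, (mdeg m).+1} | m == (k.1 + k.2)%MM) (P z)@_k.1 * (Q z)@_k.2)).
  by move=> z; rewrite mcoeffM.
by apply: polyfun_sum => k _; apply: polyfunM.
Qed.

Lemma polycoef_exp P k : polycoef P -> polycoef (fun z => P z ^+ k).
Proof.
move=> h; elim: k => [|k IH].
  by apply: polycoef_ext (polycoef_cst 1) => z; rewrite expr0.
by apply: polycoef_ext (polycoefM h IH) => z; rewrite exprS.
Qed.

Lemma polycoef_prod (J : Type) (r : seq J) (F : J -> (I -> K) -> {mpoly K[n]}) :
  (forall j, polycoef (F j)) -> polycoef (fun z => \prod_(j <- r) F j z).
Proof.
move=> h; elim: r => [|j r IH].
  by apply: polycoef_ext (polycoef_cst 1) => z; rewrite big_nil.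
by apply: polycoef_ext (polycoefM (h j) IH) => z; rewrite big_cons.
Qed.

End PolynomialCoefficients.

Lemma definable_comp (K : closedFieldType) (I J : finType) (D : (J -> K) -> Prop) (v : J -> (I -> K) -> K) :
  definable D -> (forall j, polyfun (v j)) -> definable (fun x => D (fun j => v j x)).
Proof.
move=> hD hv; apply: (@definable_ext _ _ (fun x => exists y : J -> K,
    (forall j, joinv x y (inr j) - v j (fun i => joinv x y (inl i)) = 0) /\ D (fun j => joinv x y (inr j)))).
  move=> x; split=> [[y [h1 h2]]|h].
    have -> : (fun j => v j x) = y by apply/boolp.funext => j; apply/esym/eqP; rewrite -subr_eq0; apply/eqP/h1.
    exact: h2.
  by exists (fun j => v j x); split=> [j|] //=; rewrite subrr.
apply: definable_ex (fun z : I + J -> K => (forall j, z (inr j) - v j (fun i => z (inl i)) = 0) /\ D (fun j => z (inr j))) _.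
apply: definable_and; last exact: (definable_reindex inr hD).
apply: definable_all => j; apply: definable_zero; apply: polyfunB; first exact: polyfunX.
by apply: polyfun_comp (hv j) _ => i; apply: polyfunX.
Qed.

Section PolynomialActions.
Variables (R : realType) (n : nat).
Local Notation C := R[i].

Definition gm (w : 'I_4 * 'I_4 -> C) : 'M[C]_4 := \matrix_(i, j) w (i, j).

Lemma gmK (g : 'M[C]_4) : gm (fun ij => g ij.1 ij.2) = g.
Proof. by apply/matrixP => i j; rewrite mxE. Qed.

Definition cact (g : 'M[C]_4) (x : monom n -> C) : monom n -> C := fcoef (act g (pform x)).

Lemma pform_cact g x : pform (cact g x) = act g (pform x).
Proof. by rewrite /cact pformK // act_homog // pform_homog. Qed.

Lemma cactM g h x : cact g (cact h x) = cact (h *m g) x.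
Proof. by rewrite [LHS]/cact pform_cact (act_mul g h (pform x)). Qed.

Lemma cact1 x : cact 1%:M x = x.
Proof. by rewrite /cact act1 fcoefK. Qed.

Lemma polyfun_cact (I : finType) (g : 'I_4 -> 'I_4 -> (I -> C) -> C) (x : monom n -> (I -> C) -> C) mu :
  (forall i j, polyfun (g i j)) -> (forall nu, polyfun (x nu)) ->
  polyfun (fun z => cact (\matrix_(i, j) g i j z) (fun nu => x nu z) mu).
Proof.
move=> hg hx; suff : polycoef (fun z => act (\matrix_(i, j) g i j z) (pform (fun nu => x nu z))) by apply.
apply: (@polycoef_ext _ _ _ (fun z => \sum_nu x nu z *: \prod_i (\sum_j g i j z *: 'X_j) ^+ (mval nu i))).
  move=> z; rewrite /pform /act (raddf_sum (comp_mpoly _)); apply: eq_bigr => nu _ /=.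
  rewrite comp_mpolyZ comp_mpolyX; congr (_ *: _); apply: eq_bigr => i _.
  congr (_ ^+ _).
  rewrite tnth_mktuple.
  apply: eq_bigr => j _; congr (_ *: _).
  by rewrite mxE.
apply: polycoef_sum => nu; apply: polycoefZ => //; apply: polycoef_prod => i; apply: polycoef_exp.
by apply: polycoef_sum => j; apply: polycoefZ => //; apply: polycoef_cst.
Qed.

End PolynomialActions.

(** * Density of the surfaces for which the approximation works *)

Section Degeneration.
Variables (R : realType) (n m delta : nat).
Local Notation C := R[i].
Hypothesis mn : (m <= n)%N.
Hypothesis m1 : (1 < m)%N.
Variables (G0 : monom m -> C) (u0 : 'I_delta -> 'I_3 -> C) (H : 'I_delta -> {mpoly C[4]}).
Hypothesis nod0 : nodes_enum (pform G0) (fun k => affine_pt (u0 k)).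
Hypothesis hH : forall k, H k \is m.-1.-homog.
Hypothesis detH : value_det H (fun k => affine_pt (u0 k)) != 0.

Let m0 : (0 < m)%N. Proof. exact: ltnW. Qed.

(** Three open conditions: [rho] preserves nodality and independence near [G0], [s] is the
    denominator attached to the prime ideal of the incidence variety, and [h1] ensures a single
    singular point with smooth leading form. *)
Variables (rho : (monom m -> C) -> C) (s : (dvar n delta -> C) -> C) (h1 : (monom n -> C) -> C).
Hypothesis hrho : polyfun rho.
Hypothesis rho0 : rho G0 != 0.
Hypothesis rhoP : forall x, rho x != 0 -> forall q : 'I_delta -> 'I_4 -> C,
  (forall l, singular (pform x) (q l)) -> distinct_points q -> nodes_enum (pform x) q /\ value_det H q != 0.
Hypothesis hs : polyfun s.
Hypothesis s0 : s (dpair (raise n G0) u0) != 0.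
Hypothesis hh1 : polyfun h1.
Hypothesis h1ne : exists2 x, mult_ge m x & h1 x != 0.
Hypothesis h1P : forall x, mult_ge m x -> h1 x != 0 -> sole_singular x /\ smooth_lead m x.

Implicit Types z : dvar m delta -> C.
Definition upart z (k : 'I_delta) (l : 'I_3) := z (inr (k, l)).

Lemma affine_pt_inj (u v : 'I_3 -> C) : same_point (affine_pt u) (affine_pt v) -> u = v.
Proof.
case=> c c0 ce; have c1 : c = 1 by have := ce ord0; rewrite !affine_pt0 mulr1.
by apply/boolp.funext => l; have := ce (lift ord0 l); rewrite !affine_ptS c1 mul1r.
Qed.

Lemma distinct_coordinate : exists a : 'I_delta * 'I_delta -> 'I_3, forall k l, k != l ->
  u0 k (a (k, l)) - u0 l (a (k, l)) != 0.
Proof.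
suff ex kl : exists a, kl.1 != kl.2 -> u0 kl.1 a - u0 kl.2 a != 0.
  by have [a ha] := boolp.choice ex; exists a => k l; apply: (ha (k, l)).
case: (eqVneq kl.1 kl.2) => ne; first by exists ord0.
apply: boolp.contrapT => no; case/eqP: ne; have [_ dist _] := nod0; apply: dist.
have -> : u0 kl.1 = u0 kl.2; last exact: same_point_refl.
apply/boolp.funext => a; apply/eqP; rewrite -subr_eq0; apply/eqP/eqP.
by apply/negPn/negP => h; apply: no; exists a.
Qed.

Let da := projT1 (boolp.cid distinct_coordinate).
Let daP k l : k != l -> u0 k (da (k, l)) - u0 l (da (k, l)) != 0.
Proof. exact: (projT2 (boolp.cid distinct_coordinate)). Qed.

(** A polynomial certificate that the points are distinct: each pair is compared in a coordinate
    that separates it at [u0]. *)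
Definition disc (u : 'I_delta -> 'I_3 -> C) :=
  \prod_k \prod_(l | k != l) (u k (da (k, l)) - u l (da (k, l))).

Lemma disc_distinct u : disc u != 0 -> distinct_points (fun k => affine_pt (u k)).
Proof.
move=> /prodf_neq0 h k l /affine_pt_inj e; apply/eqP/negPn/negP => kl.
by have /prodf_neq0 /(_ l kl) := h k isT; rewrite e subrr eqxx.
Qed.

Lemma disc0 : disc u0 != 0.
Proof. by apply/prodf_neq0 => k _; apply/prodf_neq0 => l kl; apply: daP. Qed.

Lemma polyfun_disc d : polyfun (fun z : dvar d delta -> C => disc (fun k l => z (inr (k, l)))).
Proof.
apply: polyfun_prod => k _; apply: polyfun_prod => l _.
by apply: polyfunB; apply: polyfunX.
Qed.

Lemma polyfun_raise (I : finType) (G : monom m -> (I -> C) -> C) mu :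
  (forall nu, polyfun (G nu)) -> polyfun (fun z : I -> C => raise n (fun nu => G nu z) mu).
Proof.
move=> hG; suff : polycoef (fun z : I -> C => 'X_ord0 ^+ (n - m) * pform (fun nu => G nu z)) by apply.
apply: polycoefM; first exact: polycoef_cst.
by apply: polycoef_sum => nu; apply: polycoefZ => //; apply: polycoef_cst.
Qed.

Definition sig z := rho (dform z) * s (dpair (raise n (dform z)) (upart z)) * disc (upart z).

Lemma polyfun_sig : polyfun sig.
Proof.
apply: polyfunM; last exact: polyfun_disc.
apply: polyfunM; first by apply: polyfun_comp hrho _ => mu; apply: polyfunX.
apply: (polyfun_comp (v := fun a z => dpair (raise n (dform z)) (upart z) a) hs) => -[mu|[k l]].
  by apply: polyfun_raise => nu; apply: polyfunX.
exact: polyfunX.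
Qed.

Lemma sig0 : sig (dpair G0 u0) != 0.
Proof. by rewrite /sig !mulf_neq0 ?disc0. Qed.

Definition good z := incidence_point z /\ sig z != 0.

Lemma good_nodes z : good z -> nodes_enum (pform (dform z)) (fun k => affine_pt (upart z k)) /\
  value_det H (fun k => affine_pt (upart z k)) != 0.
Proof.
case=> iz; rewrite /sig !mulf_eq0 !negb_or => /andP [/andP [r1 _] d1].
by apply: rhoP => //; exact: disc_distinct.
Qed.

Lemma good_s z : good z -> s (dpair (raise n (dform z)) (upart z)) != 0.
Proof. by case=> _; rewrite /sig !mulf_eq0 !negb_or => /andP [/andP [_ ]]. Qed.

Lemma raise_id (G : monom m -> C) : raise m G = G.
Proof. by rewrite /raise subnn expr0 mul1r fcoefK. Qed.

Lemma up_monom (nu : monom m) : exists mu : monom n, mval mu = (mval nu + U_(ord0) *+ (n - m))%MM.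
Proof. by apply: mval_onto; rewrite mdegD mdeg_mval mdegMn mdeg1 mul1n subnKC. Qed.

Let up := projT1 (boolp.choice up_monom).
Let upE nu : mval (up nu) = (mval nu + U_(ord0) *+ (n - m))%MM.
Proof. exact: (projT2 (boolp.choice up_monom)). Qed.

Lemma raise_up (G : monom m -> C) nu : raise n G (up nu) = G nu.
Proof.
rewrite /raise /fcoef upE mulrC mpolyXn addmC mcoeffMX; exact: mcoeff_pform.
Qed.

Lemma gr_up nu : gr (up nu) = gr nu.
Proof. rewrite /gr upE mnmDE mulmnE mnm1E eqxx mul1n; have := mval_le nu; lia. Qed.

Lemma up_onto (mu : monom n) : gr mu = m -> exists nu, mu = up nu.
Proof.
move=> h; have le : (U_(ord0) *+ (n - m) <= mval mu)%MM.
  apply/mnm_lepP => j; rewrite mulmnE mnm1E; case: eqP => [<-|_]; last by rewrite mul0n.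
  by move: h; rewrite /gr mul1n; have := mval_le mu; lia.
have [nu hnu] : exists nu : monom m, mval nu = (mval mu - U_(ord0) *+ (n - m))%MM.
  apply: mval_onto; have := mdeg_mval mu; rewrite -{1}(submK le) mdegD mdegMn mdeg1 mul1n; lia.
by exists nu; apply: mval_inj; rewrite upE hnu submK.
Qed.

(** The solver is applied to [G0] itself, in degree [m]. As the correcting forms have affine degree
    below [m], the part of affine degree [m] can be prescribed: leading forms of good nodal surfaces
    fill a neighbourhood of that of [G0]. *)
Lemma solve_lead : exists2 e : R, 0 < e & forall x : monom n -> C,
  (forall mu, cabs (x mu - lead m (raise n G0) mu) <= e) ->
  exists2 z, good z & lead m x = lead m (raise n (dform z)).
Proof.
have mm := leqnn m.
have [S [r [S0 r0 hsol]]] := incidence_solve (raise_singular mm nod0) (raise_hess mm nod0)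
  (node_formsE mm G0 m0 hH detH).
have [e0 e00 he0] := polyfun_nonzero_near polyfun_sig sig0.
have S1 : 0 < S + 1 by rewrite ltr_wpDl.
exists (Num.min r (e0 / (S + 1))); first by rewrite lt_min r0 divr_gt0.
set e := Num.min _ _ => x hx.
have e_ge0 : 0 <= e by rewrite le_min !ltW // divr_gt0.
pose v (nu : monom m) : C := if gr nu == m then x (up nu) - G0 nu else 0.
have hv nu : cabs (v nu) <= e.
  rewrite /v; case: eqP => h; last by rewrite cabs0.
  by have := hx (up nu); rewrite /lead gr_up h eqxx raise_up.
have he : 0 <= e <= r by rewrite e_ge0 ge_min lexx.
have [G [u [g1 g2 g3 g4]]] := hsol v e he hv.
have Se : S * e <= e0.
  apply: (@le_trans _ _ (S * (e0 / (S + 1)))).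
    by apply: ler_wpM2l => //; rewrite ge_min lexx orbT.
  by rewrite mulrA ler_pdivrMr // mulrC ler_pM2l // lerDl ler01.
exists (dpair G u).
  split; first by move=> k; apply: g4.
  apply: he0 => -[nu|[k l]] /=; last exact: le_trans (g3 k l) Se.
  by have := g2 nu; rewrite raise_id => h; apply: le_trans h Se.
apply/boolp.funext => mu; rewrite /lead; case: eqP => // h.
have [nu e2] := up_onto h; rewrite e2 raise_up /dform /=.
have hnu : gr nu = m by rewrite -gr_up -e2.
rewrite g1 => [|k]; last by apply: (node_forms_low mm G0 m0 detH); rewrite hnu.
by rewrite raise_id /v hnu eqxx addrC subrK.
Qed.

Definition degenerates (x : monom n -> C) := [/\ mult_ge m x, h1 x != 0 &
  exists2 z, good z & lead m x = lead m (raise n (dform z))].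

Lemma mult_ge_lead (x : monom n -> C) : mult_ge m (lead m x).
Proof. by move=> mu h; rewrite /lead ltn_eqF. Qed.

(** A complex neighbourhood is Zariski dense in a linear space, so it suffices to leave the leading
    form of [G0] a little along a generic line. The further variables [J] let the open condition
    depend on parameters, such as a change of coordinates. *)
Lemma dense_degenerates (J : finType) (Psi : (monom n + J -> C) -> C) w1 : polyfun Psi ->
  mult_ge m (fun mu => w1 (inl mu)) -> Psi w1 != 0 ->
  exists2 w, Psi w != 0 & degenerates (fun mu => w (inl mu)).
Proof.
move=> hPsi L1 p1; have [e e0 he] := solve_lead; have [x2 L2 hx2] := h1ne.
pose h1' (w : monom n + J -> C) := h1 (fun mu => w (inl mu)).
have hh1' : polyfun h1' by apply: polyfun_comp hh1 _ => mu; apply: polyfunX.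
pose w2 : monom n + J -> C := joinv x2 (fun=> 0).
pose w0 : monom n + J -> C := joinv (lead m (raise n G0)) (fun=> 0).
have [t [ht1 ht2]] := segment_generic (y := w2) hPsi hh1' p1 hx2.
set w3 := segment w1 w2 t in ht1 ht2.
have L3 : mult_ge m (fun mu => w3 (inl mu)) by apply: mult_ge_segment.
have [t' [h3 h4]] := segment_near w0 (polyfunM hPsi hh1') (mulf_neq0 ht1 ht2) e0.
exists (segment w0 w3 t'); first by move: h4; rewrite mulf_eq0 negb_or => /andP [].
split; first by apply: (mult_ge_segment t' (@mult_ge_lead _) L3).
  by move: h4; rewrite mulf_eq0 negb_or => /andP [].
by apply: he => mu; apply: h3.
Qed.

Lemma degenerates_approximants x : degenerates x ->
  exists (F X : nat -> monom n -> C) (U : nat -> 'I_delta -> 'I_3 -> C),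
  let t j : C := (j.+1%:R^-1 : R)%:C%C in
  [/\ forall j, pform (X j) = (t j ^+ m)^-1 *: act (dil (t j)) (pform (F j)),
      forall mu, ulim (fun j => F j mu) (x mu),
      uae (fun j => incidence_point (dpair (X j) (U j)) /\ (s (dpair (X j) (U j)) != 0 /\
        value_det H (fun k => affine_pt (U j k)) != 0)),
      forall k i, ulim (fun j => affine_pt (fun l => t j * U j k l) i) (i == ord0)%:R
    & uae (fun j => nodes_enum (pform (F j)) (fun k => affine_pt (fun l => t j * U j k l)))].
Proof.
case=> Lx hx [z gz lz]; have [sole smooth] := h1P Lx hx.
have [nz dz] := good_nodes gz.
have [F [X [U [h2 [h3 h4 h5] h6 h7]]]] := nodal_approximants mn m0 nz hH dz Lx lz sole smooth.
exists F, X, U; split=> //.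
  apply: uae_and; first by apply: uaeW h6.
  apply: uae_and.
    apply: ulim_neq0 (good_s gz).
    apply: ulim_polyfun hs _ => -[mu|[k l]]; [exact: h3 | exact: h4].
  apply: ulim_neq0 dz; apply: ulim_det => a b.
  rewrite [X in ulim _ X]mxE.
  apply: ulim_eq (ulim_meval (H a) (fun i => ulim_affine i (h4 b))).
  by apply: uae_true => j; rewrite [RHS]mxE.
move=> k i; rewrite /affine_pt; case: (unliftP ord0 i) => [l ->|->]; last by rewrite eqxx; apply: ulim_cst.
have -> : (lift ord0 l == ord0 :> 'I_4)%:R = 0 * upart z k l :> C by rewrite mul0r.
apply: ulimM; [exact: ulim_inv_nat | exact: h4].
Qed.

Lemma definable_degenerates : definable degenerates.
Proof.
apply: (@definable_ext _ _ (fun x => (forall mu, (gr mu < m)%N -> x mu = 0) /\ (~ (h1 x = 0) /\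
  exists z, (forall k, singular (pform (dform z)) (dpt z k)) /\ (~ (sig z = 0) /\
    forall mu, lead m x mu - lead m (raise n (dform z)) mu = 0)))).
  move=> x; split=> [[a1 [/eqP a2 [z [b1 [/eqP b2 b3]]]]]|[a1 /eqP a2 [z [b1 /eqP b2] b3]]].
    split=> //; exists z; first by split.
    by apply/boolp.funext => mu; apply/eqP; rewrite -subr_eq0; apply/eqP.
  do 2![split=> //]; exists z; do 2![split=> //]; move=> mu.
  by rewrite b3 subrr.
apply: definable_and.
  apply: definable_all => mu; apply: definable_imp; first exact: definable_const.
  by apply: definable_zero; apply: polyfunX.
apply: definable_and; first by apply/definable_not/definable_zero.
pose T : finType := (monom n + dvar m delta)%type.
apply: (definable_ex (D := fun w : T -> C =>
  (forall k, singular (pform (dform (fun a => w (inr a)))) (dpt (fun a => w (inr a)) k)) /\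
  (~ (sig (fun a => w (inr a)) = 0) /\
   forall mu, lead m (fun mu => w (inl mu)) mu - lead m (raise n (dform (fun a => w (inr a)))) mu = 0))).
apply: definable_and.
  apply: definable_all => k; apply: (@definable_singular _ _ _ (fun mu w => w (inr (inl mu)))
    (fun i w => dpt (fun a => w (inr a)) k i)) => [mu|i]; first exact: polyfunX.
  by rewrite /dpt /affine_pt; case: unlift => [l|]; [exact: polyfunX | exact: polyfunC].
apply: definable_and.
  by apply/definable_not/definable_zero; apply: polyfun_comp polyfun_sig _ => a; apply: polyfunX.
apply: definable_all => mu; apply: definable_zero; rewrite /lead; case: eqP => _; last first.
  by apply: polyfunB; apply: polyfunC.
apply: polyfunB; first exact: polyfunX.
by apply: polyfun_raise => nu; apply: polyfunX.
Qed.

Definition multiple (x : monom n -> C) := exists2 g, g \in unitmx & mult_ge m (cact g x).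

Lemma polyfun_cact_join mu : polyfun (fun w : monom n + 'I_4 * 'I_4 -> C =>
  cact (gm (fun ij => w (inr ij))) (fun nu => w (inl nu)) mu).
Proof. by apply: polyfun_cact => *; apply: polyfunX. Qed.

Lemma polyfun_det_join : polyfun (fun w : monom n + 'I_4 * 'I_4 -> C => \det (gm (fun ij => w (inr ij)))).
Proof.
apply: polyfun_det => i j; apply: polyfun_ext (polyfunX _ (inr (i, j))) => w.
by rewrite mxE.
Qed.

Lemma multiple_cact w x : \det (gm w) != 0 -> mult_ge m x -> multiple (cact (gm w) x).
Proof.
move=> dw Lx; have uw : gm w \in unitmx by rewrite unitmxE unitfE.
by exists (invmx (gm w)); rewrite ?unitmx_inv // cactM mulmxV // cact1.
Qed.

Lemma multiple_param x : multiple x -> exists x' w, [/\ \det (gm w) != 0, mult_ge m x' & x = cact (gm w) x'].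
Proof.
case=> g ug Lg; exists (cact g x), (fun ij => invmx g ij.1 ij.2); rewrite gmK; split=> //.
  by rewrite -unitfE -unitmxE unitmx_inv.
by rewrite cactM mulmxV // cact1.
Qed.

(** The set is parametrized by an open part of a linear space, pairs of an invertible matrix and a
    surface singular at the base point; two open conditions are met together on the line joining two
    parameters. *)
Lemma prime_multiple : prime_set multiple.
Proof.
split.
  exists (cact 1%:M (fun=> 0)); exists 1%:M; first exact: unitmx1.
  by rewrite !cact1.
move=> phi psi hphi hpsi [_ /multiple_param [x1 [w1 [d1 L1 ->]]] p1] [_ /multiple_param [x2 [w2 [d2 L2 ->]]] p2].
pose par (w : monom n + 'I_4 * 'I_4 -> C) := cact (gm (fun ij => w (inr ij))) (fun nu => w (inl nu)).
have hpar f : polyfun f -> polyfun (fun w => f (par w)).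
  by move=> hf; apply: (polyfun_comp (v := fun mu w => par w mu) hf) => mu; apply: polyfun_cact_join.
pose dt (w : monom n + 'I_4 * 'I_4 -> C) := \det (gm (fun ij => w (inr ij))).
have [t [t1 t2]] := segment_generic (x := joinv x1 w1) (y := joinv x2 w2)
   (polyfunM (hpar _ hphi) polyfun_det_join) (hpar _ hpsi) (mulf_neq0 p1 d1) p2.
move: t1; rewrite mulf_eq0 negb_or => /andP [t1 t3].
set w := segment _ _ t in t1 t2 t3.
exists (par w); last by rewrite mulf_neq0.
by apply: multiple_cact => //; apply: mult_ge_segment.
Qed.

(** The existence of good coordinates is definable, hence generically true or generically false;
    density of [degenerates] rules out the second case. *)
Lemma generic_degenerates : exists h, [/\ polyfun h, exists2 x, multiple x & h x != 0 &
  forall x, multiple x -> h x != 0 -> exists2 g, g \in unitmx & degenerates (cact g x)].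
Proof.
pose D (x : monom n -> C) := exists w : 'I_4 * 'I_4 -> C, ~ (\det (gm w) = 0) /\ degenerates (cact (gm w) x).
have hD : definable D.
  apply: (definable_ex (D := fun w : monom n + 'I_4 * 'I_4 -> C => ~ (\det (gm (fun ij => w (inr ij))) = 0) /\
    degenerates (cact (gm (fun ij => w (inr ij))) (fun nu => w (inl nu))))).
  apply: definable_and; first by apply/definable_not/definable_zero/polyfun_det_join.
  apply: (definable_comp (v := fun mu w => cact (gm (fun ij => w (inr ij))) (fun nu => w (inl nu)) mu)
    definable_degenerates) => mu; exact: polyfun_cact_join.
have [h [hh [x Mx hx] [hP|hP]]] := definable_generic prime_multiple hD; exists h; split=> //; first by exists x.
- move=> y My hy; have [w [/eqP dw dg]] := hP y My hy.
  by exists (gm w) => //; rewrite unitmxE unitfE.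
- by exists x.
have [x' [w' [d' L' e']]] := multiple_param Mx.
pose Psi (w : monom n + 'I_4 * 'I_4 -> C) := \det (gm (fun ij => w (inr ij))) *
  h (cact (gm (fun ij => w (inr ij))) (fun nu => w (inl nu))).
have hPsi : polyfun Psi.
  apply: polyfunM; first exact: polyfun_det_join.
  by apply: (polyfun_comp (v := fun mu w => cact (gm (fun ij => w (inr ij))) (fun nu => w (inl nu)) mu) hh) => mu;
    apply: polyfun_cact_join.
have [||w pw dw] := @dense_degenerates _ Psi (joinv x' w') hPsi; first exact: L'.
  by rewrite /Psi mulf_neq0 //= -e'.
move: pw; rewrite /Psi mulf_eq0 negb_or => /andP [d1 p1].
set g := gm (fun ij => w (inr ij)) in d1 p1; have ug : g \in unitmx by rewrite unitmxE unitfE.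
have [Lw _ _] := dw; exfalso; apply: (hP _ (multiple_cact d1 Lw) p1).
exists (fun ij => invmx g ij.1 ij.2); rewrite gmK cactM mulmxV // cact1; split=> //.
by apply/eqP; rewrite -unitfE -unitmxE unitmx_inv.
Qed.

End Degeneration.

(** * Closed sets and components of the Severi variety *)

Section CoefficientSpace.
Variables (K : numClosedFieldType) (n : nat).
Implicit Types (F : dhomog 4 K n) (Z : dhomog 4 K n -> Prop) (x : monom n -> K).

Definition form x : dhomog 4 K n := DHomog (pform_homog x).

Lemma pform_coef F : pform (coef F) = mpoly_of_dhomog F.
Proof. by case: F => F hF; apply: pformK. Qed.

Lemma coef_form x : coef (form x) = x.
Proof. exact: fcoefK. Qed.

Lemma form_coef F : form (coef F) = F.
Proof. by apply: val_inj; apply: pform_coef. Qed.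

Lemma zclosed_eqs Z : zclosed Z -> exists2 E : ((monom n -> K) -> K) -> Prop,
  forall phi, E phi -> polyfun phi /\ forall x c, phi x = 0 -> phi (fun mu => c * x mu) = 0
  & forall F, Z F <-> F != 0 /\ forall phi, E phi -> phi (coef F) = 0.
Proof.
case=> E hE ZE; exists (fun phi => exists2 Phi, E Phi & forall x, phi x = Phi.@[fun a => x (enum_val a)]).
  move=> phi [Phi EP e]; split; first by exists Phi.
  have [k hk] := hE _ EP; move=> x c; rewrite !e => x0.
  by rewrite (meval_homog_scale c _ hk) x0 mulr0.
move=> F; split=> [/ZE [F0 h]|[F0 h]].
  by split=> // phi [Phi EP e]; rewrite e; apply: h.
by apply/ZE; split=> // Phi EP; apply: (h (fun x => Phi.@[fun a => x (enum_val a)])); exists Phi.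
Qed.

Lemma homogeneous_parts_eq0 N (P : {mpoly K[#|monom n|]}) v : P = \sum_(d < N) pihomog mdeg d P ->
  (forall c, c != 0 -> P.@[fun a => c * v a] = 0) <-> (forall k : 'I_N, (pihomog mdeg k P).@[v] = 0).
Proof.
move=> hN; have scale c : P.@[fun a => c * v a] = \sum_(d < N) c ^+ d * (pihomog mdeg d P).@[v].
  rewrite {1}hN (raddf_sum (meval _)); apply: eq_bigr => d _ /=.
  by apply: meval_homog_scale; apply: pihomogP.
split=> [h k|h c _]; last by rewrite scale big1 // => d _; rewrite h mulr0.
pose q : {poly K} := \poly_(d < N) (pihomog mdeg d P).@[v].
suff q0 : q = 0 by have := coef_poly N (fun d => (pihomog mdeg d P).@[v]) k; rewrite -/q q0 coef0 ltn_ord.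
suff /eqP : q * 'X = 0 by rewrite mulf_eq0 polyX_eq0 orbF => /eqP.
apply: poly_ext => c; rewrite hornerM hornerX horner0.
have [->|c0] := eqVneq c 0; first by rewrite mulr0.
suff -> : q.[c] = 0 by rewrite mul0r.
rewrite -(h c c0) scale horner_poly; apply: eq_bigr => d _; exact: mulrC.
Qed.

(** The functions in [E] need not be homogeneous; vanishing at all nonzero multiples of [F] amounts
    to the vanishing of all their homogeneous parts, which are admissible equations. *)
Lemma zclosed_cone (E : ((monom n -> K) -> K) -> Prop) : (forall phi, E phi -> polyfun phi) ->
  zclosed (fun F => F != 0 /\ forall phi c, E phi -> c != 0 -> phi (fun mu => c * coef F mu) = 0).
Proof.
move=> hE; exists (fun Q => exists phi P N (k : 'I_N), [/\ E phi, forall x, phi x = P.@[fun a => x (enum_val a)],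
    P = \sum_(d < N) pihomog mdeg d P & Q = pihomog mdeg k P]).
  by move=> Q [phi [P [N [k [_ _ _ ->]]]]]; exists k; apply: pihomogP.
move=> F; split=> -[F0 h]; split=> //.
  move=> Q [phi [P [N [k [Ep e hN ->]]]]].
  by apply: (homogeneous_parts_eq0 (coords F) hN).1 => c c0; have := h _ _ Ep c0; rewrite e.
move=> phi c Ep c0; have [P e] := hE _ Ep; have [N hN] := mpoly_pihomog_sum P.
rewrite e; apply: ((homogeneous_parts_eq0 (coords F) hN).2 _ c c0) => k.
by apply: h; exists phi, P, N, k.
Qed.

Lemma irreducible_of_generic (X : dhomog 4 K n -> Prop) : (exists F, X F) -> (forall F, X F -> F != 0) ->
  (forall phi psi, polyfun phi -> polyfun psi -> (exists2 F, X F & phi (coef F) != 0) ->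
    (exists2 F, X F & psi (coef F) != 0) -> exists2 F, X F & phi (coef F) * psi (coef F) != 0) ->
  irreducible_set X.
Proof.
move=> ne X0 hX; split=> // Z1 Z2 cZ1 cZ2 cov; apply: boolp.contrapT => no.
have key Z : zclosed Z -> ~ (forall F, X F -> Z F) ->
    exists phi, [/\ polyfun phi, exists2 F, X F & phi (coef F) != 0 & forall F, Z F -> phi (coef F) = 0].
  move=> /zclosed_eqs [E hE ZE] nZ; apply: boolp.contrapT => no'; apply: nZ => F XF; apply/ZE.
  split=> [|phi Ep]; first exact: X0.
  apply/eqP/negPn/negP => h; apply: no'; exists phi; split; [by have [] := hE _ Ep| by exists F|].
  by move=> G /ZE [_]; apply.
have [|phi [h1 h2 h3]] := key Z1 cZ1; first by move=> h; apply: no; left.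
have [|psi [g1 g2 g3]] := key Z2 cZ2; first by move=> h; apply: no; right.
have [F XF] := hX _ _ h1 g1 h2 g2; rewrite mulf_eq0 negb_or => /andP [/eqP a /eqP b].
by case: (cov F XF) => [/h3|/g3].
Qed.

End CoefficientSpace.

Lemma zclosed_ext (K : numClosedFieldType) n (Z Z' : dhomog 4 K n -> Prop) :
  (forall F, Z F <-> Z' F) -> zclosed Z -> zclosed Z'.
Proof. by move=> ZZ [E hE ZE]; exists E => // F; rewrite -ZZ. Qed.

Section Components.
Variables (K : numClosedFieldType) (n : nat) (S : dhomog 4 K n -> Prop).

(** A union of a chain of irreducible sets is irreducible: two points showing that neither closed
    set suffices lie in a common member of the chain. *)
Lemma component_above X0 : (forall F, X0 F -> S F) -> irreducible_set X0 ->
  exists2 W, irreducible_component S W & forall F, X0 F -> W F.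
Proof.
move=> X0S irr0; pose Q (Y : dhomog 4 K n -> Prop) := (forall F, Y F -> S F) /\ irreducible_set Y.
have [||W [[WS irrW] X0W maxW]] := @zorn_above _ Q X0; first by split.
  move=> C [A0 CA0] CQ tot; split; first by move=> F [A /CQ [AS _]]; apply: AS.
  split; first by have [_ [[F A0F] _]] := CQ _ CA0; exists F, A0.
  move=> Z1 Z2 cZ1 cZ2 cov; apply: boolp.contrapT => no.
  have miss Z : ~ (forall F, (exists2 A, C A & A F) -> Z F) -> exists A F, [/\ C A, A F & ~ Z F].
    move=> h; apply: boolp.contrapT => no'; apply: h => F [A CA AF].
    by apply: boolp.contrapT => nZ; apply: no'; exists A, F.
  have [|A1 [F1 [C1 AF1 n1]]] := miss Z1; first by move=> h; apply: no; left.
  have [|A2 [F2 [C2 AF2 n2]]] := miss Z2; first by move=> h; apply: no; right.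
  have [A [CA AF1' AF2']] : exists A, [/\ C A, A F1 & A F2].
    by have [h|h] := tot _ _ C1 C2; [exists A2 | exists A1]; split=> //; apply: h.
  have [_ [_ irrA]] := CQ _ CA.
  by have [|/(_ _ AF1')|/(_ _ AF2')] := irrA _ _ cZ1 cZ2; first by move=> F AF; apply: cov; exists A.
by exists W => //; split=> // Y YS irrY WY; apply: maxW.
Qed.

End Components.

(** * Stability of components under linear changes of coordinates *)

Section Translates.
Variables (R : realType) (n : nat).
Local Notation C := R[i].
Implicit Types (F : dhomog 4 C n) (Z W : dhomog 4 C n -> Prop).

Definition act_form g F : dhomog 4 C n := form (cact g (coef F)).

Lemma act_formE g F : mpoly_of_dhomog (act_form g F) = act g (mpoly_of_dhomog F).
Proof. rewrite -[in RHS]pform_coef; exact: (pform_cact g (coef F)). Qed.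

Lemma act_formM g h F : act_form g (act_form h F) = act_form (h *m g) F.
Proof. by rewrite /act_form coef_form cactM. Qed.

Lemma act_form1 F : act_form 1%:M F = F.
Proof. by rewrite /act_form cact1 form_coef. Qed.

Lemma act_form_neq0 g F : g \in unitmx -> F != 0 -> act_form g F != 0.
Proof.
move=> ug; apply: contraNneq => e; rewrite -[F]act_form1 -(mulmxV ug) -act_formM e.
apply/eqP/val_inj; apply: etrans (act_formE (invmx g) 0) _.
apply: etrans (_ : act (invmx g) (0 *: 0) = 0); first by rewrite scale0r.
by rewrite actZ scale0r.
Qed.

Lemma polyfun_cact_cst g phi : polyfun phi -> polyfun (fun x : monom n -> C => phi (cact g x)).
Proof.
move=> h; apply: (polyfun_comp (v := fun mu x => cact g x mu) h) => mu.
apply: (@polyfun_ext _ _ (fun z : monom n -> C => cact (\matrix_(i, j) g i j) (fun nu => z nu) mu)).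
  have -> : \matrix_(i, j) g i j = g by apply/matrixP => i j; rewrite mxE.
  by [].
by apply: (polyfun_cact (g := fun i j _ => g i j)) => [i j|nu]; [exact: polyfunC | exact: polyfunX].
Qed.

Lemma cactZ g c (x : monom n -> C) : cact g (fun mu => c * x mu) = (fun mu => c * cact g x mu).
Proof.
have e (y : monom n -> C) : pform (fun mu => c * y mu) = c *: pform y.
  by rewrite /pform scaler_sumr; apply: eq_bigr => mu _; rewrite scalerA.
by rewrite /cact e actZ; apply/boolp.funext => mu; rewrite /fcoef mcoeffZ.
Qed.

Lemma zclosed_act g Z : g \in unitmx -> zclosed Z -> zclosed (fun F => Z (act_form g F)).
Proof.
move=> ug /zclosed_eqs [E hE ZE].
pose E' (phi : (monom n -> C) -> C) := exists2 psi, E psi & phi = fun x => psi (cact g x).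
have hE' phi : E' phi -> polyfun phi.
  by case=> psi Ep ->; apply: polyfun_cact_cst; have [] := hE _ Ep.
apply: zclosed_ext (zclosed_cone hE') => F; split=> [[F0 h]|/ZE [F0 h]].
  apply/ZE; split; first exact: act_form_neq0.
  move=> psi Ep; rewrite coef_form.
  have := h (fun x => psi (cact g x)) 1 (ex_intro2 _ _ psi Ep erefl) (oner_neq0 _).
  by rewrite /= cactZ => <-; congr psi; apply/boolp.funext => mu; rewrite mul1r.
split=> [|_ c [psi Ep ->] c0].
  by rewrite -[F]act_form1 -(mulmxV ug) -act_formM; apply: act_form_neq0; rewrite ?unitmx_inv.
by rewrite /= cactZ; have [_] := hE _ Ep; apply; rewrite -[cact g _]coef_form; apply: h.
Qed.

Lemma severi_act delta g F : g \in unitmx -> severi delta F -> severi delta (act_form g F).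
Proof.
move=> ug [F0 [q nq]]; split; first exact: act_form_neq0.
exists (fun k => gv (invmx g) (q k)); rewrite act_formE; apply: (nodes_enum_act (d := n) ug) nq.
by case: (F).
Qed.

(** All translates of [W] by invertible matrices together form an irreducible set, because
    invertible matrices are an open part of a linear space; by maximality this set is [W]. *)
Lemma component_act delta g W F : irreducible_component (@severi C n delta) W -> g \in unitmx ->
  W F -> W (act_form g F).
Proof.
case=> WS [[F0 WF0] irrW] maxW ug WF.
pose Y G := exists2 h, h \in unitmx & exists2 F', W F' & G = act_form h F'.
apply: (maxW Y); [by move=> _ [h uh [F' WF' ->]]; apply: severi_act => //; apply: WS | | | by exists g => //; exists F].
  split; first by exists F0, 1%:M; rewrite ?unitmx1 //; exists F0; rewrite ?act_form1.
  move=> Z1 Z2 cZ1 cZ2 cov; apply: boolp.contrapT => no.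
  have miss Z : zclosed Z -> ~ (forall F, Y F -> Z F) -> exists phi w F',
      [/\ polyfun phi, W F', \det (gm w) * phi (cact (gm w) (coef F')) != 0 & forall F, Z F -> phi (coef F) = 0].
    move=> /zclosed_eqs [E hE ZE] h; apply: boolp.contrapT => no'; apply: h => _ [h uh [F' WF' ->]].
    apply/ZE; split; first by apply: act_form_neq0 => //; have [] := WS _ WF'.
    move=> phi Ep; apply/eqP/negPn/negP => ph; apply: no'.
    exists phi, (fun ij => h ij.1 ij.2), F'; rewrite gmK; split=> //; first by have [] := hE _ Ep.
      by rewrite mulf_neq0 -?unitfE -?unitmxE //; rewrite coef_form in ph.
    by move=> G /ZE [_]; apply.
  have [|phi1 [w1 [G1 [p1 WG1 ne1 v1]]]] := miss _ cZ1; first by move=> h; apply: no; left.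
  have [|phi2 [w2 [G2 [p2 WG2 ne2 v2]]]] := miss _ cZ2; first by move=> h; apply: no; right.
  have hdet : polyfun (fun w : 'I_4 * 'I_4 -> C => \det (gm w)).
    apply: polyfun_det => i j; apply: polyfun_ext (polyfunX _ (i, j)) => w; by rewrite mxE.
  have hc (phi : (monom n -> C) -> C) G : polyfun phi ->
      polyfun (fun w : 'I_4 * 'I_4 -> C => \det (gm w) * phi (cact (gm w) (coef G))).
    move=> hp; apply: polyfunM hdet _.
    apply: (polyfun_comp (v := fun mu (w : 'I_4 * 'I_4 -> C) => cact (gm w) (coef G) mu) hp) => mu.
    by apply: (polyfun_cact (x := fun nu _ => coef G nu)) => [i j|nu]; [exact: polyfunX | exact: polyfunC].
  (* One matrix [w] keeps both witnesses [G1] and [G2] off the closed sets; irreducibility of [W]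
     against the pulled back closed sets is then contradicted. *)
  have [t [t1 t2]] := segment_generic (hc _ G1 p1) (hc _ G2 p2) ne1 ne2.
  set w := segment _ _ t in t1 t2.
  move: t1 t2; rewrite !mulf_eq0 !negb_or => /andP [d1 t1] /andP [_ t2].
  have uw : gm w \in unitmx by rewrite unitmxE unitfE.
  have [|h|h] := irrW _ _ (zclosed_act uw cZ1) (zclosed_act uw cZ2).
  - by move=> G WG; apply: cov; exists (gm w) => //; exists G.
  - by have := v1 _ (h _ WG1); rewrite coef_form => /eqP; apply/negP.
  - by have := v2 _ (h _ WG2); rewrite coef_form => /eqP; apply/negP.
by move=> G WG; exists 1%:M; [exact: unitmx1 | exists G; rewrite ?act_form1].
Qed.

(** Multiplying a form of degree [n] by [c] is the substitution by the scalar matrix of an [n]-th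
    root of [c]. *)
Lemma component_scale delta c W F : (0 < n)%N -> irreducible_component (@severi C n delta) W -> c != 0 ->
  W F -> W (form (fun mu => c * coef F mu)).
Proof.
move=> n0 cW c0 WF; pose l := n.-root c.
have ln : l ^+ n = c by apply: rootCK.
have l0 : l != 0 by apply: contraNneq c0 => l0; rewrite -ln l0 expr0n gtn_eqF.
suff -> : form (fun mu => c * coef F mu) = act_form l%:M F.
  by apply: component_act cW _ WF; rewrite unitmxE det_scalar unitfE expf_neq0.
apply: val_inj; apply: etrans (esym (act_formE _ _)); apply: mpoly_ext => v; rewrite act_eval /=.
have -> : gv l%:M v = fun i => l * v i.
  apply/boolp.funext => i; rewrite /gv (bigD1 i) //= big1 => [|j ji].
    by rewrite mxE eqxx mulr1n addr0.
  by rewrite mxE eq_sym (negbTE ji) mulr0n mul0r.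
rewrite -(pform_coef F) (meval_homog_scale l v (pform_homog (coef F))) ln !pform_eval mulr_sumr.
by apply: eq_bigr => mu _; rewrite mulrA.
Qed.

End Translates.

(** * Multiple points in coordinates *)

Lemma local_eq_act (K : numClosedFieldType) g i j p q (F : {mpoly K[4]}) :
  (forall v, gv g (chart_pt j q v) = chart_pt i p v) -> local_eq j q (act g F) = local_eq i p F.
Proof. by move=> h; apply: mpoly_ext => v; rewrite !local_eq_eval act_eval h. Qed.

Section MultiplePoints.
Variables (R : realType) (n m : nat).
Local Notation C := R[i].
Implicit Types x : monom n -> C.

Definition low (mu : monom n) : 'X_{1..3} := [multinom mval mu (lift ord0 l) | l < 3].

Lemma mdeg_low mu : mdeg (low mu) = gr mu.
Proof.
have := mdeg_mval mu; rewrite /gr mdegE (big_ord_recl 3) mdegE => e.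
by under eq_bigr => l _ do rewrite mnmE; rewrite -{2}e addKn.
Qed.

Lemma low_inj : injective low.
Proof.
move=> mu nu e; have g : gr mu = gr nu by rewrite -!mdeg_low e.
apply: mval_inj; apply/mnmP => i; case: (unliftP ord0 i) => [l ->|->].
  by have /mnmP /(_ l) := e; rewrite !mnmE.
by move: g; rewrite /gr; have := mval_le mu; have := mval_le nu; lia.
Qed.

Definition base_pt : 'I_4 -> C := affine_pt (fun=> 0).

Lemma chart_base v : chart_pt ord0 base_pt v = affine_pt v.
Proof.
apply/boolp.funext => i; rewrite /chart_pt /base_pt /affine_pt.
by case: (unlift ord0 i) => [l|] //; rewrite add0r.
Qed.

Lemma local_eq_base x : local_eq ord0 base_pt (pform x) = \sum_mu x mu *: 'X_[low mu].
Proof.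
apply: mpoly_ext => v; rewrite local_eq_eval chart_base pform_eval (raddf_sum (meval v)).
apply: eq_bigr => mu _ /=; rewrite mevalZ; congr (_ * _).
rewrite !mevalX big_ord_recl affine_pt0 expr1n mul1r; apply: eq_bigr => l _.
by rewrite affine_ptS mnmE.
Qed.

Lemma pihomog_local_base k x :
  pihomog mdeg k (local_eq ord0 base_pt (pform x)) = local_eq ord0 base_pt (pform (lead k x)).
Proof.
rewrite !local_eq_base (raddf_sum (pihomog mdeg k)); apply: eq_bigr => mu _ /=.
rewrite linearZ /= /lead -mdeg_low; case: eqP => [e|/eqP ne].
  by congr (_ *: _); apply: pihomog_dE; rewrite dhomogX /= e.
rewrite scale0r; have -> : pihomog mdeg k 'X_[low mu] = 0 :> {mpoly C[3]}; last by rewrite scaler0.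
by apply: (@pihomog_ne0 _ _ _ (mdeg (low mu))) => //; rewrite dhomogX.
Qed.

Lemma mult_ge_local x : mult_ge m x <->
  forall k, (k < m)%N -> pihomog mdeg k (local_eq ord0 base_pt (pform x)) = 0.
Proof.
split=> [h k km|h mu hmu].
  rewrite pihomog_local_base local_eq_base big1 // => mu _; rewrite /lead.
  by case: eqP => [e|_]; rewrite ?scale0r // h ?scale0r // e.
have := h _ hmu; rewrite pihomog_local_base local_eq_base => /(congr1 (mcoeff (low mu))).
rewrite mcoeff0 (raddf_sum (mcoeff (low mu))) (bigD1 mu) //= big1 => [|nu ne].
  by rewrite mcoeffZ mcoeffX eqxx mulr1 addr0 /lead eqxx.
by rewrite mcoeffZ mcoeffX (inj_eq low_inj) (negbTE ne) mulr0.
Qed.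

Lemma ordinary_base x : mult_ge m x -> smooth_lead m x -> ordinary_sing m (pform x) base_pt.
Proof.
move=> Lx smooth.
have sm : smooth_plane_curve (pihomog mdeg m (local_eq ord0 base_pt (pform x))).
  move=> v [l vl] [v0 dv]; case/eqP: vl; apply: smooth.
  apply: (@singular_euler _ n _ _ ord0); first exact: pform_homog.
  - by rewrite affine_pt0 oner_eq0.
  - by rewrite -v0 pihomog_local_base local_eq_eval chart_base.
  by move=> k; rewrite -(dv k) pihomog_local_base local_eq_deriv local_eq_eval chart_base.
exists ord0 => //; split; [by rewrite /base_pt affine_pt0 oner_eq0 | exact/mult_ge_local |].
apply/eqP => f0; apply: (sm (fun=> 1)); first by exists ord0; rewrite oner_eq0.
by rewrite f0 meval0; split=> // j; rewrite mderiv0 meval0.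
Qed.

Lemma mult_ge_singular x : (1 < m)%N -> mult_ge m x -> singular (pform x) base_pt.
Proof.
move=> m1 Lx; have h := (mult_ge_local x).1 Lx.
apply: (@singular_euler _ n _ _ ord0); first exact: pform_homog.
- by rewrite /base_pt affine_pt0 oner_eq0.
- rewrite -(local_eq0 ord0); have := congr1 (mcoeff 0%MM) (h 0%N (ltnW m1)).
  by rewrite mcoeff_pihomog mdeg0 eqxx mcoeff0.
move=> k; rewrite -local_eqU; have := congr1 (mcoeff U_(k)%MM) (h 1%N m1).
by rewrite mcoeff_pihomog mdeg1 eqxx mcoeff0.
Qed.

Lemma multiple_of_mult (F : dhomog 4 C n) p : has_mult m (mpoly_of_dhomog F) p ->
  exists2 g, g \in unitmx & mult_ge m (cact g (coef F)) /\ gv g base_pt = p.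
Proof.
case=> i [pi h _].
(* The first column is [p] and the others are the directions of the chart [i], so [g] carries the
   chart at the base point to the chart at [p]. *)
pose g : 'M[C]_4 := \matrix_(a, b) (if unlift ord0 b is Some l then (a == lift i l)%:R else p a).
have gE v : gv g (affine_pt v) = chart_pt i p v.
  apply/boolp.funext => a; rewrite /gv (big_ord_recl 3) affine_pt0 mulr1 mxE unlift_none /chart_pt.
  under eq_bigr => l _ do rewrite mxE liftK affine_ptS.
  case: (unliftP i a) => [l ->|->]; last first.
    by rewrite big1 ?addr0 // => l _; rewrite (negbTE (neq_lift _ _)) mul0r.
  congr (_ + _); rewrite (bigD1 l) //= big1 => [|k kl]; first by rewrite eqxx mul1r addr0.
  by rewrite (inj_eq (@lift_inj _ i)) eq_sym (negbTE kl) mul0r.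
exists g; last first.
  split; last by rewrite /base_pt gE chart_pt0.
  apply/mult_ge_local => k km; rewrite pform_cact pform_coef.
  have e : local_eq ord0 base_pt (act g F) = local_eq i p F.
    by apply: local_eq_act => v; rewrite chart_base gE.
  apply: etrans (h k km); exact: (congr1 (pihomog mdeg k) e).
apply: unitmx_of_inj => v gv0; apply/colP => b; rewrite [RHS]mxE.
have row a : g a ord0 * v ord0 0 + \sum_l g a (lift ord0 l) * v (lift ord0 l) 0 = 0.
  by have /colP /(_ a) := gv0; rewrite [in LHS]mxE [RHS]mxE (big_ord_recl 3).
have v0 : v ord0 0 = 0.
  have := row i; rewrite mxE unlift_none big1 ?addr0 => [/eqP|l _].
    by rewrite mulf_eq0 (negbTE pi) => /eqP.
  by rewrite mxE liftK (negbTE (neq_lift _ _)) mul0r.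
case: (unliftP ord0 b) => [l ->|->] //.
have := row (lift i l); rewrite v0 mulr0 add0r (bigD1 l) //= big1 ?addr0 => [|k kl].
  by rewrite mxE liftK eqxx mul1r.
by rewrite mxE liftK (inj_eq (@lift_inj _ i)) eq_sym (negbTE kl) mul0r.
Qed.

End MultiplePoints.

(** * The nodal surface of degree [m] with its nodes moved into the affine chart *)

Section InitialSurface.
Variables (R : realType) (m delta : nat).
Local Notation C := R[i].

Lemma node_neq0 (F : {mpoly C[4]}) p : node F p -> F != 0.
Proof.
case=> i [_ _ h] _; apply: contraNneq h => ->.
have -> : local_eq i p (0 : {mpoly C[4]}) = 0 by rewrite /local_eq raddf0.
by rewrite raddf0.
Qed.

(** The derivatives of a linear form are constant, so vanishing at one point kills them. This
    excludes [m = 1] in presence of a node. *)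
Lemma linear_form_smooth d (F : {mpoly C[4]}) p : d = 1%N -> F \is d.-homog -> singular F p -> F = 0.
Proof.
move=> -> hF [_ _ dF]; apply: mpoly_ext => v; rewrite meval0 -[LHS]mul1r -(euler v hF) big1 // => j _.
have z w : (F^`M(j)).@[w] = (F^`M(j)).@[fun=> 0].
  have := meval_homog_scale 0 w (mderiv_homog j hF); rewrite expr0 mul1r => <-.
  by apply: meval_eq => a; rewrite mul0r.
by rewrite z -(z p) dF mulr0.
Qed.

Lemma value_det_scale d (H : 'I_delta -> {mpoly C[4]}) (q q' : 'I_delta -> 'I_4 -> C) :
  (forall k, H k \is d.-homog) -> (forall k, same_point (q k) (q' k)) ->
  value_det H q != 0 -> value_det H q' != 0.
Proof.
move=> hH qq hd; have [c hc] : exists c : 'I_delta -> C, forall k, c k != 0 /\ forall i, q' k i = c k * q k i.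
  have ex k : exists c, c != 0 /\ forall i, q' k i = c * q k i by have [c c0 h] := qq k; exists c.
  by have [c hc] := boolp.choice ex; exists c.
have -> : value_det H q' = value_det H q * \prod_k c k ^+ d.
  rewrite /value_det; have -> : \prod_k c k ^+ d = \det (diag_mx (\row_l (c l ^+ d))).
    by rewrite det_diag; apply: eq_bigr => l _; rewrite mxE.
  rewrite -det_mulmx; congr (\det _); apply/matrixP => k l.
  rewrite mul_mx_diag [in LHS]mxE [in RHS]mxE [in RHS]mxE [in X in _ * X]mxE.
  have [_ e] := hc l; have -> : q' l = fun i => c l * q l i by apply/boolp.funext.
  by rewrite (meval_homog_scale _ _ (hH k)) mulrC.
by rewrite mulf_neq0 //; apply/prodf_neq0 => k _; rewrite expf_neq0 //; have [] := hc k.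
Qed.

Lemma nodes_enum_same d F (q q' : 'I_delta -> 'I_4 -> C) : F \is d.-homog ->
  (forall k, same_point (q k) (q' k)) -> nodes_enum F q -> nodes_enum F q'.
Proof.
move=> hF qq [nd dist all]; split.
- by move=> k; apply: (node_same hF (qq k)).
- move=> k l h; apply: dist; apply: same_point_trans (qq k) _.
  by apply: same_point_trans h _; apply: same_point_sym.
move=> p /all [k h]; exists k; apply: same_point_trans h; exact: same_point_sym.
Qed.

Lemma affine_nodal_surface (G : dhomog 4 C m) : (0 < m)%N -> (0 < delta)%N ->
  severi delta G -> H1_vanishes (node (mpoly_of_dhomog G)) m.-1 ->
  (1 < m)%N /\ exists (x : monom m -> C) (u : 'I_delta -> 'I_3 -> C) (H : 'I_delta -> {mpoly C[4]}),
    [/\ nodes_enum (pform x) (fun k => affine_pt (u k)), forall k, H k \is m.-1.-homog &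
        value_det H (fun k => affine_pt (u k)) != 0].
Proof.
move=> m0 d0 [G0 [q nq]] h1; have hG : mpoly_of_dhomog G \is m.-homog by case: (G).
have [nd dist all] := nq; have sq k := node_singular hG (nd k).
split.
  rewrite ltn_neqAle m0 andbT; apply: contraNneq G0 => m1; apply/eqP/val_inj.
  exact: (linear_form_smooth (esym m1) hG (sq (Ordinal d0))).
have [H [hH dH]] := indep_of_H1 hG nq h1.
have [|tau ht] := @avoiding_linform C _ q; first by move=> l; have [] := sq l.
(* Replaces the first coordinate by a linear form that vanishes at no node. *)
pose g : 'M[C]_4 := \matrix_(i, j) (if i == ord0 then tau ^+ j else (i == j)%:R).
have g0 y : gv g y ord0 = \sum_(i < 4) tau ^+ i * y i.
  by apply: eq_bigr => j _; rewrite [g _ _]mxE eqxx.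
have gS y l : gv g y (lift ord0 l) = y (lift ord0 l).
  rewrite /gv (bigD1 (lift ord0 l)) //= big1 => [|j jl].
    by rewrite [g _ _]mxE /= eqxx mul1r addr0.
  by rewrite [g _ _]mxE /= eq_sym (negbTE jl) mul0r.
have ug : g \in unitmx.
  apply: unitmx_of_inj => v hv.
  have row i : gv g (fun j => v j 0) i = 0 by have /colP /(_ i) := hv; rewrite [in LHS]mxE [RHS]mxE.
  have vS l : v (lift ord0 l) 0 = 0 by rewrite -(gS (fun j => v j 0)) row.
  apply/colP => i; rewrite [RHS]mxE; case: (unliftP ord0 i) => [l ->|->] //.
  have := row ord0; rewrite g0 (bigD1 ord0) //= big1 => [|j j0]; first by rewrite expr0 mul1r addr0.
  by case: (unliftP ord0 j) j0 => [l ->|-> //]; rewrite vS mulr0.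
pose q' k := gv g (q k); pose u k l := q' k (lift ord0 l) / q' k ord0.
have q0 k : q' k ord0 != 0 by rewrite /q' g0.
have qu k : same_point (q' k) (affine_pt (u k)).
  exists (q' k ord0)^-1; first by rewrite invr_eq0.
  move=> i; case: (unliftP ord0 i) => [l ->|->]; first by rewrite affine_ptS /u mulrC.
  by rewrite affine_pt0 mulVf.
have hG' : act (invmx g) (mpoly_of_dhomog G) \is m.-homog by apply: act_homog.
exists (fcoef (act (invmx g) (mpoly_of_dhomog G))), u, (fun k => act (invmx g) (H k)); split.
- rewrite (pformK hG'); apply: (nodes_enum_same hG' qu).
  have ug' : invmx g \in unitmx by rewrite unitmx_inv.
  have := nodes_enum_act ug' hG nq; rewrite invmxK; exact.
- by move=> k; apply: act_homog.
apply: (value_det_scale _ qu); first by move=> k; apply: act_homog.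
have -> : value_det (fun k => act (invmx g) (H k)) q' = value_det H q; last by [].
congr (\det _); apply/matrixP => k l; rewrite [LHS]mxE [RHS]mxE act_eval.
by rewrite /q' gv_unitK.
Qed.

End InitialSurface.

(** * The family of nodal surfaces near a multiple point *)

Section LimitFamily.
Variables (R : realType) (n m delta : nat).
Local Notation C := R[i].
Hypothesis mn : (m <= n)%N.
Hypothesis m1 : (1 < m)%N.
Hypothesis delta0 : (0 < delta)%N.
Variables (G0 : monom m -> C) (u0 : 'I_delta -> 'I_3 -> C) (H : 'I_delta -> {mpoly C[4]}).
Hypothesis nod0 : nodes_enum (pform G0) (fun k => affine_pt (u0 k)).
Hypothesis hH : forall k, H k \is m.-1.-homog.
Hypothesis detH : value_det H (fun k => affine_pt (u0 k)) != 0.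
Variables (rho : (monom m -> C) -> C) (s : (dvar n delta -> C) -> C) (h1 : (monom n -> C) -> C).
Hypothesis hrho : polyfun rho.
Hypothesis rho0 : rho G0 != 0.
Hypothesis rhoP : forall x, rho x != 0 -> forall q : 'I_delta -> 'I_4 -> C,
  (forall l, singular (pform x) (q l)) -> distinct_points q -> nodes_enum (pform x) q /\ value_det H q != 0.
Hypothesis hs : polyfun s.
Hypothesis s0 : s (dpair (raise n G0) u0) != 0.
Hypothesis hh1 : polyfun h1.
Hypothesis h1ne : exists2 x, mult_ge m x & h1 x != 0.
Hypothesis h1P : forall x, mult_ge m x -> h1 x != 0 -> sole_singular x /\ smooth_lead m x.
Variable P : ((dvar n delta -> C) -> C) -> Prop.
Hypothesis Pinc : forall phi z, P phi -> incidence_point z -> s z != 0 -> phi z = 0.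
Hypothesis Pnear : forall phi, polyfun phi -> (exists2 e : R, 0 < e &
  forall z, near (dpair (raise n G0) u0) e z -> incidence_point z -> phi z = 0) -> P phi.
Hypothesis Pprime : forall phi psi, polyfun phi -> polyfun psi ->
  P (fun z => phi z * psi z) -> P phi \/ P psi.

Local Notation degen := (degenerates nod0 rho s h1).

Let m0 : (0 < m)%N. Proof. exact: ltnW. Qed.
Let n0 : (0 < n)%N. Proof. exact: leq_trans m0 mn. Qed.

(** The equations are the elements of [P] that involve only the coefficients, as in elimination
    theory; nodality is imposed in addition, so that the family lies in the Severi variety. *)
Definition limit_family (F : dhomog 4 C n) := severi delta F /\
  forall phi, polyfun phi -> P (fun z => phi (dform z)) -> phi (coef F) = 0.

Lemma degenerate_exists : exists x, degen x.
Proof.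
have [//|] := @dense_degenerates _ _ _ _ mn m1 _ _ _ nod0 hH detH _ _ _ hrho rho0 hs s0 hh1 h1ne
  'I_0 (fun=> 1) (fun=> 0) (polyfunC _ 1) _ (oner_neq0 _).
by move=> w _ dw; exists (fun mu => w (inl mu)).
Qed.

Lemma severi_form (x : monom n -> C) (q : 'I_delta -> 'I_4 -> C) : nodes_enum (pform x) q -> severi delta (form x).
Proof.
move=> nq; split; last by exists q.
have [nd _ _] := nq; apply: contraTneq (node_neq0 (nd (Ordinal delta0))) => e.
by rewrite negbK -(coef_form x) e pform_coef.
Qed.

Lemma rescaled_approximant (t : C) (F X : monom n -> C) (U : 'I_delta -> 'I_3 -> C) : t != 0 ->
  pform X = (t ^+ m)^-1 *: act (dil t) (pform F) ->
  nodes_enum (pform F) (fun k => affine_pt (fun l => t * U k l)) ->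
  nodes_enum (pform X) (fun k => affine_pt (U k)) /\
  exists g c, [/\ g \in unitmx, c != 0 & form F = form (fun mu => c * coef (act_form g (form X)) mu)].
Proof.
move=> t0 XE nF; have tm : t ^+ m != 0 by rewrite expf_neq0.
have ut := dil_unit t0; split.
  rewrite XE; apply: (@nodes_enumZ _ n); [by rewrite invr_eq0 | by apply: act_homog; apply: pform_homog |].
  have := nodes_enum_act ut (pform_homog F) nF; congr nodes_enum; apply/boolp.funext => k.
  by rewrite -gv_dil_affine gv_unitK.
exists (invmx (dil t)), (t ^+ m); split=> //; first by rewrite unitmx_inv.
congr form; rewrite -[LHS]fcoefK; apply/boolp.funext => mu; rewrite coef_form coef_form /cact XE.
by rewrite actZ act_unitK // /fcoef mcoeffZ mulrA divff // mul1r.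
Qed.

(** [X j] satisfies the equations in [P] because [s] is nonzero at it; [F j] differs from [X j] by a
    dilation and a scalar, under which components are stable. *)
Lemma approximants x : degen x -> exists (F X : nat -> monom n -> C) (U : nat -> 'I_delta -> 'I_3 -> C)
    (q : nat -> 'I_delta -> 'I_4 -> C),
  [/\ forall mu, ulim (fun j => F j mu) (x mu),
      forall k i, ulim (fun j => q j k i) (base_pt R i),
      uae (fun j => nodes_enum (pform (F j)) (q j)),
      uae (fun j => nodes_enum (pform (X j)) (fun k => affine_pt (U j k)) /\
        value_det H (fun k => affine_pt (U j k)) != 0)
    & uae (fun j => limit_family (form (X j)) /\
        exists g c, [/\ g \in unitmx, c != 0 & form (F j) = form (fun mu => c * coef (act_form g (form (X j))) mu)])].
Proof.
move=> dx; have [F [X [U [h2 h3 h4 h5 h6]]]] := degenerates_approximants mn m1 hH rhoP hs h1P dx.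
pose t j : C := (j.+1%:R^-1 : R)%:C%C.
have t0 j : t j != 0 by rewrite -cabs_gt0 cabs_real gtr0_norm // invr_gt0 ltr0Sn.
exists F, X, U, (fun j k => affine_pt (fun l => t j * U j k l)); split; [exact: h3 | | exact: h6 | | ].
- move=> k i; have -> : base_pt R i = (i == ord0)%:R; last exact: h5.
  by rewrite /base_pt; case: (unliftP ord0 i) => [l ->|->]; rewrite ?affine_ptS ?affine_pt0.
- apply: uaeW (uae_and h4 h6) => j [[_ [_ dU]] nF].
  by have [nX _] := rescaled_approximant (t0 j) (h2 j) nF.
apply: uaeW (uae_and h4 h6) => j [[iX [sX _]] nF].
have [nX gc] := rescaled_approximant (t0 j) (h2 j) nF.
split; last exact: gc.
split; first exact: (severi_form nX).
by move=> phi hphi Pphi; rewrite coef_form; exact: (Pinc Pphi iX sX).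
Qed.

Lemma regular_locus : exists (rhon : (monom n -> C) -> C) (Hn : 'I_delta -> {mpoly C[4]}),
  [/\ polyfun rhon, forall k, Hn k \is n.-homog,
      exists2 F, limit_family F & rhon (coef F) != 0
    & forall x, rhon x != 0 -> forall q : 'I_delta -> 'I_4 -> C,
      (forall l, singular (pform x) (q l)) -> distinct_points q ->
      nodes_enum (pform x) q /\ value_det Hn q != 0].
Proof.
have [x dx] := degenerate_exists; have [F [X [U [q [_ _ _ hX hL]]]]] := approximants dx.
have [j [[nX dX] [LX _]]] := uae_ex (uae_and hX hL).
pose Hn k : {mpoly C[4]} := 'X_ord0 ^+ (n - m).+1 * H k.
have hHn k : Hn k \is n.-homog.
  by apply: (@dhomogM_eq _ _ (n - m).+1 m.-1); [exact: X_homog | exact: hH | lia].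
have dn : value_det Hn (fun k => affine_pt (U j k)) != 0.
  have -> : value_det Hn (fun k => affine_pt (U j k)) = value_det H (fun k => affine_pt (U j k)); last exact: dX.
  by congr (\det _); apply/matrixP => k l; rewrite [LHS]mxE [RHS]mxE X0_mul_affine.
have [rhon [r1 r2 r3]] := nodal_open n0 nX hHn dn.
by exists rhon, Hn; split; [exact: r1 | exact: hHn | exists (form (X j)); rewrite ?coef_form | exact: r3].
Qed.

(** Functions that do not vanish on the family lie outside the prime ideal [P], hence so does their
    product with [rhon] and the discriminant. This product is nonzero at incidence points
    arbitrarily near the base point, and there [rhon] and the discriminant guarantee a nodal
    surface. *)
Lemma irreducible_limit_family : irreducible_set limit_family.
Proof.
have [rhon [Hn [r1 _ [F0 LF0 r2] r3]]] := regular_locus.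
apply: irreducible_of_generic; [by exists F0 | by move=> F [[]] |].
move=> phi psi hphi hpsi [F1 [_ L1] p1] [F2 [_ L2] p2].
have lift_poly (f : (monom n -> C) -> C) : polyfun f -> polyfun (fun z : dvar n delta -> C => f (dform z)).
  by move=> hf; apply: polyfun_comp hf _ => mu; apply: polyfunX.
pose D (z : dvar n delta -> C) := disc nod0 (fun k l => z (inr (k, l))).
have hD : polyfun D := polyfun_disc nod0 n.
pose q1 (z : dvar n delta -> C) := phi (dform z) * psi (dform z); pose q2 (z : dvar n delta -> C) := rhon (dform z) * D z.
have hq1 : polyfun q1 by exact: (polyfunM (lift_poly _ hphi) (lift_poly _ hpsi)).
have hq2 : polyfun q2 by exact: (polyfunM (lift_poly _ r1) hD).
have nP : ~ P (fun z => q1 z * q2 z).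
  case/(Pprime hq1 hq2) => /Pprime; case; try exact: lift_poly; try exact: hD.
  - by move/(L1 _ hphi)/eqP; apply/negP.
  - by move/(L2 _ hpsi)/eqP; apply/negP.
  - by case: LF0 => _ L0 /(L0 _ r1)/eqP; apply/negP.
  move=> PD; have := Pinc PD (_ : incidence_point (dpair (raise n G0) u0)) s0.
  by move=> /(_ (raise_singular mn nod0))/eqP; apply/negP; apply: (disc0 nod0).
have [e e0 he] := polyfun_nonzero_near hs s0.
have [z [z1 z2 z3]] : exists z, [/\ near (dpair (raise n G0) u0) e z, incidence_point z & q1 z * q2 z != 0].
  apply: boolp.contrapT => no; apply: nP; apply: Pnear; first exact: polyfunM.
  exists e => // z nz iz; apply/eqP/negPn/negP => ne; by apply: no; exists z.
move: z3; rewrite !mulf_eq0 !negb_or => /andP [/andP [a1 a2] /andP [a3 a4]].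
have [nz _] := r3 _ a3 _ z2 (disc_distinct a4).
exists (form (dform z)); last by rewrite coef_form mulf_neq0.
split; first exact: (severi_form nz).
by move=> f hf Pf; rewrite coef_form; exact: (Pinc Pf z2 (he _ z1)).
Qed.

Variable W : dhomog 4 C n -> Prop.
Hypothesis cW : irreducible_component (@severi C n delta) W.
Hypothesis LW : forall F, limit_family F -> W F.

Lemma W_severi F : W F -> severi delta F. Proof. by case: cW => h _ _; apply: h. Qed.

Lemma approximants_in_component x : degen x -> exists (F : nat -> monom n -> C) (q : nat -> 'I_delta -> 'I_4 -> C),
  [/\ forall mu, ulim (fun j => F j mu) (x mu),
      forall k i, ulim (fun j => q j k i) (base_pt R i)
    & uae (fun j => nodes_enum (pform (F j)) (q j) /\ W (form (F j)))].
Proof.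
move=> /approximants [F [X [U [q [h3 h4 h5 _ h6]]]]]; exists F, q; split; [exact: h3 | exact: h4 |].
apply: uaeW (uae_and h5 h6) => j [nF [LX [g [c [ug c0 ->]]]]]; split; first exact: nF.
by apply: (component_scale n0 cW c0); apply: (component_act cW ug); apply: LW.
Qed.

Lemma component_regular : regular W.
Proof.
have [rhon [Hn [r1 hHn [F0 LF0 r2] r3]]] := regular_locus.
exists (fun F => F != 0 /\ forall phi c, phi = rhon -> c != 0 -> phi (fun mu => c * coef F mu) = 0).
  by apply: zclosed_cone => phi ->.
split.
  exists F0; first exact: LW.
  case=> _ /(_ rhon 1 erefl (oner_neq0 _)) /eqP; apply/negP.
  by have -> : (fun mu => 1 * coef F0 mu) = coef F0; [apply/boolp.funext => mu; rewrite mul1r | exact: r2].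
move=> F WF nZ; have [F1 [q nq]] := W_severi WF.
have [c [c0 rc]] : exists c, c != 0 /\ rhon (fun mu => c * coef F mu) != 0.
  apply: boolp.contrapT => no; apply: nZ; split=> // phi c -> c0.
  by apply/eqP/negPn/negP => h; apply: no; exists c.
have hF : mpoly_of_dhomog F \is n.-homog by case: (F).
have scale : pform (fun mu => c * coef F mu) = c *: mpoly_of_dhomog F.
  by rewrite -pform_coef /pform scaler_sumr; apply: eq_bigr => mu _; rewrite scalerA.
have [nd dist _] := nq.
have [|_ dq] := r3 _ rc q _ dist.
  by move=> l; rewrite scale; apply/singularZ => //; exact: (node_singular hF (nd l)).
exact: (H1_of_indep hF nq hHn dq).
Qed.

(** An equation of [Z] nonzero at a surface with an [m]-fold point would, in suitable coordinates,
    be nonzero at some surface in [degen]; but that one is a limit of members of [W], on which the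
    equation vanishes. *)
Lemma mult_locus_closure F : mult_locus m F -> zclosure W F.
Proof.
move=> [F0 [p /multiple_of_mult [g ug [Lg _]]]] Z cZ WZ; have [E hE ZE] := zclosed_eqs cZ.
apply/ZE; split=> // phi Ep; have [hphi _] := hE _ Ep; apply/eqP/negPn/negP => ph.
pose psi (x : monom n -> C) := phi (cact (invmx g) x).
have hpsi : polyfun psi by apply: polyfun_cact_cst.
pose Psi (w : monom n + 'I_0 -> C) := psi (fun mu => w (inl mu)).
have hPsi : polyfun Psi by apply: polyfun_comp hpsi _ => mu; apply: polyfunX.
pose w1 : monom n + 'I_0 -> C := joinv (cact g (coef F)) (fun=> 0).
have w1P : Psi w1 != 0 by rewrite /Psi /psi /= cactM mulmxV // cact1.
have [w pw dw] := dense_degenerates mn m1 nod0 hH detH hrho rho0 hs s0 hh1 h1ne hPsi (Lg : mult_ge m (fun mu => w1 (inl mu))) w1P.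
have [Fj [q [h3 _ h5]]] := approximants_in_component dw.
case/negP: pw; apply/eqP; apply: (@ulim_eq0 _ (fun j => psi (Fj j))); first exact: ulim_polyfun hpsi h3.
apply: uaeW h5 => j [_ WF].
have ug' : invmx g \in unitmx by rewrite unitmx_inv.
have /WZ /ZE [_ /(_ _ Ep)] := component_act cW ug' WF.
by rewrite coef_form coef_form.
Qed.

(** In coordinates in which a multiple of [F] belongs to [degen], the base point is its only
    singular point, so it represents the given [p]. The approximants are then carried back by the
    inverse substitution. *)
Lemma ordinary_limit : for_general (@ordinary_locus C n m)
  (fun F => forall p : 'I_4 -> C, ordinary_sing m (mpoly_of_dhomog F) p -> limit_with_nodes_tending_to delta W F p).
Proof.
have [h [hh [x0 Mx0 hx0] hP]] := generic_degenerates mn m1 nod0 hH detH hrho rho0 hs s0 hh1 h1ne.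
(* All translates of [h] are included, so that off the closed set some choice of coordinates and
   some multiple of [F] make [h] nonzero. *)
pose E (phi : (monom n -> C) -> C) := exists2 g, g \in unitmx & phi = fun x => h (cact g x).
have hE phi : E phi -> polyfun phi by case=> g _ ->; apply: polyfun_cact_cst.
exists (fun F => F != 0 /\ forall phi c, E phi -> c != 0 -> phi (fun mu => c * coef F mu) = 0).
  exact: zclosed_cone.
split.
  have [g ug dg] := hP _ Mx0 hx0; set x := cact g x0 in dg.
  have [Lx hx _] := dg; have [_ smooth] := h1P Lx hx.
  have ord := ordinary_base Lx smooth.
  exists (form x).
    split; last by exists (base_pt R).
    have [i [_ _ lne] _] := ord; apply: contraNneq lne => e.
    have -> : pform x = 0 by rewrite -(coef_form x) e pform_coef.
    by rewrite /local_eq !raddf0.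
  case=> _ /(_ (fun x => h (cact (invmx g) x)) 1) /(_ _ (oner_neq0 _)).
  move=> /(_ (ex_intro2 _ _ (invmx g) _ erefl)); rewrite unitmx_inv => /(_ ug) /eqP; apply/negP.
  have -> : (fun mu => 1 * coef (form x) mu) = x by apply/boolp.funext => mu; rewrite coef_form mul1r.
  by rewrite /x cactM mulmxV // cact1.
move=> F [F0 _] nZ p [i mp _] eps eps0.
have [g [c [ug c0 hc]]] : exists g c, [/\ g \in unitmx, c != 0 & h (cact g (fun mu => c * coef F mu)) != 0].
  apply: boolp.contrapT => no; apply: nZ; split=> // phi c [g ug ->] c0.
  by apply/eqP/negPn/negP => hc; apply: no; exists g, c.
have [a ua [La ap]] := multiple_of_mult (ex_intro _ i mp : has_mult m (mpoly_of_dhomog F) p).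
have sp : singular (pform (coef F)) p.
  by rewrite -ap; apply/(singular_act _ _ ua); rewrite -pform_cact; exact: mult_ge_singular m1 La.
set y := cact g (fun mu => c * coef F mu) in hc.
have My : multiple m y.
  exists (invmx g *m a); first by rewrite unitmx_mul unitmx_inv ug.
  rewrite /y cactM mulmxA (mulmxV ug) mul1mx cactZ => mu hmu.
  by rewrite (La mu hmu) mulr0.
have [b ub] := hP _ My hc; rewrite /y cactM; set k := g *m b; rewrite cactZ => db.
have uk : k \in unitmx by rewrite unitmx_mul ug.
have uk' : invmx k \in unitmx by rewrite unitmx_inv.
have [Lx hx _] := db; have [sole _] := h1P Lx hx.
(* [e] is the scalar between the representative [p] and the image of the base point; the nodes are
   multiplied by it in order to tend to the vector [p] itself. *)
pose p' := gv (invmx k) p; pose e := p' ord0.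
have sp' : singular (act k (pform (coef F))) p'.
  by apply/(singular_act _ _ uk); rewrite /p' gv_unitVK.
have p'E l : p' (lift ord0 l) = 0.
  apply: sole; rewrite -(pform_cact k) in sp'.
  have -> : pform (fun mu => c * cact k (coef F) mu) = c *: pform (cact k (coef F)).
    by rewrite /pform scaler_sumr; apply: eq_bigr => mu _; rewrite scalerA.
  exact/singularZ.
have p'e : p' = fun i => e * base_pt R i.
  apply/boolp.funext => j; case: (unliftP ord0 j) => [l ->|->].
    by rewrite /base_pt affine_ptS mulr0 p'E.
  by rewrite /base_pt affine_pt0 mulr1.
have e0 : e != 0.
  have [[j p'j] _ _] := sp'; apply: contraNneq p'j => ez.
  by rewrite p'e ez mul0r.
have pE j : p j = e * gv k (base_pt R) j.
  by rewrite -[p](gv_unitVK _ uk) -/p' p'e gvZ.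
have [Fj [q [f1 f2 f3]]] := approximants_in_component db.
pose r : R := cabs eps; have epsE : eps = r%:C%C by rewrite -cabsE ger0_norm // ltW.
have r0 : 0 < r by rewrite cabs_gt0 gt_eqF.
have lim1 mu : ulim (fun j => c^-1 * cact (invmx k) (Fj j) mu) (coef F mu).
  have -> : coef F mu = c^-1 * cact (invmx k) (fun mu => c * cact k (coef F) mu) mu.
    by rewrite cactZ cactM mulmxV // cact1 mulrA mulVf // mul1r.
  apply: ulimM; first exact: ulim_cst.
  exact: (ulim_polyfun (polyfun_cact_cst (invmx k) (polyfunX _ mu)) f1).
have lim2 l j : ulim (fun a => e * gv k (q a l) j) (p j).
  rewrite pE; apply: ulimM; first exact: ulim_cst.
  rewrite /gv; apply: ulim_sum => a' _; apply: ulimM; [exact: ulim_cst | exact: f2].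
have u1 : uae (fun j => forall mu, cabs (c^-1 * cact (invmx k) (Fj j) mu - coef F mu) < r).
  by apply: uae_all => mu; apply: lim1.
have u2 : uae (fun j => forall li : 'I_delta * 'I_4, cabs (e * gv k (q j li.1) li.2 - p li.2) < r).
  by apply: uae_all => li; apply: lim2.
have [j [[nF WF] [v1 v2]]] := uae_ex (uae_and f3 (uae_and u1 u2)).
exists (form (fun mu => c^-1 * coef (act_form (invmx k) (form (Fj j))) mu)), (fun l i => e * gv k (q j l) i); split.
- by apply: (component_scale n0 cW) (component_act cW uk' WF); rewrite invr_eq0.
- have hact : act (invmx k) (pform (Fj j)) \is n.-homog by apply: act_homog; apply: pform_homog.
  have -> : mpoly_of_dhomog (form (fun mu => c^-1 * coef (act_form (invmx k) (form (Fj j))) mu)) =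
      c^-1 *: act (invmx k) (pform (Fj j)).
    rewrite -pform_cact coef_form coef_form /= /pform scaler_sumr.
    by apply: eq_bigr => mu _; rewrite scalerA.
  apply: (@nodes_enumZ _ n); [by rewrite invr_eq0 | exact: hact |].
  apply: (nodes_enum_same hact (q := fun l => gv k (q j l))); first by move=> l; exists e.
  by have := nodes_enum_act uk' (pform_homog (Fj j)) nF; rewrite invmxK.
- by move=> mu; rewrite !coef_form epsE cabs_ltP; exact: v1.
by move=> l i'; rewrite epsE cabs_ltP; exact: (v2 (l, i')).
Qed.

End LimitFamily.

Theorem theorem3p3 (R : realType) (n m delta : nat)
    (hm : (1 <= m)%N) (hdelta : (1 <= delta)%N) (hnm : (m <= n)%N)
    (V : mpoly.dhomog 4 R[i] m -> Prop)
    (hV : irreducible_component (@severi R[i] m delta) V)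
    (hVreg : very_regular V) :
  exists W : mpoly.dhomog 4 R[i] n -> Prop,
    [/\ irreducible_component (@severi R[i] n delta) W,
        regular W,
        (forall F, @mult_locus R[i] n m F -> zclosure W F)
      & for_general (@ordinary_locus R[i] n m)
          (fun F => forall p : 'I_4 -> R[i], ordinary_sing m (mpoly.mpoly_of_dhomog F) p ->
             limit_with_nodes_tending_to delta W F p)].
Proof.
have [Z _ [[G VG nZ] hZ]] := hVreg; have [VS _ _] := hV.
have [m1 [G0 [u0 [H [nod0 hH detH]]]]] := affine_nodal_surface hm hdelta (VS _ VG) (hZ _ VG nZ).
have [rho [hrho rho0 rhoP]] := nodal_open hm nod0 hH detH.
have [P [s [[hs s0] Pinc Pnear Pprime]]] := incidence_local (raise_singular hnm nod0)
  (raise_hess hnm nod0) (node_formsE hnm G0 hm hH detH).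
have [h1 [hh1 h1ne h1P]] := generic_sole_smooth hnm
  (fermat_mult R hnm m1) (fermat_sole hnm m1) (fermat_smooth hnm m1).
have irr := irreducible_limit_family hnm m1 hdelta nod0 hH detH hrho rho0 rhoP hs s0 hh1 h1ne h1P Pinc Pnear Pprime.
have [W cW LW] := component_above (fun F LF => proj1 LF) irr.
exists W; split; first exact: cW.
- exact: (component_regular hnm m1 hdelta nod0 hH detH hrho rho0 rhoP hs s0 hh1 h1ne h1P Pinc cW LW).
- exact: (mult_locus_closure hnm m1 hdelta nod0 hH detH hrho rho0 rhoP hs s0 hh1 h1ne h1P Pinc cW LW).
exact: (ordinary_limit hnm m1 hdelta nod0 hH detH hrho rho0 rhoP hs s0 hh1 h1ne h1P Pinc cW LW).
Qed.
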